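(* Let $\sigma=(s_{i,j})$ be a shift matrix of size $m+n$, $\Upsilon$ a fixed $0^m1^n$-sequence and $\mu=(\mu_1,\dots,\mu_z)$ a composition of $m+n$ admissible to $\sigma$. Let $Y_\mu(\sigma)$ be the subalgebra of $Y_\mu=Y_{m|n}$ generated by the union of the following sets of parabolic generators: $$\{D_{a;i,j}^{(r)},D_{a;i,j}^{\prime(r)}\mid 1\le a\le z,\ 1\le i,j\le\mu_a,\ r\ge0\},$$ $$\{E_{b;h,k}^{(r)}\mid 1\le b<z,\ 1\le h\le\mu_b,\ 1\le k\le\mu_{b+1},\ r>s_{b,b+1}^\mu\},$$ $$\{F_{b;k,h}^{(r)}\mid 1\le b<z,\ 1\le k\le\mu_{b+1},\ 1\le h\le\mu_b,\ r>s_{b+1,b}^\mu\}.$$ Then the relations (R1)–(R16) listed in the context form a set of defining relations for $Y_\mu(\sigma)$ with respect to these generators. In other words, the superalgebra abstractly presented by these generators and relations is realized as a subalgebra of $Y_\mu$.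
   Context: Everything is over $\mathbb C$; $[x,y]=xy-(-1)^{|x||y|}yx$ is the supercommutator; ''subalgebra'' means sub-superalgebra. A $0^m1^n$-sequence $\Upsilon$ is an ordered sequence of $m$ zeros and $n$ ones; $|i|$ is its $i$-th digit. $Y_{m|n}$ is the associative unital superalgebra generated by $t_{i,j}^{(r)}$ ($1\le i,j\le m+n$, $r\ge1$), of parity $|i|+|j|$ mod 2, with relations $[t_{i,j}^{(r)},t_{h,k}^{(s)}]=(-1)^{|i||j|+|i||h|+|j||h|}\sum_{g=0}^{\min(r,s)-1}\big(t_{h,j}^{(g)}t_{i,k}^{(r+s-1-g)}-t_{h,j}^{(r+s-1-g)}t_{i,k}^{(g)}\big)$, $t_{i,j}^{(0)}=\delta_{ij}$. Put $t_{i,j}(u)=\sum_{r\ge0}t_{i,j}^{(r)}u^{-r}$, $T(u)=(t_{i,j}(u))$. For a composition $\mu=(\mu_1,\dots,\mu_z)$ of $m+n$, write uniquely $T(u)=F(u)D(u)E(u)$ with $D(u)$ block diagonal with blocks $D_a(u)$ of size $\mu_a\times\mu_a$, $E(u)$ block upper unitriangular with blocks $E_{a,b}(u)$ ($a<b$), $F(u)$ block lower unitriangular with blocks $F_{b,a}(u)$ ($a<b$); put $D'_a(u)=D_a(u)^{-1}$. The parabolic generators $D_{a;i,j}^{(r)},D_{a;i,j}^{\prime(r)},E_{b;h,k}^{(r)},F_{b;k,h}^{(r)}$ are the coefficients of $u^{-r}$ in the corresponding entries of $D_a(u)$, $D'_a(u)$, $E_{b,b+1}(u)$, $F_{b+1,b}(u)$.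 Writing $Y_\mu$ for $Y_{m|n}$ just emphasizes these generators. With $|i|_a:=|\mu_1+\dots+\mu_{a-1}+i|$, the parities of $D_{a;i,j}^{(r)}$ and $D_{a;i,j}^{\prime(r)}$ are $|i|_a+|j|_a$; of $E_{b;h,k}^{(r)}$, $|h|_b+|k|_{b+1}$; of $F_{b;k,h}^{(r)}$, $|k|_{b+1}+|h|_b$ (mod 2). A shift matrix is a matrix $\sigma=(s_{i,j})_{1\le i,j\le m+n}$ of non-negative integers with $s_{i,j}+s_{j,k}=s_{i,k}$ whenever $|i-j|+|j-k|=|i-k|$. $\mu$ is admissible to $\sigma$ if $s_{\mu_1+\dots+\mu_{a-1}+i,\ \mu_1+\dots+\mu_{a-1}+j}=0$ for all $1\le a\le z$, $1\le i,j\le\mu_a$; then $s_{a,b}^\mu:=s_{\mu_1+\dots+\mu_a,\ \mu_1+\dots+\mu_b}$. Relations (for all indices for which all symbols involved are among the listed generators): (R1) $D_{a;i,j}^{(0)}=D_{a;i,j}^{\prime(0)}=\delta_{ij}$. (R2) $\sum_{p=1}^{\mu_a}\sum_{t=0}^rD_{a;i,p}^{(t)}D_{a;p,j}^{\prime(r-t)}=\delta_{r0}\delta_{ij}$. (R3) $[D_{a;i,j}^{(r)},D_{b;h,k}^{(s)}]=\delta_{ab}(-1)^{|i|_a|j|_a+|i|_a|h|_a+|j|_a|h|_a}\sum_{t=0}^{\min(r,s)-1}\big(D_{a;h,j}^{(t)}D_{a;i,k}^{(r+s-1-t)}-D_{a;h,j}^{(r+s-1-t)}D_{a;i,k}^{(t)}\big)$.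 (R4) $[D_{a;i,j}^{(r)},E_{b;h,k}^{(s)}]=\delta_{a,b}\delta_{hj}(-1)^{|h|_a|j|_a}\sum_{p=1}^{\mu_a}\sum_{t=0}^{r-1}D_{a;i,p}^{(t)}E_{b;p,k}^{(r+s-1-t)}-\delta_{a,b+1}(-1)^{|h|_b|k|_a+|h|_b|j|_a+|j|_a|k|_a}\sum_{t=0}^{r-1}D_{a;i,k}^{(t)}E_{b;h,j}^{(r+s-1-t)}$. (R5) $[D_{a;i,j}^{(r)},F_{b;h,k}^{(s)}]=-\delta_{a,b}\delta_{i,k}(-1)^{|i|_a|j|_a+|h|_{a+1}|i|_a+|h|_{a+1}|j|_a}\sum_{p=1}^{\mu_a}\sum_{t=0}^{r-1}F_{b;h,p}^{(r+s-1-t)}D_{a;p,j}^{(t)}+\delta_{a,b+1}(-1)^{|h|_a|k|_b+|h|_a|j|_a+|j|_a|k|_b}\sum_{t=0}^{r-1}F_{b;i,k}^{(r+s-1-t)}D_{a;h,j}^{(t)}$. (R6) $[E_{a;i,j}^{(r)},F_{b;h,k}^{(s)}]=\delta_{a,b}(-1)^{|h|_{a+1}|k|_a+|j|_{a+1}|k|_a+|h|_{a+1}|j|_{a+1}+1}\sum_{t=0}^{r+s-1}D_{a;i,k}^{\prime(r+s-1-t)}D_{a+1;h,j}^{(t)}$. (R7) $[E_{a;i,j}^{(r)},E_{a;h,k}^{(s)}]=(-1)^{|h|_a|j|_{a+1}+|j|_{a+1}|k|_{a+1}+|h|_a|k|_{a+1}}\Big(\sum_{t=s_{a,a+1}^\mu+1}^{s-1}E_{a;i,k}^{(r+s-1-t)}E_{a;h,j}^{(t)}-\sum_{t=s_{a,a+1}^\mu+1}^{r-1}E_{a;i,k}^{(r+s-1-t)}E_{a;h,j}^{(t)}\Big)$.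 (R8) $[F_{a;i,j}^{(r)},F_{a;h,k}^{(s)}]=(-1)^{|h|_{a+1}|j|_a+|j|_a|k|_a+|h|_{a+1}|k|_a}\Big(\sum_{t=s_{a+1,a}^\mu+1}^{r-1}F_{a;i,k}^{(r+s-1-t)}F_{a;h,j}^{(t)}-\sum_{t=s_{a+1,a}^\mu+1}^{s-1}F_{a;i,k}^{(r+s-1-t)}F_{a;h,j}^{(t)}\Big)$. (R9) $[E_{a;i,j}^{(r+1)},E_{a+1;h,k}^{(s)}]-[E_{a;i,j}^{(r)},E_{a+1;h,k}^{(s+1)}]=(-1)^{|j|_{a+1}|h|_{a+1}}\delta_{h,j}\sum_{q=1}^{\mu_{a+1}}E_{a;i,q}^{(r)}E_{a+1;q,k}^{(s)}$. (R10) $[F_{a;i,j}^{(r+1)},F_{a+1;h,k}^{(s)}]-[F_{a;i,j}^{(r)},F_{a+1;h,k}^{(s+1)}]=(-1)^{|i|_{a+1}(|j|_a+|h|_{a+2})+|j|_a|h|_{a+2}+1}\delta_{i,k}\sum_{q=1}^{\mu_{a+1}}F_{a+1;h,q}^{(s)}F_{a;q,j}^{(r)}$. (R11) $[E_{a;i,j}^{(r)},E_{b;h,k}^{(s)}]=0$ if $|b-a|>1$, or if $b=a+1$ and $h\ne j$. (R12) $[F_{a;i,j}^{(r)},F_{b;h,k}^{(s)}]=0$ if $|b-a|>1$, or if $b=a+1$ and $i\ne k$. (R13) $\big[E_{a;i,j}^{(r)},[E_{a;h,k}^{(s)},E_{b;f,g}^{(t)}]\big]+\big[E_{a;i,j}^{(s)},[E_{a;h,k}^{(r)},E_{b;f,g}^{(t)}]\big]=0$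 if $|a-b|\ge1$. (R14) $\big[F_{a;i,j}^{(r)},[F_{a;h,k}^{(s)},F_{b;f,g}^{(t)}]\big]+\big[F_{a;i,j}^{(s)},[F_{a;h,k}^{(r)},F_{b;f,g}^{(t)}]\big]=0$ if $|a-b|\ge1$. (R15) $\big[[E_{a-1;i,f_1}^{(r)},E_{a;f_2,j}^{(s_{a,a+1}^\mu+1)}],[E_{a;h,g_1}^{(s_{a,a+1}^\mu+1)},E_{a+1;g_2,k}^{(s)}]\big]=0$ if $z\ge4$ and $|h|_a+|j|_{a+1}=1$. (R16) $\big[[F_{a-1;i,f_1}^{(r)},F_{a;f_2,j}^{(s_{a+1,a}^\mu+1)}],[F_{a;h,g_1}^{(s_{a+1,a}^\mu+1)},F_{a+1;g_2,k}^{(s)}]\big]=0$ if $z\ge4$ and $|j|_a+|h|_{a+1}=1$. *)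

(* Defs.v *)
From HB Require Import structures.
From mathcomp Require Import all_boot all_order all_algebra.
From mathcomp Require Import generic_quotient.
From mathcomp Require Import boolp reals.
From mathcomp Require Import finmap monalg.
From mathcomp Require Import complex.

Set Implicit Arguments.
Unset Strict Implicit.
Unset Printing Implicit Defensive.

Import Order.TTheory GRing.Theory Num.Theory.

Local Open Scope ring_scope.
Local Open Scope quotient_scope.

(* Parities are booleans, [true] meaning odd. *)

Notation free_alg K G := {malg K[{fmonom G}]}.

Section FreeSuperalgebra.
Variables (K : comNzRingType) (G : choiceType) (par : G -> bool).

Definition free_gen (g : G) : free_alg K G := << fmu g >>.

Definition word_parity (w : {fmonom G}) : bool := odd (count par w).

Definition parity_part (p : bool) (f : free_alg K G) : free_alg K G :=
  \sum_(w <- msupp f | word_parity w == p) << f@_w *g w >>.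

(* Bilinear extension of [x, y] = x y - (-1)^(|x||y|) y x. *)
Definition scomm (x y : free_alg K G) : free_alg K G :=
  \sum_(p : bool) \sum_(q : bool)
    (parity_part p x * parity_part q y
     - (-1) ^+ (p * q) * (parity_part q y * parity_part p x)).

End FreeSuperalgebra.

(* The algebra presented by the generators G and the relations l = r for all
   l, r such that [rels l r]. It is only a pzRingType, since a presented algebra
   may be zero. *)

Section PresentedAlgebra.
Variables (K : comNzRingType) (G : choiceType).
Variable rels : free_alg K G -> free_alg K G -> Prop.

Inductive rel_ideal : free_alg K G -> Prop :=
| rel_ideal_rel l r : rels l r -> rel_ideal (l - r)
| rel_ideal0 : rel_ideal 0
| rel_idealD x y : rel_ideal x -> rel_ideal y -> rel_ideal (x + y)
| rel_idealMl a x : rel_ideal x -> rel_ideal (a * x)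
| rel_idealMr a x : rel_ideal x -> rel_ideal (x * a).

Lemma rel_idealN x : rel_ideal x -> rel_ideal (- x).
Proof. by move=> Ix; rewrite -mulN1r; apply: rel_idealMl. Qed.

Lemma rel_idealZ (c : K) x : rel_ideal x -> rel_ideal (c *: x).
Proof. by move=> Ix; rewrite -[x]mul1r scalerAl; apply: rel_idealMl. Qed.

Definition rel_congb : rel (free_alg K G) := fun f g => `[< rel_ideal (f - g) >].

Lemma rel_congb_equiv : equiv_class_of rel_congb.
Proof.
split=> [f|f g|g f h].
- by apply/asboolP; rewrite subrr; apply: rel_ideal0.
- by apply/asboolP/asboolP=> /rel_idealN; rewrite opprB.
- by move=> /asboolP Ifg /asboolP Igh; apply/asboolP;
     have := rel_idealD Ifg Igh; rewrite addrA subrK.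
Qed.

Canonical rel_cong := EquivRelPack rel_congb_equiv.

Definition presented := {eq_quot rel_cong}.

HB.instance Definition _ := Choice.on presented.
HB.instance Definition _ := Quotient.on presented.

Definition pres_pi (f : free_alg K G) : presented := \pi_presented f.

Definition pres_gen (g : G) : presented := pres_pi (free_gen K g).

Lemma pres_piP f g : pres_pi f = pres_pi g <-> rel_ideal (f - g).
Proof.
split=> [/eqquotP /asboolP //|I].
by apply/eqquotP/asboolP.
Qed.

Lemma pres_pi_ind (P : presented -> Prop) :
  (forall f, P (pres_pi f)) -> forall x, P x.
Proof. by move=> Ppi x; rewrite -[x]reprK; apply: Ppi. Qed.

Lemma pres_repr f : rel_ideal (repr (pres_pi f) - f).
Proof. by apply/pres_piP; rewrite /pres_pi reprK. Qed.

Definition pres_add (x y : presented) := pres_pi (repr x + repr y).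
Definition pres_opp (x : presented) := pres_pi (- repr x).
Definition pres_mul (x y : presented) := pres_pi (repr x * repr y).
Definition pres_scale (c : K) (x : presented) := pres_pi (c *: repr x).

Lemma pres_addE f g : pres_add (pres_pi f) (pres_pi g) = pres_pi (f + g).
Proof.
apply/pres_piP; rewrite opprD addrACA.
by apply: rel_idealD; apply: pres_repr.
Qed.

Lemma pres_oppE f : pres_opp (pres_pi f) = pres_pi (- f).
Proof. by apply/pres_piP; rewrite -opprD; apply/rel_idealN/pres_repr. Qed.

Lemma pres_mulE f g : pres_mul (pres_pi f) (pres_pi g) = pres_pi (f * g).
Proof.
apply/pres_piP; set a := repr _; set b := repr _.
have -> : a * b - f * g = (a - f) * b + f * (b - g).
  by rewrite mulrBl mulrBr addrA subrK.
by apply: rel_idealD; [apply: rel_idealMr|apply: rel_idealMl];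
   apply: pres_repr.
Qed.

Lemma pres_scaleE c f : pres_scale c (pres_pi f) = pres_pi (c *: f).
Proof. by apply/pres_piP; rewrite -scalerBr; apply/rel_idealZ/pres_repr. Qed.

Lemma pres_addA : associative pres_add.
Proof.
by elim/pres_pi_ind=> x; elim/pres_pi_ind=> y; elim/pres_pi_ind=> z;
   rewrite !pres_addE addrA.
Qed.

Lemma pres_addC : commutative pres_add.
Proof.
by elim/pres_pi_ind=> x; elim/pres_pi_ind=> y; rewrite !pres_addE addrC.
Qed.

Lemma pres_add0 : left_id (pres_pi 0) pres_add.
Proof. by elim/pres_pi_ind=> x; rewrite pres_addE add0r. Qed.

Lemma pres_addN : left_inverse (pres_pi 0) pres_opp pres_add.
Proof. by elim/pres_pi_ind=> x; rewrite pres_oppE pres_addE addNr. Qed.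

HB.instance Definition _ := GRing.isZmodule.Build presented
  pres_addA pres_addC pres_add0 pres_addN.

Lemma pres_mulA : associative pres_mul.
Proof.
by elim/pres_pi_ind=> x; elim/pres_pi_ind=> y; elim/pres_pi_ind=> z;
   rewrite !pres_mulE mulrA.
Qed.

Lemma pres_mul1l : left_id (pres_pi 1) pres_mul.
Proof. by elim/pres_pi_ind=> x; rewrite pres_mulE mul1r. Qed.

Lemma pres_mul1r : right_id (pres_pi 1) pres_mul.
Proof. by elim/pres_pi_ind=> x; rewrite pres_mulE mulr1. Qed.

Lemma pres_mulDl : left_distributive pres_mul +%R.
Proof.
elim/pres_pi_ind=> x; elim/pres_pi_ind=> y; elim/pres_pi_ind=> z.
by rewrite /+%R /= !(pres_mulE, pres_addE) mulrDl.
Qed.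

Lemma pres_mulDr : right_distributive pres_mul +%R.
Proof.
elim/pres_pi_ind=> x; elim/pres_pi_ind=> y; elim/pres_pi_ind=> z.
by rewrite /+%R /= !(pres_mulE, pres_addE) mulrDr.
Qed.

HB.instance Definition _ := GRing.Zmodule_isPzRing.Build presented
  pres_mulA pres_mul1l pres_mul1r pres_mulDl pres_mulDr.

Lemma pres_scaleA c d x : pres_scale c (pres_scale d x) = pres_scale (c * d) x.
Proof. by elim/pres_pi_ind: x => x; rewrite !pres_scaleE scalerA. Qed.

Lemma pres_scale1 : left_id 1 pres_scale.
Proof. by elim/pres_pi_ind=> x; rewrite pres_scaleE scale1r. Qed.

Lemma pres_scaleDr : right_distributive pres_scale +%R.
Proof.
move=> c; elim/pres_pi_ind=> x; elim/pres_pi_ind=> y.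
by rewrite /+%R /= !(pres_scaleE, pres_addE) scalerDr.
Qed.

Lemma pres_scaleDl x : {morph pres_scale^~ x : a b / a + b}.
Proof.
move=> a b; elim/pres_pi_ind: x => x.
by rewrite {2}/+%R /= !(pres_scaleE, pres_addE) scalerDl.
Qed.

HB.instance Definition _ := GRing.Zmodule_isLmodule.Build K presented
  pres_scaleA pres_scale1 pres_scaleDr pres_scaleDl.

Lemma pres_scalerAl (c : K) (x y : presented) : c *: (x * y) = (c *: x) * y.
Proof.
elim/pres_pi_ind: x => x; elim/pres_pi_ind: y => y.
by rewrite /*:%R /*%R /= !(pres_scaleE, pres_mulE) scalerAl.
Qed.

Definition homogeneous (par : G -> bool) (p : bool) (x : presented) : Prop :=
  exists2 f, parity_part par p f = f & x = pres_pi f.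

Definition sub_superalgebra (par : G -> bool) (B : presented -> Prop) : Prop :=
  [/\ B 1,
      forall (c : K) x y, B x -> B y -> B (c *: x + y),
      forall x y, B x -> B y -> B (x * y)
    & forall x0 x1, homogeneous par false x0 -> homogeneous par true x1 ->
        B (x0 + x1) -> B x0 /\ B x1].

Definition sub_superalgebra_gen (par : G -> bool) (S : presented -> Prop)
    (x : presented) : Prop :=
  forall B, sub_superalgebra par B -> (forall y, S y -> B y) -> B x.

End PresentedAlgebra.

(* Ups is the 0^m1^n-sequence. All indices below are 0-based, [true] is the
   digit 1. *)

Section SuperYangian.
Variables (K : comNzRingType) (N : nat) (Ups : seq bool).

Definition digit (i : nat) : nat := nth false Ups i.

(* (i, j, r) stands for t_{i,j}^{(r+1)}. *)
Definition tgen : Type := 'I_N * 'I_N * nat.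

HB.instance Definition _ := Choice.on tgen.

Definition tgen_parity (g : tgen) : bool := odd (digit g.1.1 + digit g.1.2).

Definition tsym (i j : 'I_N) (r : nat) : free_alg K tgen :=
  if r is r'.+1 then free_gen K ((i, j, r') : tgen) else (i == j)%:R.

Inductive yangian_rel : free_alg K tgen -> free_alg K tgen -> Prop :=
| Yangian_rel i j h k r s : (0 < r)%N -> (0 < s)%N ->
    yangian_rel
      (scomm tgen_parity (tsym i j r) (tsym h k s))
      ((-1) ^+ (digit i * digit j + digit i * digit h + digit j * digit h) *
       \sum_(g < minn r s)
         (tsym h j g * tsym i k (r + s - 1 - g)
          - tsym h j (r + s - 1 - g) * tsym i k g)).

Definition super_yangian := presented yangian_rel.

HB.instance Definition _ := GRing.PzRing.on super_yangian.
HB.instance Definition _ := GRing.Lmodule.on super_yangian.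

(* T(u), as the sequence of the coefficients of u^{-r}. *)
Definition Tmx (r : nat) : 'M[super_yangian]_N :=
  \matrix_(i, j) pres_pi yangian_rel (tsym i j r).

End SuperYangian.

(* Power series in u^{-1} with matrix coefficients are sequences of matrices. *)

Definition ps_mul (Y : pzRingType) (N : nat) (A B : nat -> 'M[Y]_N) (r : nat) :
  'M[Y]_N := \sum_(t < r.+1) A t *m B (r - t)%N.

Definition ps_one (Y : pzRingType) (N : nat) (r : nat) : 'M[Y]_N :=
  if r is 0%N then 1%:M else 0.

Definition ps_inverse (Y : pzRingType) (N : nat) (A B : nat -> 'M[Y]_N) : Prop :=
  ps_mul A B =1 @ps_one Y N /\ ps_mul B A =1 @ps_one Y N.

(* [reshape_index mu p] is the (0-based) number of the block containing p, and
   [flatten_index mu a i] is mu_1 + ... + mu_{a-1} + i. *)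

Definition gauss_decomposition (Y : pzRingType) (N : nat) (mu : seq nat)
    (T F D E : nat -> 'M[Y]_N) : Prop :=
  let blk := reshape_index mu in
  [/\ T =1 ps_mul (ps_mul F D) E,
      forall r (p q : 'I_N), blk p != blk q -> D r p q = 0,
      forall r (p q : 'I_N), ~~ (blk p < blk q)%N ->
        E r p q = if blk p == blk q then @ps_one Y N r p q else 0
    & forall r (p q : 'I_N), ~~ (blk q < blk p)%N ->
        F r p q = if blk p == blk q then @ps_one Y N r p q else 0].

(* [gauss_decomposition_exists] and [ps_inverse_exists], with [Tmx0] below, show
   that T(u) has a Gauss decomposition and that its D(u) is invertible. *)

Section PowerSeriesFacts.
Variables (Y : pzRingType) (N : nat).
Implicit Types A B C : nat -> 'M[Y]_N.

Lemma ps_mul_rev A B r : ps_mul A B r = \sum_(t < r.+1) A (r - t)%N *m B t.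
Proof.
rewrite /ps_mul (reindex_inj rev_ord_inj) /=; apply: eq_bigr => t _.
by rewrite subSS subKn // -ltnS.
Qed.

Lemma eq_ps_mul A A' B B' : A =1 A' -> B =1 B' -> ps_mul A B =1 ps_mul A' B'.
Proof. by move=> eA eB r; apply: eq_bigr => t _; rewrite eA eB. Qed.

Lemma ps_mulA A B C : ps_mul A (ps_mul B C) =1 ps_mul (ps_mul A B) C.
Proof.
move=> r; rewrite [RHS]ps_mul_rev.
pose coef3 j k := A j *m (B (r - j - k)%N *m C k).
transitivity (\sum_(j < r.+1) \sum_(k < r.+1 | (k <= r - j)%N) coef3 j k).
  apply: eq_bigr => /= j _; rewrite ps_mul_rev mulmx_sumr.
  by rewrite (big_ord_narrow_leq (leq_subr _ _)).
rewrite (exchange_big_dep predT) //=; apply: eq_bigr => k _.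
transitivity (\sum_(j < r.+1 | (j <= r - k)%N) coef3 j k).
  apply: eq_bigl => j; rewrite -ltnS -(ltnS j) -!subSn ?leq_ord //.
  by rewrite -subn_gt0 -(subn_gt0 j) -!subnDA addnC.
rewrite (big_ord_narrow_leq (leq_subr _ _)) mulmx_suml.
by apply: eq_bigr => j _; rewrite /coef3 -!subnDA addnC mulmxA.
Qed.

Lemma ps_mul1l A : ps_mul (@ps_one Y N) A =1 A.
Proof.
move=> r; rewrite /ps_mul big_ord_recl subn0 mul1mx big1 ?addr0 // => t _.
by rewrite mul0mx.
Qed.

Lemma ps_mul1r A : ps_mul A (@ps_one Y N) =1 A.
Proof.
move=> r; rewrite ps_mul_rev big_ord_recl subn0 mulmx1 big1 ?addr0 // => t _.
by rewrite mulmx0.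
Qed.

Lemma course_of_values (X : Type) (x0 : X) (step : (nat -> X) -> nat -> X) :
  (forall h h' r, (forall k, (k < r)%N -> h k = h' k) -> step h r = step h' r) ->
  exists f, forall r, f r = step f r.
Proof.
move=> Hstep; pose h n := iter n (fun g => step g) (fun _ => x0).
have Hh k : forall n n', (k < n)%N -> (k < n')%N -> h n k = h n' k.
  elim/ltn_ind: k => k IH [//|n] [//|n'] ltkn ltkn' /=.
  by apply: Hstep => j ltjk; apply: IH => //; apply: leq_trans ltjk _.
exists (fun r => h r.+1 r) => r.
by apply: (Hstep (h r)) => k ltkr; apply: Hh.
Qed.

Lemma ps_right_inverse A : A 0%N = 1%:M ->
  exists2 B, B 0%N = 1%:M & ps_mul A B =1 @ps_one Y N.
Proof.
move=> A0.
pose step (g : nat -> 'M[Y]_N) r := @ps_one Y N r - \sum_(t < r) A t.+1 *m g (r - t.+1)%N.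
have [|B HB] := @course_of_values _ 0 step.
  move=> g g' r Hg; congr (_ - _); apply: eq_bigr => t _; congr (_ *m _).
  by apply: Hg; rewrite ltn_subrL /= (leq_trans _ (ltn_ord t)).
exists B; first by rewrite HB /step big_ord0 subr0.
by move=> r; rewrite /ps_mul big_ord_recl A0 mul1mx subn0 HB /step subrK.
Qed.

Lemma ps_inverse_exists A : A 0%N = 1%:M -> exists B, ps_inverse A B.
Proof.
move=> A0; have [B B0 AB] := ps_right_inverse A0.
have [C _ BC] := ps_right_inverse B0.
exists B; split=> // r; rewrite -[RHS]BC; apply: eq_ps_mul => // {}r.
rewrite -[LHS]ps_mul1r -(eq_ps_mul (frefl A) BC) ps_mulA.
by rewrite (eq_ps_mul AB (frefl C)) ps_mul1l.
Qed.

Lemma ps_mulS A B r : ps_mul A B r.+1 =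
  A 0%N *m B r.+1 + (\sum_(t < r) A t.+1 *m B (r - t)%N + A r.+1 *m B 0%N).
Proof.
rewrite /ps_mul big_ord_recl big_ord_recr /= subn0 subnn.
by congr (_ + (_ + _)).
Qed.

Lemma ps_mul_perturb A A' B B' r :
  A 0%N = 1%:M -> B 0%N = 1%:M -> (0 < r)%N ->
  (forall k, (k < r)%N -> A' k = A k) -> (forall k, (k < r)%N -> B' k = B k) ->
  ps_mul A B r = ps_mul A' B' r + (A r - A' r) + (B r - B' r).
Proof.
case: r => // r A0 B0 _ HA HB.
rewrite !ps_mulS (HA 0%N) // (HB 0%N) // A0 B0 !mul1mx !mulmx1.
have -> : \sum_(t < r) A' t.+1 *m B' (r - t)%N = \sum_(t < r) A t.+1 *m B (r - t)%N.
  by apply: eq_bigr => t _; rewrite HA ?ltnS // HB // ltnS leq_subr.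
set S := \sum_(t < r) _; rewrite -(addrA (B' _)) -(addrA S) [A' _ + _]addrC.
by rewrite subrK [RHS]addrC [RHS]addrA subrK.
Qed.

Lemma gauss_decomposition_exists (mu : seq nat) (T : nat -> 'M[Y]_N) :
  T 0%N = 1%:M ->
  exists F D E, gauss_decomposition mu T F D E /\ D 0%N = 1%:M.
Proof.
move=> T0; pose blk := reshape_index mu.
pose low (X : 'M[Y]_N) := \matrix_(p, q) if (blk q < blk p)%N then X p q else 0.
pose dia (X : 'M[Y]_N) := \matrix_(p, q) if blk p == blk q then X p q else 0.
pose upp (X : 'M[Y]_N) := \matrix_(p, q) if (blk p < blk q)%N then X p q else 0.
have split3 X : low X + dia X + upp X = X.
  apply/matrixP=> p q; rewrite !mxE.
  by case: (ltngtP (blk p) (blk q)) => _; rewrite ?add0r ?addr0.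
pose tr r (A : nat -> 'M[Y]_N) k := if (k < r)%N then A k else 0.
pose Z := nat -> 'M[Y]_N * 'M[Y]_N * 'M[Y]_N.
pose fF (h : Z) k := (h k).1.1.
pose fD (h : Z) k := (h k).1.2.
pose fE (h : Z) k := (h k).2.
pose X (h : Z) r :=
  T r - ps_mul (ps_mul (tr r (fF h)) (tr r (fD h))) (tr r (fE h)) r.
pose step (h : Z) r := if r is 0 then (1%:M, 1%:M, 1%:M)
  else (low (X h r), dia (X h r), upp (X h r)).
have [|h Hh] := @course_of_values _ (0, 0, 0) step.
  move=> h h' [//|r] Hr; rewrite /step.
  suff -> : X h r.+1 = X h' r.+1 by [].
  congr (_ - _); apply: eq_ps_mul => [k|k]; first apply: eq_ps_mul => {}k.
  - by rewrite /tr /fF; case: ifP => // /Hr ->.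
  - by rewrite /tr /fD; case: ifP => // /Hr ->.
  - by rewrite /tr /fE; case: ifP => // /Hr ->.
have F0 : fF h 0%N = 1%:M by rewrite /fF Hh.
have D0 : fD h 0%N = 1%:M by rewrite /fD Hh.
have E0 : fE h 0%N = 1%:M by rewrite /fE Hh.
have FD0 : ps_mul (fF h) (fD h) 0%N = 1%:M.
  by rewrite /ps_mul big_ord1 F0 D0 mul1mx.
exists (fF h), (fD h), (fE h); split=> //; split.
- case=> [|r]; first by rewrite T0 /ps_mul !big_ord1 F0 D0 E0 !mul1mx.
  have Htr A k : (k < r.+1)%N -> tr r.+1 A k = A k by rewrite /tr => ->.
  have tr0 A : tr r.+1 A r.+1 = 0 by rewrite /tr ltnn.
  rewrite (@ps_mul_perturb _ (ps_mul (tr r.+1 (fF h)) (tr r.+1 (fD h)))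
             _ (tr r.+1 (fE h))) //; last 2 first.
  + move=> k ltkr; apply: eq_bigr => t _; have lett := ltn_ord t.
    rewrite ltnS in lett; rewrite !Htr ?(leq_ltn_trans lett) //.
    by apply: leq_ltn_trans ltkr; apply: leq_subr.
  + by move=> k; apply: Htr.
  rewrite [ps_mul (fF h) _ _](@ps_mul_perturb _ (tr r.+1 (fF h))
             _ (tr r.+1 (fD h))) //;
    try by move=> k; apply: Htr.
  rewrite !tr0 !subr0; set P := ps_mul (tr _ _) (tr _ _) _.
  rewrite [_ - P]addrC -(addrA P) addKr -[RHS]addrA.
  by rewrite /fF /fD /fE Hh /= split3 /X addrC subrK.
- move=> r p q; rewrite /fD Hh; case: r => [|r] npq /=; last first.
    by rewrite mxE /blk (negPf npq).
  by rewrite mxE; case: (eqVneq p q) npq => // ->; rewrite eqxx.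
- move=> r p q; rewrite /fE Hh; case: r => [|r] npq /=; last first.
    by rewrite !mxE /blk (negPf npq) if_same.
  rewrite mxE; case: (eqVneq (p : 'I_N) q) => [->|//]; first by rewrite eqxx.
  by rewrite if_same.
- move=> r p q; rewrite /fF Hh; case: r => [|r] npq /=; last first.
    by rewrite !mxE /blk (negPf npq) if_same.
  rewrite mxE; case: (eqVneq (p : 'I_N) q) => [->|//]; first by rewrite eqxx.
  by rewrite if_same.
Qed.

End PowerSeriesFacts.

Definition composition (mu : seq nat) (N : nat) : Prop :=
  all (ltn 0) mu /\ sumn mu = N.

(* Entry of a matrix at natural number positions, x0 outside of the matrix. *)
Definition mx_at (R : Type) (N : nat) (x0 : R) (A : 'M[R]_N) (p q : nat) : R :=
  if insub p is Some i then if insub q is Some j then A i j else x0 else x0.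

Definition shift_matrix (N : nat) (s : 'M[nat]_N) : Prop :=
  forall i j k : 'I_N, (`|i - j| + `|j - k| = `|i - k|)%N ->
    (s i j + s j k)%N = s i k.

Definition admissible (N : nat) (s : 'M[nat]_N) (mu : seq nat) : Prop :=
  forall a i j, (a < size mu)%N -> (i < nth 0%N mu a)%N -> (j < nth 0%N mu a)%N ->
    mx_at 0%N s (flatten_index mu a i) (flatten_index mu a j) = 0%N.

(* s_{a,b}^mu: the entry of s at the last positions of the blocks a and b. *)
Definition block_shift (N : nat) (s : 'M[nat]_N) (mu : seq nat) (a b : nat) : nat :=
  mx_at 0%N s (sumn (take a.+1 mu)).-1 (sumn (take b.+1 mu)).-1.

(* Symbols D_{a;i,j}^{(r)}, D'_{a;i,j}^{(r)}, E_{b;h,k}^{(r)}, F_{b;k,h}^{(r)},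
   in this order of the arguments; a, b, h, i, j, k are 0-based. *)
Inductive parabolic_symbol :=
| SD of nat & nat & nat & nat
| SD' of nat & nat & nat & nat
| SE of nat & nat & nat & nat
| SF of nat & nat & nat & nat.

Definition symbol_code (g : parabolic_symbol) : nat * nat * nat * nat * nat :=
  match g with
  | SD a i j r => (0, a, i, j, r)
  | SD' a i j r => (1, a, i, j, r)
  | SE b h k r => (2, b, h, k, r)
  | SF b k h r => (3, b, k, h, r)
  end%N.

Definition symbol_decode (c : nat * nat * nat * nat * nat) : parabolic_symbol :=
  let: (n, a, i, j, r) := c in
  match n with
  | 0 => SD a i j r
  | 1 => SD' a i j r
  | 2 => SE a i j r
  | _ => SF a i j r
  end%N.

Lemma symbol_codeK : cancel symbol_code symbol_decode.
Proof. by case. Qed.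

HB.instance Definition _ :=
  Choice.copy parabolic_symbol (can_type symbol_codeK).

Section Parabolic.
Variables (K : comNzRingType) (N : nat) (Ups : seq bool).
Variables (sigma : 'M[nat]_N) (mu : seq nat).

Definition listed (g : parabolic_symbol) : bool :=
  match g with
  | SD a i j _ | SD' a i j _ =>
      [&& (a < size mu)%N, (i < nth 0%N mu a)%N & (j < nth 0%N mu a)%N]
  | SE b h k r =>
      [&& (b.+1 < size mu)%N, (h < nth 0%N mu b)%N, (k < nth 0%N mu b.+1)%N
        & (block_shift sigma mu b b.+1 < r)%N]
  | SF b k h r =>
      [&& (b.+1 < size mu)%N, (k < nth 0%N mu b.+1)%N, (h < nth 0%N mu b)%N
        & (block_shift sigma mu b.+1 b < r)%N]
  end.

Definition pgen : Type := {g : parabolic_symbol | listed g}.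

HB.instance Definition _ := Choice.on pgen.

(* The parity digit |i|_a. *)
Definition bdigit (a i : nat) : nat := digit Ups (flatten_index mu a i).

Definition symbol_parity (g : parabolic_symbol) : bool :=
  match g with
  | SD a i j _ | SD' a i j _ => odd (bdigit a i + bdigit a j)
  | SE b h k _ => odd (bdigit b h + bdigit b.+1 k)
  | SF b k h _ => odd (bdigit b.+1 k + bdigit b h)
  end.

Definition pgen_parity (g : pgen) : bool := symbol_parity (val g).

(* Symbols that are not listed are 0; below they only occur with a vanishing
   Kronecker delta. *)
Definition psym (g : parabolic_symbol) : free_alg K pgen :=
  if insub g is Some g' then free_gen K (g' : pgen) else 0.

Local Notation D a i j r := (psym (SD a i j r)).
Local Notation D' a i j r := (psym (SD' a i j r)).
Local Notation E b h k r := (psym (SE b h k r)).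
Local Notation F b k h r := (psym (SF b k h r)).
Local Notation "[[ x , y ]]" := (scomm pgen_parity x y) (at level 0).
Local Notation "<| i |>_ a" := (bdigit a i)
  (at level 0, i at level 99, a at level 0, format "<| i |>_ a").
Local Notation delta x y := ((x == y :> nat)%:R).
Local Notation mu_ a := (nth 0%N mu a).
Local Notation smu a b := (block_shift sigma mu a b).

Inductive parabolic_rel : free_alg K pgen -> free_alg K pgen -> Prop :=
| R1D a i j : listed (SD a i j 0) ->
    parabolic_rel (D a i j 0) (delta i j)
| R1D' a i j : listed (SD' a i j 0) ->
    parabolic_rel (D' a i j 0) (delta i j)
| R2 a i j r : listed (SD a i j r) ->
    parabolic_rel
      (\sum_(p < mu_ a) \sum_(t < r.+1) D a i p t * D' a p j (r - t))
      (delta r 0%N * delta i j)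
| R3 a i j r b h k s : listed (SD a i j r) -> listed (SD b h k s) ->
    parabolic_rel
      [[D a i j r, D b h k s]]
      (delta a b *
       (-1) ^+ (<|i|>_a * <|j|>_a + <|i|>_a * <|h|>_a + <|j|>_a * <|h|>_a) *
       \sum_(t < minn r s)
         (D a h j t * D a i k (r + s - 1 - t)
          - D a h j (r + s - 1 - t) * D a i k t))
| R4 a i j r b h k s : listed (SD a i j r) -> listed (SE b h k s) ->
    parabolic_rel
      [[D a i j r, E b h k s]]
      (delta a b * delta h j * (-1) ^+ (<|h|>_a * <|j|>_a) *
         (\sum_(p < mu_ a) \sum_(t < r) D a i p t * E b p k (r + s - 1 - t))
       - delta a b.+1 *
         (-1) ^+ (<|h|>_b * <|k|>_a + <|h|>_b * <|j|>_a + <|j|>_a * <|k|>_a) *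
         (\sum_(t < r) D a i k t * E b h j (r + s - 1 - t)))
| R5 a i j r b h k s : listed (SD a i j r) -> listed (SF b h k s) ->
    parabolic_rel
      [[D a i j r, F b h k s]]
      (- (delta a b * delta i k *
          (-1) ^+ (<|i|>_a * <|j|>_a + <|h|>_(a.+1) * <|i|>_a + <|h|>_(a.+1) * <|j|>_a) *
          (\sum_(p < mu_ a) \sum_(t < r) F b h p (r + s - 1 - t) * D a p j t))
       + delta a b.+1 *
         (-1) ^+ (<|h|>_a * <|k|>_b + <|h|>_a * <|j|>_a + <|j|>_a * <|k|>_b) *
         (\sum_(t < r) F b i k (r + s - 1 - t) * D a h j t))
| R6 a i j r b h k s : listed (SE a i j r) -> listed (SF b h k s) ->
    parabolic_rel
      [[E a i j r, F b h k s]]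
      (delta a b *
       (-1) ^+ (<|h|>_(a.+1) * <|k|>_a + <|j|>_(a.+1) * <|k|>_a
                + <|h|>_(a.+1) * <|j|>_(a.+1) + 1) *
       \sum_(t < r + s) D' a i k (r + s - 1 - t) * D a.+1 h j t)
| R7 a i j r h k s : listed (SE a i j r) -> listed (SE a h k s) ->
    parabolic_rel
      [[E a i j r, E a h k s]]
      ((-1) ^+ (<|h|>_a * <|j|>_(a.+1) + <|j|>_(a.+1) * <|k|>_(a.+1)
                + <|h|>_a * <|k|>_(a.+1)) *
       (\sum_((smu a a.+1).+1 <= t < s) E a i k (r + s - 1 - t) * E a h j t
        - \sum_((smu a a.+1).+1 <= t < r) E a i k (r + s - 1 - t) * E a h j t))
| R8 a i j r h k s : listed (SF a i j r) -> listed (SF a h k s) ->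
    parabolic_rel
      [[F a i j r, F a h k s]]
      ((-1) ^+ (<|h|>_(a.+1) * <|j|>_a + <|j|>_a * <|k|>_a + <|h|>_(a.+1) * <|k|>_a) *
       (\sum_((smu a.+1 a).+1 <= t < r) F a i k (r + s - 1 - t) * F a h j t
        - \sum_((smu a.+1 a).+1 <= t < s) F a i k (r + s - 1 - t) * F a h j t))
| R9 a i j r h k s : listed (SE a i j r) -> listed (SE a.+1 h k s) ->
    parabolic_rel
      ([[E a i j r.+1, E a.+1 h k s]] - [[E a i j r, E a.+1 h k s.+1]])
      ((-1) ^+ (<|j|>_(a.+1) * <|h|>_(a.+1)) * delta h j *
       \sum_(q < mu_ a.+1) E a i q r * E a.+1 q k s)
| R10 a i j r h k s : listed (SF a i j r) -> listed (SF a.+1 h k s) ->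
    parabolic_rel
      ([[F a i j r.+1, F a.+1 h k s]] - [[F a i j r, F a.+1 h k s.+1]])
      ((-1) ^+ (<|i|>_(a.+1) * (<|j|>_a + <|h|>_(a.+2)) + <|j|>_a * <|h|>_(a.+2) + 1) *
       delta i k *
       \sum_(q < mu_ a.+1) F a.+1 h q s * F a q j r)
| R11 a i j r b h k s : listed (SE a i j r) -> listed (SE b h k s) ->
    (1 < `|b - a|)%N \/ (b = a.+1 /\ h <> j) ->
    parabolic_rel [[E a i j r, E b h k s]] 0
| R12 a i j r b h k s : listed (SF a i j r) -> listed (SF b h k s) ->
    (1 < `|b - a|)%N \/ (b = a.+1 /\ i <> k) ->
    parabolic_rel [[F a i j r, F b h k s]] 0
| R13 a i j r h k s b f g t :
    listed (SE a i j r) -> listed (SE a h k s) -> listed (SE b f g t) ->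
    (1 <= `|a - b|)%N ->
    parabolic_rel
      ([[E a i j r, [[E a h k s, E b f g t]]]]
       + [[E a i j s, [[E a h k r, E b f g t]]]]) 0
| R14 a i j r h k s b f g t :
    listed (SF a i j r) -> listed (SF a h k s) -> listed (SF b f g t) ->
    (1 <= `|a - b|)%N ->
    parabolic_rel
      ([[F a i j r, [[F a h k s, F b f g t]]]]
       + [[F a i j s, [[F a h k r, F b f g t]]]]) 0
| R15 a i f1 r f2 j h g1 g2 k s :
    (4 <= size mu)%N -> (0 < a)%N -> (<|h|>_a + <|j|>_(a.+1))%N = 1%N ->
    listed (SE a.-1 i f1 r) -> listed (SE a f2 j (smu a a.+1).+1) ->
    listed (SE a h g1 (smu a a.+1).+1) -> listed (SE a.+1 g2 k s) ->
    parabolic_rel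
      [[ [[E a.-1 i f1 r, E a f2 j (smu a a.+1).+1]],
         [[E a h g1 (smu a a.+1).+1, E a.+1 g2 k s]] ]] 0
| R16 a i f1 r f2 j h g1 g2 k s :
    (4 <= size mu)%N -> (0 < a)%N -> (<|j|>_a + <|h|>_(a.+1))%N = 1%N ->
    listed (SF a.-1 i f1 r) -> listed (SF a f2 j (smu a.+1 a).+1) ->
    listed (SF a h g1 (smu a.+1 a).+1) -> listed (SF a.+1 g2 k s) ->
    parabolic_rel
      [[ [[F a.-1 i f1 r, F a f2 j (smu a.+1 a).+1]],
         [[F a h g1 (smu a.+1 a).+1, F a.+1 g2 k s]] ]] 0.

End Parabolic.

Definition presented_shifted_yangian (K : comNzRingType) (N : nat)
    (Ups : seq bool) (sigma : 'M[nat]_N) (mu : seq nat) :=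
  presented (@parabolic_rel K N Ups sigma mu).

(* The elements of the algebra named by the symbols, F, D, D', E being the
   coefficient sequences of F(u), D(u), D(u)^{-1}, E(u). The blocks of the
   inverse of the block diagonal matrix D(u) are the inverses D'_a(u). *)
Definition parabolic_elt (Y : pzRingType) (N : nat) (mu : seq nat)
    (F D D' E : nat -> 'M[Y]_N) (g : parabolic_symbol) : Y :=
  match g with
  | SD a i j r => mx_at 0 (D r) (flatten_index mu a i) (flatten_index mu a j)
  | SD' a i j r => mx_at 0 (D' r) (flatten_index mu a i) (flatten_index mu a j)
  | SE b h k r => mx_at 0 (E r) (flatten_index mu b h) (flatten_index mu b.+1 k)
  | SF b k h r => mx_at 0 (F r) (flatten_index mu b.+1 k) (flatten_index mu b h)
  end.

Definition shifted_yangian (K : comNzRingType) (N : nat) (Ups : seq bool)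
    (sigma : 'M[nat]_N) (mu : seq nat)
    (F D D' E : nat -> 'M[super_yangian K N Ups]_N) :
    super_yangian K N Ups -> Prop :=
  sub_superalgebra_gen (@tgen_parity N Ups)
    (fun y => exists2 g, listed sigma mu g & y = parabolic_elt mu F D D' E g).

Lemma Tmx0 (K : comNzRingType) (N : nat) (Ups : seq bool) :
  Tmx K N Ups 0 = 1%:M :> 'M[super_yangian K N Ups]_N.
Proof. by apply/matrixP=> i j; rewrite !mxE /=; case: (i == j). Qed.

(* Main.v *)
(** The relations (R1)-(R16) are read off the RTT relation on two tensor legs, by
    inserting the block projections into the Gauss factors of T(u); the cubic
    and quartic relations then follow with the super Jacobi identity. So the
    presented algebra P maps onto the shifted Yangian, and only injectivity is
    left. Filter P by giving the r-th generators degree r - 1. In the associated graded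
    algebra the relations become those of a loop superalgebra: iterated brackets
    of the E's (and of the F's) with consecutive blocks depend only on the ends (i, j) and on
    the total degree r, and together with the D's they span a Lie
    superalgebra. Hence P is spanned by ordered monomials in root vectors
    indexed by triples (i, j, r). In the Yangian, the root vector (i, j, r) is,
    up to sign, t_(i,j)^(r+1) plus terms of lower degree, so it suffices that
    ordered monomials in the t_(i,j)^(r+1) are linearly independent. This
    follows by induction on the length of the monomials from
    the algebra map T(u) |-> A(u) T(u), where A(u) is the vector
    representation twisted by a formal parameter a: the difference with
    T(u) |-> T(u) removes, to leading order, one factor of a monomial at a time. *)
Require Import Defs.
From HB Require Import structures.
From mathcomp Require Import all_boot all_order all_algebra.
From mathcomp Require Import generic_quotient.
From mathcomp Require Import boolp reals.
From mathcomp Require Import finmap monalg.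
From mathcomp Require Import complex.
From mathcomp Require Import zify.
From Stdlib Require Ncring Ncring_tac.

Set Implicit Arguments.
Unset Strict Implicit.
Unset Printing Implicit Defensive.

Import GRing.Theory.

Local Open Scope ring_scope.

(** Multiplying RTT on both sides by the inverse of X on the second leg compares entries of X with
    entries of its inverse. For X a window (the Gauss factors restricted to consecutive blocks) the
    first row of X is D E and the last column of the inverse is $E^{-1}D^{-1}$, so cutting by block
    projections isolates single factors. Only [E, E] within one pair of blocks resists: an unknown
    commutator in one variable is left over and is eliminated by comparing coefficients. The
    relations for F are those for E in the opposite ring, where transposition exchanges the two
    triangular factors. Degree r - 1 fits because $[t^{(r)},t^{(s)}]$ has the top term
    $t^{(r+s-1)}$, while the products $t^{(g)}t^{(r+s-1-g)}$ with both exponents positive have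
    degree one less. The ground ring enters through three facts: 1/2 turns the square of an odd root
    vector into a bracket, absence of 2-torsion kills brackets equal to their own negative, and the
    k-th power of an even letter contributes the factor k when one letter is removed. The quartic
    relations are indispensable only for an odd middle vector: for an even one the Serre relations
    already give the vanishing. *)

Section NcRing.
Variable R : pzRingType.

(** Makes the standard decision procedure for non-commutative ring identities available in every
    [pzRingType], under the name [ncring]. *)
#[export] Instance nc_ring_ops :
  @Ncring.Ring_ops R 0 1 +%R *%R (fun x y => x - y) -%R eq := {}.

#[export] Instance nc_ring : @Ncring.Ring R _ _ _ _ _ _ _ nc_ring_ops.
Proof.
split; try exact: _.
- exact: add0r.
- exact: addrC.
- exact: addrA.
- exact: mul1r.
- exact: mulr1.
- exact: mulrA.
- move=> x y z; exact: mulrDl.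
- move=> x y z; exact: mulrDr.
- move=> x; exact: subrr.
Qed.
End NcRing.

Ltac ncring := Ncring_tac.non_commutative_ring.

(** * Power series over a ring *)

(** A separate name for sequences, so that the Cauchy product can be declared as a ring structure.
    The variable is $u^{-1}$ for the Gauss factors; later it also serves as the parameter of an
    evaluation module and as a counter of degrees. *)
Definition fps (R : Type) : Type := nat -> R.

HB.instance Definition _ (R : Type) := gen_eqMixin (fps R).
HB.instance Definition _ (R : Type) := gen_choiceMixin (fps R).

Section FpsRing.
Variable R : pzRingType.
Implicit Types f g h : fps R.

Definition fps_zero : fps R := fun=> 0.
Definition fps_opp f : fps R := fun n => - f n.
Definition fps_add f g : fps R := fun n => f n + g n.
Definition fps_mul f g : fps R := fun n => \sum_(t < n.+1) f t * g (n - t)%N.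
Definition fps_cst (x : R) : fps R := fun n => if n is 0 then x else 0.

Lemma fps_addA : associative fps_add.
Proof. by move=> f g h; apply/funext=> n; rewrite /fps_add addrA. Qed.
Lemma fps_addC : commutative fps_add.
Proof. by move=> f g; apply/funext=> n; rewrite /fps_add addrC. Qed.
Lemma fps_add0 : left_id fps_zero fps_add.
Proof. by move=> f; apply/funext=> n; rewrite /fps_add add0r. Qed.
Lemma fps_addN : left_inverse fps_zero fps_opp fps_add.
Proof. by move=> f; apply/funext=> n; rewrite /fps_add addNr. Qed.

HB.instance Definition _ := GRing.isZmodule.Build (fps R)
  fps_addA fps_addC fps_add0 fps_addN.

(** Scalar series are series of 1 x 1 matrices, so associativity is inherited from [ps_mulA]. *)
Let mx1 f n : 'M[R]_1 := (f n)%:M.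

Let mx1M f g n : (fps_mul f g n)%:M = ps_mul (mx1 f) (mx1 g) n.
Proof.
rewrite /fps_mul /ps_mul raddf_sum; apply: eq_bigr => t _.
exact: scalar_mxM.
Qed.

Let mx1_inj : injective (fun x : R => x%:M : 'M[R]_1).
Proof. by move=> x y /matrixP/(_ 0 0); rewrite !mxE. Qed.

Lemma fps_mulA : associative fps_mul.
Proof.
move=> f g h; apply/funext=> n; apply: mx1_inj.
rewrite !mx1M (eq_ps_mul (frefl _) (mx1M g h)) ps_mulA.
exact: (eq_ps_mul (fun m => esym (mx1M f g m)) (frefl _)).
Qed.

Lemma fps_mul1l : left_id (fps_cst 1) fps_mul.
Proof.
move=> f; apply/funext=> n; rewrite /fps_mul big_ord_recl mul1r subn0.
by rewrite big1 ?addr0 // => i _; rewrite mul0r.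
Qed.
Lemma fps_mul1r : right_id (fps_cst 1) fps_mul.
Proof.
move=> f; apply/funext=> n; rewrite /fps_mul big_ord_recr /= subnn mulr1.
rewrite big1 ?add0r // => i _.
by have := ltn_ord i; rewrite -subn_gt0; case: (n - i)%N => //= m _; rewrite mulr0.
Qed.
Lemma fps_mulDl : left_distributive fps_mul +%R.
Proof.
move=> f g h; apply/funext=> n.
by rewrite /fps_mul [RHS]/+%R/= /fps_add -big_split; apply: eq_bigr => i _; rewrite mulrDl.
Qed.
Lemma fps_mulDr : right_distributive fps_mul +%R.
Proof.
move=> f g h; apply/funext=> n.
by rewrite /fps_mul [RHS]/+%R/= /fps_add -big_split; apply: eq_bigr => i _; rewrite mulrDr.
Qed.

HB.instance Definition _ := GRing.Zmodule_isPzRing.Build (fps R)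
  fps_mulA fps_mul1l fps_mul1r fps_mulDl fps_mulDr.

Lemma fpsP f g : (forall n, f n = g n) -> f = g.
Proof. by move=> fg; apply/funext. Qed.

Lemma fps0E n : (0 : fps R) n = 0. Proof. by []. Qed.
Lemma fpsDE f g n : (f + g) n = f n + g n. Proof. by []. Qed.
Lemma fpsNE f n : (- f) n = - f n. Proof. by []. Qed.
Lemma fpsBE f g n : (f - g) n = f n - g n. Proof. by []. Qed.
Lemma fpsME f g n : (f * g) n = \sum_(t < n.+1) f t * g (n - t)%N. Proof. by []. Qed.
Lemma fps1E n : (1 : fps R) n = (n == 0%N)%:R. Proof. by case: n. Qed.
Lemma fps_cstE x n : fps_cst x n = if n == 0%N then x else 0. Proof. by case: n. Qed.

Definition fps_coef n (f : fps R) : R := f n.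
Lemma fps_coef_is_additive n : zmod_morphism (fps_coef n).
Proof. by []. Qed.
HB.instance Definition _ n := GRing.isZmodMorphism.Build (fps R) R (fps_coef n)
  (fps_coef_is_additive n).

Lemma fps_cst_is_additive : zmod_morphism fps_cst.
Proof. by move=> x y; apply: fpsP => -[|n] //=; rewrite fpsBE subr0. Qed.
HB.instance Definition _ := GRing.isZmodMorphism.Build R (fps R) fps_cst fps_cst_is_additive.

Lemma fps_cstMl x f n : (fps_cst x * f) n = x * f n.
Proof.
rewrite fpsME big_ord_recl subn0 big1 ?addr0 // => i _.
by rewrite mul0r.
Qed.
Lemma fps_cstMr x f n : (f * fps_cst x) n = f n * x.
Proof.
rewrite fpsME big_ord_recr /= subnn big1 ?add0r // => i _.
by have := ltn_ord i; rewrite -subn_gt0; case: (n - i)%N => //= m _; rewrite mulr0.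
Qed.

Lemma fps_cst_is_multiplicative : monoid_morphism fps_cst.
Proof.
by split=> // x y; apply: fpsP => -[|n]; rewrite fps_cstMl //= mulr0.
Qed.
HB.instance Definition _ := GRing.isMonoidMorphism.Build R (fps R) fps_cst
  fps_cst_is_multiplicative.

Definition fps_X : fps R := fun n => (n == 1%N)%:R.

Lemma fps_XM f n : (fps_X * f) n = if n is n'.+1 then f n' else 0.
Proof.
case: n => [|n]; rewrite fpsME big_ord_recl mul0r add0r ?big_ord0 //.
rewrite big_ord_recl /= mul1r subn1 big1 ?addr0 // => i _.
by rewrite mul0r.
Qed.

Lemma fps_MX f n : (f * fps_X) n = if n is n'.+1 then f n' else 0.
Proof.
case: n => [|n]; rewrite fpsME big_ord_recr /= subnn mulr0 addr0 ?big_ord0 //.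
rewrite big_ord_recr /= subSnn mulr1 big1 ?add0r // => i _.
rewrite /fps_X [_ == _]negbTE ?mulr0 //.
by have := ltn_ord i; rewrite -subn_gt0 subSn; case: (n - i)%N; rewrite // ltnW.
Qed.

Lemma fps_XC f : fps_X * f = f * fps_X.
Proof. by apply: fpsP => n; rewrite fps_XM fps_MX. Qed.

End FpsRing.

Section FpsMap.
Variables (R S : pzRingType) (h : {rmorphism R -> S}).

Definition fps_map (f : fps R) : fps S := fun n => h (f n).

Lemma fps_map_is_additive : zmod_morphism fps_map.
Proof. by move=> f g; apply: fpsP => n; rewrite fpsBE /fps_map fpsBE raddfB. Qed.
HB.instance Definition _ := GRing.isZmodMorphism.Build (fps R) (fps S) fps_map
  fps_map_is_additive.

Lemma fps_map_is_multiplicative : monoid_morphism fps_map.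
Proof.
split=> [|f g]; apply: fpsP => n.
  by rewrite /fps_map !fps1E rmorph_nat.
by rewrite /fps_map !fpsME raddf_sum; apply: eq_bigr => i _; exact: rmorphM.
Qed.
HB.instance Definition _ := GRing.isMonoidMorphism.Build (fps R) (fps S) fps_map
  fps_map_is_multiplicative.
End FpsMap.

Section Sign.
Variable R : pzRingType.
Implicit Types x y : R.

Lemma signrC (b : bool) x : (-1) ^+ b * x = x * (-1) ^+ b.
Proof. exact/esym/commr_sign. Qed.

Lemma mulr_signl (b : bool) x y : x * ((-1) ^+ b * y) = (-1) ^+ b * (x * y).
Proof. by rewrite mulrA -signrC mulrA. Qed.

Lemma mulr_sign2 (b c : bool) x : (-1) ^+ b * ((-1) ^+ c * x) = (-1) ^+ (b (+) c) * x.
Proof. by rewrite mulrA signr_addb. Qed.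

End Sign.

(** * Two tensor legs with the super sign rule *)

Section Legs.
Variables (Z : pzRingType) (N : nat) (p : 'I_N -> bool).
Local Notation M := 'M[Z]_N.
Local Notation MM := 'M['M[Z]_N]_N.
Implicit Types A B : M.

(* Two copies of the N x N matrices over Z with the super tensor product sign
   rule: the entry of leg1 A * leg2 B at (i, j), (h, k) is
   (-1)^(|h|(|i| + |j|)) A i j * B h k. *)
Definition leg1 A : MM := \matrix_(i, j) \matrix_(h, k)
  (if h == k then (-1) ^+ (p h && (p i (+) p j)) * A i j else 0).
Definition leg2 A : MM := A%:M.
(** The super permutation $P$ of the two tensor factors, written blockwise; $u-v-P$ is the rational
    R-matrix. *)
Definition flip : MM := \matrix_(i, j) \matrix_(h, k)
  (if (h == j) && (k == i) then (-1) ^+ (p i && p j) else 0).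

Lemma mmP (x y : MM) : (forall i j h k, x i j h k = y i j h k) -> x = y.
Proof. by move=> xy; apply/matrixP=> i j; apply/matrixP=> h k; apply: xy. Qed.

Lemma mmME (x y : MM) i j h k :
  (x * y) i j h k = \sum_a \sum_b x i a h b * y a j b k.
Proof.
by rewrite mxE summxE; apply: eq_bigr => a _; rewrite [LHS]mxE.
Qed.

Lemma leg1E A i j h k :
  leg1 A i j h k = if h == k then (-1) ^+ (p h && (p i (+) p j)) * A i j else 0.
Proof. by rewrite !mxE. Qed.

Lemma leg2E A i j h k : leg2 A i j h k = if i == j then A h k else 0.
Proof. by rewrite !mxE; case: (i == j); rewrite ?mulr1n ?mulr0n ?mxE. Qed.

Lemma flipE i j h k :
  flip i j h k = if (h == j) && (k == i) then (-1) ^+ (p i && p j) else 0.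
Proof. by rewrite !mxE. Qed.

Lemma leg1_leg2E A B i j h k :
  (leg1 A * leg2 B) i j h k = (-1) ^+ (p h && (p i (+) p j)) * A i j * B h k.
Proof.
rewrite mmME (bigD1 j) //= [X in _ + X]big1 ?addr0; last first.
  by move=> a aj; rewrite big1 // => b _; rewrite leg2E (negPf aj) mulr0.
rewrite (bigD1 h) //= leg1E eqxx leg2E eqxx big1 ?addr0 // => b bh.
by rewrite leg1E eq_sym (negPf bh) mul0r.
Qed.

Lemma leg2_leg1E A B i j h k :
  (leg2 B * leg1 A) i j h k = (-1) ^+ (p k && (p i (+) p j)) * (B h k * A i j).
Proof.
rewrite mmME (bigD1 i) //= [X in _ + X]big1 ?addr0; last first.
  by move=> a ai; rewrite big1 // => b _; rewrite leg2E eq_sym (negPf ai) mul0r.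
rewrite (bigD1 k) //= leg1E eqxx leg2E eqxx big1 ?addr0 ?mulr_signl // => b bh.
by rewrite leg1E (negPf bh) mulr0.
Qed.

Lemma flipMlE (x : MM) i j h k :
  (flip * x) i j h k = (-1) ^+ (p i && p h) * x h j i k.
Proof.
rewrite mmME (bigD1 h) //= [X in _ + X]big1 ?addr0; last first.
  move=> a ah; rewrite big1 // => b _.
  by rewrite flipE eq_sym (negPf ah) mul0r.
rewrite (bigD1 i) //= flipE !eqxx big1 ?addr0 // => b bi.
by rewrite flipE (negPf bi) andbF mul0r.
Qed.

Lemma flipMrE (x : MM) i j h k :
  (x * flip) i j h k = (-1) ^+ (p j && p k) * x i k h j.
Proof.
rewrite mmME (bigD1 k) //= [X in _ + X]big1 ?addr0; last first.
  move=> a ak; rewrite big1 // => b _.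
  by rewrite flipE [k == a]eq_sym (negPf ak) andbF mulr0.
rewrite (bigD1 j) //= flipE !eqxx andbC signrC big1 ?addr0 // => b bj.
by rewrite flipE (negPf bj) mulr0.
Qed.

Lemma flipK : flip * flip = 1.
Proof.
apply: mmP => i j h k; rewrite flipMlE flipE !mxE.
rewrite [k == h]eq_sym; have [->|ij] := eqVneq i j; last by rewrite !mxE /= mulr0.
by rewrite !mxE; case: eqVneq => [->|_] /=; rewrite ?mulr0 // -signr_addb andbC addbb.
Qed.

Lemma flip_leg1 A : flip * leg1 A = leg2 A * flip.
Proof.
apply: mmP => i j h k; rewrite flipMlE flipMrE leg1E leg2E.
have [->|_] := eqVneq i k; last by rewrite !mulr0.
rewrite mulrA -signr_addb; congr ((-1) ^+ _ * _); congr nat_of_bool.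
by case: (p k); case: (p h); case: (p j).
Qed.

Lemma leg2_is_additive : zmod_morphism leg2.
Proof. exact: raddfB. Qed.
HB.instance Definition _ := GRing.isZmodMorphism.Build M MM leg2 leg2_is_additive.

Lemma leg2_is_multiplicative : monoid_morphism leg2.
Proof. by split=> // A B; apply: scalar_mxM. Qed.
HB.instance Definition _ := GRing.isMonoidMorphism.Build M MM leg2
  leg2_is_multiplicative.

(** Conjugation by the involution [flip] exchanges the legs; hence [leg1], whose signs are awkward,
    inherits additivity and multiplicativity from the scalar embedding [leg2]. *)
Lemma leg1_flip A : leg1 A = flip * leg2 A * flip.
Proof. by rewrite -[LHS]mul1r -flipK -mulrA flip_leg1 mulrA. Qed.

Lemma leg1_is_additive : zmod_morphism leg1.
Proof. by move=> A B; rewrite !leg1_flip raddfB mulrBr mulrBl. Qed.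
HB.instance Definition _ := GRing.isZmodMorphism.Build M MM leg1 leg1_is_additive.

Lemma leg1_is_multiplicative : monoid_morphism leg1.
Proof.
split=> [|A B]; rewrite !leg1_flip ?rmorph1 ?mulr1 ?flipK //.
by rewrite rmorphM -!mulrA; congr (_ * (_ * _)); rewrite mulrA flipK mul1r.
Qed.
HB.instance Definition _ := GRing.isMonoidMorphism.Build M MM leg1
  leg1_is_multiplicative.

End Legs.

(** * The RTT relation on two legs *)

Section Assoc.
Variable R : pzRingType.
Lemma eq_mulA (a b c d : R) : a * b = c * d -> forall w, a * (b * w) = c * (d * w).
Proof. by move=> ab w; rewrite !mulrA ab. Qed.
Lemma eq_mulA1 (a b c : R) : a * b = c -> forall w, a * (b * w) = c * w.
Proof. by move=> ab w; rewrite !mulrA ab. Qed.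
Lemma mulCA (a : R) : (forall x, a * x = x * a) -> forall x y, x * (a * y) = a * (x * y).
Proof. by move=> aC x y; rewrite !mulrA -aC. Qed.
End Assoc.

(* The calculus of a matrix X over a ring of power series put on the first leg
   with a variable va (a1) and on the second leg with a variable vb (b2), P
   being the flip of the two legs. *)
Record two_leg (M S S0 : pzRingType) := TwoLeg {
  a1 : {rmorphism M -> S}; a2 : {rmorphism M -> S};
  b1 : {rmorphism M -> S}; b2 : {rmorphism M -> S};
  va : S; vb : S; P : S; P0 : S0;
  coef : nat -> nat -> {additive S -> S0};
  vaC : forall x, va * x = x * va;
  vbC : forall x, vb * x = x * vb;
  PP : P * P = 1;
  P0P0 : P0 * P0 = 1;
  Pa1 : forall x, P * a1 x = a2 x * P;
  Pb1 : forall x, P * b1 x = b2 x * P;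
  coef_eq0 : forall x, (forall n m, coef n m x = 0) -> x = 0;
  coef_va : forall n m x, coef n m (va * x) = if n is n'.+1 then coef n' m x else 0;
  coef_vb : forall n m x, coef n m (vb * x) = if m is m'.+1 then coef n m' x else 0;
  coef_Pl : forall n m x, coef n m (P * x) = P0 * coef n m x;
  coef_Pr : forall n m x, coef n m (x * P) = coef n m x * P0
}.

Section TwoLegTheory.
Variables (M S S0 : pzRingType) (L : two_leg M S S0).
Implicit Types x y z v X : M.
Local Notation a1 := (a1 L).
Local Notation a2 := (a2 L).
Local Notation b1 := (b1 L).
Local Notation b2 := (b2 L).
Local Notation P := (P L).
Local Notation va := (va L).
Local Notation vb := (vb L).
Local Notation coef := (coef L).

(** With [va] $=u^{-1}$ and [vb] $=v^{-1}$ this is $(u-v)/(uv)$, and [prod_var] is $1/(uv)$; so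
    [c - q * P] is the R-matrix $u-v-P$ divided by $uv$, which keeps it inside power series. Both
    are locked so that they stay atoms under rewriting. *)
Definition diff_var : S := locked (vb - va).
Definition prod_var : S := locked (va * vb).
Local Notation c := diff_var.
Local Notation q := prod_var.

Lemma diff_varE : c = vb - va. Proof. by rewrite /diff_var -lock. Qed.
Lemma prod_varE : q = va * vb. Proof. by rewrite /prod_var -lock. Qed.
Lemma diff_varC s : c * s = s * c.
Proof. rewrite diff_varE; by rewrite mulrBl mulrBr vaC vbC. Qed.
Lemma prod_varC s : q * s = s * q.
Proof. by rewrite prod_varE -mulrA vbC mulrA vaC mulrA. Qed.
Local Notation cC := diff_varC.
Local Notation qC := prod_varC.
Local Notation cA := (mulCA diff_varC).
Local Notation qA := (mulCA prod_varC).

Lemma Pa2 x : P * a2 x = a1 x * P.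
Proof. by rewrite -[LHS]mulr1 -(PP L) mulrA -(mulrA P) -Pa1 mulrA PP mul1r. Qed.
Lemma Pb2 x : P * b2 x = b1 x * P.
Proof. by rewrite -[LHS]mulr1 -(PP L) mulrA -(mulrA P) -Pb1 mulrA PP mul1r. Qed.

(** Abstracts a constant diagonal 0-1 matrix: it does not see the variable, and its first leg
    commutes with everything on the second. The block projections are of this kind. *)
Definition diagonal x := a1 x = b1 x /\
  forall y, a1 x * a2 y = a2 y * a1 x /\ a1 x * b2 y = b2 y * a1 x.

Lemma diag2 x : diagonal x -> a2 x = b2 x.
Proof.
by case=> e _; rewrite -[a2 x]mulr1 -(PP L) mulrA -Pa1 e Pb1 -mulrA PP mulr1.
Qed.
Lemma Pinj s t : P * s = P * t -> s = t.
Proof. by move=> e; rewrite -[s]mul1r -[t]mul1r -(PP L) -!mulrA e. Qed.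
Lemma PM s s' t t' : P * s = s' * P -> P * t = t' * P -> P * (s * t) = s' * t' * P.
Proof. by move=> es et; rewrite mulrA es -mulrA et mulrA. Qed.
Lemma diag_a1 x y : diagonal x -> a1 y * a2 x = a2 x * a1 y.
Proof.
case=> _ /(_ y) [e _]; apply: Pinj.
by rewrite (PM (Pa1 _ _) (Pa2 _)) (PM (Pa2 _) (Pa1 _ _)) e.
Qed.
Lemma diag_b1 x y : diagonal x -> b1 y * a2 x = a2 x * b1 y.
Proof.
case=> dx /(_ y) [_ e]; apply: Pinj.
by rewrite (PM (Pb1 _ _) (Pa2 _)) (PM (Pa2 _) (Pb1 _ _)) e.
Qed.
Lemma diag_a2 x y : diagonal x -> a1 x * a2 y = a2 y * a1 x.
Proof. by case=> _ /(_ y) []. Qed.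
Lemma diag_b2 x y : diagonal x -> a1 x * b2 y = b2 y * a1 x.
Proof. by case=> _ /(_ y) []. Qed.
Lemma diag1 x : diagonal x -> a1 x = b1 x. Proof. by case. Qed.

Definition rtt X :=
  (c - q * P) * (a1 X * b2 X) = b2 X * a1 X * (c - q * P).

(** RTT with the inverse [X'] multiplied on the second leg from both sides, then cut by projections.
    The right side depends on the overlaps [z * y] and [x * v], so disjoint cuts remove one or both
    of its terms. Apart from D with D inside one block, the relations of D, E and F obtained below
    all start from such a cut. *)
Lemma mixed_cut X X' w x y z v : rtt X -> X * X' = w -> X' * X = w ->
  w * v = v -> z * w = z ->
  diagonal x -> diagonal y -> diagonal z -> diagonal v ->
  c * (a1 (x * X * y) * b2 (z * X' * v) - b2 (z * X' * v) * a1 (x * X * y))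
  = q * (P * a1 (z * y) * a2 (x * X) * b2 (X' * v)
         - a1 (x * v) * b2 (z * X') * a2 (X * y) * P).
Proof.
move=> rX XX' X'X wv zw dx dy dz dv.
have bX : b2 X * (b2 X' * b2 v) = b2 v by rewrite -!rmorphM mulrA XX' wv.
have bX' : b2 z * (b2 X' * b2 X) = b2 z by rewrite -!rmorphM X'X zw.
(* RTT surrounded by the cuts and by [X']; [e1] to [e4] bring the four products of the claim to the
   shape of the four terms in its expansion. *)
have H : a1 x * (b2 z * (b2 X' * ((c - q * P) * (a1 X * b2 X) * (b2 X' * (b2 v * a1 y)))))
       = a1 x * (b2 z * (b2 X' * (b2 X * a1 X * (c - q * P) * (b2 X' * (b2 v * a1 y))))).
  by rewrite rX.
have x2 t : a1 x * b2 t = b2 t * a1 x := diag_b2 _ dx.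
have y2 t : a1 y * b2 t = b2 t * a1 y := diag_b2 _ dy.
have y2' t : a1 y * a2 t = a2 t * a1 y := diag_a2 _ dy.
have x2' t : a1 x * a2 t = a2 t * a1 x := diag_a2 _ dx.
have z2 t : a1 t * b2 z = b2 z * a1 t by rewrite -(diag2 dz); apply: diag_a1.
have e1 : a1 (x * X * y) * b2 (z * X' * v)
    = a1 x * (b2 z * (a1 X * (b2 X' * (b2 v * a1 y)))).
  rewrite !rmorphM /= -!mulrA (eq_mulA (y2 _)) (eq_mulA (y2 _)) y2.
  by rewrite (eq_mulA (z2 _)).
have e2 : b2 (z * X' * v) * a1 (x * X * y)
    = a1 x * (b2 z * (b2 X' * (a1 X * (b2 v * a1 y)))).
  rewrite !rmorphM /= -!mulrA -(eq_mulA (x2 _)) -(eq_mulA (x2 _)) -(eq_mulA (x2 _)).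
  do 3!congr (_ * _); rewrite -(diag2 dv) -(eq_mulA (diag_a1 _ dv)) //.
have e3 : P * a1 (z * y) * a2 (x * X) * b2 (X' * v)
    = a1 x * (b2 z * (a1 X * (P * (b2 X' * (b2 v * a1 y))))).
  rewrite !rmorphM /= -!mulrA -(eq_mulA (Pa2 _)) -(diag2 dz).
  rewrite -(eq_mulA (Pa1 _ _)) -(eq_mulA (Pa2 _)); congr (_ * _).
  rewrite (eq_mulA (y2' _)) (eq_mulA (y2' _)) (eq_mulA (y2 _)) y2.
  rewrite !mulrA; do 4!congr (_ * _).
  by rewrite (diag_a1 _ dx).
have e4 : a1 (x * v) * b2 (z * X') * a2 (X * y) * P
    = a1 x * (b2 z * (b2 X' * (P * (a1 X * (b2 v * a1 y))))).
  rewrite !rmorphM /= -!mulrA (eq_mulA (Pa1 _ _)) -(diag2 dv) (eq_mulA (Pa2 _)) Pa1.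
  congr (_ * _); rewrite (eq_mulA (diag_b2 _ dv)) (eq_mulA (diag_b2 _ dv)).
  by rewrite (eq_mulA (diag_a2 _ dv)).
rewrite e1 e2 e3 e4.
move: H.
rewrite mulrBl !mulrBr !mulrBl !mulrBr -!mulrA.
have bXA t : b2 z * (b2 X' * (b2 X * t)) = b2 z * t by rewrite !mulrA -(mulrA (b2 z)) bX'.
have bXB t : b2 X * (b2 X' * (b2 v * t)) = b2 v * t by rewrite !mulrA -(mulrA (b2 X)) bX.
rewrite ![_ * (c * _)]cA ![_ * (q * _)]qA !bXA !bXB.
set u1 := c * _; set u2 := q * _; set u3 := c * _; set u4 := q * _ => H.
by rewrite -[u3](subrK u4) -H; ncring.
Qed.

(** If multiplication by [va] and by [vb] agree on s, vanishing spreads from the border of exponent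
    0 in [va] to all exponents: $u^{-1}-v^{-1}$ is not a zero divisor. *)
Lemma diff_var_inj s : c * s = 0 -> s = 0.
Proof.
rewrite diff_varE => e; apply: (@coef_eq0 _ _ _ L) => n.
have sh i j : coef i j (vb * s) = coef i j (va * s).
  by apply/eqP; rewrite -subr_eq0 -raddfB -mulrBl e raddf0.
elim: n => [|n IH] m; first by have := sh 0%N m.+1; rewrite coef_va coef_vb.
by have := sh n.+1 m.+1; rewrite coef_va coef_vb IH.
Qed.

Lemma central_expand (z u : S) : (c * z - q * (u * P)) * (c - q * P)
  = c * (c * z) - q * (c * (z * P)) - q * (c * (u * P)) + q * (q * u).
Proof.
rewrite mulrBr -(cC (_ - _)) [_ * (q * P)](mulCA qC) !mulrBl -!mulrA PP mulr1.
by rewrite mulrBr [c * (q * _)](mulCA qC); ncring.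
Qed.

Lemma central_expand2 (a b u z : S) : c * (c * (- (a * z) - u * b + u * z))
  = - (c * (a * (c * z))) - c * (c * u * b) + c * u * (c * z).
Proof. by rewrite ![_ * (c * z)](mulCA cC); ncring. Qed.

Lemma cq_expand (V k : S) :
  V * (c * c - q * q) = c * (q * (P * k)) * (c + q * P) ->
  vb * (vb * V) - va * (vb * V) *+ 2 + va * (va * V)
    - va * (va * (vb * (vb * V)))
  = va * (vb * (vb * (vb * (P * k)))) - va * (va * (vb * (vb * (P * k)))) *+ 2
    + va * (va * (va * (vb * (P * k))))
    + (va * (va * (vb * (vb * (vb * (P * k * P)))))
    - va * (va * (va * (vb * (vb * (P * k * P)))))).
Proof.
have vab t : vb * (va * t) = va * (vb * t) by rewrite (mulCA (@vaC _ _ _ L)).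
rewrite mulrBr [V * (c * c)](mulCA cC) -(cC V) [V * (q * q)](mulCA qC) -(qC V).
rewrite mulrDr -(cC (c * _)) [c * (q * (P * k)) * (q * P)](mulCA qC) -!(mulrA c) -!(mulrA q).
rewrite !diff_varE !prod_varE.
move: (P * k) (P * k * P) => k1 k2; rewrite -!(mulrA va).
rewrite !mulrBl !mulrBr !vab => e.
apply: subr0_eq; move/eqP: e; rewrite -subr_eq0 => /eqP e.
by rewrite -[RHS]e !mulr2n; ncring.
Qed.

Lemma coef_va0 m (x : S) : coef 0 m (va * x) = 0. Proof. by rewrite coef_va. Qed.
Lemma coef_vaS n m (x : S) : coef n.+1 m (va * x) = coef n m x. Proof. by rewrite coef_va. Qed.
Lemma coef_vb0 n (x : S) : coef n 0 (vb * x) = 0. Proof. by rewrite coef_vb. Qed.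
Lemma coef_vbS n m (x : S) : coef n m.+1 (vb * x) = coef n m x. Proof. by rewrite coef_vb. Qed.
Lemma coef_add n m (x y : S) : coef n m (x + y) = coef n m x + coef n m y.
Proof. exact: raddfD. Qed.
Lemma coef_opp n m (x : S) : coef n m (- x) = - coef n m x.
Proof. exact: raddfN. Qed.
Lemma coef_mul2 n m (x : S) : coef n m (x *+ 2) = coef n m x *+ 2.
Proof. exact: raddfMn. Qed.
Definition coefE := (coef_add, coef_opp, coef_mul2, coef_va0, coef_vaS, coef_vb0, coef_vbS, coef_Pl, coef_Pr).

(** One equation for two unknowns: V, and a series k in [vb] alone. High exponents of [va] kill V
    beyond exponent 1, exponent 1 expresses V through k, and exponent 2 then forces k to vanish.
    This eliminates the one-variable commutator left over in the computation of [E(u), E(v)]. *)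
Lemma cq_eq0 (V k : S) :
  V * (c * c - q * q) = c * (q * (P * k)) * (c + q * P) ->
  (forall m, coef 0 m V = 0) -> (forall n m, coef n.+1 m k = 0) -> V = 0.
Proof.
move=> /cq_expand Vc V0 kS.
pose z := (mulr0, mul0r, mul0rn, subr0, addr0, add0r, oppr0).
have {}Vc n m := congr1 (coef n m) Vc.
have Vn m n : coef n.+2 m V = 0.
  elim/ltn_ind: m n => m IH n.
  have := Vc n.+4 m.
  case: m IH => [|[|m]] IH; rewrite !coefE ?kS ?z //.
  - by rewrite !(IH 0%N) ?z.
  - by case: m IH => [|m] IH; rewrite ?coefE ?kS ?(IH 1%N) ?(IH 0%N) ?(IH m.+2) ?(IH m.+1) ?z.
have V1 m : coef 1 m V = P0 L * (if m is m'.+1 then coef 0 m' k else 0).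
  have := Vc 1%N m.+2.
  rewrite !coefE ?V0.
  by case: m => [|m]; rewrite ?coefE ?z // => ->.
have k0 m : coef 0 m k = 0.
  have := Vc 2 m.+3.
  rewrite !coefE !V0 !Vn !V1 ?kS ?z -[LHS]addr0 => e.
  move: (addrI _ e) => /esym.
  move=> /(congr1 (fun s => P0 L * (s * P0 L))).
  by rewrite -!mulrA P0P0 mulr1 mulrA P0P0 mul1r mul0r mulr0.
apply: (@coef_eq0 _ _ _ L) => -[|[|n]] m; rewrite ?V0 ?Vn // V1.
by case: m => [|m]; rewrite ?k0 mulr0.
Qed.

(** The factorization
    $\begin{pmatrix}1&0\\F&1\end{pmatrix}\begin{pmatrix}D&0\\0&G\end{pmatrix}\begin{pmatrix}1&E\\0&1\end{pmatrix}$
    of X on w = x + y, and that of its inverse [X'], recorded through those rows, columns and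
    corners that the cuts produce. *)
Record two_block (w x y X X' D D' G G' E F : M) : Prop := TwoBlock {
  tb_w : w = x + y; tb_dx : diagonal x; tb_dy : diagonal y;
  tb_xx : x * x = x; tb_yy : y * y = y; tb_xy : x * y = 0; tb_yx : y * x = 0;
  tb_rtt : rtt X; tb_XX' : X * X' = w; tb_X'X : X' * X = w;
  tb_xD : x * D = D; tb_Dx : D * x = D; tb_DD' : D * D' = x; tb_D'D : D' * D = x;
  tb_xD' : x * D' = D'; tb_D'x : D' * x = D';
  tb_yG : y * G = G; tb_Gy : G * y = G; tb_GG' : G * G' = y; tb_G'G : G' * G = y;
  tb_yG' : y * G' = G'; tb_G'y : G' * y = G';
  tb_xE : x * E = E; tb_Ey : E * y = E; tb_yF : y * F = F; tb_Fx : F * x = F;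
  tb_xX : x * X = D * (x + E); tb_Xx : X * x = (x + F) * D;
  tb_Xy : X * y = G + (x + F) * D * E;
  tb_X'y : X' * y = (y - E) * G'; tb_yX' : y * X' = G' * (y - F);
  tb_X'x : X' * x = D' - (y - E) * G' * F
}.

Section TwoBlockTheory.
Variables (w x y X X' D D' G G' E F : M).
Hypothesis TB : two_block w x y X X' D D' G G' E F.
Local Notation dE := (b2 E - a2 E).
Let dx := tb_dx TB.
Let dy := tb_dy TB.

Let wx : w * x = x. Proof. by rewrite (tb_w TB) mulrDl (tb_xx TB) (tb_yx TB) addr0. Qed.
Let wy : w * y = y. Proof. by rewrite (tb_w TB) mulrDl (tb_xy TB) (tb_yy TB) add0r. Qed.
Let xw : x * w = x. Proof. by rewrite (tb_w TB) mulrDr (tb_xx TB) (tb_xy TB) addr0. Qed.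
Let yw : y * w = y. Proof. by rewrite (tb_w TB) mulrDr (tb_yx TB) (tb_yy TB) add0r. Qed.
Let Ex : E * x = 0. Proof. by rewrite -(tb_Ey TB) -mulrA (tb_yx TB) mulr0. Qed.
Let yE : y * E = 0. Proof. by rewrite -(tb_xE TB) mulrA (tb_yx TB) mul0r. Qed.
Let Fy : F * y = 0. Proof. by rewrite -(tb_Fx TB) -mulrA (tb_xy TB) mulr0. Qed.
Let xXx : x * X * x = D.
Proof. by rewrite (tb_xX TB) -mulrA mulrDl Ex addr0 (tb_xx TB) (tb_Dx TB). Qed.
Let xXy : x * X * y = D * E.
Proof. by rewrite (tb_xX TB) -mulrA mulrDl (tb_xy TB) (tb_Ey TB) add0r. Qed.
Let yX'y : y * X' * y = G'.
Proof. by rewrite (tb_yX' TB) -mulrA mulrBl Fy subr0 (tb_yy TB) (tb_G'y TB). Qed.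
Let yX'x : y * X' * x = - (G' * F).
Proof. by rewrite (tb_yX' TB) -mulrA mulrBl (tb_yx TB) (tb_Fx TB) sub0r mulrN. Qed.
Let xX'y : x * X' * y = - (E * G').
Proof. by rewrite -mulrA (tb_X'y TB) mulrA mulrBr (tb_xy TB) (tb_xE TB) sub0r mulNr. Qed.

Lemma cut_D_G : c * (a1 D * b2 G' - b2 G' * a1 D) = 0.
Proof.
have := mixed_cut (tb_rtt TB) (tb_XX' TB) (tb_X'X TB) wy yw dx dx dy dy.
rewrite xXx yX'y (tb_yx TB) (tb_xy TB) => ->.
by rewrite !rmorph0 !(mulr0, mul0r) subrr mulr0.
Qed.

Lemma comm_D_G' : a1 D * b2 G' = b2 G' * a1 D.
Proof. by apply/eqP; rewrite -subr_eq0; apply/eqP/diff_var_inj/cut_D_G. Qed.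

(** Origin of the difference E(v) - E(u) in the relations with E: a row of X in the variable u meets
    a column of [X'] in the variable v on the same leg. *)
Let Ex2 : a2 (x + E) * b2 (y - E) = - dE.
Proof.
have f1 : a2 x * b2 y = 0 by rewrite (diag2 dx) -rmorphM (tb_xy TB) rmorph0.
have f2 : a2 x * b2 E = b2 E by rewrite (diag2 dx) -rmorphM (tb_xE TB).
have f3 : a2 E * b2 y = a2 E by rewrite -(diag2 dy) -rmorphM (tb_Ey TB).
have f4 : a2 E * b2 E = 0.
  by rewrite -f3 -mulrA -(rmorphM b2) yE rmorph0 mulr0.
by rewrite (rmorphD a2) (rmorphB b2) mulrDl !mulrBr f1 f2 f3 f4; ncring.
Qed.
Let Fx2 : b2 (y - F) * a2 (x + F) = a2 F - b2 F.
Proof.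
have f1 : b2 y * a2 x = 0 by rewrite (diag2 dx) -rmorphM (tb_yx TB) rmorph0.
have f2 : b2 F * a2 x = b2 F by rewrite (diag2 dx) -rmorphM (tb_Fx TB).
have f3 : b2 y * a2 F = a2 F by rewrite -(diag2 dy) -rmorphM (tb_yF TB).
have f4 : b2 F * a2 F = 0.
  by rewrite -f3 mulrA -(rmorphM b2) Fy rmorph0 mul0r.
by rewrite (rmorphD a2) (rmorphB b2) mulrBl !mulrDr f1 f2 f3 f4; ncring.
Qed.
Let a1y t : a1 t * b2 y = b2 y * a1 t.
Proof. by rewrite -(diag2 dy) (diag_a1 _ dy). Qed.
Let x2E : a2 x * dE = dE.
Proof. by rewrite mulrBr {1}(diag2 dx) -!rmorphM (tb_xE TB). Qed.
Let dEy2 : dE * b2 y = dE.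
Proof. by rewrite mulrBl -{2}(diag2 dy) -!rmorphM (tb_Ey TB). Qed.
Let x1E : a1 x * dE = dE * a1 x.
Proof. by rewrite mulrBr mulrBl (diag_b2 _ dx) (diag_a2 _ dx). Qed.
Let PyD : P * (a1 y * a2 D) = a1 D * (P * a1 y).
Proof. by rewrite (diag_a2 _ dy) mulrA Pa2 mulrA. Qed.
Let PxD : P * (a1 x * a2 D) = a1 D * (P * a1 x).
Proof. by rewrite (diag_a2 _ dx) mulrA Pa2 mulrA. Qed.

(** The cuts deliver relations multiplied by an invertible diagonal block; this lemma and the next
    two cancel it inside its corner. *)
Lemma strip_b2G' (u v : S) : u * b2 y = u -> v * b2 y = v -> u * b2 G' = v * b2 G' -> u = v.
Proof.
move=> uy vy /(congr1 (fun s => s * b2 G)).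
by rewrite -!mulrA -rmorphM (tb_G'G TB) uy vy.
Qed.
Lemma strip_a1D (u v : S) : a1 x * u = u -> a1 x * v = v -> a1 D * u = a1 D * v -> u = v.
Proof.
move=> xu xv /(congr1 (fun s => a1 D' * s)).
by rewrite !mulrA -rmorphM (tb_D'D TB) xu xv.
Qed.
Lemma strip_G'b2 (u v : S) : b2 y * u = u -> b2 y * v = v -> b2 G' * u = b2 G' * v -> u = v.
Proof.
move=> xu xv /(congr1 (fun s => b2 G * s)).
by rewrite !mulrA -rmorphM (tb_GG' TB) xu xv.
Qed.

Lemma comm_D_E : c * (a1 D * b2 E - b2 E * a1 D) = q * (P * (a1 x * (a2 D * dE))).
Proof.
apply: strip_b2G'.
- by rewrite -mulrA mulrBl -!mulrA a1y (eq_mulA1 (esym (rmorphM _ _ _))) -rmorphM (tb_Ey TB).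
- by rewrite -!mulrA dEy2.
have := mixed_cut (tb_rtt TB) (tb_XX' TB) (tb_X'X TB) wy xw dx dx dx dy.
rewrite xXx xX'y (tb_xy TB) (tb_xx TB) (tb_xX TB) (tb_X'y TB) !rmorph0 !mul0r subr0.
rewrite [a2 (D * _)]rmorphM [b2 (_ * G')]rmorphM rmorphN rmorphM /=.
rewrite -!mulrA (eq_mulA1 Ex2) => e.
transitivity (- (c * (a1 D * - (b2 E * b2 G') - - (b2 E * b2 G') * a1 D))).
  rewrite -[RHS]mulrN; congr (_ * _).
  by rewrite mulrBl -!mulrA comm_D_G'; ncring.
by rewrite e !(mulrN, mulNr) opprK.
Qed.

Let PyDA t : P * (a1 y * (a2 D * t)) = a1 D * (P * (a1 y * t)).
Proof. by have := congr1 (fun s => s * t) PyD; rewrite /= -!mulrA. Qed.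
Let PxDA t : P * (a1 x * (a2 D * t)) = a1 D * (P * (a1 x * t)).
Proof. by have := congr1 (fun s => s * t) PxD; rewrite /= -!mulrA. Qed.

Lemma comm_E_G' :
  c * (a1 E * b2 G' - b2 G' * a1 E) = - (q * (P * (a1 y * (dE * b2 G')))).
Proof.
apply: strip_a1D.
- rewrite (mulCA cC) mulrBr (eq_mulA (diag_b2 _ dx)).
  by rewrite mulrA -!rmorphM (tb_xE TB).
- rewrite mulrN (mulCA qC) (eq_mulA (esym (Pa2 _))) -(eq_mulA (diag_a2 _ dy)).
  by rewrite (eq_mulA1 x2E).
have := mixed_cut (tb_rtt TB) (tb_XX' TB) (tb_X'X TB) wy yw dx dy dy dy.
rewrite xXy yX'y (tb_xy TB) (tb_yy TB) (tb_xX TB) (tb_X'y TB) !rmorph0 !mul0r subr0.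
rewrite [a2 (D * _)]rmorphM [b2 (_ * G')]rmorphM [a1 (D * E)]rmorphM /=.
rewrite -!mulrA (eq_mulA1 Ex2) -(eq_mulA comm_D_G') -mulrBr (mulCA cC) => ->.
by rewrite mulrN (mulCA qC) -PyDA; ncring.
Qed.

Lemma comm_E_G : c * (a1 E * b2 G - b2 G * a1 E) = q * (P * (b1 G * dE)).
Proof.
have yG : b2 y * b2 G = b2 G by rewrite -rmorphM (tb_yG TB).
have GG' : b2 G * b2 G' = b2 y by rewrite -rmorphM (tb_GG' TB).
have G'G : b2 G' * b2 G = b2 y by rewrite -rmorphM (tb_G'G TB).
have Gy : b2 G * b2 y = b2 G by rewrite -rmorphM (tb_Gy TB).
have := congr1 (fun s => - (b2 G * s * b2 G)) comm_E_G'.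
have -> : - (b2 G * (c * (a1 E * b2 G' - b2 G' * a1 E)) * b2 G)
  = c * (a1 E * b2 G - b2 G * a1 E).
  rewrite (mulCA cC) -mulrA -mulrN; congr (_ * _).
  rewrite mulrBr mulrBl -!mulrA G'G a1y (eq_mulA1 GG') (eq_mulA1 Gy) -(eq_mulA (a1y _)) yG.
  by rewrite opprB.
move=> ->; rewrite mulrN mulNr opprK (mulCA qC) -!mulrA G'G dEy2; congr (_ * _).
rewrite [b2 G * (P * _)]mulrA -Pb1 -mulrA; congr (_ * _).
by rewrite (diag1 dy) mulrA -rmorphM (tb_Gy TB).
Qed.

Lemma comm_D_F :
  c * (a1 D * b2 F - b2 F * a1 D) = q * (a1 x * ((a2 F - b2 F) * (a2 D * P))).
Proof.
have yb2F : b2 y * b2 F = b2 F by rewrite -rmorphM (tb_yF TB).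
have ya2F : b2 y * a2 F = a2 F by rewrite -(diag2 dy) -rmorphM (tb_yF TB).
apply: strip_G'b2.
- by rewrite (mulCA cC) mulrBr -(eq_mulA (a1y _)) yb2F (eq_mulA1 yb2F).
- by rewrite (mulCA qC) -(eq_mulA (diag_b2 _ dx)) mulrBl mulrBr (eq_mulA1 ya2F) (eq_mulA1 yb2F).
have := mixed_cut (tb_rtt TB) (tb_XX' TB) (tb_X'X TB) wx yw dx dx dy dx.
rewrite xXx yX'x (tb_yx TB) (tb_xx TB) (tb_yX' TB) (tb_Xx TB) !rmorph0 !(mulr0, mul0r) sub0r.
rewrite [a2 (_ * D)]rmorphM [b2 (G' * (_ - _))]rmorphM rmorphN rmorphM /=.
rewrite -!mulrA (eq_mulA1 Fx2) => e.
transitivity (- (c * (a1 D * - (b2 G' * b2 F) - - (b2 G' * b2 F) * a1 D))).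
  rewrite (mulCA cC) -[RHS]mulrN; congr (_ * _).
  by rewrite mulrBr (eq_mulA (esym comm_D_G')); ncring.
by rewrite e (mulCA qC) -(eq_mulA (diag_b2 _ dx)) mulrN opprK.
Qed.

(** The cut gives the commutator of D E with G' F. Peeling off D and G', at the cost of the
    relations between D and F and between E and G', leaves [E, F]. *)
Lemma comm_E_F :
  c * (a1 E * b2 F - b2 F * a1 E) = q * (a1 D' * (a2 G * P) - P * (b1 G * b2 D')).
Proof.
have yb2F : b2 y * b2 F = b2 F by rewrite -rmorphM (tb_yF TB).
have xa1E : a1 x * a1 E = a1 E by rewrite -rmorphM (tb_xE TB).
have xD' : a1 x * a1 D' = a1 D' by rewrite -rmorphM (tb_xD' TB).
have yb1G : b1 y * b1 G = b1 G by rewrite -rmorphM (tb_yG TB).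
have ya2G : b2 y * a2 G = a2 G by rewrite -(diag2 dy) -rmorphM (tb_yG TB).
have xb2D' : a2 x * b2 D' = b2 D' by rewrite (diag2 dx) -rmorphM (tb_xD' TB).
have b2yP t : b2 y * (P * t) = P * (b1 y * t) by rewrite mulrA -Pb1 mulrA.
have a1xP t : a1 x * (P * t) = P * (a2 x * t) by rewrite mulrA -Pa2 mulrA.
apply: strip_G'b2.
- by rewrite (mulCA cC) mulrBr -(eq_mulA (a1y _)) yb2F (eq_mulA1 yb2F).
- rewrite (mulCA qC) mulrBr -(eq_mulA (a1y _)) (eq_mulA1 ya2G).
  by rewrite b2yP (eq_mulA1 yb1G).
apply: strip_a1D.
- rewrite (eq_mulA (diag_b2 _ dx)) (mulCA cC) mulrBr (eq_mulA1 xa1E).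
  by rewrite (eq_mulA (diag_b2 _ dx)) xa1E.
- rewrite (eq_mulA (diag_b2 _ dx)) (mulCA qC) mulrBr (eq_mulA1 xD').
  by rewrite a1xP -(eq_mulA (diag_b1 _ dx)) xb2D'.
have := mixed_cut (tb_rtt TB) (tb_XX' TB) (tb_X'X TB) wx yw dx dy dy dx.
rewrite xXy yX'x (tb_xx TB) (tb_yy TB) (tb_xX TB) (tb_X'x TB) (tb_yX' TB) (tb_Xy TB).
set d := a1 D; set e := a1 E; set f := b2 F; set g := b2 G'.
have gd : g * d = d * g by rewrite /g /d comm_D_G'.
have H1 : a2 (D * (x + E)) * b2 (D' - (y - E) * G' * F)
    = a2 D * b2 D' + a2 D * (dE * (g * f)).
  have ED' : a2 E * b2 D' = 0.
    rewrite -(tb_Ey TB) -(tb_xD' TB) !rmorphM (diag2 dy).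
    by rewrite -mulrA [b2 y * _]mulrA -(rmorphM b2) (tb_yx TB) rmorph0 mul0r mulr0.
  rewrite rmorphM rmorphB -mulrA mulrBr !(rmorphM b2) -!mulrA (eq_mulA1 Ex2).
  by rewrite rmorphD mulrDl ED' xb2D' addr0 mulNr opprK mulrDr.
have H2 : b2 (G' * (y - F)) * a2 (G + (x + F) * D * E)
    = g * (a2 G + (a2 F - f) * (a2 D * a2 E)).
  have FG : f * a2 G = 0.
    rewrite /f -(tb_Fx TB) -(tb_yG TB) !rmorphM -(diag2 dx).
    by rewrite -mulrA [a2 x * _]mulrA -(rmorphM a2) (tb_xy TB) rmorph0 mul0r mulr0.
  rewrite (rmorphM b2) (rmorphD a2) (rmorphM a2 _ E) (rmorphM a2 _ D) -!mulrA.
  rewrite mulrDr (eq_mulA1 Fx2); congr (_ * (_ + _)).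
  by rewrite rmorphB mulrBl -/f FG ya2G subr0.
rewrite -[P * a1 y * _ * _]mulrA H1 -[a1 x * b2 _ * _]mulrA H2.
rewrite rmorphM rmorphN rmorphM -/d -/e -/f -/g => H0.
have cE := comm_E_G'; rewrite -/e -/g in cE.
have cF := comm_D_F; rewrite -/d -/f in cF.
rewrite ![_ * (c * _)](mulCA cC).
transitivity (- (c * (d * e * - (g * f) - - (g * f) * (d * e)))
     - d * (c * (e * g - g * e)) * f - g * (c * (d * f - f * d)) * e).
  have -> : d * (g * (e * f - f * e)) =
      - (d * e * - (g * f) - - (g * f) * (d * e)) - d * ((e * g - g * e) * f)
      - g * ((d * f - f * d) * e) + (g * d - d * g) * f * e by ncring.
  rewrite gd subrr !mul0r addr0 [c * (_ - _ - _)]mulrBr [c * (_ - _)]mulrBr mulrN.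
  rewrite -[d * _ * f]mulrA -[g * _ * e]mulrA -[c * (e * g - _) * f]mulrA.
  by rewrite -[c * (d * f - _) * e]mulrA ![_ * (c * (_ * _))](mulCA cC).
rewrite H0 cE cF.
have gx : g * a1 x = a1 x * g by rewrite /g (diag_b2 _ dx).
have E1 : d * (g * (a1 D' * (a2 G * P))) = a1 x * (g * (a2 G * P)).
  by rewrite -(eq_mulA gd) [d * (_ * _)]mulrA -(rmorphM a1) (tb_DD' TB) (eq_mulA gx).
have E2 : d * (g * (P * (b1 G * b2 D'))) = P * (a1 y * (a2 D * b2 D')).
  rewrite [g * (P * _)]mulrA /g -Pb1 -[_ * _ * (b1 G * _)]mulrA [b1 G' * _]mulrA.
  by rewrite -(rmorphM b1) (tb_G'G TB) -(diag1 dy) -PyDA.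
rewrite !(mulCA qC) !(mulrBr (d * _), mulrBr d, mulrBr g) E1 E2.
have E3 : d * (P * (a1 y * (dE * g))) = P * (a1 y * (a2 D * (dE * g))) by rewrite PyDA.
have Pe : P * e = a2 E * P by rewrite /e Pa1.
have E4 : g * (a1 x * ((a2 F - f) * (a2 D * P))) * e
    = a1 x * (g * ((a2 F - f) * (a2 D * (a2 E * P)))).
  by rewrite -!mulrA Pe -(eq_mulA (esym gx)).
rewrite [d * - _]mulrN [d * (q * _)](mulCA qC) E3 -[q * (g * _) * e]mulrA E4.
by ncring.
Qed.

Section Ad.
Hypothesis E0 : forall m, coef 0 m (a1 E * b2 E - b2 E * a1 E) = 0.
Hypothesis EE0 : forall n m, coef n.+1 m (b1 E * b2 E - b2 E * b1 E) = 0.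
Local Notation dE1 := (b1 E - a1 E).

Let DE_EG : a1 (D * E) * b2 (E * G') = b2 (E * G') * a1 (D * E).
Proof.
have := mixed_cut (tb_rtt TB) (tb_XX' TB) (tb_X'X TB) wy xw dx dy dx dy.
rewrite xXy xX'y (tb_xy TB) !rmorph0 !(mulr0, mul0r) subrr mulr0 => /diff_var_inj.
by rewrite rmorphN mulrN mulNr opprK addrC => /eqP; rewrite subr_eq0 => /eqP.
Qed.

(** Both overlaps vanish for the cuts D E and E G', so these commute. Extracting [E(u), E(v)] from
    that uses one relation between D and E and one between E and G', whence the square of c. *)
Lemma comm_E_E2 : c * (c * (a1 E * b2 E - b2 E * a1 E))
  = c * (q * (P * (b1 E * dE - dE * a1 E))) - q * (q * (dE1 * dE)).
Proof.
have fy : b2 E * b2 y = b2 E by rewrite -rmorphM (tb_Ey TB).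
have xe : a1 x * a1 E = a1 E by rewrite -rmorphM (tb_xE TB).
have dE1x t : a2 x * (dE1 * t) = dE1 * (a2 x * t).
  by rewrite !mulrA; congr (_ * _); rewrite mulrBr mulrBl (diag_a1 _ dx) (diag_b1 _ dx).
have a1xP t : a1 x * (P * t) = P * (a2 x * t) by rewrite mulrA -Pa2 mulrA.
apply: strip_b2G'.
- by rewrite -!mulrA mulrBl -!mulrA fy a1y (eq_mulA1 fy).
- have h1 : (b1 E * dE - dE * a1 E) * b2 y = b1 E * dE - dE * a1 E.
    by rewrite mulrBl -[_ * a1 E * _]mulrA a1y -!mulrA dEy2 (eq_mulA1 dEy2).
  by rewrite mulrBl -!(mulrA c) -!(mulrA q) -!(mulrA P) h1 -(mulrA dE1) dEy2.
apply: strip_a1D.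
- rewrite -!mulrA !(mulCA cC) mulrBl mulrBr -!mulrA (eq_mulA1 xe).
  by rewrite (eq_mulA (diag_b2 _ dx)) (eq_mulA1 xe).
- rewrite mulrBl mulrBr -!mulrA !(mulCA cC) !(mulCA qC) a1xP.
  have -> t : a1 x * (dE1 * t) = dE1 * t.
    by rewrite mulrA mulrBr -!rmorphM (diag1 dx) -rmorphM (tb_xE TB).
  rewrite mulrBl mulrBr -!mulrA -(eq_mulA (diag_b1 _ dx)) (eq_mulA1 x2E).
  by rewrite (eq_mulA1 x2E).
have V0 := DE_EG; rewrite !rmorphM in V0.
have cE := comm_E_G'; have cD := comm_D_E.
move: V0 cE cD (comm_D_G').
set d := a1 D; set e := a1 E; set f := b2 E; set g := b2 G'.
move=> V0 cE cD gd.
have E0' : d * (e * f - f * e) * g = - (d * f * (e * g - g * e))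
    - (d * f - f * d) * (e * g) + (d * f - f * d) * (e * g - g * e).
  apply/eqP; rewrite -subr_eq0; apply/eqP.
  have -> : d * (e * f - f * e) * g - (- (d * f * (e * g - g * e))
     - (d * f - f * d) * (e * g) + (d * f - f * d) * (e * g - g * e))
     = (d * e * (f * g) - f * g * (d * e)) - f * (d * g - g * d) * e by ncring.
  by rewrite V0 gd !subrr mulr0 mul0r subr0.
rewrite -!mulrA ![d * (c * _)](mulCA cC) [d * (_ * g)]mulrA E0'.
transitivity (- (c * (d * f * (c * (e * g - g * e))))
   - c * (c * (d * f - f * d) * (e * g))
   + c * (d * f - f * d) * (c * (e * g - g * e))).
  exact: central_expand2.
rewrite cE cD.
have fP t : f * (P * t) = P * (b1 E * t) by rewrite /f mulrA -Pb1 mulrA.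
have dP t : (f - a2 E) * (P * t) = P * ((b1 E - e) * t).
  by rewrite mulrA mulrBl -Pb1 -Pa1 -mulrBr -mulrA.
have b1Ey t : b1 E * (a1 y * t) = b1 E * t.
  by rewrite (diag1 dy) mulrA -rmorphM (tb_Ey TB).
have a1Ey t : (b1 E - e) * (a1 y * t) = (b1 E - e) * t.
  by rewrite mulrA mulrBl -rmorphM {1}(diag1 dy) -rmorphM (tb_Ey TB).
have T1 t : d * (f * (P * (a1 y * t))) = d * (P * (b1 E * t)).
  by rewrite fP b1Ey.
have T2 t : P * (a1 x * (a2 D * ((f - a2 E) * (e * t)))) = d * (P * ((f - a2 E) * (e * t))).
  by rewrite PxDA (eq_mulA x1E) (eq_mulA1 xe).
have T3 t : P * (a1 x * (a2 D * ((f - a2 E) * (P * (a1 y * ((f - a2 E) * t)))))) = d * ((b1 E - e) * ((f - a2 E) * t)).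
  by rewrite PxDA dP a1xP [P * (P * _)]mulrA PP mul1r a1Ey dE1x (eq_mulA1 x2E).
have -> : d * ((c * (q * (P * (b1 E * (f - a2 E) - (f - a2 E) * e))) - q * (q * ((b1 E - e) * (f - a2 E)))) * g)
  = c * (q * (d * (P * (b1 E * ((f - a2 E) * g))))) - c * (q * (d * (P * ((f - a2 E) * (e * g)))))
    - q * (q * (d * ((b1 E - e) * ((f - a2 E) * g)))).
  rewrite mulrBl mulrBr -!mulrA ![d * (c * _)](mulCA cC) ![d * (q * _)](mulCA qC).
  by ncring.
rewrite -T1 -T2 -T3 !mulrN opprK -!mulrA.
rewrite ![f * (q * _)](mulCA qC) ![d * (q * _)](mulCA qC).
by rewrite ![(f - a2 E) * (q * _)](mulCA qC) ![a2 D * (q * _)](mulCA qC)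
     ![a1 x * (q * _)](mulCA qC) ![P * (q * _)](mulCA qC).
Qed.

Local Notation k := (b1 E * b2 E - b2 E * b1 E).
Local Notation Z := (a1 E * b2 E - b2 E * a1 E).

(** The square of c in [comm_E_E2] is absorbed by splitting off the R-matrix on the right; the price
    is the commutator k of E with itself in the single variable v. *)
Lemma comm_E_E_diff :
  (c * Z - q * (dE1 * dE * P)) * (c - q * P) = c * (q * (P * k)).
Proof.
rewrite central_expand comm_E_E2.
have PdE : P * dE = dE1 * P by rewrite mulrBr mulrBl Pb2 Pa2.
have PdE1 : P * dE1 = dE * P by rewrite mulrBr mulrBl Pb1 Pa1.
have -> : P * (b1 E * dE - dE * a1 E) = Z * P + dE1 * dE * P + P * k.
  have -> : Z * P = P * (a2 E * b1 E - b1 E * a2 E).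
    rewrite mulrBr !(PM (Pa2 _) (Pb1 _ _)) !(PM (Pb1 _ _) (Pa2 _)).
    by rewrite -mulrBl.
  have -> : dE1 * dE * P = P * (dE * dE1).
    by rewrite (PM PdE PdE1).
  by ncring.
by rewrite !(mulCA cC q) ; ncring.
Qed.

Lemma comm_E_E : c * Z = q * (dE1 * dE * P).
Proof.
set V := c * Z - q * (dE1 * dE * P).
(* Multiplication by c + q P replaces the R-matrix by the central element $c^2-q^2$. *)
have Vc : V * (c * c - q * q) = c * (q * (P * k)) * (c + q * P).
  rewrite -comm_E_E_diff -/V -mulrA; congr (_ * _).
  rewrite mulrDr !mulrBl -(cC (q * P)) -(mulrA q P) [P * (q * P)](mulCA qC) PP mulr1.
  by ncring.
have V0 m : coef 0 m V = 0.
  rewrite raddfB diff_varE prod_varE mulrBl raddfB -!mulrA !coef_va coef_vb.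
  by case: m => [|m]; rewrite ?E0 !subr0.
by apply: subr0_eq; apply: (cq_eq0 Vc V0 EE0).
Qed.

End Ad.
End TwoBlockTheory.
End TwoLegTheory.

(** * Windows: Gauss factors restricted to an interval of blocks *)

Section Windows.
Variables (M S S0 : pzRingType) (L : two_leg M S S0).
Local Notation a1 := (a1 L).
Local Notation a2 := (a2 L).
Local Notation b1 := (b1 L).
Local Notation b2 := (b2 L).
Local Notation P := (P L).
Local Notation c := (diff_var L).
Local Notation q := (prod_var L).
Local Notation R := (c - q * P).
Implicit Types X x w : M.

Definition rtt_inv X' := a1 X' * b2 X' * R = R * (b2 X' * a1 X').

Lemma sandwich (l d u u' d' l' w : M) : u * u' = w -> d * d' = 1 -> l * l' = w ->
  l * w = l -> w * d = d * w -> l * d * u * (u' * d' * l') = w.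
Proof.
move=> uu dd ll lw wd; rewrite !mulrA -[l * d * u * u']mulrA uu -[l * d * w]mulrA -wd.
by rewrite mulrA lw -[l * d * d']mulrA dd mulr1.
Qed.

Lemma diag_R x : diagonal L x -> a1 x * b2 x * R = R * (a1 x * b2 x).
Proof.
move=> dx; rewrite mulrBr mulrBl -diff_varC [_ * (q * P)](mulCA (prod_varC L)).
congr (_ - _); rewrite -(mulrA q); congr (_ * _).
by rewrite !mulrA Pa1 -!mulrA Pb2 -(diag2 dx) -(diag1 dx) mulrA (diag_a2 _ dx) -mulrA.
Qed.

Lemma cut12 x X : diagonal L x ->
  a1 (x * X * x) * b2 (x * X * x) = a1 x * b2 x * (a1 X * b2 X) * (a1 x * b2 x).
Proof.
move=> dx; rewrite !rmorphM -!mulrA; congr (_ * _).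
rewrite [a1 x * _](eq_mulA (diag_b2 _ dx)) [a1 x * (b2 X * _)](eq_mulA (diag_b2 _ dx)).
by rewrite -(diag2 dx) [a1 X * _](eq_mulA (diag_a1 _ dx)).
Qed.

Lemma cut21 x X : diagonal L x ->
  b2 (x * X * x) * a1 (x * X * x) = a1 x * b2 x * (b2 X * a1 X) * (a1 x * b2 x).
Proof.
move=> dx; rewrite !rmorphM -!mulrA -(diag2 dx) -[a2 x * (a1 x * _)](eq_mulA (diag_a2 _ dx)).
rewrite -[b2 X * (a1 x * _)](eq_mulA (diag_b2 _ dx)) [a2 x * (a1 x * _)](eq_mulA (esym (diag_a2 _ dx))).
by do 3!congr (_ * _); rewrite (eq_mulA (esym (diag_a1 _ dx))) -(diag_a1 _ dx).
Qed.

Lemma conj_comm (r x u v : S) : x * r = r * x -> r * u = v * r ->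
  r * (x * u * x) = x * v * x * r.
Proof. by move=> xr ru; rewrite !mulrA -xr -(mulrA x r) ru -!mulrA xr. Qed.

Lemma rtt_cut x X : diagonal L x -> rtt L X -> rtt L (x * X * x).
Proof.
move=> dx rX; rewrite /rtt (cut12 _ dx) (cut21 _ dx).
by apply: conj_comm => //; apply: diag_R.
Qed.

Lemma rtt_inv_cut x X : diagonal L x -> rtt_inv X -> rtt_inv (x * X * x).
Proof.
move=> dx rX; rewrite /rtt_inv (cut12 _ dx) (cut21 _ dx); apply/esym.
by apply: conj_comm => //; apply: diag_R.
Qed.

Section Inverse.
Variables (w X X' : M).
Hypotheses (dw : diagonal L w) (ww : w * w = w).
Hypotheses (XX' : X * X' = w) (X'X : X' * X = w).
Hypotheses (wX : w * X = X) (Xw : X * w = X) (wX' : w * X' = X') (X'w : X' * w = X').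
Let w12 := a1 w * b2 w.
Let X12 : a1 X * b2 X * (b2 X' * a1 X') = w12.
Proof.
rewrite -mulrA [b2 X * _]mulrA -(rmorphM b2) XX' -(diag2 dw) -(diag_a1 _ dw) mulrA.
by rewrite -rmorphM XX' (diag2 dw).
Qed.
Let X21 : a1 X' * b2 X' * (b2 X * a1 X) = w12.
Proof.
rewrite -mulrA [b2 X' * _]mulrA -(rmorphM b2) X'X -(diag2 dw) -(diag_a1 _ dw) mulrA.
by rewrite -rmorphM X'X (diag2 dw).
Qed.
Let w12X' : w12 * (b2 X' * a1 X') = b2 X' * a1 X'.
Proof.
by rewrite /w12 -(mulrA (a1 w)) [b2 w * _]mulrA -rmorphM wX' (eq_mulA (diag_b2 _ dw)) -rmorphM wX'.
Qed.
Let X'w12 : a1 X' * b2 X' * w12 = a1 X' * b2 X'.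
Proof.
rewrite /w12 -mulrA (eq_mulA (esym (diag_b2 X' dw))) -rmorphM X'w.
by rewrite mulrA -rmorphM X'w.
Qed.
Let Y12 : b2 X * a1 X * (a1 X' * b2 X') = w12.
Proof.
rewrite -mulrA [a1 X * _]mulrA -(rmorphM a1) XX' /w12 (diag_b2 _ dw) mulrA -rmorphM XX'.
by rewrite (diag_b2 _ dw).
Qed.
Let Y21 : b2 X' * a1 X' * (a1 X * b2 X) = w12.
Proof.
rewrite -mulrA [a1 X' * _]mulrA -(rmorphM a1) X'X /w12 (diag_b2 _ dw) mulrA -rmorphM X'X.
by rewrite (diag_b2 _ dw).
Qed.
Let w12X : w12 * (a1 X * b2 X) = a1 X * b2 X.
Proof.
rewrite /w12 -mulrA -(diag2 dw) -[a2 w * _](eq_mulA (diag_a1 X dw)) (diag2 dw).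
by rewrite -rmorphM wX mulrA -rmorphM wX.
Qed.
Let Xw12 : b2 X * a1 X * w12 = b2 X * a1 X.
Proof.
rewrite /w12 -mulrA [a1 X * _]mulrA -rmorphM Xw -(diag2 dw) (diag_a1 _ dw) (diag2 dw).
by rewrite mulrA -rmorphM Xw.
Qed.

Lemma rtt_rtt_inv : rtt L X -> rtt_inv X'.
Proof.
move=> rX; rewrite /rtt_inv -{1}X'w12 -!(mulrA (a1 X' * b2 X')) (diag_R dw).
rewrite -/w12 -X12 [R * _]mulrA rX -!(mulrA (b2 X * a1 X)) mulrA X21.
by rewrite mulrA (diag_R dw) -mulrA -/w12 w12X'.
Qed.

Lemma rtt_inv_rtt : rtt_inv X' -> rtt L X.
Proof.
move=> rX; rewrite /rtt -{1}w12X mulrA -(diag_R dw) -/w12 -Y12 -(mulrA _ _ R) rX.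
by rewrite -!(mulrA (b2 X * a1 X)) -!(mulrA R) Y21 -(diag_R dw) mulrA -/w12 Xw12.
Qed.
End Inverse.

Variable pr : pred nat -> M.
Hypothesis pr_diag : forall A, diagonal L (pr A).
Hypothesis prM : forall A B, pr A * pr B = pr (predI A B).
Hypothesis eq_pr : forall A B, A =1 B -> pr A = pr B.
Hypothesis pr0 : pr pred0 = 0.
Hypothesis prT : pr predT = 1.
Hypothesis prU : forall A B, (forall a, ~~ (A a && B a)) -> pr (predU A B) = pr A + pr B.

Definition lower X := forall A B : pred nat,
  (forall s t, A s -> B t -> (s < t)%N) -> pr A * X * pr B = 0.
Definition upper X := forall A B : pred nat,
  (forall s t, A s -> B t -> (t < s)%N) -> pr A * X * pr B = 0.
Definition unit_diag X := forall a, pr (pred1 a) * X * pr (pred1 a) = pr (pred1 a).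

Definition itv lo hi : pred nat := fun a => (lo <= a <= hi)%N.

Lemma prK A : pr A * pr A = pr A.
Proof. by rewrite prM; apply: eq_pr => a /=; rewrite andbb. Qed.
Lemma prMl A B : {subset A <= B} -> pr A * pr B = pr A.
Proof. by move=> AB; rewrite prM; apply: eq_pr => a /=; rewrite andb_idr // => /AB. Qed.
Lemma prMr A B : {subset A <= B} -> pr B * pr A = pr A.
Proof. by move=> AB; rewrite prM; apply: eq_pr => a /=; rewrite andb_idl // => /AB. Qed.
Lemma prM0 A B : (forall a, ~~ (A a && B a)) -> pr A * pr B = 0.
Proof. by move=> AB; rewrite prM -pr0; apply: eq_pr => a; apply/negbTE/AB. Qed.

Lemma pr_split lo hi : pr (fun a => a < lo)%N + pr (itv lo hi)
  + pr (fun a => (lo <= a) && (hi < a))%N = 1.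
Proof.
rewrite -prT -!prU; first by apply: eq_pr => a; rewrite /itv /=; lia.
- by move=> a; rewrite /itv /=; lia.
- by move=> a; rewrite /itv /=; lia.
Qed.

Lemma lower_itv X Y lo hi : lower X -> lower Y ->
  pr (itv lo hi) * X * pr (itv lo hi) * Y * pr (itv lo hi) = pr (itv lo hi) * X * Y * pr (itv lo hi).
Proof.
move=> lX lY; transitivity (pr (itv lo hi) * X * 1 * Y * pr (itv lo hi)); last by rewrite mulr1.
rewrite -(pr_split lo hi).
rewrite !mulrDr !mulrDl [X in _ = _ + X](_ : _ = 0) ?addr0; last first.
  by rewrite lX ?mul0r // => s t; rewrite /itv; lia.
rewrite [X in _ = X + _](_ : _ = 0) ?add0r ?mulrA //.
by rewrite -!mulrA [pr _ * (Y * _)]mulrA lY ?mulr0 // => s t; rewrite /itv; lia.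
Qed.

Lemma upper_itv X Y lo hi : upper X -> upper Y ->
  pr (itv lo hi) * X * pr (itv lo hi) * Y * pr (itv lo hi) = pr (itv lo hi) * X * Y * pr (itv lo hi).
Proof.
move=> lX lY; transitivity (pr (itv lo hi) * X * 1 * Y * pr (itv lo hi)); last by rewrite mulr1.
rewrite -(pr_split lo hi).
rewrite !mulrDr !mulrDl [X in _ = _ + X](_ : _ = 0) ?addr0; last first.
  by rewrite -!mulrA [pr _ * (Y * _)]mulrA lY ?mulr0 // => s t; rewrite /itv; lia.
rewrite [X in _ = X + _](_ : _ = 0) ?add0r ?mulrA //.
by rewrite lX ?mul0r // => s t; rewrite /itv; lia.
Qed.

Variables F F' D D' E E' : M.
Hypotheses (FF' : F * F' = 1) (F'F : F' * F = 1).
Hypotheses (DD' : D * D' = 1) (D'D : D' * D = 1).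
Hypotheses (EE' : E * E' = 1) (E'E : E' * E = 1).
Hypotheses (lF : lower F) (lF' : lower F') (uE : upper E) (uE' : upper E').
Hypotheses (dF : unit_diag F) (dF' : unit_diag F') (dE : unit_diag E) (dE' : unit_diag E').
Hypotheses (prD : forall A, pr A * D = D * pr A) (prD' : forall A, pr A * D' = D' * pr A).
Hypothesis rT : rtt L (F * D * E).

Local Notation "'w_' lo hi" := (pr (itv lo hi)) (at level 10, lo at level 8, hi at level 8).
(** For lo = 0 this is the corner of T on the blocks up to hi; in general it is the Schur complement
    in that corner of the blocks before lo. Its inverse [win'] is built from the inverse factors in
    reversed order. *)
Definition win lo hi := w_ lo hi * F * w_ lo hi * D * (w_ lo hi * E * w_ lo hi).
Definition win' lo hi := w_ lo hi * E' * w_ lo hi * D' * (w_ lo hi * F' * w_ lo hi).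

Section Win.
Variables lo hi : nat.
Local Notation w := (w_ lo hi).
Let wK : w * w = w := prK _.
Lemma itv_EE' : w * E * w * (w * E' * w) = w.
Proof. by rewrite !mulrA -(mulrA (w * E)) wK upper_itv // -mulrA mulrA -(mulrA w) EE' mulr1 wK. Qed.
Lemma itv_E'E : w * E' * w * (w * E * w) = w.
Proof. by rewrite !mulrA -(mulrA (w * E')) wK upper_itv // -mulrA mulrA -(mulrA w) E'E mulr1 wK. Qed.
Lemma itv_FF' : w * F * w * (w * F' * w) = w.
Proof. by rewrite !mulrA -(mulrA (w * F)) wK lower_itv // -mulrA mulrA -(mulrA w) FF' mulr1 wK. Qed.
Lemma itv_F'F : w * F' * w * (w * F * w) = w.
Proof. by rewrite !mulrA -(mulrA (w * F')) wK lower_itv // -mulrA mulrA -(mulrA w) F'F mulr1 wK. Qed.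
Lemma win_win' : win lo hi * win' lo hi = w.
Proof. by apply: sandwich; rewrite ?itv_EE' ?itv_FF' ?DD' ?prD -?mulrA ?wK. Qed.
Lemma win'_win : win' lo hi * win lo hi = w.
Proof. by apply: sandwich; rewrite ?itv_E'E ?itv_F'F ?D'D ?prD' -?mulrA ?wK. Qed.
Lemma win_l : w * win lo hi = win lo hi. Proof. by rewrite /win !mulrA wK. Qed.
Lemma win_r : win lo hi * w = win lo hi. Proof. by rewrite /win -!mulrA wK. Qed.
Lemma win'_l : w * win' lo hi = win' lo hi. Proof. by rewrite /win' !mulrA wK. Qed.
Lemma win'_r : win' lo hi * w = win' lo hi. Proof. by rewrite /win' -!mulrA wK. Qed.
End Win.

Lemma lower_row X A B : lower X -> (forall a, B a = ~~ A a) ->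
  (forall s t, A s -> B t -> (s < t)%N) -> pr A * X = pr A * X * pr A.
Proof.
move=> lX BA AB; rewrite -[LHS]mulr1 -prT (_ : pr predT = pr A + pr B) ?mulrDr ?(lX A B) ?addr0 //.
rewrite -prU => [|a]; last by rewrite BA andbN.
by apply: eq_pr => a /=; rewrite BA orbN.
Qed.
Lemma upper_col X A B : upper X -> (forall a, A a = ~~ B a) ->
  (forall s t, A s -> B t -> (t < s)%N) -> X * pr B = pr B * X * pr B.
Proof.
move=> lX BA AB; rewrite -[LHS]mul1r -prT (_ : pr predT = pr A + pr B).
  by rewrite mulrDl [pr A * _]mulrA lX // add0r mulrA.
rewrite -prU => [|a]; last by rewrite BA andNb.
by apply: eq_pr => a /=; rewrite BA orNb.
Qed.

(** Initial corners of T are windows, because F is lower and E is upper triangular, and RTT passes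
    to corners. The inverse of such a corner satisfies RTT with the R-matrix on the other side, and
    the final corner of that inverse is the inverse of the window; inverting once more gives RTT for
    the window. *)
Lemma rtt_win lo hi : rtt L (win lo hi).
Proof.
have dw A : diagonal L (pr A) := pr_diag A.
have r0 : rtt L (win 0 hi).
  have -> : win 0 hi = w_ 0 hi * (F * D * E) * w_ 0 hi.
    rewrite /win -(@upper_col E (fun a => hi < a)%N) //; last 2 first.
    - by move=> a; rewrite /itv; lia.
    - by move=> s t; rewrite /itv; lia.
    rewrite -(@lower_row F _ (fun a => hi < a)%N) //; last 2 first.
    - by move=> a; rewrite /itv; lia.
    - by move=> s t; rewrite /itv; lia.
    by rewrite !mulrA.
  exact: rtt_cut.
have {}r0 := rtt_rtt_inv (dw _) (win_win' 0 hi) (win'_win 0 hi) (win'_l 0 hi) (win'_r 0 hi) r0.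
apply: (rtt_inv_rtt (dw _) (win_win' lo hi) (win'_win lo hi) (win_l lo hi) (win_r lo hi)).
pose l : pred nat := fun a => (lo <= a)%N.
have -> : win' lo hi = pr l * win' 0 hi * pr l.
  rewrite /win'.
  have lw : pr l * w_ 0 hi = w_ lo hi by rewrite prM; apply: eq_pr => a; rewrite /itv /l /=; lia.
  have wl : w_ 0 hi * pr l = w_ lo hi by rewrite prM; apply: eq_pr => a; rewrite /itv /l /=; lia.
  have splitlo : w_ 0 hi = w_ lo hi + pr (fun a => (a < lo) && (a <= hi))%N.
    rewrite -prU => [|a]; last by rewrite /itv; lia.
    by apply: eq_pr => a; rewrite /itv /=; lia.
  have Er : w_ lo hi * E' * w_ 0 hi = w_ lo hi * E' * w_ lo hi.
    rewrite splitlo mulrDr [X in _ + X]uE' ?addr0 // => s t; rewrite /itv; lia.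
  have Fr : w_ 0 hi * F' * w_ lo hi = w_ lo hi * F' * w_ lo hi.
    rewrite splitlo !mulrDl [X in _ + X]lF' ?addr0 // => s t; rewrite /itv; lia.
  by rewrite !mulrA lw Er -!mulrA wl (mulrA (w_ 0 hi)) Fr !mulrA.
exact: rtt_inv_cut.
Qed.

Local Notation e_ a := (pr (pred1 a)).

Definition cm u v := a1 u * b2 v = b2 v * a1 u.

Lemma cmMl u u' v : cm u v -> cm u' v -> cm (u * u') v.
Proof. by rewrite /cm !rmorphM -mulrA => uv u'v; rewrite u'v !mulrA uv. Qed.
Lemma cmMr u v v' : cm u v -> cm u v' -> cm u (v * v').
Proof. by rewrite /cm !rmorphM mulrA => uv uv'; rewrite uv -!mulrA uv'. Qed.
Lemma comm_prod (d g u v : S) : d * v = v * d -> u * g = g * u -> d * g = g * d ->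
  d * u * (v * g) - v * g * (d * u) = d * (u * v - v * u) * g.
Proof.
move=> dv ug dg; rewrite mulrBr mulrBl; congr (_ - _); first by rewrite !mulrA.
by rewrite -!mulrA ug (eq_mulA dv) (eq_mulA dg).
Qed.
Lemma corner_comm (x d d' v : S) : d * d' = x -> d' * d = x -> x * d' = d' -> d' * x = d' ->
  x * v = v * x -> d * v = v * d -> d' * v = v * d'.
Proof.
move=> dd d'd ld rd xv dv; rewrite -{1}rd -mulrA xv -dd [v * _]mulrA -dv -(mulrA d) mulrA d'd.
by rewrite mulrA xv -mulrA ld.
Qed.
Lemma cm_invl A d d' v : d * d' = pr A -> d' * d = pr A -> pr A * d' = d' ->
  d' * pr A = d' -> cm d v -> cm d' v.
Proof.
move=> dd d'd ld rd dv; apply: (corner_comm (x := a1 (pr A)) (d := a1 d)); rewrite -?rmorphM ?dd ?d'd ?ld ?rd //.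
exact: diag_b2.
Qed.
Lemma cm_invr A d d' v : d * d' = pr A -> d' * d = pr A -> pr A * d' = d' ->
  d' * pr A = d' -> cm v d -> cm v d'.
Proof.
move=> dd d'd ld rd dv; apply/esym; apply: (corner_comm (x := b2 (pr A)) (d := b2 d)); rewrite -?rmorphM ?dd ?d'd ?ld ?rd //.
by rewrite -(diag2 (pr_diag A)) (diag_a1 _ (pr_diag A)).
Qed.

Section Mixed.
Variables lo hi : nat.
Hypothesis lohi : (lo < hi)%N.
Local Notation w := (w_ lo hi).
Local Notation e := (e_ lo).
Local Notation f := (e_ hi).
Let wK : w * w = w := prK _.
Let ew : e * w = e. Proof. by apply: prMl => a /eqP ->; rewrite /in_mem /= /itv; lia. Qed.
Let fw : f * w = f. Proof. by apply: prMl => a /eqP ->; rewrite /in_mem /= /itv; lia. Qed.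
Let wf : w * f = f. Proof. by apply: prMr => a /eqP ->; rewrite /in_mem /= /itv; lia. Qed.
Let ef : e * f = 0.
Proof. by apply: prM0 => a /=; apply/negP => /andP[/eqP -> /eqP]; lia. Qed.
Let w_e : w = e + pr (fun a => lo < a <= hi)%N.
Proof.
rewrite -prU => [|a]; last by rewrite /=; apply/negP=> /andP[/eqP ->]; lia.
by apply: eq_pr => a; rewrite /itv /=; lia.
Qed.
Let w_f : w = f + pr (fun a => lo <= a < hi)%N.
Proof.
rewrite -prU => [|a]; last by rewrite /=; apply/negP=> /andP[/eqP ->]; lia.
by apply: eq_pr => a; rewrite /itv /=; lia.
Qed.

(** The first row of a window sees only D and E, since F is the identity there; dually the last
    column of the inverse sees only E' and D'. This is why cutting at lo and hi isolates single
    factors. *)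
Lemma win_row : e * win lo hi = D * (e * E * w).
Proof.
have eFw : e * F * w = e.
  by rewrite w_e mulrDr dF lF ?addr0 // => s t /= /eqP ->; lia.
by rewrite /win !mulrA ew eFw prD -(mulrA D) ew.
Qed.
Lemma win'_col : win' lo hi * f = w * E' * f * D'.
Proof.
have wFf : w * F' * f = f.
  by rewrite w_f !mulrDl dF' lF' ?addr0 // => s t /= /[swap] /eqP ->; lia.
by rewrite /win' -!mulrA wf (mulrA w F') wFf !mulrA -(mulrA _ w D') prD' -!mulrA wf prD'.
Qed.
Lemma win'_row : f * win' lo hi = D' * (f * F' * w).
Proof.
have fEw : f * E' * w = f.
  by rewrite w_f mulrDr dE' uE' ?addr0 // => s t /= /eqP ->; lia.
by rewrite /win' !mulrA fw fEw prD' -(mulrA D') fw.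
Qed.

Variables A B : pred nat.
Hypothesis AI : forall a, A a -> (lo <= a <= hi)%N.
Hypothesis BI : forall a, B a -> (lo <= a <= hi)%N.
Let wA : w * pr A = pr A. Proof. by apply: prMr => a /AI. Qed.
Let Bw : pr B * w = pr B. Proof. by apply: prMl => a /BI. Qed.
Let wB : w * pr B = pr B. Proof. by apply: prMr => a /BI. Qed.

Lemma mixed_E_E :
  c * (a1 (D * (e * E * pr A)) * b2 (pr B * E' * f * D')
       - b2 (pr B * E' * f * D') * a1 (D * (e * E * pr A)))
  = q * (P * a1 (pr B * pr A) * a2 (D * (e * E * w)) * b2 (w * E' * f * D')).
Proof.
have := mixed_cut (rtt_win lo hi) (win_win' lo hi) (win'_win lo hi) wf Bw
  (pr_diag (pred1 lo)) (pr_diag A) (pr_diag B) (pr_diag (pred1 hi)).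
rewrite win_row -(mulrA (pr B) (win' lo hi)) win'_col ef !rmorph0 !mul0r subr0.
by rewrite -(mulrA D) -(mulrA (_ * E)) wA !(mulrA (pr B)) Bw.
Qed.

Lemma cm_E_E : (forall a, ~~ (A a && B a)) -> cm (D * (e * E * pr A)) (pr B * E' * f * D').
Proof.
move=> AB; apply/eqP; rewrite -subr_eq0; apply/eqP/(diff_var_inj (L := L)).
rewrite mixed_E_E (prM0 (A := B) (B := A)); last by move=> a; rewrite andbC.
by rewrite !rmorph0 mulr0 !mul0r mulr0.
Qed.

Lemma cm_E_F : ~~ A hi -> ~~ B lo -> cm (D * (e * E * pr A)) (D' * (f * F' * pr B)).
Proof.
move=> Ah Bl; apply/eqP; rewrite -subr_eq0; apply/eqP/(diff_var_inj (L := L)).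
have := mixed_cut (rtt_win lo hi) (win_win' lo hi) (win'_win lo hi) wB fw
  (pr_diag (pred1 lo)) (pr_diag A) (pr_diag (pred1 hi)) (pr_diag B).
rewrite win_row win'_row (prM0 (A := pred1 hi) (B := A)); last first.
  by move=> a /=; apply/negP=> /andP[/eqP ->]; apply/negP.
rewrite (prM0 (A := pred1 lo) (B := B)); last first.
  by move=> a /=; apply/negP=> /andP[/eqP ->]; apply/negP.
by rewrite !rmorph0 mulr0 !mul0r subr0 mulr0 -!mulrA wA wB.
Qed.
End Mixed.

Local Notation D_ a := (D * e_ a).
Local Notation D'_ a := (D' * e_ a).
Lemma D_D'_ a : D_ a * D'_ a = e_ a.
Proof. by rewrite -mulrA (mulrA (e_ a)) prD' -mulrA prK mulrA DD' mul1r. Qed.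
Lemma D'_D_ a : D'_ a * D_ a = e_ a.
Proof. by rewrite -mulrA (mulrA (e_ a)) prD -mulrA prK mulrA D'D mul1r. Qed.
Lemma D_l a : e_ a * D_ a = D_ a. Proof. by rewrite mulrA prD -mulrA prK. Qed.
Lemma D_r a : D_ a * e_ a = D_ a. Proof. by rewrite -mulrA prK. Qed.
Lemma D'_l a : e_ a * D'_ a = D'_ a. Proof. by rewrite mulrA prD' -mulrA prK. Qed.
Lemma D'_r a : D'_ a * e_ a = D'_ a. Proof. by rewrite -mulrA prK. Qed.

Lemma cm_D_invl a v : cm (D_ a) v -> cm (D'_ a) v.
Proof. exact: cm_invl (D_D'_ a) (D'_D_ a) (D'_l a) (D'_r a). Qed.
Lemma cm_D'_invr a v : cm v (D'_ a) -> cm v (D_ a).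
Proof. exact: cm_invr (D'_D_ a) (D_D'_ a) (D_l a) (D_r a). Qed.
Lemma cm_D_invr a v : cm v (D_ a) -> cm v (D'_ a).
Proof. exact: cm_invr (D_D'_ a) (D'_D_ a) (D'_l a) (D'_r a). Qed.

Section Strip.
Variables lo hi : nat.
Hypothesis lohi : (lo < hi)%N.

Let D_lo : D * (e_ lo * E * e_ lo) = D_ lo. Proof. by rewrite dE. Qed.
Let stripl U : D'_ lo * (D * (e_ lo * U)) = e_ lo * U.
Proof. by rewrite [D * _]mulrA mulrA D'_D_. Qed.
Let stripr V : V * e_ hi * D' * D_ hi = V * e_ hi.
Proof. by rewrite -(mulrA V) prD' -(mulrA V) D'_D_. Qed.

Let sub1 k : (lo < k < hi)%N -> forall a, pred1 k a -> (lo <= a <= hi)%N.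
Proof. by move=> lk a /eqP ->; lia. Qed.
Let vD V : V * e_ hi * D' = V * e_ hi * D'_ hi.
Proof. by rewrite -[RHS]mulrA [e_ hi * (D' * _)]mulrA prD' -(mulrA D') prK -prD' mulrA. Qed.

(** The extreme case of the cut for E and E': with A at lo and B at hi both triangular factors are
    unit diagonal, and only D and D' remain. *)
Lemma cm_D_D : cm (D_ lo) (D_ hi).
Proof.
apply: cm_D'_invr; rewrite -D_lo -(prD' (pred1 hi)) -{1}(dE' hi).
apply: cm_E_E => // a; rewrite /=; try by move=> /eqP ->; lia.
by apply/negP=> /andP[/eqP -> /eqP]; lia.
Qed.
Let cm_D_D'hi : cm (D_ lo) (D'_ hi) := cm_D_invr cm_D_D.

Lemma cm_D_E b : (lo < b <= hi)%N -> cm (D_ lo) (e_ b * E' * e_ hi).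
Proof.
move=> lb; rewrite -[_ * e_ hi]stripr; apply: cmMr; last exact: cm_D_D.
rewrite -D_lo; apply: cm_E_E => // a; rewrite /=; try by move=> /eqP ->; lia.
by apply/negP=> /andP[/eqP -> /eqP]; lia.
Qed.

Lemma cm_E_D k : (lo <= k < hi)%N -> cm (e_ lo * E * e_ k) (D_ hi).
Proof.
move=> lk; apply: cm_D'_invr; rewrite -[e_ lo * E * e_ k]mulrA -stripl; apply: cmMl.
  by apply: cm_D_invl; apply: cm_D_D'hi.
rewrite -(prD' (pred1 hi)) -{1}(dE' hi) (mulrA (e_ lo)).
apply: cm_E_E => // a; rewrite /=; try by move=> /eqP ->; lia.
by apply/negP=> /andP[/eqP -> /eqP]; lia.
Qed.

Lemma cm_E_E' k b : (lo <= k < hi)%N -> (lo < b <= hi)%N -> k != b ->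
  cm (e_ lo * E * e_ k) (e_ b * E' * e_ hi).
Proof.
move=> lk lb kb; rewrite -[_ * e_ hi]stripr; apply: cmMr; last exact: cm_E_D.
rewrite -[e_ lo * E * e_ k]mulrA -stripl; apply: cmMl.
  by apply: cm_D_invl; rewrite vD; apply: cmMr (cm_D_E lb) cm_D_D'hi.
rewrite (mulrA (e_ lo)); apply: cm_E_E => // a; rewrite /=; try by move=> /eqP ->; lia.
by apply/negP=> /andP[/eqP -> /eqP]; lia.
Qed.

(** When the two entries meet in block k the overlap is a projection, and the right side is a row of
    E times a column of E' over the whole window. The factors D and D' at the two ends are cancelled
    with the commutations already known. *)
Lemma comm_E_E_mid k : (lo < k < hi)%N ->
  c * (a1 (e_ lo * E * e_ k) * b2 (e_ k * E' * e_ hi)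
       - b2 (e_ k * E' * e_ hi) * a1 (e_ lo * E * e_ k))
  = q * (P * (a1 (e_ k) * (a2 (e_ lo * E * w_ lo hi) * b2 (w_ lo hi * E' * e_ hi)))).
Proof.
move=> lk.
have := @mixed_E_E _ _ lohi (pred1 k) (pred1 k).
rewrite prK => H0; have {}H0 := H0 (sub1 lk) (sub1 lk); move: H0.
set U := e_ lo * E * e_ k; set V := e_ k * E' * e_ hi.
set A := e_ lo * E * _; set B := w_ lo hi * E' * _.
have -> : D * U = D_ lo * U by rewrite /U -!mulrA (mulrA (e_ lo) (e_ lo)) prK.
have -> : D * A = D_ lo * A by rewrite /A -!mulrA (mulrA (e_ lo) (e_ lo)) prK.
rewrite vD (vD (w_ lo hi * E')) -/V -/B => H.
have DV : cm (D_ lo) V by apply: cm_D_E; lia.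
have UD : cm U (D'_ hi) by apply: cm_D_invr; apply: cm_E_D; lia.
move: H; rewrite (rmorphM a1 (D_ lo) U) (rmorphM b2 V) (comm_prod DV UD cm_D_D'hi).
rewrite (rmorphM a2 (D_ lo) A) (rmorphM b2 B) => H.
have {}H := congr1 (fun s => a1 (D'_ lo) * s * b2 (D_ hi)) H.
have xe t : a1 t * b2 (e_ hi) = b2 (e_ hi) * a1 t.
  by rewrite -(diag2 (pr_diag _)) (diag_a1 _ (pr_diag _)).
have eZ : a1 (e_ lo) * (a1 U * b2 V - b2 V * a1 U) * b2 (e_ hi) = a1 U * b2 V - b2 V * a1 U.
  have eU : a1 (e_ lo) * a1 U = a1 U by rewrite -rmorphM /U !mulrA prK.
  have Vf : b2 V * b2 (e_ hi) = b2 V by rewrite -rmorphM /V -!mulrA prK.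
  rewrite mulrBr mulrBl -!mulrA Vf xe (eq_mulA1 Vf) (eq_mulA1 eU).
  by rewrite (eq_mulA (diag_b2 _ (pr_diag _))) eU.
have dd : a1 (D'_ lo) * a1 (D_ lo) = a1 (e_ lo) by rewrite -rmorphM D'_D_.
have gg : b2 (D'_ hi) * b2 (D_ hi) = b2 (e_ hi) by rewrite -rmorphM D'_D_.
rewrite -eZ -mulrA -gg -(eq_mulA1 dd).
move: H; rewrite -!mulrA ![a1 (D'_ lo) * (c * _)](mulCA (@diff_varC _ _ _ L)) => ->.
rewrite [LHS](mulCA (@prod_varC _ _ _ L)) (eq_mulA (diag_a2 _ (pr_diag _))) (eq_mulA (Pa2 _ _)).
rewrite (eq_mulA1 dd) (eq_mulA (esym (Pa2 _ _))) -(eq_mulA (diag_a2 _ (pr_diag _))).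
have Bf : b2 B * b2 (e_ hi) = b2 B by rewrite -rmorphM /B -!mulrA prK.
have eA : a2 (e_ lo) * a2 A = a2 A by rewrite -rmorphM /A !mulrA prK.
by rewrite gg Bf (eq_mulA1 eA).
Qed.

Let hiV V : e_ hi * V = D_ hi * (D' * (e_ hi * V)).
Proof. by rewrite [D' * _]mulrA mulrA D_D'_. Qed.

Lemma cm_D_F b : (lo < b <= hi)%N -> cm (D_ lo) (e_ hi * F' * e_ b).
Proof.
move=> lb; rewrite -mulrA hiV; apply: cmMr; first exact: cm_D_D.
by rewrite -D_lo (mulrA (e_ hi)); apply: cm_E_F; rewrite /=; try (by move=> a /eqP ->; lia); lia.
Qed.

Lemma cm_E_F' k b : (lo <= k < hi)%N -> (lo < b <= hi)%N ->
  cm (e_ lo * E * e_ k) (e_ hi * F' * e_ b).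
Proof.
move=> lk lb; rewrite -[e_ lo * E * e_ k]mulrA -stripl; apply: cmMl.
  by apply: cm_D_invl; apply: cm_D_F.
rewrite -[e_ hi * F' * _]mulrA hiV (mulrA (e_ lo)) (mulrA (e_ hi)); apply: cmMr.
  have -> : D * (e_ lo * E * e_ k) = D_ lo * (e_ lo * E * e_ k).
    by rewrite !mulrA -(mulrA D (e_ lo) (e_ lo)) prK.
  by apply: cmMl; [apply: cm_D_D | apply: cm_E_D].
by apply: cm_E_F; rewrite /=; try (by move=> a /eqP ->; lia); lia.
Qed.
End Strip.

Section TwoBlockWindow.
Variables lo mid hi : nat.
Hypothesis lmh : (lo <= mid < hi)%N.
Local Notation x := (w_ lo mid).
Local Notation y := (w_ mid.+1 hi).
Local Notation w := (w_ lo hi).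
Let wxy : w = x + y.
Proof.
rewrite -prU => [|a]; last by rewrite /itv; lia.
by apply: eq_pr => a; rewrite /itv /=; lia.
Qed.
Let xK : x * x = x := prK _.
Let yK : y * y = y := prK _.
Let xy0 : x * y = 0. Proof. by apply: prM0 => a; rewrite /itv; lia. Qed.
Let yx0 : y * x = 0. Proof. by apply: prM0 => a; rewrite /itv; lia. Qed.
Let xFy Z : lower Z -> x * Z * y = 0.
Proof. by apply=> s t; rewrite /itv; lia. Qed.
Let yEx Z : upper Z -> y * Z * x = 0.
Proof. by apply=> s t; rewrite /itv; lia. Qed.

(** The upper right factor of the coarse factorization into two groups of blocks; [x * E' * x] is
    the inverse of [x * E * x], so this divides the corner of E by its diagonal part. [tbF] is its
    lower analogue. *)
Definition tbE := x * E' * x * (E * y).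
Definition tbF := y * F * x * (F' * x).

Lemma two_block_win : two_block L w x y (win lo hi) (win' lo hi)
  (win lo mid) (win' lo mid) (win mid.+1 hi) (win' mid.+1 hi) tbE tbF.
Proof.
have wx : w * x = x by rewrite wxy mulrDl xK yx0 addr0.
have wy : w * y = y by rewrite wxy mulrDl xy0 yK add0r.
have xw : x * w = x by rewrite wxy mulrDr xK xy0 addr0.
have yw : y * w = y by rewrite wxy mulrDr yx0 yK add0r.
have Ewx Z : upper Z -> w * Z * x = x * Z * x.
  by move=> uZ; rewrite wxy !mulrDl yEx // addr0.
have yEw Z : upper Z -> y * Z * w = y * Z * y.
  by move=> uZ; rewrite wxy !mulrDr yEx // add0r.
have Fwy Z : lower Z -> w * Z * y = y * Z * y.
  by move=> lZ; rewrite wxy !mulrDl xFy // add0r.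
have xFw Z : lower Z -> x * Z * w = x * Z * x.
  by move=> lZ; rewrite wxy !mulrDr xFy // addr0.
have Ewx' Z : upper Z -> w * (Z * x) = x * (Z * x) by move=> /Ewx; rewrite -!mulrA.
have yEw' Z : upper Z -> y * (Z * w) = y * (Z * y) by move=> /yEw; rewrite -!mulrA.
have Fwy' Z : lower Z -> w * (Z * y) = y * (Z * y) by move=> /Fwy; rewrite -!mulrA.
have xFw' Z : lower Z -> x * (Z * w) = x * (Z * x) by move=> /xFw; rewrite -!mulrA.
have sw A t : pr A * (D * t) = D * (pr A * t) by rewrite mulrA prD -mulrA.
have sw' A t : pr A * (D' * t) = D' * (pr A * t) by rewrite mulrA prD' -mulrA.
have prKA A t : pr A * (pr A * t) = pr A * t by rewrite mulrA prK.
have wxA t : w * (x * t) = x * t by rewrite mulrA wx.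
have wyA t : w * (y * t) = y * t by rewrite mulrA wy.
have xwA t : x * (w * t) = x * t by rewrite mulrA xw.
have ywA t : y * (w * t) = y * t by rewrite mulrA yw.
have EE'A l h t : w_ l h * (E * (w_ l h * (E' * (w_ l h * t)))) = w_ l h * t.
  by have := itv_EE' l h; rewrite -!mulrA prKA => /(congr1 (fun s => s * t)); rewrite -!mulrA.
have FF'A l h t : w_ l h * (F * (w_ l h * (F' * (w_ l h * t)))) = w_ l h * t.
  by have := itv_FF' l h; rewrite -!mulrA prKA => /(congr1 (fun s => s * t)); rewrite -!mulrA.
have F'FA l h t : w_ l h * (F' * (w_ l h * (F * (w_ l h * t)))) = w_ l h * t.
  by have := itv_F'F l h; rewrite -!mulrA prKA => /(congr1 (fun s => s * t)); rewrite -!mulrA.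
(* The identity E' E = 1 on the window, cut by x on the left and by y on the right. *)
have EE2 : x * E' * x * (E * y) = - (x * E' * y * (E * y)).
  apply/eqP; rewrite -addr_eq0 -mulrDl -mulrDr -wxy.
  by rewrite -(mulrA (x * E')) -xw -wy -!mulrA; have := itv_E'E lo hi;
    rewrite -!mulrA (mulrA w w) prK => /(congr1 (fun s => x * s * y)); rewrite -!mulrA wy xy0 => ->.
have FF2 : y * F' * y * (F * x) = - (y * F' * x * (F * x)).
  apply/eqP; rewrite -addr_eq0 addrC -mulrDl -mulrDr -wxy.
  by rewrite -(mulrA (y * F')) -yw -wx -!mulrA; have := itv_F'F lo hi;
    rewrite -!mulrA (mulrA w w) prK => /(congr1 (fun s => y * s * x)); rewrite -!mulrA wx yx0 => ->.
have H4 : win' lo hi * y = (y - tbE) * win' mid.+1 hi.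
  transitivity (w * E' * y * (D' * (y * F' * y))).
    by rewrite /win' -!mulrA wy Fwy' // -!sw' wyA prKA.
  rewrite {1}wxy !mulrDl [LHS]addrC /win' -!mulrA ?prKA; congr (_ + _).
  have := congr1 (fun s => s * (y * (E' * (y * (D' * (y * (F' * y))))))) EE2.
  by rewrite !mulNr /tbE -!mulrA !prKA => ->; rewrite opprK EE'A -sw' prKA.
have H5 : y * (F' * (y * (F * (x * (F' * x))))) = - (y * (F' * x)).
  have := congr1 (fun s => s * (x * (F' * x))) FF2.
  have FF0 : x * (F * (x * (F' * x))) = x by have := itv_FF' lo mid; rewrite -!mulrA prKA.
  by rewrite mulNr -!mulrA !prKA FF0.
split=> //.
- exact: rtt_win.
- exact: win_win'.
- exact: win'_win.
- exact: win_l.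
- exact: win_r.
- exact: win_win'.
- exact: win'_win.
- exact: win'_l.
- exact: win'_r.
- exact: win_l.
- exact: win_r.
- exact: win_win'.
- exact: win'_win.
- exact: win'_l.
- exact: win'_r.
- by rewrite /tbE !mulrA xK.
- by rewrite /tbE -!mulrA yK.
- by rewrite /tbF !mulrA yK.
- by rewrite /tbF -!mulrA xK.
- transitivity (x * F * x * (D * (x * E * w))).
    by rewrite /win !mulrA xw xFw // -!mulrA sw xwA sw prKA.
  rewrite wxy mulrDr [in RHS]mulrDr /win -!mulrA xK !mulrDr; congr (_ + _).
  by rewrite /tbE -!mulrA prKA EE'A.
- transitivity (w * F * x * (D * (x * E * x))).
    by rewrite /win -!mulrA wx Ewx' // -!sw wxA prKA.
  rewrite {1}wxy !mulrDl /win /tbF -!mulrA ?prKA; congr (_ + _).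
  by rewrite F'FA.
- transitivity (w * F * (D * (w * E * y))).
    by rewrite /win -!mulrA wy -!sw !prKA.
  transitivity (w * F * x * (D * (x * E * y)) + w * F * y * (D * (y * E * y))).
    rewrite {2}wxy !mulrDl !mulrDr; congr (_ + _).
      by rewrite -!mulrA -!sw prKA.
    by rewrite -!mulrA -!sw prKA.
  rewrite Fwy // addrC; congr (_ + _); first by rewrite /win -!mulrA.
  rewrite wxy !mulrDl /win /tbF /tbE -!mulrA ?prKA ?EE'A; congr (_ + _).
  by rewrite F'FA.

- transitivity (y * E' * y * (D' * (y * F' * w))).
    by rewrite /win' !mulrA yw yEw // -!mulrA sw' ywA sw' prKA.
  rewrite wxy !mulrDr [LHS]addrC /win' -!mulrA ?prKA yK; congr (_ + _).
  by rewrite !mulrN /tbF -!mulrA prKA H5 !mulrN opprK.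
- transitivity (w * E' * (D' * (w * F' * x))).
    by rewrite /win' -!mulrA wx -!sw' !prKA.
  transitivity (w * E' * x * (D' * (x * F' * x)) + w * E' * y * (D' * (y * F' * x))).
    rewrite {2}wxy !mulrDl !mulrDr; congr (_ + _).
      by rewrite -!mulrA -!sw' prKA.
    by rewrite -!mulrA -!sw' prKA.
  rewrite Ewx //; congr (_ + _); first by rewrite /win' -!mulrA.
  rewrite -H4 /tbF; transitivity (- (w * E' * (D' * (y * F' * y))) * (y * F * x * (F' * x))).
    by rewrite mulNr -!mulrA prKA H5 !mulrN opprK -!sw' prKA.
  have H6 : win' lo hi * y = w * E' * (D' * (y * F' * y)).
    by rewrite /win' -!mulrA wy Fwy' // -!sw' wyA.
  by rewrite mulNr H6.
Qed.

Let itv1 a : pr (itv a a) = e_ a.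
Proof. by apply: eq_pr => b; rewrite /itv /= -eqn_leq eq_sym. Qed.

(** With one block in the first group the coarse factor is a row of E; with one block in the second
    group it is minus a column of E' ([tbE_col]). One abstract relation therefore serves both
    matrices. *)
Lemma tbE_row : lo = mid -> tbE = e_ lo * E * y.
Proof. by move=> lm; rewrite /tbE -lm itv1 dE' mulrA. Qed.

Lemma tbF_col : lo = mid -> tbF = y * F * e_ lo.
Proof. by move=> lm; rewrite /tbF -lm itv1 -!mulrA [e_ lo * (_ * _)]mulrA dF'. Qed.

Lemma tbE_col : mid.+1 = hi -> tbE = - (x * E' * e_ hi).
Proof.
move=> mh; have ye : y = e_ hi by rewrite -mh itv1.
apply/eqP; rewrite -[- _]add0r eq_sym subr_eq; apply/eqP; rewrite -ye -[LHS]xy0.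
have xw : x * w = x by rewrite wxy mulrDr xK xy0 addr0.
have wy : w * y = y by rewrite wxy mulrDl xy0 yK add0r.
have wK : w * w = w := prK _.
have <- : x * E' * w * E * y = x * y.
  transitivity (x * w * E' * (w * w) * E * (w * y)); first by rewrite xw wK wy ?mulrA.
  transitivity (x * (w * E' * w * (w * E * w)) * y); first by rewrite !mulrA.
  by rewrite itv_E'E xw.
rewrite wxy !mulrDr !mulrDl /tbE !mulrA; congr (_ + _).
have yEy : y * E * y = y by rewrite ye dE.
transitivity (x * E' * (y * E * y)); first by rewrite !mulrA.
by rewrite yEy.
Qed.

Lemma tbF_row : mid.+1 = hi -> tbF = - (e_ hi * F' * x).
Proof.
move=> mh; have ye : y = e_ hi by rewrite -mh itv1.
apply/eqP; rewrite -[- _]add0r eq_sym subr_eq; apply/eqP; rewrite -ye -[LHS]yx0.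
have yw : y * w = y by rewrite wxy mulrDr yK yx0 add0r.
have wx : w * x = x by rewrite wxy mulrDl yx0 xK addr0.
have wK : w * w = w := prK _.
have <- : y * F * w * F' * x = y * x.
  transitivity (y * w * F * (w * w) * F' * (w * x)); first by rewrite yw wK wx ?mulrA.
  transitivity (y * (w * F * w * (w * F' * w)) * x); first by rewrite !mulrA.
  by rewrite itv_FF' yw.
rewrite wxy !mulrDr !mulrDl /tbF !mulrA; congr (_ + _).
have yFy : y * F * y = y by rewrite ye dF.
by rewrite yFy.
Qed.
End TwoBlockWindow.
End Windows.

(** * The two-leg calculus inside matrices of matrices *)

Section Rcomp.
Variables (A B C : pzRingType).
Definition rcomp (g : {rmorphism B -> C}) (f : {rmorphism A -> B}) : {rmorphism A -> C} := g \o f.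
Definition fps_map_rm (h : {rmorphism A -> B}) : {rmorphism fps A -> fps B} := fps_map h.
Definition fps_cst_rm : {rmorphism A -> fps A} := @fps_cst A.
Variables (N : nat) (p : 'I_N -> bool).
Definition leg1_rm : {rmorphism 'M[A]_N -> 'M['M[A]_N]_N} := leg1 p.
Definition leg2_rm : {rmorphism 'M[A]_N -> 'M['M[A]_N]_N} := @leg2 A N.
End Rcomp.

Section Concrete.
Variables (Y : pzRingType) (N : nat) (p : 'I_N -> bool) (blk : 'I_N -> nat).
Local Notation MY := 'M[Y]_N.
Local Notation M := (fps MY).
Local Notation MM := 'M['M[Y]_N]_N.
Local Notation S := (fps (fps MM)).
Implicit Types f g x : M.
Implicit Types A B : MY.

(** Series of series: the outer one carries the variable of [va], the inner one that of [vb]. So the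
    a-legs act on outer coefficients by constants, and the b-legs are constants of the outer
    series. *)
Definition leg_a1 : {rmorphism M -> S} :=
  rcomp (fps_map_rm (fps_cst_rm MM)) (fps_map_rm (leg1_rm Y p)).
Definition leg_a2 : {rmorphism M -> S} :=
  rcomp (fps_map_rm (fps_cst_rm MM)) (fps_map_rm (leg2_rm Y N)).
Definition leg_b1 : {rmorphism M -> S} := rcomp (fps_cst_rm (fps MM)) (fps_map_rm (leg1_rm Y p)).
Definition leg_b2 : {rmorphism M -> S} := rcomp (fps_cst_rm (fps MM)) (fps_map_rm (leg2_rm Y N)).
Definition flipS : S := fps_cst (fps_cst (flip Y p)).
Definition coefS n m : {additive S -> MM} := fps_coef m \o fps_coef n.

Lemma SP (x y : S) : (forall n m, x n m = y n m) -> x = y.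
Proof. by move=> xy; apply: fpsP => n; apply: fpsP => m; apply: xy. Qed.

Lemma leg_a1E f n m : leg_a1 f n m = if m == 0%N then leg1 p (f n) else 0.
Proof. by rewrite /= /fps_map fps_cstE. Qed.
Lemma leg_a2E f n m : leg_a2 f n m = if m == 0%N then leg2 (f n) else 0.
Proof. by rewrite /= /fps_map fps_cstE. Qed.
Lemma leg_b1E f n m : leg_b1 f n m = if n == 0%N then leg1 p (f m) else 0.
Proof. by rewrite /= fps_cstE; case: eqP. Qed.
Lemma leg_b2E f n m : leg_b2 f n m = if n == 0%N then leg2 (f m) else 0.
Proof. by rewrite /= fps_cstE; case: eqP. Qed.

Lemma flipSMl (x : S) n m : (flipS * x) n m = flip Y p * x n m.
Proof. by rewrite fps_cstMl fps_cstMl. Qed.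
Lemma flipSMr (x : S) n m : (x * flipS) n m = x n m * flip Y p.
Proof. by rewrite fps_cstMr fps_cstMr. Qed.

Lemma varS_a n m (x : S) :
  (fps_X (fps MM) * x) n m = if n is n'.+1 then x n' m else 0.
Proof. by rewrite fps_XM; case: n. Qed.
Lemma varS_b n m (x : S) :
  (fps_cst (fps_X MM) * x) n m = if m is m'.+1 then x n m' else 0.
Proof. by rewrite fps_cstMl fps_XM. Qed.

Lemma varS_aC (x : S) : fps_X (fps MM) * x = x * fps_X (fps MM).
Proof. exact: fps_XC. Qed.
Lemma varS_bC (x : S) : fps_cst (fps_X MM) * x = x * fps_cst (fps_X MM).
Proof. by apply: fpsP => n; rewrite fps_cstMl fps_cstMr fps_XC. Qed.
Lemma flipSK : flipS * flipS = 1.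
Proof.
apply: SP => n m; rewrite flipSMl /flipS; case: n m => [|n] [|m] /=; rewrite ?mulr0 //.
exact: flipK.
Qed.
Lemma flipS_a1 f : flipS * leg_a1 f = leg_a2 f * flipS.
Proof.
apply: SP => n m; rewrite flipSMl flipSMr leg_a1E leg_a2E.
by case: (m == 0%N); rewrite ?flip_leg1 ?mulr0 ?mul0r.
Qed.
Lemma flipS_b1 f : flipS * leg_b1 f = leg_b2 f * flipS.
Proof.
apply: SP => n m; rewrite flipSMl flipSMr leg_b1E leg_b2E.
by case: (n == 0%N); rewrite ?flip_leg1 ?mulr0 ?mul0r.
Qed.

Lemma coefS_eq0 (x : S) : (forall n m, coefS n m x = 0) -> x = 0.
Proof. by move=> x0; apply: SP => n m; apply: x0. Qed.
Lemma coefS_a n m (x : S) :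
  coefS n m (fps_X (fps MM) * x) = if n is n'.+1 then coefS n' m x else 0.
Proof. exact: varS_a. Qed.
Lemma coefS_b n m (x : S) :
  coefS n m (fps_cst (fps_X MM) * x) = if m is m'.+1 then coefS n m' x else 0.
Proof. exact: varS_b. Qed.
Lemma coefS_Pl n m (x : S) : coefS n m (flipS * x) = flip Y p * coefS n m x.
Proof. exact: flipSMl. Qed.
Lemma coefS_Pr n m (x : S) : coefS n m (x * flipS) = coefS n m x * flip Y p.
Proof. exact: flipSMr. Qed.

Definition legs : two_leg M S MM :=
  TwoLeg varS_aC varS_bC flipSK (flipK Y p) flipS_a1 flipS_b1
    coefS_eq0 coefS_a coefS_b coefS_Pl coefS_Pr.

Lemma map_cst_mul (u v : fps MM) n m :
  (fps_map (fps_cst_rm MM) u * fps_cst v : S) n m = u n * v m.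
Proof. by rewrite fps_cstMr fps_cstMl. Qed.
Lemma cst_map_mul (u v : fps MM) n m :
  (fps_cst v * fps_map (fps_cst_rm MM) u : S) n m = v m * u n.
Proof. by rewrite fps_cstMl fps_cstMr. Qed.
Lemma a1b2E f g n m : (a1 legs f * b2 legs g) n m = leg1 p (f n) * leg2 (g m).
Proof. exact: map_cst_mul. Qed.
Lemma b2a1E f g n m : (b2 legs g * a1 legs f) n m = leg2 (g m) * leg1 p (f n).
Proof. exact: cst_map_mul. Qed.
Lemma a2b2E f g n m : (a2 legs f * b2 legs g) n m = leg2 (f n * g m).
Proof. by rewrite [leg2 _](rmorphM (@leg2 Y N)); apply: map_cst_mul. Qed.
Lemma b1a2E f g n m : (b1 legs f * a2 legs g) n m = leg1 p (f m) * leg2 (g n).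
Proof. exact: cst_map_mul. Qed.
Lemma map_cst_prod (u v : fps MM) n m :
  (fps_map (fps_cst_rm MM) u * fps_map (fps_cst_rm MM) v : S) n m.+1 = 0.
Proof.
have -> : fps_map (fps_cst_rm MM) u * fps_map (fps_cst_rm MM) v = fps_map_rm (fps_cst_rm MM) (u * v).
  by rewrite rmorphM.
by [].
Qed.
Lemma cst_prod (u v : fps MM) : fps_cst u * fps_cst v = fps_cst (u * v) :> S.
Proof. by rewrite rmorphM. Qed.
Lemma a1a2E f g n m : (a1 legs f * a2 legs g) n m.+1 = 0.
Proof. exact: map_cst_prod. Qed.
Lemma a2a2E f g n m : (a2 legs f * a2 legs g) n m.+1 = 0.
Proof. exact: map_cst_prod. Qed.
Lemma b1b2E0 f g m : (b1 legs f * b2 legs g) 0%N m = \sum_(t < m.+1) leg1 p (f t) * leg2 (g (m - t)%N).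
Proof. by rewrite [_ * _]cst_prod. Qed.
Lemma b2b1E f g n m : (b2 legs g * b1 legs f) n.+1 m = 0.
Proof. by rewrite [_ * _]cst_prod. Qed.
Lemma b1b2E f g n m : (b1 legs f * b2 legs g) n.+1 m = 0.
Proof. by rewrite [_ * _](_ : _ = fps_cst (fps_map (leg1_rm Y p) f * fps_map (leg2_rm Y N) g)) // rmorphM. Qed.

Definition dgm (A : pred nat) : MY :=
  \matrix_(i, j) (if (i == j) && A (blk i) then 1 else 0).
Definition prj (A : pred nat) : M := fps_cst (dgm A).

Lemma dgm_mull (A : pred nat) X i j : (dgm A * X) i j = if A (blk i) then X i j else 0.
Proof.
rewrite mxE (bigD1 i) //= big1 ?addr0; last first.
  by move=> k ki; rewrite mxE eq_sym (negPf ki) mul0r.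
by rewrite mxE eqxx /=; case: ifP; rewrite ?mul1r ?mul0r.
Qed.
Lemma dgm_mulr (A : pred nat) X i j : (X * dgm A) i j = if A (blk j) then X i j else 0.
Proof.
rewrite mxE (bigD1 j) //= big1 ?addr0; last first.
  by move=> k ki; rewrite mxE (negPf ki) mulr0.
by rewrite mxE eqxx /=; case: ifP; rewrite ?mulr1 ?mulr0.
Qed.

Lemma prj_prj (A B : pred nat) f n i j :
  (prj A * f * prj B) n i j = if A (blk i) && B (blk j) then f n i j else 0.
Proof.
rewrite fps_cstMr fps_cstMl dgm_mulr dgm_mull.
by case: (A _); case: (B _).
Qed.
Lemma prj_l (A : pred nat) f n i j : (prj A * f) n i j = if A (blk i) then f n i j else 0.
Proof. by rewrite fps_cstMl dgm_mull. Qed.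
Lemma prj_r (A : pred nat) f n i j : (f * prj A) n i j = if A (blk j) then f n i j else 0.
Proof. by rewrite fps_cstMr dgm_mulr. Qed.

Lemma serP f g : (forall n i j, f n i j = g n i j) -> f = g.
Proof. by move=> fg; apply: fpsP => n; apply/matrixP=> i j; apply: fg. Qed.

Lemma prj0 : prj pred0 = 0.
Proof. by apply: serP => n i j; rewrite /prj fps_cstE; case: eqP => _; rewrite !mxE ?andbF. Qed.
Lemma prjT : prj predT = 1.
Proof.
rewrite /prj (_ : dgm _ = 1) ?rmorph1 //; apply/matrixP=> i j; rewrite !mxE andbT.
by case: eqP.
Qed.
Lemma eq_prj (A B : pred nat) : A =1 B -> prj A = prj B.
Proof. by move=> AB; congr fps_cst; apply/matrixP=> i j; rewrite !mxE AB. Qed.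
Lemma prjM (A B : pred nat) : prj A * prj B = prj (predI A B).
Proof.
apply: serP => n i j; rewrite prj_l /prj !fps_cstE.
case: eqP => _; rewrite !mxE /=; last by case: ifP.
by case: (A _); rewrite ?andbF.
Qed.
Lemma prjU (A B : pred nat) : (forall a, ~~ (A a && B a)) -> prj (predU A B) = prj A + prj B.
Proof.
move=> AB; apply: serP => n i j; rewrite mxE /prj !fps_cstE.
case: eqP => _; rewrite !mxE ?addr0 //=; have := AB (blk i).
by case: (A _); case: (B _) => //=; rewrite ?andbT ?andbF; case: (i == j); rewrite ?addr0 ?add0r.
Qed.
Lemma diag_prj (A : pred nat) : diagonal legs (prj A).
Proof.
have key B : leg1 p (dgm A) * leg2 B = leg2 B * leg1 p (dgm A).
  apply: mmP => i j h k; rewrite leg1_leg2E leg2_leg1E mxE.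
  case: eqP => [->|_]; last by rewrite !(mulr0, mul0r).
  by rewrite addbb !andbF !expr0 !mul1r; case: ifP; rewrite ?mulr1 ?mul1r ?mulr0 ?mul0r.
have pA : fps_map (leg1_rm Y p) (prj A) = fps_cst (leg1 p (dgm A)).
  by apply: fpsP => -[|n]; rewrite /fps_map //= raddf0.
split=> [|y].
  apply: SP => n m; rewrite leg_a1E leg_b1E /prj !fps_cstE.
  by case: n m => [|n] [|m] //=; rewrite raddf0.
have e : fps_map (leg1_rm Y p) (prj A) * fps_map (leg2_rm Y N) y
    = fps_map (leg2_rm Y N) y * fps_map (leg1_rm Y p) (prj A).
  by rewrite pA; apply: fpsP => n; rewrite fps_cstMl fps_cstMr /fps_map; apply: key.
split; first by have := congr1 (fps_map_rm (fps_cst_rm MM)) e; rewrite !rmorphM.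
apply: SP => n m; rewrite a1b2E b2a1E /prj fps_cstE.
by case: (n == 0%N); rewrite ?key // raddf0 mulr0 mul0r.
Qed.

Lemma a1_prj (A : pred nat) (x : S) n m : (a1 legs (prj A) * x) n m = leg1 p (dgm A) * x n m.
Proof.
have -> : a1 legs (prj A) = fps_cst (fps_cst (leg1 p (dgm A))) :> S.
  apply: SP => n' m'; rewrite leg_a1E /prj !fps_cstE.
  by case: n' m' => [|n'] [|m'] //=; rewrite raddf0.
by rewrite !fps_cstMl.
Qed.

(** The parities of x and y enter a supercommutator only through their product, which is b. *)
Definition sc (b : bool) (x y : Y) : Y := x * y - (-1) ^+ b * (y * x).
Local Notation par i j := (p i (+) p j).

Lemma mmBE (x y : MM) i j h k : (x - y) i j h k = x i j h k - y i j h k.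
Proof. by rewrite !mxE. Qed.
Lemma mmNE (x : MM) i j h k : (- x) i j h k = - x i j h k.
Proof. by rewrite !mxE. Qed.

Lemma legs_commE A B i j h k :
  (leg1 p A * leg2 B - leg2 B * leg1 p A) i j h k =
  (-1) ^+ (p h && par i j) * sc (par i j && par h k) (A i j) (B h k).
Proof.
rewrite mmBE leg1_leg2E leg2_leg1E /sc mulrBr mulrA.
by congr (_ - _); rewrite mulr_sign2; congr ((-1) ^+ _ * _); congr nat_of_bool; case: (par i j); case: (p h); case: (p k).
Qed.

Lemma flip_leg_leg2E A B i j h k :
  (flip Y p * (leg1 p A * leg2 B)) i j h k = (-1) ^+ (p i && p j) * (A h j * B i k).
Proof.
rewrite flipMlE leg1_leg2E -mulrA mulr_sign2; congr ((-1) ^+ _ * _); congr nat_of_bool.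
by case: (p i); case: (p j); case: (p h).
Qed.
Lemma leg_leg2_flipE A B i j h k :
  (leg1 p A * leg2 B * flip Y p) i j h k = (-1) ^+ (p h && (p i (+) p k) (+) p j && p k) * (A i k * B h j).
Proof. by rewrite flipMrE leg1_leg2E -mulrA mulr_sign2 addbC. Qed.
Lemma leg2_leg_flipE A B i j h k :
  (leg2 B * leg1 p A * flip Y p) i j h k = (-1) ^+ (p i && p j) * (B h j * A i k).
Proof.
rewrite flipMrE leg2_leg1E mulr_sign2; congr ((-1) ^+ _ * _); congr nat_of_bool.
by case: (p i); case: (p j); case: (p k).
Qed.

(** The right side is divisible by both variables, so the borders of Z vanish and a recursion along
    antidiagonals remains. [diff_var_sum] solves it from one border, [diff_var_sumr] from the other;
    this is where the finite sums over t in the relations come from. *)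
Lemma diff_varE2 (Z W : S) : diff_var legs * Z = prod_var legs * W ->
  [/\ forall s, Z 0%N s = 0, forall r, Z r 0%N = 0
    & forall r s, Z r.+1 s = Z r s.+1 + W r s].
Proof.
rewrite diff_varE prod_varE mulrBl -mulrA => e.
have E n m := congr1 (coef legs n m) e.
split=> [s|r|r s].
- by have := E 0%N s.+1; rewrite !coefE subr0.
- by have := E r.+1 0%N; rewrite !coefE sub0r => /eqP; rewrite oppr_eq0 => /eqP.
- have := E r.+1 s.+1; rewrite !coefE => /eqP.
  by rewrite subr_eq addrC => /eqP.
Qed.

Lemma diff_var_sum (Z W : S) r s : diff_var legs * Z = prod_var legs * W ->
  Z r s = \sum_(t < r) W t (r + s - 1 - t)%N.
Proof.
case/diff_varE2 => Z0 _ ZW; elim: r s => [|r IH] s; first by rewrite big_ord0.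
rewrite ZW IH big_ord_recr /=; congr (_ + W _ _); last by lia.
by apply: eq_bigr => t _; congr (W _ _); lia.
Qed.
Lemma diff_var_sumr (Z W : S) r s : diff_var legs * Z = prod_var legs * W ->
  Z r s = - \sum_(t < s) W (r + s - 1 - t)%N t.
Proof.
case/diff_varE2 => _ Z0 ZW; elim: s r => [|s IH] r; first by rewrite big_ord0 oppr0.
have := ZW r s; rewrite IH => /eqP; rewrite -subr_eq => /eqP <-.
rewrite big_ord_recr /= opprD; congr (- _ - W _ _); last by lia.
by apply: eq_bigr => t _; congr (W _ _); lia.
Qed.

End Concrete.

(** * Relations between the Gauss factors *)

Lemma subr_swap (V : zmodType) (a b d e : V) : a - b = d - e <-> a - d = b - e.
Proof.
split=> /eqP; rewrite subr_eq => /eqP e'; apply/eqP; rewrite subr_eq e'.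
  by rewrite addrAC -addrA addrC.
by rewrite addrAC -addrA addrC.
Qed.

Lemma rtt_comm (M S S0 : pzRingType) (L : two_leg M S S0) X :
  rtt L X <-> diff_var L * (a1 L X * b2 L X - b2 L X * a1 L X)
  = prod_var L * (P L * (a1 L X * b2 L X) - b2 L X * a1 L X * P L).
Proof.
rewrite /rtt; move: (a1 L X * b2 L X) (b2 L X * a1 L X) => u v.
rewrite mulrBl !mulrBr -diff_varC -!mulrA (mulCA (@prod_varC _ _ _ L)).
exact: subr_swap.
Qed.

Section Unitriangular.
Variables (Y : pzRingType) (N : nat) (ord : rel 'I_N).
Hypotheses (ordT : transitive ord) (ordI : irreflexive ord).

Definition unitri (X : fps 'M[Y]_N) := forall r i j, ~~ ord i j ->
  X r i j = ((r == 0%N) && (i == j))%:R.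

Lemma fps_mul0E (X X' : fps 'M[Y]_N) : (X * X') 0%N = X 0%N * X' 0%N.
Proof. by rewrite fpsME big_ord1. Qed.

Lemma fps_mulSE (X X' : fps 'M[Y]_N) r : (X * X') r.+1 =
  X 0%N * X' r.+1 + \sum_(t < r.+1) X t.+1 * X' (r - t)%N.
Proof. by rewrite fpsME big_ord_recl. Qed.

Lemma unitri_inv (X X' : fps 'M[Y]_N) : X 0%N = 1 -> unitri X -> X * X' = 1 -> unitri X'.
Proof.
move=> X0 uX XX'; have X'0 : X' 0%N = 1.
  by have := congr1 (@^~ 0%N) XX'; rewrite fps_mul0E X0 mul1r.
elim/ltn_ind=> -[|r] IH i j nij; first by rewrite X'0 mxE; case: eqP.
have := congr1 (@^~ r.+1) XX'; rewrite fps_mulSE X0 mul1r => /matrixP/(_ i j).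
rewrite !mxE summxE big1 ?addr0 // => t _.
rewrite mxE big1 // => k _; case: (boolP (ord i k)) => oik; last by rewrite uX // mul0r.
have nkj : ~~ ord k j by apply: contra nij; apply: ordT.
rewrite IH // ?ltnS ?leq_subr //; case: (eqVneq k j) oik nij => [->|_ _ _]; first by move=> ->.
by rewrite andbF mulr0.
Qed.

Lemma fps_inverse_exists (X : fps 'M[Y]_N) : X 0%N = 1 -> exists X', X * X' = 1 /\ X' * X = 1.
Proof.
move=> /ps_inverse_exists[X' [e1 e2]]; exists X'; split; apply: fpsP => n.
  by rewrite [LHS]e1; case: n.
by rewrite [LHS]e2; case: n.
Qed.

End Unitriangular.

Section Pencil.
Variables (Y : pzRingType) (N : nat) (p : 'I_N -> bool) (blk : 'I_N -> nat).
Local Notation par i j := (p i (+) p j).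
Local Notation lowo := (fun i j : 'I_N => (blk j < blk i)%N).
Local Notation uppo := (fun i j : 'I_N => (blk i < blk j)%N).

Definition rtt_coef (T : fps 'M[Y]_N) := forall i j h k r s, (0 < r)%N -> (0 < s)%N ->
  sc (par i j && par h k) (T r i j) (T s h k) =
  (-1) ^+ ((p i && p j) (+) (p i && p h) (+) (p j && p h)) *
  \sum_(g < minn r s) (T g h j * T (r + s - 1 - g)%N i k - T (r + s - 1 - g)%N h j * T g i k).

(** T is arbitrary here: the same facts are applied to the generating matrix of the Yangian, to its
    transpose over the opposite ring, and to the trivial decomposition with one block. *)
Record pencil (T F D D' E : fps 'M[Y]_N) : Prop := Pencil {
  pc_T : T = F * D * E;
  pc_F0 : F 0%N = 1; pc_D0 : D 0%N = 1; pc_E0 : E 0%N = 1;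
  pc_F : unitri lowo F; pc_E : unitri uppo E;
  pc_D : forall r i j, blk i != blk j -> D r i j = 0;
  pc_DD' : D * D' = 1; pc_D'D : D' * D = 1;
  pc_rtt : rtt_coef T
}.

Section Facts.
Variables T F D D' E F' E' : fps 'M[Y]_N.
Hypothesis pc : pencil T F D D' E.
Hypotheses (FF' : F * F' = 1) (F'F : F' * F = 1) (EE' : E * E' = 1) (E'E : E' * E = 1).
Local Notation L := (legs Y p).
Local Notation bprj := (prj Y blk).

Lemma lowoT : transitive lowo. Proof. by move=> j i k ij jk; apply: ltn_trans ij. Qed.
Lemma uppoT : transitive uppo. Proof. by move=> j i k ij jk; apply: ltn_trans ij jk. Qed.
Let uF' : unitri lowo F' := unitri_inv lowoT (pc_F0 pc) (pc_F pc) FF'.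
Let uE' : unitri uppo E' := unitri_inv uppoT (pc_E0 pc) (pc_E pc) EE'.

Lemma lower_unitri X : unitri lowo X -> lower bprj X.
Proof.
move=> uX A B AB; apply: serP => n i j; rewrite prj_prj mxE.
case: ifP => // /andP[Ai Bj]; have ij := AB _ _ Ai Bj.
rewrite uX; last by rewrite -leqNgt ltnW.
by have [e|_] := eqVneq i j; [move: ij; rewrite e ltnn | rewrite andbF].
Qed.
Lemma upper_unitri X : unitri uppo X -> upper bprj X.
Proof.
move=> uX A B AB; apply: serP => n i j; rewrite prj_prj mxE.
case: ifP => // /andP[Ai Bj]; have ij := AB _ _ Ai Bj.
rewrite uX; last by rewrite -leqNgt ltnW.
by have [e|_] := eqVneq i j; [move: ij; rewrite e ltnn | rewrite andbF].
Qed.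
Lemma unit_diag_unitri ord X : unitri ord X -> (forall i j, blk i = blk j -> ~~ ord i j) ->
  unit_diag bprj X.
Proof.
move=> uX nord a; apply: serP => n i j; rewrite prj_prj /prj fps_cstE.
case: (boolP (pred1 a (blk i) && pred1 a (blk j))) => [/andP[/eqP ia /eqP ja]|nij].
  rewrite uX ?nord ?ia ?ja //; case: n => [|n]; rewrite mxE ?eqxx ?ia ?andbT //=.
  by rewrite eqxx andbT; case: (i == j).
case: n => [|n] /=; rewrite mxE //; have [e|//] := eqVneq i j.
by move: nij; rewrite e andbb => /negPf /= ->.
Qed.

Lemma prj_D A : bprj A * D = D * bprj A.
Proof.
apply: serP => n i j; rewrite prj_l prj_r.
case: (eqVneq (blk i) (blk j)) => [->//|ij].
by rewrite (pc_D pc) // !if_same.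
Qed.
Lemma prj_D' A : bprj A * D' = D' * bprj A.
Proof.
transitivity (D' * (bprj A * D) * D').
  by rewrite prj_D !mulrA (pc_D'D pc) mul1r.
by rewrite -!mulrA (pc_DD' pc) mulr1.
Qed.

Lemma diff_var_intro (Z W : fps (fps 'M['M[Y]_N]_N)) :
  (forall s, Z 0%N s = 0) -> (forall r, Z r 0%N = 0) ->
  (forall r s, Z r.+1 s = Z r s.+1 + W r s) -> diff_var L * Z = prod_var L * W.
Proof.
move=> Z0 Z0' ZW; apply/eqP; rewrite -subr_eq0; apply/eqP.
apply: (@coef_eq0 _ _ _ L) => -[|n] [|m]; rewrite diff_varE prod_varE mulrBl -mulrA !coefE;
  rewrite /= /fps_coef ?Z0 ?Z0' ?ZW ?subrr ?subr0 //.
by rewrite [_ + W _ _]addrC addrK subrr.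
Qed.

Definition comm_ab (X : fps 'M[Y]_N) := a1 L X * b2 L X - b2 L X * a1 L X.
Definition flip_ab (X : fps 'M[Y]_N) := P L * (a1 L X * b2 L X) - b2 L X * a1 L X * P L.

Lemma comm_abE X Z r s i j h k :
  (a1 L X * b2 L Z - b2 L Z * a1 L X) r s i j h k =
  (-1) ^+ (p h && par i j) * sc (par i j && par h k) (X r i j) (Z s h k).
Proof. by rewrite -legs_commE -(a1b2E p) -(b2a1E p). Qed.

Lemma flip_abE X t u i j h k : flip_ab X t u i j h k =
  (-1) ^+ (p i && p j) * (X t h j * X u i k - X u h j * X t i k).
Proof.
rewrite mulrBr -(flip_leg_leg2E p) -(leg2_leg_flipE p) -mmBE -(a1b2E p) -(b2a1E p).
by rewrite -(flipSMl p) -(flipSMr p).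
Qed.

Lemma sign_moveK (b : bool) (x y : Y) : (-1) ^+ b * x = y -> x = (-1) ^+ b * y.
Proof. by move=> <-; rewrite mulr_sign2 addbb mul1r. Qed.

Lemma sc_nat0 b (c : bool) (x : Y) : ~~ (c && b) -> sc b c%:R x = 0.
Proof. by case: c => /= [/negPf->|_]; rewrite /sc ?(mul1r, mulr1) ?subrr // mul0r !mulr0 subr0. Qed.
Lemma sc_nat0r b (c : bool) (x : Y) : ~~ (c && b) -> sc b x c%:R = 0.
Proof. by case: c => /= [/negPf->|_]; rewrite /sc ?(mul1r, mulr1) ?subrr // mul0r !mulr0 subr0. Qed.

Lemma T0 : T 0%N = 1.
Proof. by rewrite (pc_T pc) !fps_mul0E (pc_F0 pc) (pc_D0 pc) (pc_E0 pc) !mul1r. Qed.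

(** By antisymmetry the terms between the smaller and the larger exponent cancel in pairs; hence the
    sum cut at the minimum, as in the defining relation, satisfies the recursion of [diff_varE2]. *)
Lemma minn_sum_step (W : nat -> nat -> Y) r s :
  (forall t u, W t u = - W u t) -> (forall t, W t t = 0) ->
  \sum_(g < minn r.+1 s) W g (r.+1 + s - 1 - g)%N
  = \sum_(g < minn r s.+1) W g (r + s.+1 - 1 - g)%N + W r s.
Proof.
move=> asym W0; have -> : (r.+1 + s = r + s.+1)%N by lia.
case: (ltngtP r s) => [rs|sr|->].
- by rewrite (minn_idPl rs) (minn_idPl _) ?(leqW (ltnW rs)) // big_ord_recr /=; congr (_ + W _ _); lia.
- rewrite (minn_idPr _) ?(leqW (ltnW sr)) // (minn_idPr sr) big_ord_recr /=.
  by rewrite -addrA (_ : r + s.+1 - 1 - s = r)%N ?[W s r]asym ?addNr ?addr0 //; lia.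
- by rewrite W0 addr0 (minn_idPr (leqnSn s)) (minn_idPl (leqnSn s)).
Qed.

Lemma comm_min_sum r s i j h k : comm_ab T r s i j h k =
  \sum_(g < minn r s) flip_ab T g (r + s - 1 - g)%N i j h k.
Proof.
rewrite comm_abE; case: r s => [|r] [|s]; rewrite ?minn0 ?min0n ?big_ord0.
- by rewrite T0 mxE sc_nat0 ?mulr0 //; case: eqP => // ->; rewrite addbb.
- by rewrite T0 mxE sc_nat0 ?mulr0 //; case: eqP => // ->; rewrite addbb.
- by rewrite T0 mxE sc_nat0r ?mulr0 //; case: eqP => // ->; rewrite addbb andbF.
rewrite (pc_rtt pc) // mulr_sign2 mulr_sumr; apply: eq_bigr => g _.
rewrite flip_abE; congr ((-1) ^+ _ * _); congr nat_of_bool.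
by case: (p h); case: (p i); case: (p j).
Qed.

Lemma flip_ab_asym X t u i j h k : flip_ab X t u i j h k = - flip_ab X u t i j h k.
Proof. by rewrite !flip_abE -[RHS]mulrN opprB. Qed.
Lemma flip_ab_diag X t i j h k : flip_ab X t t i j h k = 0.
Proof. by rewrite flip_abE subrr mulr0. Qed.

Lemma rtt_legs : rtt L T.
Proof.
apply/rtt_comm/diff_var_intro => [s|r|r s]; apply: mmP => i j h k.
- by rewrite comm_min_sum min0n big_ord0 !mxE.
- by rewrite comm_min_sum minn0 big_ord0 !mxE.
have mmD (x y : 'M['M[Y]_N]_N) : (x + y) i j h k = x i j h k + y i j h k by rewrite !mxE.
rewrite [RHS]mmD !comm_min_sum.
by apply: (@minn_sum_step (fun t u => flip_ab T t u i j h k)) => [t u|t];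
  [exact: flip_ab_asym | exact: flip_ab_diag].
Qed.

Let lF := lower_unitri (pc_F pc).
Let lF' := lower_unitri uF'.
Let uuE := upper_unitri (pc_E pc).
Let uuE' := upper_unitri uE'.
Let nlow i j : blk i = blk j -> ~~ lowo i j. Proof. by move=> /= ->; rewrite ltnn. Qed.
Let nupp i j : blk i = blk j -> ~~ uppo i j. Proof. by move=> /= ->; rewrite ltnn. Qed.
Let dF := unit_diag_unitri (pc_F pc) nlow.
Let dF' := unit_diag_unitri uF' nlow.
Let dE := unit_diag_unitri (pc_E pc) nupp.
Let dE' := unit_diag_unitri uE' nupp.
Let rT : rtt L (F * D * E). Proof. by rewrite -(pc_T pc); apply: rtt_legs. Qed.

Let W lo hi := win bprj F D E lo hi.

Lemma rtt_window lo hi : rtt L (W lo hi).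
Proof.
exact: (rtt_win (@diag_prj _ _ p blk) (@prjM _ _ blk) (@eq_prj _ _ blk) (@prjT _ _ blk)
  (@prjU _ _ blk) FF' F'F (pc_DD' pc) (pc_D'D pc) EE' E'E lF lF' uuE uuE' prj_D prj_D' rT).
Qed.

Local Notation e_ a := (bprj (pred1 a)).
Local Notation theory f := (f bprj (@diag_prj _ _ p blk) (@prjM _ _ blk) (@eq_prj _ _ blk) (prj0 Y blk)
  (@prjT _ _ blk) (@prjU _ _ blk)) (only parsing).

Lemma prj_itv1 a : bprj (itv a a) = e_ a.
Proof. by apply: eq_prj => b; rewrite /itv /= -eqn_leq eq_sym. Qed.

Lemma win_D a : W a a = D * e_ a.
Proof.
rewrite /W /win prj_itv1 dF dE prj_D -mulrA; congr (D * _).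
by rewrite prjM; apply: eq_prj => b /=; rewrite andbb.
Qed.

Lemma colE a i j r (X : fps 'M[Y]_N) : blk j = a -> (X * e_ a) r i j = X r i j.
Proof. by move=> ja; rewrite prj_r /= ja eqxx. Qed.

Lemma cm_sc u v r s i j h k : cm L u v -> sc (par i j && par h k) (u r i j) (v s h k) = 0.
Proof.
move=> uv; have := comm_abE u v r s i j h k; rewrite uv subrr => e.
apply: (@etrans _ _ ((-1) ^+ (p h && par i j) * 0)); last by rewrite mulr0.
by apply: sign_moveK; rewrite -e !mxE.
Qed.

Ltac win_hyps := first
  [ exact: (@diag_prj _ _ p blk) | exact: (@prjM _ _ blk) | exact: (@eq_prj _ _ blk)
  | exact: (prj0 Y blk) | exact: (@prjT _ _ blk) | exact: (@prjU _ _ blk)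
  | exact: FF' | exact: F'F | exact: (pc_DD' pc) | exact: (pc_D'D pc) | exact: EE' | exact: E'E
  | exact: lF | exact: lF' | exact: uuE | exact: uuE' | exact: dF | exact: dF' | exact: dE
  | exact: dE' | exact: prj_D | exact: prj_D' | exact: rT ].

Let wDD lo hi : (lo < hi)%N -> cm L (D * e_ lo) (D * e_ hi).
Proof. by move=> lh; eapply cm_D_D; try exact rT; try win_hyps. Qed.
Let wDE lo hi b : (lo < b <= hi)%N -> cm L (D * e_ lo) (e_ b * E' * e_ hi).
Proof.
move=> lh; eapply cm_D_E; try exact rT; try win_hyps; lia.
Qed.
Let wED lo hi k : (lo <= k < hi)%N -> cm L (e_ lo * E * e_ k) (D * e_ hi).
Proof.
move=> lh; eapply cm_E_D; try exact rT; try win_hyps; lia.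
Qed.
Let wEE lo hi k b : (lo <= k < hi)%N -> (lo < b <= hi)%N -> k != b ->
  cm L (e_ lo * E * e_ k) (e_ b * E' * e_ hi).
Proof.
move=> lh bh kb; eapply cm_E_E'; try exact rT; try win_hyps; lia.
Qed.
Let wEF lo hi k b : (lo <= k < hi)%N -> (lo < b <= hi)%N ->
  cm L (e_ lo * E * e_ k) (e_ hi * F' * e_ b).
Proof.
move=> lh bh; eapply cm_E_F'; try exact rT; try win_hyps; lia.
Qed.
Let wmid lo hi k : (lo < k < hi)%N ->
  diff_var L * (a1 L (e_ lo * E * e_ k) * b2 L (e_ k * E' * e_ hi)
       - b2 L (e_ k * E' * e_ hi) * a1 L (e_ lo * E * e_ k))
  = prod_var L * (P L * (a1 L (e_ k) * (a2 L (e_ lo * E * bprj (itv lo hi)) * b2 L (bprj (itv lo hi) * E' * e_ hi)))).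
Proof.
move=> lh; eapply comm_E_E_mid; try exact rT; try win_hyps; lia.
Qed.
Let wtb lo mid hi : (lo <= mid < hi)%N ->
  two_block L (bprj (itv lo hi)) (bprj (itv lo mid)) (bprj (itv mid.+1 hi)) (win bprj F D E lo hi) (win' bprj F' D' E' lo hi)
  (win bprj F D E lo mid) (win' bprj F' D' E' lo mid) (win bprj F D E mid.+1 hi) (win' bprj F' D' E' mid.+1 hi)
  (tbE bprj E E' lo mid hi) (tbF bprj F F' lo mid hi).
Proof.
by move=> lh; apply: two_block_win => //; win_hyps.
Qed.

Lemma rel_DD i j h k r s : blk i = blk j -> blk h = blk j -> blk k = blk j ->
  sc (par i j && par h k) (D r i j) (D s h k) =
  (-1) ^+ ((p i && p j) (+) (p i && p h) (+) (p j && p h)) *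
  \sum_(g < minn r s) (D g h j * D (r + s - 1 - g)%N i k - D (r + s - 1 - g)%N h j * D g i k).
Proof.
move=> ij hj kj; set a := blk j in ij hj kj.
have DE t u v : blk v = a -> W a a t u v = D t u v by move=> va; rewrite win_D colE.
have /rtt_comm/diff_varE2[Z0 _ ZS] := rtt_window a a.
have mmD (x y : 'M['M[Y]_N]_N) : (x + y) i j h k = x i j h k + y i j h k by rewrite !mxE.
have Zsum : comm_ab (W a a) r s i j h k =
    \sum_(g < minn r s) flip_ab (W a a) g (r + s - 1 - g)%N i j h k.
  elim: r s => [|r IH] s; first by rewrite min0n big_ord0 [comm_ab _ _ _]Z0 !mxE.
  rewrite [comm_ab _ _ _]ZS mmD [X in X + _](IH s.+1).
  rewrite (@minn_sum_step (fun t u => flip_ab (W a a) t u i j h k)) // => [t u|t].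
    exact: flip_ab_asym.
  exact: flip_ab_diag.
move: Zsum; rewrite comm_abE => /sign_moveK; rewrite !DE // => ->.
rewrite !mulr_sumr; apply: eq_bigr => g _; rewrite flip_abE mulr_sign2 !DE //.
by congr ((-1) ^+ _ * _); congr nat_of_bool; case: (p h); case: (p i); case: (p j).
Qed.

Lemma scC b (x y : Y) : sc b x y = - ((-1) ^+ b * sc b y x).
Proof. by rewrite /sc mulrBr mulr_sign2 addbb mul1r opprB. Qed.

Lemma rel_DD0 i j h k r s : blk i = blk j -> blk h = blk k -> blk j != blk h ->
  sc (par i j && par h k) (D r i j) (D s h k) = 0.
Proof.
move=> ij hk jh; have D_ t u v : D t u v = (D * e_ (blk v)) t u v by rewrite colE.
rewrite (D_ r i) (D_ s h); case: (ltngtP (blk j) (blk k)) => [l|l|e].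
- by rewrite (cm_sc _ _ _ _ _ _ (wDD l)).
- by rewrite scC andbC (cm_sc _ _ _ _ _ _ (wDD l)) mulr0 oppr0.
- by rewrite e hk eqxx in jh.
Qed.

Lemma fps_oppE (X : fps 'M[Y]_N) r i j : (- X) r i j = - X r i j.
Proof. exact: mxE. Qed.

Lemma rcE a b r i j X : blk i = a -> blk j = b -> (e_ a * X * e_ b) r i j = X r i j.
Proof. by move=> ia jb; rewrite prj_prj /= ia jb !eqxx. Qed.

Lemma tbE_rowE lo hi r i j : (lo < hi)%N -> blk i = lo -> (lo < blk j <= hi)%N ->
  tbE bprj E E' lo lo hi r i j = E r i j.
Proof.
move=> lh il jh; rewrite (@tbE_row _ bprj (@eq_prj _ _ blk) E E' dE' lo lo hi) //.
by rewrite prj_prj /itv /= il eqxx jh.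
Qed.
Lemma tbE_colE lo mid r i j : (lo <= mid)%N -> (lo <= blk i <= mid)%N -> blk j = mid.+1 ->
  tbE bprj E E' lo mid mid.+1 r i j = - E' r i j.
Proof.
move=> lh il jh.
have lmh : (lo <= mid < mid.+1)%N by rewrite lh ltnSn.
have -> : tbE bprj E E' lo mid mid.+1 = - (bprj (itv lo mid) * E' * e_ mid.+1).
  by eapply tbE_col; try win_hyps.
by rewrite fps_oppE prj_prj /itv /= il jh eqxx.
Qed.

(** The coarse factor of a window of two blocks can be read as a row of E or as minus a column of
    E'; no intermediate block contributes. *)
Lemma E'_adj r i j : (blk j = (blk i).+1)%N -> E' r i j = - E r i j.
Proof.
move=> ij; rewrite -(tbE_rowE r (ltnSn (blk i)) (erefl _)) ?ij ?ltnSn ?leqnn //.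
by rewrite (tbE_colE r (leqnn _)) ?opprK ?leqnn.
Qed.

Lemma tbF_colE lo hi r i j : (lo < hi)%N -> blk j = lo -> (lo < blk i <= hi)%N ->
  tbF bprj F F' lo lo hi r i j = F r i j.
Proof.
move=> lh jl ih; have -> : tbF bprj F F' lo lo hi = bprj (itv lo.+1 hi) * F * e_ lo.
  by eapply tbF_col; try win_hyps.
by rewrite prj_prj /itv /= jl eqxx ih.
Qed.

Lemma win'_D a : win' bprj F' D' E' a a = D' * e_ a.
Proof.
rewrite /win' prj_itv1 dF' dE' prj_D' -mulrA; congr (D' * _).
by rewrite prjM; apply: eq_prj => b /=; rewrite andbb.
Qed.

Lemma mmD (x y : 'M['M[Y]_N]_N) i j h k : (x + y) i j h k = x i j h k + y i j h k.
Proof. by rewrite !mxE. Qed.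
Lemma mm0 i j h k : (0 : 'M['M[Y]_N]_N) i j h k = 0.
Proof. by rewrite !mxE. Qed.
Lemma mm_sum (I : finType) (f : I -> 'M['M[Y]_N]_N) i j h k :
  (\sum_t f t) i j h k = \sum_t f t i j h k.
Proof. by rewrite !summxE. Qed.
Lemma fps2B (x y : fps (fps 'M['M[Y]_N]_N)) n m : (x - y) n m = x n m - y n m.
Proof. by []. Qed.
Lemma dgmE A i j : @dgm Y N blk A i j = ((i == j) && A (blk i))%:R.
Proof. by rewrite mxE; case: ifP. Qed.
Lemma fps_coef_flipl x n m : (P L * x : fps (fps _)) n m = flip Y p * x n m.
Proof. exact: flipSMl. Qed.
Lemma fps_coef_flipr x n m : (x * P L : fps (fps _)) n m = x n m * flip Y p.
Proof. exact: flipSMr. Qed.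

Lemma rel_DE i j h k r s : blk i = blk j -> blk h = blk j -> blk k = (blk j).+1 -> (0 < s)%N ->
  sc (par i j && par h k) (D r i j) (E s h k) =
  (-1) ^+ p j * ((h == j)%:R * \sum_(t < r) (D t * E (r + s - 1 - t)%N) i k).
Proof.
move=> ij hj kj s0; set a := blk j in ij hj kj.
have lh : (a <= a < a.+1)%N by rewrite leqnn ltnSn.
have := diff_var_sum r s (comm_D_E (wtb lh)); rewrite [win _ _ _ _ _ _]win_D.
set X := tbE _ _ _ _ _ _ => /(congr1 (fun z : 'M['M[Y]_N]_N => z i j h k)).
rewrite comm_abE => /sign_moveK; rewrite colE // /X tbE_rowE ?hj ?kj ?ltnSn ?leqnn // => ->.
rewrite mm_sum !mulr_sumr; apply: eq_bigr => t _.
(* The second exponent is positive because s is; there the product of two legs in the first variable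
   has no coefficient. *)
have [u ->] : exists u, (r + s - 1 - t)%N = u.+1 by exists (r + s - 2 - t)%N; have := ltn_ord t; lia.
rewrite fps_coef_flipl a1_prj mulrBr fps2B a2a2E subr0 a2b2E flip_leg_leg2E dgmE.
rewrite mulr_sign2; have [->|nhj] := eqVneq h j; last by rewrite /= !mul0r !mulr0.
rewrite /itv /= ?leqnn !mul1r.
have -> : (p j && par i j) (+) (p i && p j) = p j by case: (p i); case: (p j).
congr (_ * _); rewrite !mxE; apply: eq_bigr => l _.
case: (eqVneq (blk l) a) => [la|la]; last by rewrite prj_r (pc_D pc) ?ij 1?eq_sym // if_same !mul0r.
by rewrite colE // -/X tbE_rowE ?kj ?la ?ltnSn ?leqnn.
Qed.

Lemma rel_ED i j h k r s : blk j = (blk i).+1 -> blk h = blk j -> blk k = blk j -> (0 < r)%N ->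
  sc (par i j && par h k) (E r i j) (D s h k) =
  (-1) ^+ ((p h && par i j) (+) (p i && p j)) *
    \sum_(t < s) D t h j * E (r + s - 1 - t)%N i k.
Proof.
move=> ji hj kj r0; set a := blk i in ji.
have lh : (a <= a < a.+1)%N by rewrite leqnn ltnSn.
have := diff_var_sumr r s (comm_E_G (wtb lh)); rewrite [win _ _ _ _ a.+1 _]win_D.
set X := tbE _ _ _ _ _ _ => /(congr1 (fun z : 'M['M[Y]_N]_N => z i j h k)).
rewrite comm_abE => /sign_moveK; rewrite colE ?kj // /X tbE_rowE ?ji ?ltnSn ?leqnn // => ->.
rewrite mmNE mm_sum -sumrN !mulr_sumr; apply: eq_bigr => t _.
have [u ->] : exists u, (r + s - 1 - t)%N = u.+1 by exists (r + s - 2 - t)%N; have := ltn_ord t; lia.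
rewrite fps_coef_flipl mulrBr fps2B b1b2E sub0r b1a2E [flip Y p * - _]mulrN mmNE opprK flip_leg_leg2E.
by rewrite mulr_sign2 colE // -/X tbE_rowE ?kj ?ji ?ltnSn ?leqnn.
Qed.

Lemma rel_EF i j h k r s : blk j = (blk i).+1 -> blk h = blk j -> blk k = blk i ->
  (0 < r)%N -> (0 < s)%N ->
  sc (par i j && par h k) (E r i j) (F s h k) =
  - ((-1) ^+ ((p h && p k) (+) (p j && p k) (+) (p h && p j)) *
    \sum_(t < r + s) D' (r + s - 1 - t)%N i k * D t h j).
Proof.
move=> ji hj ki r0 s0; set a := blk i in ji ki.
have lh : (a <= a < a.+1)%N by rewrite leqnn ltnSn.
have := diff_var_sum r s (comm_E_F (wtb lh)).
rewrite [win _ _ _ _ a.+1 _]win_D [win' _ _ _ _ a _]win'_D.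
set X := tbE _ _ _ _ _ _; set X' := tbF _ _ _ _ _ _ => /(congr1 (fun z : 'M['M[Y]_N]_N => z i j h k)).
rewrite comm_abE => /sign_moveK; rewrite /X tbE_rowE ?ji ?ltnSn ?leqnn //.
rewrite /X' tbF_colE ?hj ?ji ?ltnSn ?leqnn // => ->.
(* Each product on the right lives in one variable, so only t = 0 survives; it contributes the
   complete convolution of D' with D. *)
rewrite mm_sum -[RHS]mulrN; case: r r0 => // r _; rewrite big_ord_recl big1 ?addr0 => [|t _]; last first.
  have [u ->] : exists u, (r.+1 + s - 1 - lift ord0 t)%N = u.+1.
    by exists (r.+1 + s - 2 - lift ord0 t)%N; rewrite lift0; have := ltn_ord t; lia.
  by rewrite fps2B fps_coef_flipl b1b2E mulr0 subr0 [a1 L _ * _]mulrA fps_coef_flipr a1a2E mul0r mm0.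
have [u eu] : exists u, (r.+1 + s - 1 - @ord0 r)%N = u.+1 by exists (r + s - 1)%N; rewrite /=; lia.
have e2 : (r.+1 + s = u.+2)%N by move: eu; rewrite /= subn0; lia.
rewrite eu e2 fps2B fps_coef_flipl [a1 L _ * _]mulrA fps_coef_flipr a1a2E mul0r sub0r mmNE.
rewrite b1b2E0 mulr_sumr mm_sum -!sumrN !mulr_sumr; apply: eq_bigr => t _.
rewrite flip_leg_leg2E colE // colE // mulrN mulr_sign2 mulrN; congr (- _).
have D'D u1 u2 : sc (par i k && par h j) (D' u1 i k) (D u2 h j) = 0.
  rewrite -(colE i u1 D' ki) -(colE h u2 D ji); apply: cm_sc.
  by eapply cm_D_invl; try exact: (wDD (ltnSn a)); try win_hyps.
have -> : D t h j * D' (u.+1 - t)%N i k = (-1) ^+ (par i k && par h j) * (D' (u.+1 - t)%N i k * D t h j).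
  have /eqP := D'D (u.+1 - t)%N t; rewrite subr_eq0 => /eqP ->.
  by rewrite mulr_sign2 addbb mul1r.
have -> : (u.+2 - 1 - t = u.+1 - t)%N by lia.
rewrite mulr_sign2; congr ((-1) ^+ _ * _); congr nat_of_bool.
by case: (p h); case: (p i); case: (p j); case: (p k).
Qed.

(** Valid for the coarse factor Z of any two-group window; specialized below to a row of E and to a
    column of E'. *)
Lemma rel_EE_gen w x y X X' C C' G G' Z H : two_block L w x y X X' C C' G G' Z H -> Z 0%N = 0 ->
  forall i j h k r s, (0 < r)%N -> (0 < s)%N ->
  sc (par i j && par h k) (Z r i j) (Z s h k) =
  (-1) ^+ ((p h && p j) (+) (p h && p k) (+) (p j && p k)) *
  (\sum_(1 <= t < s) Z (r + s - 1 - t)%N i k * Z t h j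
   - \sum_(1 <= t < r) Z (r + s - 1 - t)%N i k * Z t h j).
Proof.
move=> TB Z0 i j h k r s r0 s0.
have E0 m : coef L 0 m (a1 L Z * b2 L Z - b2 L Z * a1 L Z) = 0.
  by rewrite /= /fps_coef fps2B a1b2E b2a1E Z0 !raddf0 mul0r mulr0 subr0.
have EE0 n m : coef L n.+1 m (b1 L Z * b2 L Z - b2 L Z * b1 L Z) = 0.
  by rewrite /= /fps_coef fps2B b1b2E b2b1E subr0.
have := diff_var_sum r s (comm_E_E TB E0 EE0).
move=> /(congr1 (fun z : 'M['M[Y]_N]_N => z i j h k)); rewrite comm_abE => /sign_moveK ->.
pose V t u := leg1 p (Z t) * leg2 (Z u) : 'M['M[Y]_N]_N.
have WE t u : ((b1 L Z - a1 L Z) * (b2 L Z - a2 L Z) * P L : fps (fps _)) t u.+1 =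
    ((if t == 0%N then \sum_(v < u.+2) V v (u.+1 - v)%N else 0) - V u.+1 t - V t u.+1) * flip Y p.
  rewrite fps_coef_flipr mulrBl !mulrBr; congr (_ * _).
  rewrite 3!fps2B a1b2E a1a2E b1a2E subr0; congr (_ - _ - _).
  by case: t => [|t]; rewrite ?b1b2E0 ?b1b2E.
have flipV t u : (V t u * flip Y p) i j h k =
    (-1) ^+ (p h && (p i (+) p k) (+) p j && p k) * (Z t i k * Z u h j).
  by rewrite leg_leg2_flipE.
set n := (r + s - 1)%N; pose Q t := (V t (n - t)%N * flip Y p) i j h k.
have VQ t u : (t + u = n)%N -> (V t u * flip Y p) i j h k = Q t.
  by move=> tu; rewrite /Q; congr ((V _ _ * _) _ _ _ _); lia.
have Q0 : Q 0%N = 0 by rewrite /Q /V Z0 raddf0 !mul0r mm0.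
have Qn : Q n = 0 by rewrite /Q /V subnn Z0 raddf0 mulr0 mul0r mm0.
(* The coefficient t = 0 contributes a full convolution. Splitting it at r and reflecting t to n - t
   cancels one of the two sums, and the missing exponent 0 of Z removes the end terms. *)
rewrite mm_sum; have -> : \sum_(t < r) ((b1 L Z - a1 L Z) * (b2 L Z - a2 L Z) * P L : fps (fps _)) t (n - t)%N i j h k
   = \sum_(t < n.+1) Q t - \sum_(t < r) (Q (n - t)%N + Q t).
  rewrite (eq_bigr (fun t : 'I_r => (if t == 0%N :> nat then \sum_(t < n.+1) Q t else 0) - (Q (n - t)%N + Q t))).
    rewrite sumrB; congr (_ - _); move: (\sum_(_ < n.+1) _) => q; clear -r0.
    by case: (r) r0 => // r' _; rewrite big_ord_recl big1 ?addr0.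
  move=> t _; have [u eu] : exists u, (n - t)%N = u.+1.
    by exists (n - t).-1; rewrite prednK // /n; have := ltn_ord t; lia.
  rewrite eu WE !mulrBl !mmBE !VQ; try by rewrite -eu; have := ltn_ord t; lia.
  rewrite -addrA -opprD; congr (_ - _).
  case: eqP => [t0|]; last by rewrite mul0r mm0.
  rewrite mulr_suml mm_sum; have -> : u.+2 = n.+1 by rewrite -eu t0 subn0.
  by apply: eq_bigr => v _; rewrite VQ //; have := ltn_ord v; lia.
have -> : \sum_(t < n.+1) Q t = \sum_(t < r) Q t + \sum_(t < s) Q (n - t)%N.
  rewrite -(big_mkord xpredT Q) (@big_cat_nat _ _ _ r) //=; last by rewrite /n; lia.
  rewrite big_mkord; congr (_ + _); rewrite big_nat_rev /= -{1}[r]add0n big_addn big_mkord.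
  have -> : (n.+1 - r = s)%N by rewrite /n; lia.
  by apply: eq_bigr => t _; congr Q; have := ltn_ord t; rewrite /n; lia.
rewrite big_split /= opprD addrA; set q1 := \sum_(t < r) Q t; set q2 := \sum_(t < r) Q _.
set q3 := \sum_(t < s) _; have -> : q1 + q3 - q2 - q1 = q3 - q2.
  by rewrite addrAC [q1 + _]addrC addrK.
have sumQ m : (0 < m)%N -> \sum_(t < m) Q (n - t)%N = \sum_(1 <= t < m) Q (n - t)%N.
  by move=> m0; rewrite -(big_mkord xpredT (fun t => Q (n - t)%N)) big_ltn // subn0 Qn add0r.
rewrite /q3 /q2 !sumQ // !mulrBr !mulr_sumr; congr (_ - _); apply: eq_big_nat => t /andP[t0 lt];
  rewrite /Q flipV mulr_sign2; congr (_ * (Z _ _ _ * Z _ _ _));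
  try (by move: lt; rewrite /n; lia); congr ((-1) ^+ _); congr nat_of_bool;
  by case: (p i); case: (p j); case: (p h); case: (p k).
Qed.

Lemma scNr b (x y : Y) : sc b x (- y) = - sc b x y.
Proof. by rewrite /sc mulrN mulNr mulrN opprK opprB addrC. Qed.
Lemma scNl b (x y : Y) : sc b (- x) y = - sc b x y.
Proof. by rewrite /sc mulrN mulNr mulrN opprK opprB addrC. Qed.

Lemma rel_EE_row i j h k r s : blk h = blk i -> (blk i < blk j)%N -> (blk i < blk k)%N ->
  (0 < r)%N -> (0 < s)%N ->
  sc (par i j && par h k) (E r i j) (E s h k) =
  (-1) ^+ ((p h && p j) (+) (p h && p k) (+) (p j && p k)) *
  (\sum_(1 <= t < s) E (r + s - 1 - t)%N i k * E t h j
   - \sum_(1 <= t < r) E (r + s - 1 - t)%N i k * E t h j).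
Proof.
move=> hi ij ik r0 s0; set a := blk i in hi ij ik; set b := maxn (blk j) (blk k).
have ab : (a < b)%N by rewrite leq_max ij.
have lh : (a <= a < b)%N by rewrite leqnn.
have ejE t l m : blk l = a -> (a < blk m <= b)%N -> tbE bprj E E' a a b t l m = E t l m.
  by move=> la mb; rewrite tbE_rowE.
have jb : (a < blk j <= b)%N by rewrite ij leq_maxl.
have kb : (a < blk k <= b)%N by rewrite ik leq_maxr.
have Z0 : tbE bprj E E' a a b 0%N = 0.
  rewrite (@tbE_row _ bprj (@eq_prj _ _ blk) E E' dE' a a b) //; apply/matrixP => l m.
  rewrite prj_prj mxE (pc_E0 pc) mxE; case: ifP => // /andP[/eqP la /andP[am _]].
  by have [e|//] := eqVneq l m; move: am; rewrite -e la ltnn.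
have := rel_EE_gen (wtb lh) Z0 i j h k r0 s0; rewrite !ejE // => ->.
by congr (_ * (_ - _)); apply: eq_bigr => t _; rewrite !ejE.
Qed.

Lemma rel_EE_col i j h k r s : blk k = blk j -> (blk i < blk j)%N -> (blk h < blk j)%N ->
  (0 < r)%N -> (0 < s)%N ->
  sc (par i j && par h k) (E' r i j) (E' s h k) =
  (-1) ^+ ((p h && p j) (+) (p h && p k) (+) (p j && p k)) *
  (\sum_(1 <= t < s) E' (r + s - 1 - t)%N i k * E' t h j
   - \sum_(1 <= t < r) E' (r + s - 1 - t)%N i k * E' t h j).
Proof.
move=> kj ij hj r0 s0; set a := minn (blk i) (blk h); have [b jb] : exists b, blk j = b.+1.
  by exists (blk j).-1; lia.
have lh : (a <= b < b.+1)%N by rewrite /a; lia.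
have ab : (a <= b)%N by rewrite /a; lia.
have ejE t l m : (a <= blk l <= b)%N -> blk m = b.+1 -> tbE bprj E E' a b b.+1 t l m = - E' t l m.
  by move=> la mb; rewrite tbE_colE.
have ib : (a <= blk i <= b)%N by rewrite /a; lia.
have hb : (a <= blk h <= b)%N by rewrite /a; lia.
have Z0 : tbE bprj E E' a b b.+1 0%N = 0.
  have -> : tbE bprj E E' a b b.+1 = - (bprj (itv a b) * E' * e_ b.+1) by eapply tbE_col; try win_hyps.
  apply/matrixP => l m; rewrite fps_oppE prj_prj mxE.
  have -> : E' 0%N = 1 by have := congr1 (@^~ 0%N) EE'; rewrite fps_mul0E (pc_E0 pc) mul1r.
  case: ifP => [/andP[/andP[_ lb] /eqP mb]|_]; last by rewrite oppr0.
  by rewrite mxE; have [e|] := eqVneq l m; [move: lb; rewrite e mb ltnn | rewrite oppr0].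
have := rel_EE_gen (wtb lh) Z0 i j h k r0 s0; rewrite !ejE ?kj // scNl scNr opprK => ->.
by congr (_ * (_ - _)); apply: eq_bigr => t _; rewrite !ejE ?kj // mulrNN.
Qed.

(** At exponent 0 both E and E' are the identity, so the border cases r = 1 and s = 1 produce
    entries of E and E' two blocks apart. These start the inductions for the Serre and the quartic
    relations. *)
Lemma rel_mid i j h k r s : blk j = (blk i).+1 -> blk h = blk j -> blk k = (blk j).+1 ->
  let Z r s := sc (par i j && par h k) (E r i j) (E s h k) in
  [/\ (0 < r)%N -> (0 < s)%N ->
        Z r.+1 s - Z r s.+1 = (-1) ^+ p j * ((h == j)%:R * \sum_(l | blk l == blk j) E r i l * E s l k),
      (0 < r)%N -> Z r 1%N = (-1) ^+ p j * ((h == j)%:R * E r i k),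
      (0 < s)%N -> Z 1%N s = - ((-1) ^+ p j * ((h == j)%:R * E' s i k))
    & h != j -> Z r s = 0].
Proof.
move=> ji hj kj; set a := blk i in ji; set m := blk j in ji hj kj; set b := blk k in kj.
have lh : (a < m < b)%N by rewrite kj ji !ltnSn.
have e := wmid lh; case: (diff_varE2 e) => Z0 Z0' ZS.
set Z := fun r s => sc _ _ _; pose g := (-1) ^+ (p h && par i j) : Y.
pose Q r s := \sum_l (e_ a * E * bprj (itv a b)) r i l * (bprj (itv a b) * E' * e_ b) s l k.
have ZE r' s' : (a1 L (e_ a * E * e_ m) * b2 L (e_ m * E' * e_ b)
       - b2 L (e_ m * E' * e_ b) * a1 L (e_ a * E * e_ m)) r' s' i j h k = - (g * Z r' s').
  rewrite comm_abE rcE // rcE // E'_adj ?hj ?kj // scNr mulrN; congr (- (_ * sc _ _ _)).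
have WE r' s' : (P L * (a1 L (e_ m) * (a2 L (e_ a * E * bprj (itv a b)) * b2 L (bprj (itv a b) * E' * e_ b))))
   r' s' i j h k = (-1) ^+ (p i && p j) * ((h == j)%:R * Q r' s').
  rewrite fps_coef_flipl a1_prj a2b2E flip_leg_leg2E dgmE /= hj eqxx andbT; congr (_ * (_ * _)).
  by rewrite mxE.
have sgn (x : Y) : (-1) ^+ (p h && par i j) * ((-1) ^+ (p i && p j) * ((h == j)%:R * x))
    = (-1) ^+ p j * ((h == j)%:R * x).
  rewrite mulr_sign2; have [->|_] := eqVneq h j; last by rewrite !mul0r !mulr0.
  by congr ((-1) ^+ _ * _); congr nat_of_bool; case: (p i); case: (p j).
have gK (x y : Y) : g * x = y -> x = g * y by apply: sign_moveK.
have Q1 r' s' : (0 < r')%N -> (0 < s')%N -> Q r' s' = - \sum_(l | blk l == m) E r' i l * E s' l k.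
  move=> r0 s0; rewrite -sumrN [RHS]big_mkcond; apply: eq_bigr => l _.
  rewrite !prj_prj /= !eqxx /= andbT /itv; case: (eqVneq (blk l) m) => [lm|lm].
    have -> : (a <= blk l <= b)%N by rewrite lm; lia.
    by rewrite E'_adj ?mulrN ?lm.
  case: (boolP (a <= blk l <= b)%N) => [ib|_]; last by rewrite mul0r.
  have [e1|e1] := eqVneq (blk l) a.
    rewrite (_ : E r' i l = 0) ?mul0r // (pc_E pc) /= ?e1 ?ltnn //.
    by rewrite (gtn_eqF r0).
  rewrite (_ : E' s' l k = 0) ?mulr0 ?if_same // uE' ?(gtn_eqF s0) //=.
  by rewrite -leqNgt -/b; lia.
have Qr0 r' : (0 < r')%N -> Q r' 0%N = E r' i k.
  move=> r0; rewrite /Q (bigD1 k) //= big1 ?addr0 => [|l lk].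
    rewrite !prj_prj /= /itv !eqxx -/b leqnn andbT.
    have -> : (a <= b)%N by lia.
    by rewrite [E' 0%N](_ : _ = 1) ?mxE ?eqxx ?mulr1 // -[RHS](congr1 (@^~ 0%N) EE') fps_mul0E (pc_E0 pc) mul1r.
  rewrite !prj_prj [E' 0%N](_ : _ = 1) ?mxE ?(negPf lk) ?if_same ?mulr0 //.
  by rewrite -[RHS](congr1 (@^~ 0%N) EE') fps_mul0E (pc_E0 pc) mul1r.
have Q0s s' : Q 0%N s' = E' s' i k.
  rewrite /Q (bigD1 i) //= big1 ?addr0 => [|l li].
    rewrite !prj_prj /= /itv !eqxx -/a leqnn andbT /=.
    have -> : (a <= b)%N by lia.
    by rewrite (pc_E0 pc) mxE eqxx mul1r.
  by rewrite !prj_prj (pc_E0 pc) mxE eq_sym (negPf li) if_same mul0r.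
have ZSe r' s' : - (g * Z r'.+1 s') = - (g * Z r' s'.+1) + (-1) ^+ (p i && p j) * ((h == j)%:R * Q r' s').
  by rewrite -!ZE -WE -mmD ZS.
have Z0e s' : - (g * Z 0%N s') = 0 by rewrite -ZE Z0 mm0.
have Z0e' r' : - (g * Z r' 0%N) = 0 by rewrite -ZE Z0' mm0.
have g0 x : g * x = 0 -> x = 0 by move=> /gK ->; rewrite mulr0.
have key (u v w : Y) : - (g * u) = - (g * v) + (-1) ^+ (p i && p j) * ((h == j)%:R * w) ->
    u - v = - ((-1) ^+ p j * ((h == j)%:R * w)).
  move=> e'; rewrite -sgn -[RHS]mulrN; apply: gK.
  by rewrite mulrBr -[g * u]opprK e' opprD opprK addrAC subrr add0r.
split=> [r0 s0|r0|s0|nhj].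
- by rewrite (key _ _ _ (ZSe r s)) Q1 // !mulrN opprK.
- have := key _ _ _ (ZSe r 0%N); rewrite (g0 (Z r.+1 0%N)) ?Qr0 // => [/eqP|]; last first.
    by apply/eqP; rewrite -oppr_eq0; apply/eqP.
  by rewrite sub0r eqr_opp => /eqP.
- have := key _ _ _ (ZSe 0%N s); rewrite (g0 (Z 0%N s.+1)) ?Q0s // ?subr0 //.
  by apply/eqP; rewrite -oppr_eq0; apply/eqP.
- elim: r s => [|r IH] s; first by apply: g0; apply/eqP; rewrite -oppr_eq0; apply/eqP.
  by rewrite -[LHS]subr0 -(IH s.+1) (key _ _ _ (ZSe r s)) (negPf nhj) mul0r mulr0 oppr0.
Qed.

Lemma rel_far i j h k r s : blk j = (blk i).+1 -> blk k = (blk h).+1 ->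
  (blk j < blk h)%N || (blk k < blk i)%N ->
  sc (par i j && par h k) (E r i j) (E s h k) = 0.
Proof.
move=> ji kh; wlog jh : i j h k r s ji kh / (blk j < blk h)%N.
  move=> H /orP[jh|ki]; first by apply: H => //; rewrite jh.
  by rewrite scC andbC H ?mulr0 ?oppr0 // ki.
move=> _; rewrite -[E s h k]opprK -E'_adj // scNr.
rewrite -(rcE r E (erefl (blk i)) (erefl (blk j))) -(rcE s E' (erefl (blk h)) (erefl (blk k))).
by rewrite cm_sc ?oppr0 //; apply: wEE; lia.
Qed.

(** Two interlacing entries, E from block a to a + 2 and E' from a + 1 to a + 3, inside one window:
    the inner ends lie in different blocks, so the cut has no overlap. *)
Lemma rel_quartic i j h k r s : blk j = (blk i).+2 -> blk h = (blk i).+1 -> blk k = (blk h).+2 ->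
  sc (par i j && par h k) (E r i j) (E' s h k) = 0.
Proof.
move=> ji hi kh.
rewrite -(rcE r E (erefl (blk i)) (erefl (blk j))) -(rcE s E' (erefl (blk h)) (erefl (blk k))).
by rewrite cm_sc //; apply: wEE; lia.
Qed.

Lemma F'_adj r i j : (blk i = (blk j).+1)%N -> F' r i j = - F r i j.
Proof.
move=> ij; rewrite -(@tbF_colE (blk j) (blk i) r i j) ?ij ?ltnSn ?leqnn //.
have lmh : (blk j <= blk j < (blk j).+1)%N by rewrite leqnn ltnSn.
have -> : tbF bprj F F' (blk j) (blk j) (blk j).+1 = - (e_ (blk j).+1 * F' * bprj (itv (blk j) (blk j))).
  by eapply tbF_row; try win_hyps.
by rewrite fps_oppE opprK prj_prj /itv /= ij eqxx leqnn.
Qed.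

Lemma rel_EF_far i j h k r s : blk j = (blk i).+1 -> blk h = (blk k).+1 -> (blk i < blk k)%N ->
  sc (par i j && par h k) (E r i j) (F s h k) = 0.
Proof.
move=> ji hk ik; rewrite -[F s h k]opprK -F'_adj // scNr.
rewrite -(rcE r E (erefl (blk i)) (erefl (blk j))) -(rcE s F' (erefl (blk h)) (erefl (blk k))).
by rewrite cm_sc ?oppr0 //; apply: wEF; lia.
Qed.

Lemma rel_DE_far i j h k r s : blk i = blk j -> blk k = (blk h).+1 -> blk i != blk h -> blk i != blk k ->
  sc (par i j && par h k) (D r i j) (E s h k) = 0.
Proof.
move=> ij kh nh nk; rewrite -(colE i r D (esym ij)).
case: (ltngtP (blk i) (blk h)) => [l|l|e].
- rewrite -[E s h k]opprK -E'_adj // scNr -(rcE s E' (erefl (blk h)) (erefl (blk k))).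
  by rewrite cm_sc ?oppr0 //; apply: wDE; lia.
- rewrite -(rcE s E (erefl (blk h)) (erefl (blk k))) scC andbC cm_sc ?mulr0 ?oppr0 //.
  by apply: wED; lia.
- by rewrite e eqxx in nh.
Qed.

End Facts.
End Pencil.

(** * The super bracket; Serre and quartic relations *)

Section Bracket.
Variable Y : pzRingType.
Implicit Types x y z : Y.

(* a and b are the parities of x and y. *)
Definition br (a b : bool) x y : Y := locked (sc (a && b) x y).
Lemma brE a b x y : br a b x y = sc (a && b) x y. Proof. by rewrite /br -lock. Qed.

Ltac booleans := repeat match goal with b : bool |- _ => case: b end.

Lemma br_jacobi a b c x y z : br a (b (+) c) x (br b c y z) =
  br (a (+) b) c (br a b x y) z + (-1) ^+ (a && b) * br b (a (+) c) y (br a c x z).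
Proof. by rewrite !brE /sc; case: a b c => [] [] []; rewrite /= ?expr0 ?expr1; ncring. Qed.

Lemma br_mulr a b c x y z : br a (b (+) c) x (y * z) =
  br a b x y * z + (-1) ^+ (a && b) * (y * br a c x z).
Proof. by rewrite !brE /sc; case: a b c => [] [] []; rewrite /= ?expr0 ?expr1; ncring. Qed.
Lemma br_mull a b c x y z : br (a (+) b) c (x * y) z =
  x * br b c y z + (-1) ^+ (b && c) * (br a c x z * y).
Proof. by rewrite !brE /sc; case: a b c => [] [] []; rewrite /= ?expr0 ?expr1; ncring. Qed.
Lemma brC a b x y : br a b x y = - ((-1) ^+ (a && b) * br b a y x).
Proof. by rewrite !brE andbC -scC. Qed.
Lemma brDr a b x y z : br a b x (y + z) = br a b x y + br a b x z.
Proof. by rewrite !brE /sc; case: a b => [] []; rewrite /= ?expr0 ?expr1; ncring. Qed.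
Lemma brDl a b x y z : br a b (x + y) z = br a b x z + br a b y z.
Proof. by rewrite !brE /sc; case: a b => [] []; rewrite /= ?expr0 ?expr1; ncring. Qed.
Lemma br0r a b x : br a b x 0 = 0. Proof. by rewrite !brE /sc mul0r !mulr0 subrr. Qed.
Lemma br0l a b x : br a b 0 x = 0. Proof. by rewrite !brE /sc mul0r !mulr0 subrr. Qed.
Lemma brNr a b x y : br a b x (- y) = - br a b x y. Proof. by rewrite !brE scNr. Qed.
Lemma brNl a b x y : br a b (- x) y = - br a b x y. Proof. by rewrite !brE scNl. Qed.
Lemma br_sumr I (s : seq I) (Q : pred I) (f : I -> Y) a b x :
  br a b x (\sum_(i <- s | Q i) f i) = \sum_(i <- s | Q i) br a b x (f i).
Proof. by apply: (big_morph _ (brDr a b x) (br0r a b x)). Qed.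
Lemma br_suml I (s : seq I) (Q : pred I) (f : I -> Y) a b x :
  br a b (\sum_(i <- s | Q i) f i) x = \sum_(i <- s | Q i) br a b (f i) x.
Proof. by apply: (big_morph (fun y => br a b y x)) => [y z|]; rewrite ?brDl ?br0l. Qed.
Lemma br_signr a b (c : bool) x y : br a b x ((-1) ^+ c * y) = (-1) ^+ c * br a b x y.
Proof. by case: c; rewrite ?mul1r ?mulN1r ?brNr. Qed.
Lemma br_signl a b (c : bool) x y : br a b ((-1) ^+ c * x) y = (-1) ^+ c * br a b x y.
Proof. by case: c; rewrite ?mul1r ?mulN1r ?brNl. Qed.
Lemma br_natr a b (c : bool) x y : br a b x (c%:R * y) = c%:R * br a b x y.
Proof. by case: c; rewrite ?mul1r ?mul0r ?br0r. Qed.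
(* Moving x through [p, [x, q]] = [[p, x], q] in both forms gives opposite signs. *)
Lemma quartic_twice a b x y z : br a b y z = 0 -> br false b x (br false b x z) = 0 ->
  br false a x (br false a x y) = 0 ->
  br a b (br a false y x) (br false b x z) + br a b (br a false y x) (br false b x z) = 0.
Proof.
set u := br a false y x; set v := br false b x z => yz xv xxy.
have xy : br false a x y = - u by rewrite brC mul1r.
have xu : br false a x u = 0 by rewrite -[u]opprK -xy brNr xxy oppr0.
have J1 : br a b y v = br a b u z.
  by have := br_jacobi a false b y x z; rewrite addbF addFb andbF yz br0r mulr0 addr0.
have := br_jacobi false a b x y v; rewrite addFb xv br0r mulr0 addr0 xy brNl J1.
by rewrite br_jacobi addFb xu br0l add0r mul1r => /eqP; rewrite -addr_eq0 => /eqP.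
Qed.

End Bracket.

Lemma sum_one (V : nmodType) (I : finType) (Q : pred I) (f : I -> V) i :
  Q i -> (forall m, Q m -> m != i -> f m = 0) -> \sum_(m | Q m) f m = f i.
Proof.
by move=> Qi f0; rewrite (bigD1 i) //= big1 ?addr0 // => m /andP[]; apply: f0.
Qed.

Section Relations.
Variables (Y : pzRingType) (N : nat) (p : 'I_N -> bool) (blk : 'I_N -> nat).
Hypothesis two_tf : forall y : Y, y + y = 0 -> y = 0.
Local Notation par i j := (p i (+) p j).
Variables T F D D' E F' E' : fps 'M[Y]_N.
Hypothesis pc : pencil p blk T F D D' E.
Hypotheses (FF' : F * F' = 1) (F'F : F' * F = 1) (EE' : E * E' = 1) (E'E : E' * E = 1).

(** The symmetrized double bracket of (R13); the primed arguments carry the exchanged exponents. *)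
Definition nest (a1 a2 c : bool) (x1 x1' x2 x2' y : Y) :=
  br a1 (a2 (+) c) x1 (br a2 c x2 y) + br a1 (a2 (+) c) x1' (br a2 c x2' y).

Lemma nestD a1 a2 c (x1 x1' x2 x2' y y' : Y) :
  nest a1 a2 c x1 x1' x2 x2' (y + y') = nest a1 a2 c x1 x1' x2 x2' y + nest a1 a2 c x1 x1' x2 x2' y'.
Proof. by rewrite /nest !brDr addrACA. Qed.
Lemma nestN a1 a2 c (x1 x1' x2 x2' y : Y) :
  nest a1 a2 c x1 x1' x2 x2' (- y) = - nest a1 a2 c x1 x1' x2 x2' y.
Proof. by rewrite /nest !brNr opprD. Qed.
Lemma nest_sign a1 a2 c (b : bool) (x1 x1' x2 x2' y : Y) :
  nest a1 a2 c x1 x1' x2 x2' ((-1) ^+ b * y) = (-1) ^+ b * nest a1 a2 c x1 x1' x2 x2' y.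
Proof. by case: b; rewrite ?mul1r // !mulN1r nestN. Qed.
Lemma sign_eq0 (b : bool) (y : Y) : 0 = (-1) ^+ b * y -> y = 0.
Proof. by case: b; rewrite ?mul1r // mulN1r => /esym/eqP; rewrite oppr_eq0 => /eqP. Qed.
Lemma nest0 a1 a2 c (x1 x1' x2 x2' : Y) : nest a1 a2 c x1 x1' x2 x2' 0 = 0.
Proof. by rewrite /nest !br0r addr0. Qed.

(** A factor d commuting with all four outer arguments can be pulled out. Together with the relation
    between D and E this raises the exponent of y. *)
Lemma nest_Ml a1 a2 b c (x1 x1' x2 x2' d y : Y) :
  br a1 b x1 d = 0 -> br a1 b x1' d = 0 -> br a2 b x2 d = 0 -> br a2 b x2' d = 0 ->
  nest a1 a2 c x1 x1' x2 x2' y = 0 -> nest a1 a2 (b (+) c) x1 x1' x2 x2' (d * y) = 0.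
Proof.
move=> h1 h1' h2 h2' n0.
rewrite /nest !br_mulr h2 h2' !mul0r !add0r !br_signr addbCA !br_mulr h1 h1' !mul0r !add0r.
by rewrite -!mulrDr -/(nest _ _ _ _ _ _ _ _) n0 !mulr0.
Qed.
Lemma nest_Mr a1 a2 c (x1 x1' x2 x2' d y : Y) :
  br a1 false x1 d = 0 -> br a1 false x1' d = 0 -> br a2 false x2 d = 0 -> br a2 false x2' d = 0 ->
  nest a1 a2 c x1 x1' x2 x2' y = 0 -> nest a1 a2 c x1 x1' x2 x2' (y * d) = 0.
Proof.
move=> h1 h1' h2 h2' n0; rewrite -[c]addbF.
rewrite /nest !br_mulr h2 h2' !mulr0 !addr0 addbA !br_mulr h1 h1' !mulr0 !addr0.
by rewrite -mulrDl -/(nest _ _ _ _ _ _ _ _) n0 mul0r.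
Qed.

Lemma D0E i j : D 0%N i j = (i == j)%:R.
Proof. by rewrite (pc_D0 pc) mxE. Qed.

Lemma br_row_asym i j h k r s : blk h = blk i -> (blk i < blk j)%N -> (blk i < blk k)%N ->
  (0 < r)%N -> (0 < s)%N ->
  br (par i j) (par h k) (E r i j) (E s h k) + br (par i j) (par h k) (E s i j) (E r h k) = 0.
Proof.
move=> hi ij ik r0 s0; rewrite !brE !(rel_EE_row pc FF' F'F EE' E'E) // (addnC s r).
by rewrite -mulrDr [X in _ * X]addrC addrA subrK subrr mulr0.
Qed.
Lemma br_col_asym i j h k r s : blk k = blk j -> (blk i < blk j)%N -> (blk h < blk j)%N ->
  (0 < r)%N -> (0 < s)%N ->
  br (par i j) (par h k) (E' r i j) (E' s h k) + br (par i j) (par h k) (E' s i j) (E' r h k) = 0.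
Proof.
move=> kj ij hj r0 s0; rewrite !brE !(rel_EE_col pc FF' F'F EE' E'E) // (addnC s r).
by rewrite -mulrDr [X in _ * X]addrC addrA subrK subrr mulr0.
Qed.

Lemma br_E_D_far i j f g r s : blk j = (blk i).+1 -> blk f = blk g -> blk f != blk i -> blk f != blk j ->
  br (par i j) (par f g) (E r i j) (D s f g) = 0.
Proof.
move=> ji fg fi fj; rewrite brC brE (rel_DE_far pc FF' F'F EE' E'E) ?mulr0 ?oppr0 //.
Qed.

(** Induction on the exponent t of the neighbouring factor. At t = 1 the inner bracket is an entry
    of E two blocks long, and the claim is the antisymmetry of the relation within a row. The step
    brackets with $D^{(2)}_{g,g}$, which sits in a block commuting with the other factors and raises
    t by one. *)
Lemma serre_hi i j h k f g r s t : blk j = (blk i).+1 -> blk h = blk i -> blk k = blk j ->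
  blk f = blk j -> blk g = (blk f).+1 -> (0 < r)%N -> (0 < s)%N -> (0 < t)%N ->
  nest (par i j) (par h k) (par f g) (E r i j) (E s i j) (E s h k) (E r h k) (E t f g) = 0.
Proof.
move=> ji hi kj fj gf r0 s0; elim: t => // -[|t] IH _.
  have e u : (0 < u)%N -> br (par h k) (par f g) (E u h k) (E 1%N f g) =
      (-1) ^+ p k * ((f == k)%:R * E u h g).
    move=> u0; have kh : blk k = (blk h).+1 by rewrite kj hi.
    have fk : blk f = blk k by rewrite fj kj.
    have gk : blk g = (blk k).+1 by rewrite gf fj kj.
    by case: (rel_mid pc FF' F'F EE' E'E u 1%N kh fk gk) => _ e _ _; rewrite brE e.
  rewrite /nest !e // !br_signr !br_natr -!mulrDr; have [fk|_] := eqVneq f k; last by rewrite mul0r mulr0.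
  have -> : par h k (+) par f g = par h g by rewrite fk; case: (p h); case: (p k); case: (p g).
  by rewrite br_row_asym ?mulr0 //; lia.
have com u x y : blk y = (blk x).+1 -> blk x = blk i -> br (par x y) false (E u x y) (D 2%N g g) = 0 /\
    br (par x y) false (E u x y) (D 1%N g g) = 0.
  by move=> yx xi; split; rewrite -[false](addbb (p g)) br_E_D_far ?yx ?xi ?gf ?fj ?ji //; lia.
have /(_ isT) := @rel_ED _ _ _ _ _ _ _ _ _ _ _ pc FF' F'F EE' E'E f g g g t.+1 2%N gf erefl erefl.
rewrite addbb andbF /sc expr0 mul1r !big_ord_recl big_ord0 addr0 /= D0E eqxx mul1r.
have -> : (t.+1 + 2 - 1 - 0 = t.+2)%N by lia.
have -> : (t.+1 + 2 - 1 - bump 0 0 = t.+1)%N by rewrite /bump; lia.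
move=> /(congr1 (nest (par i j) (par h k) (par f g) (E r i j) (E s i j) (E s h k) (E r h k))).
have /(_ isT) IH' := IH; rewrite nestD nestN.
have [[i2 i1] [i2' i1']] := (com r i j ji erefl, com s i j ji erefl).
have khh : blk k = (blk h).+1 by rewrite kj hi.
have [[h2 h1] [h2' h1']] := (com s h k khh hi, com r h k khh hi).
have nl d := @nest_Ml (par i j) (par h k) false (par f g) _ _ _ _ d (E t.+1 f g).
rewrite nest_Mr // nl // subr0.
rewrite nest_sign => /sign_eq0; rewrite nestD.
by rewrite nl // addr0.
Qed.

(** Mirror image of [serre_hi]: columns of E' replace rows of E at t = 1, and $D^{(2)}_{f,f}$ raises
    the exponent. Its relation with E sums over the block of f, hence the induction is over all f in
    that block. *)
Lemma serre_lo i j h k f g r s t : blk j = (blk i).+1 -> blk h = blk i -> blk k = blk j ->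
  blk g = blk i -> blk g = (blk f).+1 -> (0 < r)%N -> (0 < s)%N -> (0 < t)%N ->
  nest (par i j) (par h k) (par f g) (E r i j) (E s i j) (E s h k) (E r h k) (E t f g) = 0.
Proof.
move=> ji hi kj gi gf r0 s0; elim: t f gf => // -[|t] IH f gf _.
  have e u : (0 < u)%N -> br (par h k) (par f g) (E u h k) (E 1%N f g) =
      (-1) ^+ (par h k && par f g (+) p g) * ((h == g)%:R * E' u f k).
    move=> u0; rewrite brC.
    have hg : blk h = blk g by rewrite hi gi.
    have kg : blk k = (blk g).+1 by rewrite kj ji gi.
    case: (rel_mid pc FF' F'F EE' E'E 1%N u gf hg kg) => _ _ e _.
    by rewrite brE e // mulrN opprK mulr_sign2.
  rewrite /nest !e // !br_signr !br_natr -!mulrDr; have [hg|_] := eqVneq h g; last by rewrite mul0r mulr0.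
  have -> : par h k (+) par f g = par f k by rewrite hg; case: (p f); case: (p k); case: (p g).
  have EE1 u : E u i j = - E' u i j by rewrite (E'_adj pc EE' E'E) ?opprK.
  by rewrite !EE1 !brNl -opprD br_col_asym ?oppr0 ?mulr0 //; lia.
have com u v x y l : blk y = (blk x).+1 -> blk x = blk i -> blk l = blk f ->
    br (par x y) (par f l) (E u x y) (D v f l) = 0.
  by move=> yx xi lf; apply: br_E_D_far => //; lia.
have /(_ isT) := @rel_DE _ _ _ _ _ _ _ _ _ _ _ pc FF' F'F EE' E'E f f f g 2%N t.+1 erefl erefl gf.
rewrite addbb andFb /sc expr0 !mul1r eqxx mul1r !big_ord_recl big_ord0 addr0 /=.
have -> : (2 + t.+1 - 1 - 0 = t.+2)%N by lia.
have -> : (2 + t.+1 - 1 - bump 0 0 = t.+1)%N by rewrite /bump; lia.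
rewrite (pc_D0 pc) mul1r [in RHS]mxE.
move=> /(congr1 (nest (par i j) (par h k) (par f g) (E r i j) (E s i j) (E s h k) (E r h k))).
have khh : blk k = (blk h).+1 by rewrite kj hi.
have sum0 u : nest (par i j) (par h k) (par f g) (E r i j) (E s i j) (E s h k) (E r h k)
    (\sum_l D u f l * E t.+1 l g) = 0.
  have /(_ isT) IH' := IH f gf.
  elim/big_rec: _ => [|l y _ Hy]; first exact: nest0.
  rewrite nestD Hy addr0; have [lf|lf] := eqVneq (blk l) (blk f); last first.
    by rewrite (pc_D pc) 1?eq_sym // mul0r nest0.
  have -> : par f g = par f l (+) par l g by case: (p f); case: (p l); case: (p g).
  by rewrite nest_Ml ?com //; apply: IH; rewrite ?lf.
rewrite nestD nestN -[in nest _ _ _ _ _ _ _ (D 2%N f f * _)](addFb (par f g)).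
have cm2 u x y : blk y = (blk x).+1 -> blk x = blk i -> br (par x y) false (E u x y) (D 2%N f f) = 0.
  by move=> yx xi; have := com u 2%N x y f yx xi erefl; rewrite addbb.
have /(_ isT) IH' := IH f gf.
rewrite nest_Ml ?cm2 // nest_Mr ?cm2 // subr0.
by rewrite nest_sign => /sign_eq0; rewrite nestD sum0 addr0.
Qed.

Lemma rel_serre i j h k f g r s t : blk j = (blk i).+1 -> blk h = blk i -> blk k = blk j ->
  blk f != blk i -> blk g = (blk f).+1 -> (0 < r)%N -> (0 < s)%N -> (0 < t)%N ->
  nest (par i j) (par h k) (par f g) (E r i j) (E s i j) (E s h k) (E r h k) (E t f g) = 0.
Proof.
move=> ji hi kj fi gf r0 s0 t0.
have [fj|fj] := eqVneq (blk f) (blk j); first exact: serre_hi.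
have [gi|gi] := eqVneq (blk g) (blk i); first exact: serre_lo.
by rewrite /nest ![br (par h k) _ _ _]brE !(rel_far pc FF' F'F EE' E'E) ?br0r ?addr0 //; try (apply/orP; lia); lia.
Qed.

Let mid {i j h k} := @rel_mid _ _ p blk _ _ _ _ _ _ _ pc FF' F'F EE' E'E i j h k.

Lemma br_mid0 i j h k r s : blk j = (blk i).+1 -> blk h = blk j -> blk k = (blk j).+1 -> h != j ->
  br (par i j) (par h k) (E r i j) (E s h k) = 0.
Proof. by move=> ji hj kj nhj; rewrite brE; case: (mid r s ji hj kj) => _ _ _ ->. Qed.

Lemma br_mid0' i j h k r s : blk j = (blk i).+1 -> blk h = blk j -> blk k = (blk j).+1 -> h != j ->
  br (par h k) (par i j) (E s h k) (E r i j) = 0.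
Proof. by move=> ji hj kj nhj; rewrite brC br_mid0 // mulr0 oppr0. Qed.

Lemma br_midS i j k r s : blk j = (blk i).+1 -> blk k = (blk j).+1 -> (0 < r)%N -> (0 < s)%N ->
  br (par i j) (par j k) (E r.+1 i j) (E s j k) = br (par i j) (par j k) (E r i j) (E s.+1 j k)
  + (-1) ^+ p j * \sum_(l | blk l == blk j) E r i l * E s l k.
Proof.
move=> ji kj r0 s0; rewrite !brE; case: (mid r s ji erefl kj) => /(_ r0 s0) /eqP e _ _ _.
by move: e; rewrite subr_eq addrC eqxx mul1r => /eqP.
Qed.

Lemma br_same i j h k t : blk j = (blk i).+1 -> blk h = blk i -> blk k = blk j -> (0 < t)%N ->
  br (par i j) (par h k) (E t i j) (E t h k) = 0.
Proof. by move=> ji hi kj t0; apply: two_tf; apply: br_row_asym => //; lia. Qed.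

Lemma br_far0 i j h k r s : blk j = (blk i).+1 -> blk h = (blk j).+1 -> blk k = (blk h).+1 ->
  br (par i j) (par h k) (E r i j) (E s h k) = 0.
Proof. by move=> ji hj kh; rewrite brE (rel_far pc FF' F'F EE' E'E) //; apply/orP; lia. Qed.

Lemma serre_same i j h k f g t u : blk j = (blk i).+1 -> blk h = blk i -> blk k = blk j ->
  blk f != blk i -> blk g = (blk f).+1 -> (0 < t)%N -> (0 < u)%N ->
  br (par i j) (par h k (+) par f g) (E t i j) (br (par h k) (par f g) (E t h k) (E u f g)) = 0.
Proof. by move=> *; apply: two_tf; apply: rel_serre. Qed.

Lemma serre_swap i j h k f g t u : blk j = (blk i).+1 -> blk h = blk i -> blk k = blk j ->
  blk f != blk i -> blk g = (blk f).+1 -> (0 < t)%N -> (0 < u)%N ->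
  br (par i j) (par h k (+) par f g) (E t.+1 i j) (br (par h k) (par f g) (E t h k) (E u f g)) =
  - br (par i j) (par h k (+) par f g) (E t i j) (br (par h k) (par f g) (E t.+1 h k) (E u f g)).
Proof.
move=> ji hi kj fi gf t0 u0; apply/eqP; rewrite -addr_eq0; apply/eqP.
exact: (@rel_serre i j h k f g t.+1 t u).
Qed.

Section Quartic.
Variables i h j k : 'I_N.
Hypotheses (hi : blk h = (blk i).+1) (jh : blk j = (blk h).+1) (kj : blk k = (blk j).+1).
Hypothesis hjN : p j = ~~ p h.
Local Notation P := (par i h).
Local Notation X := (par h j).
Local Notation Q := (par j k).
Let al r u := br P X (E r i h) (E u h j).
Let be u s := br X Q (E u h j) (E s j k).
Let W r u s := br P (X (+) Q) (E r i h) (be u s).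
Variable t : nat.
Hypothesis t0 : (0 < t)%N.
Let S s := \sum_(m | blk m == blk j) E t h m * E s m k.
Let R m r := \sum_(l | blk l == blk h) E r i l * E t l m.
Let i_h : blk i != blk h. Proof. by lia. Qed.
Let j_h : blk j != blk h. Proof. by lia. Qed.

Lemma be_S s : (0 < s)%N -> be t.+1 s = be t s.+1 + (-1) ^+ p j * S s.
Proof. by move=> s0; rewrite /be br_midS. Qed.
Lemma al_Sm m r : blk m = blk j -> (0 < r)%N -> br P (par h m) (E r i h) (E t.+1 h m) =
  br P (par h m) (E r.+1 i h) (E t h m) - (-1) ^+ p h * R m r.
Proof. by move=> mj r0; rewrite br_midS ?mj // addrK. Qed.

Lemma x_be s : (0 < s)%N -> br X (X (+) Q) (E t h j) (be t s) = 0.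
Proof. by move=> s0; rewrite /be serre_same. Qed.

(** Only m = j contributes, since for other m the bracket with the second factor vanishes. The sign
    is negative because passing the odd x past itself changes the sign. *)
Lemma x_S s : (0 < s)%N -> br X (X (+) Q) (E t h j) (S s) = - (E t h j * be t s).
Proof.
move=> s0; rewrite /S br_sumr (sum_one (i := j)) ?eqxx // => [|m /eqP mj nmj].
  rewrite br_mulr br_same // mul0r add0r andbb -/(be t s).
  transitivity ((-1) ^+ true * (E t h j * be t s)); last by rewrite mulN1r.
  by congr ((-1) ^+ nat_of_bool _ * _); rewrite hjN; case: (p h).
have -> : X (+) Q = par h m (+) par m k.
  by case: (p h); case: (p j); case: (p m); case: (p k).
by rewrite br_mulr br_same // mul0r add0r br_mid0 ?mj // !mulr0.
Qed.

Lemma x1_be s : (0 < s)%N -> br X (X (+) Q) (E t.+1 h j) (be t s) = (-1) ^+ p j * (E t h j * be t s).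
Proof.
move=> s0; rewrite [LHS]serre_swap // -/(be t.+1 s) be_S // brDr br_signr x_be // add0r x_S //.
by rewrite mulrN opprK.
Qed.

Lemma R_be r s : (0 < r)%N -> (0 < s)%N ->
  br (P (+) X) (X (+) Q) (R j r) (be t s) = (-1) ^+ (X && (X (+) Q)) * (W r t s * E t h j).
Proof.
move=> r0 s0; rewrite /R br_suml (sum_one (i := h)) ?eqxx // => [|l /eqP lh nlh].
  by rewrite br_mull x_be // mulr0 add0r.
have -> : P (+) X = par i l (+) par l j.
  by case: (p h); case: (p j); case: (p i); case: (p l).
rewrite br_mull /be serre_same ?lh // mulr0 add0r.
rewrite br_jacobi br_mid0 ?lh // 1?eq_sym // br0l add0r [br (par i l) Q _ _]br_far0 ?lh // br0r.
by rewrite !mulr0 mul0r mulr0.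
Qed.

Hypothesis IH : forall r s, (0 < r)%N -> (0 < s)%N ->
  br (P (+) X) (X (+) Q) (al r t) (be t s) = 0.

Lemma x_p r u : br X P (E u h j) (E r i h) = - ((-1) ^+ (P && X) * al r u).
Proof. by rewrite brC andbC. Qed.

Lemma x_W r s : (0 < r)%N -> (0 < s)%N -> br X (P (+) (X (+) Q)) (E t h j) (W r t s) = 0.
Proof.
move=> r0 s0; rewrite br_jacobi x_p brNl br_signl [X (+) P]addbC IH // mulr0 oppr0 add0r.
by rewrite x_be // br0r mulr0.
Qed.

Lemma x1_W r s : (0 < r)%N -> (0 < s)%N -> br X (P (+) (X (+) Q)) (E t.+1 h j) (W r t s) =
  (-1) ^+ (P (+) p j) * (al r t * be t s).
Proof.
move=> r0 s0; rewrite br_jacobi x_p [X (+) P]addbC brNl br_signl {1}/al al_Sm //.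
rewrite brDl IH // add0r brNl br_signl R_be // x1_be //.
rewrite br_signr br_mulr -/(W r t s) -/(al r t).
have := x_W r0 s0; rewrite brE /sc => /eqP; rewrite subr_eq0 => /eqP ->.
rewrite hjN; move: (W r t s * _) (al r t * _) => u v; clear.
by case: (p i); case: (p h); case: (p k); rewrite /= ?expr0 ?expr1; ncring.
Qed.

Let am m r := br P (par h m) (E r i h) (E t h m).

Lemma x_am m r : blk m = blk j -> (0 < r)%N -> br X (P (+) par h m) (E t h j) (am m r) = 0.
Proof.
move=> mj r0; rewrite /am [br P _ _ _]brC brNr br_signr [P (+) _]addbC.
by rewrite serre_same ?mj ?mulr0 ?oppr0.
Qed.

Lemma x1_am m r : blk m = blk j -> (0 < r)%N ->
  br X (P (+) par h m) (E t.+1 h j) (am m r) = - ((-1) ^+ (p h (+) P) * (al r t * E t h m)).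
Proof.
move=> mj r0.
have -> : br X (P (+) par h m) (E t.+1 h j) (am m r) =
    - br X (P (+) par h m) (E t h j) (br P (par h m) (E r i h) (E t.+1 h m)).
  rewrite /am [br P _ _ (E t h m)]brC [br P _ _ (E t.+1 h m)]brC !brNr !br_signr [P (+) _]addbC.
  by rewrite serre_swap ?mj // mulrN.
rewrite al_Sm // brDr -/(am m r.+1) x_am // add0r brNr opprK br_signr /R br_sumr.
rewrite (sum_one (i := h)) ?eqxx // => [|l /eqP lh nlh].
  rewrite br_mulr br_same // !mulr0 addr0 x_p mulNr mulrN -mulrA mulr_sign2.
  by congr (- ((-1) ^+ nat_of_bool _ * _)); rewrite hjN; case: (p i); case: (p h).
have -> : P (+) par h m = par i l (+) par l m.
  by case: (p h); case: (p m); case: (p i); case: (p l).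
by rewrite br_mulr br_mid0' ?lh // 1?eq_sym // mul0r add0r br_same ?lh ?mj // !mulr0.
Qed.

Lemma p_S r s : br P (X (+) Q) (E r i h) (S s) = \sum_(m | blk m == blk j) am m r * E s m k.
Proof.
rewrite /S br_sumr; apply: eq_bigr => m /eqP mj.
have -> : X (+) Q = par h m (+) par m k.
  by case: (p h); case: (p j); case: (p m); case: (p k).
by rewrite br_mulr [br P (par m k) _ _]br_far0 ?mj // !mulr0 addr0.
Qed.

Lemma x1_A r s : (0 < r)%N -> (0 < s)%N ->
  br X (P (+) (X (+) Q)) (E t.+1 h j) (br P (X (+) Q) (E r i h) (S s)) =
  - ((-1) ^+ P * (al r t * be t s.+1)).
Proof.
move=> r0 s0; rewrite p_S br_sumr.
have -> : \sum_(m | blk m == blk j) br X (P (+) (X (+) Q)) (E t.+1 h j) (am m r * E s m k) =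
    \sum_(m | blk m == blk j) (- ((-1) ^+ (p h (+) P) * (al r t * (E t h m * E s m k)))
     + (m == j)%:R * ((-1) ^+ (~~ P) * (al r t * be t.+1 s))).
  apply: eq_bigr => m /eqP mj.
  have -> : P (+) (X (+) Q) = (P (+) par h m) (+) par m k.
    by case: (p i); case: (p h); case: (p j); case: (p m); case: (p k).
  rewrite br_mulr x1_am // mulNr -!mulrA; congr (_ + _).
  have [->|nmj] := eqVneq m j; last by rewrite br_mid0 ?mj // !mulr0 mul0r.
  by rewrite mul1r; congr ((-1) ^+ nat_of_bool _ * _); rewrite hjN; case: (p i); case: (p h).
rewrite big_split /= sumrN -!mulr_sumr -/(S s) (sum_one (i := j)) ?eqxx ?mul1r //; last first.
  by move=> m _ /negPf ->; rewrite mul0r.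
rewrite be_S // hjN mulrDr; move: (al r t) (S s) (be t s.+1) => u v w; clear.
by case: (p i); case: (p h); rewrite /= ?expr0 ?expr1; ncring.
Qed.

(** Call the factors p, x and q, with x odd. Bracketing $x_{t+1}$ with $[p,[x_{t+1},q]]$ gives the
    claim up to sign, because $x_{t+1}$ kills $[x_{t+1},q]$ by the Serre relation. The same bracket
    is zero: the shift relation lowers the exponent of the inner x, and the contributions [x1_W] and
    [x1_A] cancel. *)
Lemma quartic_step r s : (0 < r)%N -> (0 < s)%N ->
  br (P (+) X) (X (+) Q) (al r t.+1) (be t.+1 s) = 0.
Proof.
move=> r0 s0.
have xW : br X (P (+) (X (+) Q)) (E t.+1 h j) (W r t.+1 s) = 0.
  rewrite /W be_S // brDr br_signr brDr br_signr -/(W r t s.+1) x1_W // x1_A //.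
  by rewrite mulrN mulr_sign2 [p j (+) _]addbC subrr.
move: xW; rewrite br_jacobi x_p /be serre_same // br0r mulr0 addr0.
rewrite [X (+) P]addbC brNl br_signl => /eqP; rewrite oppr_eq0 => /eqP /esym; exact: sign_eq0.
Qed.
End Quartic.

(** At t = 1 the two inner brackets collapse to an entry of E and one of E', which commute by
    [rel_quartic]. *)
Lemma quartic_same i h j k r s t : blk h = (blk i).+1 -> blk j = (blk h).+1 -> blk k = (blk j).+1 ->
  p j = ~~ p h -> (0 < r)%N -> (0 < s)%N -> (0 < t)%N ->
  br (par i h (+) par h j) (par h j (+) par j k) (br (par i h) (par h j) (E r i h) (E t h j))
    (br (par h j) (par j k) (E t h j) (E s j k)) = 0.
Proof.
move=> hi jh kj hjN r0 s0 t0; elim: t t0 r s r0 s0 => // -[|t] IH _ r s r0 s0; last first.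
  by apply: quartic_step => // r' s' r0' s0'; apply: IH.
have -> : br (par i h) (par h j) (E r i h) (E 1%N h j) = (-1) ^+ p h * E r i j.
  by rewrite brE; case: (mid r 1%N hi erefl jh) => _ e _ _; rewrite e // eqxx mul1r.
have -> : br (par h j) (par j k) (E 1%N h j) (E s j k) = - ((-1) ^+ p j * E' s h k).
  by rewrite brE; case: (mid 1%N s jh erefl kj) => _ _ e _; rewrite e // eqxx mul1r.
rewrite br_signl brNr br_signr brE.
have -> : par i h (+) par h j = par i j by case: (p i); case: (p h); case: (p j).
have -> : par h j (+) par j k = par h k by case: (p k); case: (p h); case: (p j).
by rewrite (rel_quartic pc FF' F'F EE' E'E) ?mulr0 ?oppr0 ?mulr0 //; lia.
Qed.

(** For an even middle factor the two Serre relations make the bracket its own negative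
    ([quartic_twice]). *)
Lemma quartic_even i h j k r s t : blk h = (blk i).+1 -> blk j = (blk h).+1 -> blk k = (blk j).+1 ->
  p j = p h -> (0 < r)%N -> (0 < s)%N -> (0 < t)%N ->
  br (par i h (+) par h j) (par h j (+) par j k) (br (par i h) (par h j) (E r i h) (E t h j))
    (br (par h j) (par j k) (E t h j) (E s j k)) = 0.
Proof.
move=> hi jh kj e r0 s0 t0; have j_h : blk j != blk h by lia.
have i_h : blk i != blk h by lia.
have x0 : par h j = false by rewrite e addbb.
have := @serre_same h j h j j k t s jh erefl erefl j_h kj t0 s0.
have := @serre_same h j h j i h t r jh erefl erefl i_h hi t0 r0.
rewrite x0 => xa xb; rewrite addbF; apply: two_tf; apply: quartic_twice => //.
by apply: br_far0.
Qed.

(** Up to sign the position in the middle block is immaterial: both sides obey the same shift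
    recursion and start from the same entry of E. With [be_indep] this reduces the quartic relation
    to one and the same middle entry in both brackets. *)
Lemma al_indep i f h j r t : blk f = (blk i).+1 -> blk h = blk f -> blk j = (blk f).+1 ->
  (0 < r)%N -> (0 < t)%N ->
  br (par i f) (par f j) (E r i f) (E t f j) =
  (-1) ^+ (p f (+) p h) * br (par i h) (par h j) (E r i h) (E t h j).
Proof.
move=> fi hf jf r0; have hi : blk h = (blk i).+1 by rewrite hf.
have jh : blk j = (blk h).+1 by rewrite hf.
elim: t r r0 => // -[|t] IH r r0 _.
  rewrite !brE; case: (mid r 1%N fi erefl jf) => _ -> // _ _.
  case: (mid r 1%N hi erefl jh) => _ -> // _ _; rewrite !eqxx !mul1r mulr_sign2.
  by rewrite addbK.
have e x : blk x = (blk i).+1 -> blk j = (blk x).+1 -> br (par i x) (par x j) (E r i x) (E t.+2 x j) =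
    br (par i x) (par x j) (E r.+1 i x) (E t.+1 x j)
    - (-1) ^+ p x * \sum_(l | blk l == blk x) E r i l * E t.+1 l j.
  by move=> xi jx; rewrite br_midS // addrK.
by rewrite !e // IH // mulrBr mulr_sign2 addbK hf.
Qed.

Lemma be_indep h g j k s t : blk g = (blk h).+1 -> blk j = blk g -> blk k = (blk g).+1 ->
  (0 < s)%N -> (0 < t)%N ->
  br (par h g) (par g k) (E t h g) (E s g k) =
  (-1) ^+ (p g (+) p j) * br (par h j) (par j k) (E t h j) (E s j k).
Proof.
move=> gh jg kg s0; have jh : blk j = (blk h).+1 by rewrite jg.
have kj : blk k = (blk j).+1 by rewrite jg.
elim: t s s0 => // -[|t] IH s s0 _.
  rewrite !brE; case: (mid 1%N s gh erefl kg) => _ _ -> // _.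
  case: (mid 1%N s jh erefl kj) => _ _ -> // _; rewrite !eqxx !mul1r mulrN mulr_sign2.
  by rewrite addbK.
by rewrite br_midS // [in RHS]br_midS // (IH s.+1) // mulrDr mulr_sign2 addbK jg.
Qed.

Lemma rel_quartics i f1 f2 j h g1 g2 k r s t : blk f1 = (blk i).+1 -> blk f2 = blk f1 ->
  blk h = blk f1 -> blk j = (blk f1).+1 -> blk g1 = blk j -> blk g2 = blk j -> blk k = (blk j).+1 ->
  (0 < r)%N -> (0 < s)%N -> (0 < t)%N ->
  br (par i f1 (+) par f2 j) (par h g1 (+) par g2 k)
    (br (par i f1) (par f2 j) (E r i f1) (E t f2 j))
    (br (par h g1) (par g2 k) (E t h g1) (E s g2 k)) = 0.
Proof.
move=> fi f2f hf jf gj g2j kj r0 s0 t0.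
have [e1|n1] := eqVneq f2 f1; last by rewrite br_mid0 ?br0l // ?f2f.
have [e2|n2] := eqVneq g2 g1; last first.
  by rewrite [br (par h g1) _ _ _]br_mid0 ?br0r // ?gj ?g2j // hf.
rewrite e1 e2 (@al_indep i f1 h) // (@be_indep h g1 j) ?gj ?hf // br_signl br_signr.
have -> : par i f1 (+) par f1 j = par i h (+) par h j.
  by case: (p i); case: (p h); case: (p f1); case: (p j).
have -> : par h g1 (+) par g1 k = par h j (+) par j k.
  by case: (p k); case: (p h); case: (p g1); case: (p j).
have [e|e] := eqVneq (p j) (p h); first by rewrite quartic_even ?hf ?mulr0.
have hjN : p j = ~~ p h by case: (p j) (p h) e => [] [].
by rewrite quartic_same ?hf ?mulr0.
Qed.

End Relations.

(** * Transposition into the opposite ring and the relations for F *)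

Section Converse.
Variable Y : pzRingType.
Implicit Types x y : Y.

Lemma conv_sign (b : bool) x : ((-1) ^+ b : Y^c) * (x : Y^c) = (-1) ^+ b * x :> Y.
Proof. by case: b; [rewrite !mulN1r | rewrite !mul1r]. Qed.
Lemma sc_conv b x y : sc b (x : Y^c) (y : Y^c) = sc b y x :> Y.
Proof. by rewrite /sc conv_sign. Qed.
Lemma sc_conv' b x y : sc b (x : Y^c) (y : Y^c) = - ((-1) ^+ b * sc b x y) :> Y.
Proof. by rewrite sc_conv scC. Qed.
Lemma br_conv a b x y : br a b (x : Y^c) (y : Y^c) = - ((-1) ^+ (a && b) * br a b x y) :> Y.
Proof. by rewrite !brE sc_conv'. Qed.

Variable N : nat.
(** Over the opposite ring transposition reverses products, so $T=FDE$ becomes $T^t=E^tD^tF^t$ with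
    $F^t$ upper triangular. Each relation for E applied to this pencil is a relation for F, up to
    the signs collected in [sc_conv']. *)
Definition fps_tr (X : fps 'M[Y]_N) : fps 'M[Y^c]_N := fun r => \matrix_(i, j) (X r j i : Y^c).

Lemma fps_trE X r i j : fps_tr X r i j = X r j i. Proof. by rewrite mxE. Qed.
Lemma fps_tr1 : fps_tr 1 = 1.
Proof.
apply: fpsP => -[|r]; apply/matrixP => i j; rewrite fps_trE.
  by rewrite [LHS](_ : _ = (1 : 'M[Y]_N) j i) // [RHS](_ : _ = (1 : 'M[Y^c]_N) i j) // !mxE eq_sym.
by rewrite [LHS](_ : _ = (0 : 'M[Y]_N) j i) // [RHS](_ : _ = (0 : 'M[Y^c]_N) i j) // !mxE.
Qed.
Lemma fps_trM X X' : fps_tr (X * X') = fps_tr X' * fps_tr X.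
Proof.
have entry (Z : pzRingType) (A B : fps 'M[Z]_N) r i j :
    (A * B) r i j = \sum_(t < r.+1) \sum_l A t i l * B (r - t)%N l j.
  by rewrite fpsME summxE; apply: eq_bigr => t _; rewrite mxE.
apply: fpsP => r; apply/matrixP => i j; rewrite fps_trE !entry.
rewrite [RHS](reindex_inj rev_ord_inj); apply: eq_bigr => t _.
apply: eq_bigr => l _; rewrite !fps_trE /= subSS subKn //.
by have := ltn_ord t; rewrite ltnS.
Qed.

End Converse.

Section ConversePencil.
Variables (Y : pzRingType) (N : nat) (p : 'I_N -> bool) (blk : 'I_N -> nat).
Local Notation par i j := (p i (+) p j).
Variables T F D D' E : fps 'M[Y]_N.

Lemma rtt_coef_conv : rtt_coef p T -> rtt_coef p (fps_tr T).
Proof.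
move=> rT i j h k r s r0 s0; rewrite !fps_trE.
have := rT j i k h r s r0 s0; set m := minn r s; set n := (r + s - 1)%N => e.
have -> : sc (par i j && par h k) (T r j i : Y^c) (T s k h : Y^c) =
    - ((-1) ^+ (par j i && par k h) * sc (par j i && par k h) (T r j i) (T s k h)) :> Y.
  by rewrite sc_conv' [par i j]addbC [par h k]addbC.
rewrite e mulr_sign2 conv_sign mulr_sumr mulr_sumr.
have -> : - (\sum_(g < m) (-1) ^+ ((par j i && par k h) (+) ((p j && p i) (+) (p j && p k) (+) (p i && p k))) *
    (T g k i * T (n - g)%N j h - T (n - g)%N k i * T g j h)) =
   \sum_(g < m) (-1) ^+ ((p i && p j) (+) (p i && p h) (+) (p j && p h)) *
    (T (n - g)%N k i * T g j h - T g k i * T (n - g)%N j h).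
  rewrite -sumrN; apply: eq_bigr => g _; rewrite -[LHS]mulrN opprB.
  by congr ((-1) ^+ nat_of_bool _ * _); case: (p i); case: (p j); case: (p h); case: (p k).
by apply: eq_bigr => g _; rewrite !fps_trE.
Qed.

Lemma pencil_conv : pencil p blk T F D D' E ->
  pencil p blk (fps_tr T) (fps_tr E) (fps_tr D) (fps_tr D') (fps_tr F).
Proof.
have tr1 (X : fps 'M[Y]_N) : X 0%N = 1 -> fps_tr X 0%N = 1.
  by move=> X0; apply/matrixP => i j; rewrite fps_trE X0 !mxE eq_sym.
case=> TE F0 D0 E0 uF uE bD DD' D'D rT; split; rewrite ?tr1 //.
- by rewrite TE !fps_trM mulrA.
- by move=> r i j nij; rewrite fps_trE uE // [j == i]eq_sym.
- by move=> r i j nij; rewrite fps_trE uF // [j == i]eq_sym.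
- by move=> r i j nij; rewrite fps_trE bD // eq_sym.
- by rewrite -fps_trM D'D fps_tr1.
- by rewrite -fps_trM DD' fps_tr1.
- exact: rtt_coef_conv.
Qed.

Hypothesis two_tf : forall y : Y, y + y = 0 -> y = 0.
Hypothesis pc : pencil p blk T F D D' E.
Variables F' E' : fps 'M[Y]_N.
Hypotheses (FF' : F * F' = 1) (F'F : F' * F = 1) (EE' : E * E' = 1) (E'E : E' * E = 1).
Let pcT := pencil_conv pc.
Let eEE : fps_tr E * fps_tr E' = 1. Proof. by rewrite -fps_trM E'E fps_tr1. Qed.
Let eE'E : fps_tr E' * fps_tr E = 1. Proof. by rewrite -fps_trM EE' fps_tr1. Qed.
Let eFF : fps_tr F * fps_tr F' = 1. Proof. by rewrite -fps_trM F'F fps_tr1. Qed.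
Let eF'F : fps_tr F' * fps_tr F = 1. Proof. by rewrite -fps_trM FF' fps_tr1. Qed.

Lemma conv_signK (b : bool) (x y : Y) : - ((-1) ^+ b * x) = y -> x = - ((-1) ^+ b * y).
Proof. by move=> <-; rewrite mulrN opprK mulr_sign2 addbb mul1r. Qed.

Lemma conv_signK2 (b : bool) (x y z : Y) :
  - ((-1) ^+ b * x) - - ((-1) ^+ b * y) = z -> x - y = - ((-1) ^+ b * z).
Proof. by move=> <-; rewrite -opprD -mulrBr mulrN opprK mulr_sign2 addbb mul1r. Qed.

Lemma rel_DF i j h k r s : blk i = blk j -> blk k = blk j -> blk h = (blk j).+1 -> (0 < s)%N ->
  sc (par i j && par h k) (D r i j) (F s h k) =
  - ((-1) ^+ ((p i && p j) (+) (p h && p i) (+) (p h && p j)) *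
     ((i == k)%:R * \sum_(t < r) (F (r + s - 1 - t)%N * D t) h j)).
Proof.
move=> ij kj hj s0.
have := @rel_DE _ _ _ _ _ _ _ _ _ _ _ pcT eEE eE'E eFF eF'F j i k h r s.
rewrite ij kj => /(_ erefl erefl hj s0); rewrite !fps_trE.
have -> : par j i && par k h = par i j && par h k.
  by case: (p i); case: (p j); case: (p h); case: (p k).
rewrite [in LHS]sc_conv' => /conv_signK ->; congr (- _).
rewrite conv_sign mulr_sign2.
have [->|_] := eqVneq k i; last by rewrite [X in _ * X = _]mul0r [X in _ = _ * X]mul0r [LHS]mulr0 [RHS]mulr0.
congr ((-1) ^+ nat_of_bool _ * _); first by case: (p i); case: (p j); case: (p h).
rewrite [LHS]mul1r [RHS]mul1r; apply: eq_bigr => t _; rewrite !mxE; apply: eq_bigr => l _.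
by rewrite !fps_trE.
Qed.

Lemma rel_FD i j h k r s : blk i = blk j -> blk h = blk j -> blk j = (blk k).+1 -> (0 < s)%N ->
  sc (par i j && par h k) (D r i j) (F s h k) =
  (-1) ^+ ((p h && p k) (+) (p h && p j) (+) (p j && p k)) *
     \sum_(t < r) F (r + s - 1 - t)%N i k * D t h j.
Proof.
move=> ij hj jk s0.
have := @rel_ED _ _ _ _ _ _ _ _ _ _ _ pcT eEE eE'E eFF eF'F k h j i s r.
rewrite ij hj => /(_ jk erefl erefl s0); rewrite !fps_trE.
have -> : par k h && par j i = par i j && par h k.
  by case: (p i); case: (p j); case: (p h); case: (p k).
rewrite [in LHS]sc_conv conv_sign => ->.
have -> : (p j && par k h) (+) (p k && p h) = (p h && p k) (+) (p h && p j) (+) (p j && p k).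
  by case: (p j); case: (p h); case: (p k).
by congr (_ * _); apply: eq_bigr => t _; rewrite !fps_trE (addnC s r).
Qed.

Lemma rel_DF_far i j h k r s : blk i = blk j -> blk h = (blk k).+1 -> blk i != blk h -> blk i != blk k ->
  sc (par i j && par h k) (D r i j) (F s h k) = 0.
Proof.
move=> ij hk ih ik.
have := @rel_DE_far _ _ _ _ _ _ _ _ _ _ _ pcT eEE eE'E eFF eF'F j i k h r s.
rewrite -ij => /(_ erefl hk ik ih); rewrite !fps_trE.
have -> : par j i && par k h = par i j && par h k.
  by case: (p i); case: (p j); case: (p h); case: (p k).
by rewrite [in LHS]sc_conv' => /conv_signK ->; rewrite mulr0 oppr0.
Qed.

Lemma rel_EF_far' i j h k r s : blk j = (blk i).+1 -> blk h = (blk k).+1 -> blk i != blk k ->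
  sc (par i j && par h k) (E r i j) (F s h k) = 0.
Proof.
move=> ji hk; rewrite neq_ltn => /orP[ik|ki]; first exact: (rel_EF_far pc FF' F'F EE' E'E).
have := @rel_EF_far _ _ _ _ _ _ _ _ _ _ _ pcT eEE eE'E eFF eF'F k h j i s r hk ji ki.
rewrite !fps_trE.
have -> : par k h && par j i = par i j && par h k.
  by case: (p i); case: (p j); case: (p h); case: (p k).
by rewrite [in LHS]sc_conv.
Qed.

(** Transposition reverses the order of the two factors in the quadratic sums; the reflection of t
    to r + s - 1 - t restores the form of (R8). *)
Lemma sum_nat_flip (V : zmodType) (f : nat -> V) r s : (0 < r)%N -> (0 < s)%N ->
  \sum_(1 <= t < s) f t - \sum_(1 <= t < r) f t =
  \sum_(1 <= t < s) f (r + s - 1 - t)%N - \sum_(1 <= t < r) f (r + s - 1 - t)%N.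
Proof.
move=> r0 s0; set n := (r + s - 1)%N.
have e a b : (0 < a)%N -> (0 < b)%N -> (a + b - 1)%N = n ->
    \sum_(1 <= t < b) f (n - t)%N = \sum_(1 <= t < n) f t - \sum_(1 <= t < a) f t.
  move=> a0 b0 abn; rewrite (@big_cat_nat _ _ _ a 1 n) //=; last by lia.
  rewrite [X in _ = X - _]addrC addrK big_nat_rev -[RHS](_ : \sum_(1 + a.-1 <= i < n) f i = _); last first.
    by congr (\sum_(_ <= i < n) _); lia.
  rewrite big_addn (_ : n - a.-1 = b)%N; last by lia.
  by apply: eq_big_nat => t /andP[t0 tb]; congr f; lia.
rewrite (e r s) // (e s r) 1?addnC //; set q := \sum_(1 <= t < n) _.
by rewrite opprB [RHS]addrC addrA subrK.
Qed.

Lemma rel_FF i j h k r s : blk h = blk i -> blk k = blk j -> blk i = (blk j).+1 ->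
  (0 < r)%N -> (0 < s)%N ->
  sc (par i j && par h k) (F r i j) (F s h k) =
  (-1) ^+ ((p h && p j) (+) (p j && p k) (+) (p h && p k)) *
  (\sum_(1 <= t < r) F (r + s - 1 - t)%N i k * F t h j
   - \sum_(1 <= t < s) F (r + s - 1 - t)%N i k * F t h j).
Proof.
move=> hi kj ij r0 s0.
have lji : (blk j < blk i)%N by lia.
have ljh : (blk j < blk h)%N by lia.
have := @rel_EE_row _ _ _ _ _ _ _ _ _ _ _ pcT eEE eE'E eFF eF'F j i k h r s kj lji ljh r0 s0.
rewrite !fps_trE.
have -> : par j i && par k h = par i j && par h k.
  by case: (p i); case: (p j); case: (p h); case: (p k).
rewrite [in LHS]sc_conv' => /conv_signK ->.
rewrite conv_sign mulr_sign2 -mulrN.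
set f := fun t => F t i k * F (r + s - 1 - t)%N h j.
have -> : - ((\sum_(1 <= t < s) fps_tr F (r + s - 1 - t)%N j h * fps_tr F t k i) -
   (\sum_(1 <= t < r) fps_tr F (r + s - 1 - t)%N j h * fps_tr F t k i) : Y) =
   \sum_(1 <= t < r) f t - \sum_(1 <= t < s) f t.
  rewrite opprB; congr (_ - _); apply: eq_bigr => t _; by rewrite !fps_trE.
rewrite -opprB (sum_nat_flip f r0 s0) opprB.
have -> : (par i j && par h k) (+) ((p k && p i) (+) (p k && p h) (+) (p i && p h)) =
  (p h && p j) (+) (p j && p k) (+) (p h && p k).
  by case: (p i); case: (p j); case: (p h); case: (p k).
congr (_ * (_ - _)); apply: eq_big_nat => t /andP[_ lt]; rewrite /f;
  by congr (_ * F _ _ _); lia.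
Qed.

Lemma rel_midF i j h k r s : blk i = (blk j).+1 -> blk k = blk i -> blk h = (blk i).+1 ->
  (0 < r)%N -> (0 < s)%N ->
  sc (par i j && par h k) (F r.+1 i j) (F s h k) - sc (par i j && par h k) (F r i j) (F s.+1 h k) =
  - ((-1) ^+ ((p i && (p j (+) p h)) (+) (p j && p h)) *
     ((i == k)%:R * \sum_(l | blk l == blk i) F s h l * F r l j)).
Proof.
move=> ij ki hi r0 s0.
have := @rel_mid _ _ _ _ _ _ _ _ _ _ _ pcT eEE eE'E eFF eF'F j i k h r s ij ki hi.
case=> /(_ r0 s0) e _ _ _; move: e; rewrite !fps_trE.
have -> : par j i && par k h = par i j && par h k.
  by case: (p i); case: (p j); case: (p h); case: (p k).
rewrite ![in LHS]sc_conv' => /conv_signK2 ->; rewrite conv_sign mulr_sign2; congr (- _).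
have [->|_] := eqVneq k i; last by rewrite [X in _ * X = _]mul0r [X in _ = _ * X]mul0r [LHS]mulr0 [RHS]mulr0.
congr ((-1) ^+ nat_of_bool _ * _); first by case: (p i); case: (p j); case: (p h).
rewrite [LHS]mul1r [RHS]mul1r; apply: eq_bigr => l _.
by rewrite !fps_trE.
Qed.

Lemma rel_F0 i j h k r s : blk i = (blk j).+1 -> blk h = (blk k).+1 ->
  (blk i < blk k)%N || (blk h < blk j)%N || (blk k == blk i) && (k != i) ->
  sc (par i j && par h k) (F r i j) (F s h k) = 0.
Proof.
move=> ij hk c.
have {c} : sc (par j i && par k h) (fps_tr F r j i) (fps_tr F s k h) = 0.
  case/orP: c => [c|/andP[/eqP ki nki]].
    by apply: (rel_far pcT eEE eE'E eFF eF'F).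
  have hi : blk h = (blk i).+1 by rewrite hk ki.
  by case: (rel_mid pcT eEE eE'E eFF eF'F r s ij ki hi) => _ _ _ ->.
rewrite !fps_trE.
have -> : par j i && par k h = par i j && par h k.
  by case: (p i); case: (p j); case: (p h); case: (p k).
by rewrite [in LHS]sc_conv' => /conv_signK ->; rewrite mulr0 oppr0.
Qed.

Lemma rel_serreF i j h k f g r s t : blk i = (blk j).+1 -> blk h = blk i -> blk k = blk j ->
  blk g != blk j -> blk f = (blk g).+1 -> (0 < r)%N -> (0 < s)%N -> (0 < t)%N ->
  nest (par i j) (par h k) (par f g) (F r i j) (F s i j) (F s h k) (F r h k) (F t f g) = 0.
Proof.
move=> ij hi kj gj fg r0 s0 t0.
have := @rel_serre _ _ _ _ _ _ _ _ _ _ _ pcT eEE eE'E eFF eF'F j i k h g f r s t ij kj hi gj fg r0 s0 t0.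
rewrite /nest !fps_trE [par j i]addbC [par k h]addbC [par g f]addbC.
rewrite ![br (par h k) (par f g) _ _]br_conv ![in LHS]br_conv !brNr !br_signr.
set u := br _ _ _ _; set v := br _ _ _ _ => e.
have {e} : (-1) ^+ (par i j && (par h k (+) par f g)) * ((-1) ^+ (par h k && par f g) * (u + v)) = 0.
  rewrite !mulrDr -[RHS]e; congr (_ + _); by rewrite mulrN opprK.
rewrite mulr_sign2 => /esym; exact: sign_eq0.
Qed.

Lemma rel_quarticsF i f1 f2 j h g1 g2 k r s t : blk f1 = (blk i).+1 -> blk f2 = blk f1 ->
  blk h = blk f1 -> blk j = (blk f1).+1 -> blk g1 = blk j -> blk g2 = blk j -> blk k = (blk j).+1 ->
  (0 < r)%N -> (0 < s)%N -> (0 < t)%N ->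
  br (par f1 i (+) par j f2) (par g1 h (+) par k g2)
    (br (par f1 i) (par j f2) (F r f1 i) (F t j f2))
    (br (par g1 h) (par k g2) (F t g1 h) (F s k g2)) = 0.
Proof.
move=> fi f2f hf jf gj g2j kj r0 s0 t0.
have two_tf' (y : Y^c) : y + y = 0 -> y = 0 by apply: two_tf.
have := @rel_quartics _ _ _ _ two_tf' _ _ _ _ _ _ _ pcT eEE eE'E eFF eF'F
  i f1 f2 j h g1 g2 k r s t fi f2f hf jf gj g2j kj r0 s0 t0.
rewrite !fps_trE [par i f1]addbC [par f2 j]addbC [par h g1]addbC [par g2 k]addbC.
rewrite [br (par f1 i) (par j f2) _ _]br_conv [br (par g1 h) (par k g2) _ _]br_conv.
rewrite [in LHS]br_conv brNl brNr opprK br_signl br_signr !mulr_sign2 => /eqP.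
rewrite oppr_eq0 => /eqP e; exact: (@sign_eq0 Y _ _ (esym e)).
Qed.

End ConversePencil.

(** * Evaluation of free and presented superalgebras *)

Section FreeEval.
Variables (K : comNzRingType) (G : choiceType) (Q : pzRingType).
Variables (eta : {rmorphism K -> Q}) (v : G -> Q).
Hypothesis etaC : forall c x, eta c * x = x * eta c.

Definition word_val (w : seq G) : Q := \prod_(g <- w) v g.
(** The target is a plain ring with a central homomorphism from K rather than an algebra type, so
    that rings of series and of matrices can serve without further structure. *)
Definition free_eval (f : free_alg K G) : Q := \sum_(w <- msupp f) eta f@_w * word_val w.

Lemma free_evalEw (d : {fset {fmonom G}}) f : (msupp f `<=` d)%fset ->
  free_eval f = \sum_(w <- d) eta f@_w * word_val w.
Proof.
move=> le; rewrite [LHS](big_fset_incl _ le) => //= x xd /mcoeff_outdom ->.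
by rewrite raddf0 mul0r.
Qed.

Lemma free_evalU c w : free_eval << c *g w >> = eta c * word_val w.
Proof. by rewrite (free_evalEw msuppU_le) big_seq_fset1 mcoeffUU. Qed.

Lemma free_eval_is_additive : zmod_morphism free_eval.
Proof.
move=> f g; set E := (msupp f `|` msupp g)%fset.
rewrite !(@free_evalEw E) ?fsubsetUl ?fsubsetUr //; last exact: msuppB_le.
by rewrite -sumrB; apply: eq_bigr => w _; rewrite mcoeffB raddfB mulrBl.
Qed.

HB.instance Definition _ := GRing.isZmodMorphism.Build (free_alg K G) Q free_eval
  free_eval_is_additive.

Lemma free_eval_is_multiplicative : monoid_morphism free_eval.
Proof.
split=> [|f g]; first by rewrite free_evalU rmorph1 mul1r /word_val fm1 big_nil.
rewrite malgME raddf_sum mulr_suml /=; apply: eq_bigr => i _.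
rewrite raddf_sum mulr_sumr /=; apply: eq_bigr => j _.
rewrite free_evalU /word_val fmM big_cat rmorphM /= -!mulrA; congr (_ * _).
by rewrite !mulrA etaC.
Qed.

HB.instance Definition _ := GRing.isMonoidMorphism.Build (free_alg K G) Q free_eval
  free_eval_is_multiplicative.

Definition free_eval_rm : {rmorphism free_alg K G -> Q} := free_eval.

Lemma free_eval_gen g : free_eval_rm (free_gen K g) = v g.
Proof. by rewrite /= free_evalU rmorph1 mul1r /word_val fmU big_seq1. Qed.

Lemma free_evalZ c f : free_eval_rm (c *: f) = eta c * free_eval_rm f.
Proof.
rewrite -mul_malgC rmorphM; congr (_ * _).
by rewrite /= free_evalU /word_val fm1 big_nil mulr1.
Qed.

Variable rels : free_alg K G -> free_alg K G -> Prop.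
Hypothesis rels_eval : forall l r, rels l r -> free_eval_rm l = free_eval_rm r.

Lemma rel_ideal_eval f : rel_ideal rels f -> free_eval_rm f = 0.
Proof.
elim=> [l r /rels_eval lr||x y _ x0 _ y0|a x _ x0|a x _ x0].
- by rewrite rmorphB lr subrr.
- exact: rmorph0.
- by rewrite rmorphD x0 y0 addr0.
- by rewrite rmorphM x0 mulr0.
- by rewrite rmorphM x0 mul0r.
Qed.

Definition pres_lift (x : presented rels) : Q := free_eval_rm (repr x).

Lemma pres_liftE f : pres_lift (pres_pi rels f) = free_eval_rm f.
Proof.
by apply/eqP; rewrite -subr_eq0 -rmorphB; apply/eqP/rel_ideal_eval/pres_repr.
Qed.

Lemma pres_lift_is_additive : zmod_morphism pres_lift.
Proof.
elim/pres_pi_ind=> f; elim/pres_pi_ind=> g.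
rewrite [_ - _](_ : _ = pres_pi rels (f - g)) ?pres_liftE ?rmorphB //.
by rewrite [- _]pres_oppE [LHS]pres_addE.
Qed.
HB.instance Definition _ := GRing.isZmodMorphism.Build (presented rels) Q pres_lift
  pres_lift_is_additive.

Lemma pres_lift_is_multiplicative : monoid_morphism pres_lift.
Proof.
split=> [|x y]; first by rewrite [1](_ : _ = pres_pi rels 1) // pres_liftE rmorph1.
elim/pres_pi_ind: x => f; elim/pres_pi_ind: y => g.
by rewrite [_ * _]pres_mulE !pres_liftE rmorphM.
Qed.
HB.instance Definition _ := GRing.isMonoidMorphism.Build (presented rels) Q pres_lift
  pres_lift_is_multiplicative.

Definition pres_lift_rm : {rmorphism presented rels -> Q} := pres_lift.

End FreeEval.

Section FreeInd.
Variables (K : comNzRingType) (G : choiceType).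

Lemma free_ind (P : free_alg K G -> Prop) :
  P 0 -> P 1 -> (forall c f, P f -> P (c *: f)) -> (forall f g, P f -> P g -> P (f + g)) ->
  (forall g f, P f -> P (free_gen K g * f)) -> forall f, P f.
Proof.
move=> P0 P1 PZ PD PM f; rewrite [f]monalgE; elim/big_ind: _ => // w _.
rewrite (_ : << _ *g w >> = f@_w *: << w >>); last first.
  by apply/malgP => u; rewrite mcoeffZ !mcoeffU mulrnAr mulr1.
apply: PZ; case: w => w; elim: w => [|g w IH]; first by rewrite -fmoneE.
have -> : << FMonom (g :: w) >> = free_gen K g * << FMonom w >> :> free_alg K G.
  rewrite malgM_def /free_gen fgmulUU mulr1; congr << _ *g _ >>.
  by apply/eqP; rewrite fmP fmM fmU.
exact: PM.
Qed.

Variables (rels : free_alg K G -> free_alg K G -> Prop).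
Lemma pres_piM f g : pres_pi rels (f * g) = pres_pi rels f * pres_pi rels g.
Proof. by rewrite [RHS]pres_mulE. Qed.
Lemma pres_piD f g : pres_pi rels (f + g) = pres_pi rels f + pres_pi rels g.
Proof. by rewrite [RHS]pres_addE. Qed.
Lemma pres_piN f : pres_pi rels (- f) = - pres_pi rels f.
Proof. by rewrite [RHS]pres_oppE. Qed.
Lemma pres_piB f g : pres_pi rels (f - g) = pres_pi rels f - pres_pi rels g.
Proof. by rewrite pres_piD pres_piN. Qed.
Lemma pres_pi_is_multiplicative : monoid_morphism (pres_pi rels).
Proof. by split; [exact: erefl | exact: pres_piM]. Qed.
HB.instance Definition _ := GRing.isZmodMorphism.Build (free_alg K G) (presented rels) (pres_pi rels) pres_piB.
HB.instance Definition _ := GRing.isMonoidMorphism.Build (free_alg K G) (presented rels)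
  (pres_pi rels) pres_pi_is_multiplicative.
Definition pres_pi_rm : {rmorphism free_alg K G -> presented rels} := pres_pi rels.
Lemma pres_piZ c f : pres_pi rels (c *: f) = c *: pres_pi rels f.
Proof. by rewrite [RHS]pres_scaleE. Qed.

Lemma malg_cstC c (f : free_alg K G) : c%:MP * f = f * c%:MP.
Proof.
rewrite mul_malgC (malgMEw (fsubset_refl _) (msuppC_le c)).
apply/malgP => w; rewrite mcoeffZ {1}[f]monalgE !raddf_sum mulr_sumr.
apply: eq_bigr => u _; rewrite big_seq_fset1 /= mulm1 !mcoeffU eqxx mulr1n.
by rewrite mulrnAr mulrC.
Qed.

Definition pres_cst : {rmorphism K -> presented rels} :=
  rcomp pres_pi_rm (@malgC _ K : {rmorphism K -> free_alg K G}).
Lemma pres_cstMl c x : pres_cst c * x = c *: x.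
Proof. by elim/pres_pi_ind: x => f; rewrite -[LHS]pres_piM mul_malgC pres_piZ. Qed.
Lemma pres_cstC c x : pres_cst c * x = x * pres_cst c.
Proof. by elim/pres_pi_ind: x => f; rewrite -[LHS]pres_piM malg_cstC [LHS]pres_piM. Qed.

End FreeInd.

Section Parity.
Variables (K : comNzRingType) (G : choiceType) (par : G -> bool).
Implicit Types f g : free_alg K G.

Definition pure p f := forall w, f@_w != 0 -> word_parity par w = p.

Lemma parity_partE p f w : (parity_part par p f)@_w = if word_parity par w == p then f@_w else 0.
Proof.
rewrite /parity_part raddf_sum /= big_mkcond /=.
transitivity (\sum_(u <- msupp f) (if word_parity par w == p then (f@_u *+ (u == w)) else 0)).
  apply: eq_bigr => u _; have [->|uw] := eqVneq u w.
    by case: ifP => // _; rewrite mcoeffU eqxx.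
  by case: ifP => _; rewrite ?mcoeffU ?(negPf uw) !if_same.
case: ifP => _; last by rewrite big1.
rewrite [in RHS](monalgE f) raddf_sum; apply: eq_bigr => u _ /=.
by rewrite mcoeffU.
Qed.

Lemma pureP p f : parity_part par p f = f <-> pure p f.
Proof.
split=> [e w|pf]; last first.
  apply/malgP => w; rewrite parity_partE; case: eqP => // wp.
  by apply/esym/eqP; apply: contra_notT wp => /pf.
by apply: contraNeq => wp; rewrite -e parity_partE (negPf wp).
Qed.

Lemma pure_part p f : pure p (parity_part par p f).
Proof. by move=> w; rewrite parity_partE; have [//|_] := eqVneq (word_parity par w) p; rewrite eqxx. Qed.

Lemma pure0 p : pure p 0. Proof. by move=> w; rewrite mcoeff0 eqxx. Qed.
Lemma pureD p f g : pure p f -> pure p g -> pure p (f + g).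
Proof.
move=> pf pg w; rewrite mcoeffD => n0.
have [e|/pf//] := eqVneq f@_w 0; apply: pg; move: n0; by rewrite e add0r.
Qed.
Lemma pureN p f : pure p f -> pure p (- f).
Proof. by move=> pf w; rewrite mcoeffN oppr_eq0 => /pf. Qed.
Lemma pureZ p (c : K) f : pure p f -> pure p (c *: f).
Proof. by move=> pf w; rewrite mcoeffZ => n0; apply: pf; apply: contra_neq n0 => ->; rewrite mulr0. Qed.
Lemma pureB p f g : pure p f -> pure p g -> pure p (f - g).
Proof. by move=> pf /pureN; apply: pureD. Qed.
Lemma pure_sum I (s : seq I) (Q : pred I) (F : I -> free_alg K G) p :
  (forall i, Q i -> pure p (F i)) -> pure p (\sum_(i <- s | Q i) F i).
Proof. by move=> pF; elim/big_ind: _ => //; [apply: pure0 | apply: pureD]. Qed.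
Lemma pureM p q f g : pure p f -> pure q g -> pure (p (+) q) (f * g).
Proof.
move=> pf pg; rewrite malgME big_seq; apply: pure_sum => u uf; rewrite big_seq; apply: pure_sum => w wg.
move=> x; rewrite mcoeffU; have [<- _|_] := eqVneq (mmul u w) x; last by rewrite mulr0n eqxx.
rewrite /word_parity fmM count_cat oddD; congr (_ (+) _).
  by apply: pf; rewrite mcoeff_neq0.
by apply: pg; rewrite mcoeff_neq0.
Qed.
Lemma pure1 : pure false 1.
Proof. by move=> w; rewrite mcoeff1; have [-> _|_] := eqVneq w (@mone _); rewrite ?eqxx // /word_parity fm1. Qed.
Lemma pure_gen (x : G) : pure (par x) (free_gen K x).
Proof.
move=> w; rewrite /free_gen mcoeffU; have [<- _|_] := eqVneq (fmu x) w; last by rewrite mulr0n eqxx.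
by rewrite /word_parity fmU /= addn0; case: (par x).
Qed.
Lemma pure_sign p (b : nat) f : pure p f -> pure p ((-1) ^+ b * f).
Proof. by move=> pf; rewrite -signr_odd; case: odd; rewrite ?mul1r // mulN1r; apply: pureN. Qed.

Lemma part_pure p q f : pure p f -> parity_part par q f = if q == p then f else 0.
Proof.
move=> pf; apply/malgP => w; rewrite parity_partE.
have [->|nqp] := eqVneq q p; last first.
  rewrite mcoeff0; case: eqP => // wq; apply/eqP; apply: contraNT nqp => /pf <-.
  by rewrite wq.
by case: eqP => // wp; apply/esym/eqP; apply: contra_notT wp => /pf.
Qed.

Lemma br_parts (A : pzRingType) (part : bool -> A -> A) p q (x y : A) :
  (forall a, part a x = if a == p then x else 0) ->
  (forall a, part a y = if a == q then y else 0) ->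
  \sum_(a : bool) \sum_(b : bool)
    (part a x * part b y - (-1) ^+ (a * b) * (part b y * part a x)) = br p q x y.
Proof.
move=> px py; rewrite !big_bool !px !py brE /sc /=.
case: p q {px py} => [] []; rewrite /= ?(mul0r, mulr0) ?oppr0 ?(subr0, addr0, add0r) //.
Qed.

Lemma scomm_pure p q f g : pure p f -> pure q g -> scomm par f g = br p q f g.
Proof.
move=> pf pg.
exact: (@br_parts _ (parity_part par) _ _ _ _ (fun a => part_pure a pf) (fun a => part_pure a pg)).
Qed.

Lemma pure_scomm p q f g : pure p f -> pure q g -> pure (p (+) q) (scomm par f g).
Proof.
move=> pf pg; rewrite (scomm_pure pf pg) brE /sc; apply: pureB; first exact: pureM.
by apply: pure_sign; rewrite addbC; apply: pureM.
Qed.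

Lemma rmorph_br (Q : pzRingType) (h : {rmorphism free_alg K G -> Q}) a b f g :
  h (br a b f g) = br a b (h f) (h g).
Proof. by rewrite !brE /sc rmorphB !rmorphM /= rmorph_sign. Qed.

Lemma parts_sum f : f = parity_part par false f + parity_part par true f.
Proof.
by apply/malgP => w; rewrite mcoeffD !parity_partE; case: word_parity; rewrite ?addr0 ?add0r.
Qed.

End Parity.

(** * The parabolic relations in the super Yangian *)

Section Positions.
Variables (N : nat) (mu : seq nat).
Hypothesis sum_mu : sumn mu = N.
Definition blk_of (I : 'I_N) := reshape_index mu I.
Definition off_of (I : 'I_N) := reshape_offset mu I.
Local Notation blk := blk_of.
Local Notation off := off_of.

Lemma flat_pos I : flatten_index mu (blk I) (off I) = I.
Proof. exact: reshape_indexK. Qed.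

Lemma blk_lt I : (blk I < size mu)%N.
Proof. by apply: reshape_indexP; rewrite sum_mu. Qed.
Lemma off_lt I : (off I < nth 0%N mu (blk I))%N.
Proof. by apply: reshape_offsetP; rewrite sum_mu. Qed.

Lemma pos_exists a i : (a < size mu)%N -> (i < nth 0%N mu a)%N -> exists I, blk I = a /\ off I = i.
Proof.
move=> ha hi; have lt : (flatten_index mu a i < N)%N by rewrite -sum_mu flatten_indexP.
exists (Ordinal lt); rewrite /blk_of /off_of /=.
by rewrite flatten_indexKl // flatten_indexKr.
Qed.

Lemma pos_inj I J : blk I = blk J -> off I = off J -> I = J.
Proof. by move=> b o; apply: val_inj; rewrite /= -(flat_pos I) -(flat_pos J) b o. Qed.

Lemma block_sum (V : nmodType) a (f : nat -> V) : (a < size mu)%N ->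
  \sum_(i < nth 0%N mu a) f i = \sum_(L | blk L == a) f (off L).
Proof.
move=> ha; have [z|nz] := posnP (nth 0%N mu a).
  rewrite z big_ord0 big_pred0 // => L; apply/negP => /eqP La.
  by have := off_lt L; rewrite La z.
have /choice[pos posP] (i : 'I_(nth 0%N mu a)) := pos_exists ha (ltn_ord i).
rewrite (reindex pos) /=; last first.
  have ltL L : blk L == a -> (off L < nth 0%N mu a)%N by move=> /eqP <-; apply: off_lt.
  exists (fun L => insubd (Ordinal nz) (off L)) => [i _|L La].
    by apply: val_inj; case: (posP i) => _ o; rewrite val_insubd o ltn_ord.
  have [b o] := posP (insubd (Ordinal nz) (off L)); apply: pos_inj.
    by rewrite b; move: La => /eqP.
  by rewrite o val_insubd ltL.
apply: eq_big => [i|i _]; first by case: (posP i) => ->; rewrite eqxx.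
by case: (posP i) => _ ->.
Qed.

End Positions.

Lemma mx_at_ord (A : Type) N (x0 : A) (M : 'M[A]_N) (I J : 'I_N) : mx_at x0 M I J = M I J.
Proof. by rewrite /mx_at !valK. Qed.

Lemma sign3 (R : pzRingType) (a b c d e f : bool) :
  (-1) ^+ (a * b + c * d + e * f)%N = (-1) ^+ ((a && b) (+) (c && d) (+) (e && f)) :> R.
Proof. by rewrite -signr_odd !oddD !oddM !oddb. Qed.

(** The terms up to the shift occur in both sums and cancel; hence (R7) and (R8), whose sums start
    above the shift, follow from the same relations with sums starting at 1. *)
Lemma sum_cut (V : zmodType) (f : nat -> V) c r s : (c < r)%N -> (c < s)%N ->
  \sum_(c.+1 <= t < s) f t - \sum_(c.+1 <= t < r) f t = \sum_(1 <= t < s) f t - \sum_(1 <= t < r) f t.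
Proof.
move=> cr cs; rewrite (@big_cat_nat _ _ _ c.+1 1 s) //= [in RHS](@big_cat_nat _ _ _ c.+1 1 r) //=.
by rewrite opprD addrACA subrr add0r.
Qed.

Lemma fps_mulmxE (Q : pzRingType) N (X Z : fps 'M[Q]_N) r i j :
  (X * Z) r i j = \sum_(t < r.+1) \sum_l X t i l * Z (r - t)%N l j.
Proof. by rewrite fpsME summxE; apply: eq_bigr => t _; rewrite mxE. Qed.

Section Evaluation.
Variable Q : pzRingType.
Variables (N : nat) (Ups : seq bool) (sigma : 'M[nat]_N) (mu : seq nat).
Hypothesis sum_mu : sumn mu = N.
Local Notation blk := (@blk_of N mu).
Local Notation off := (@off_of N mu).
Definition ord_digit (I : 'I_N) : bool := nth false Ups I.
Local Notation p := ord_digit.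
Local Notation par i j := (p i (+) p j).
Hypothesis two_tf : forall y : Q, y + y = 0 -> y = 0.
Variables T F D D' E F' E' : fps 'M[Q]_N.
Hypothesis pc : pencil p blk T F D D' E.
Hypotheses (FF' : F * F' = 1) (F'F : F' * F = 1) (EE' : E * E' = 1) (E'E : E' * E = 1).
Local Notation smu a b := (block_shift sigma mu a b).
(* The relations are evaluated over an abstract ring A, of which only the free
   superalgebra is used: unification in the latter is too expensive. *)
Variables (A : pzRingType) (ev : {rmorphism A -> Q}) (sym : parabolic_symbol -> A).
Variables (com : A -> A -> A) (gpure : bool -> A -> Prop).
Hypothesis ev_sym : forall g, listed sigma mu g -> ev (sym g) = parabolic_elt mu F D D' E g.
Hypothesis pure_sym : forall g, gpure (symbol_parity Ups mu g) (sym g).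
Hypothesis ev_scomm : forall a b x y, gpure a x -> gpure b y -> ev (com x y) = br a b (ev x) (ev y).
Hypothesis pure_scomm : forall a b x y, gpure a x -> gpure b y -> gpure (a (+) b) (com x y).

Lemma evD x y : ev (x + y) = ev x + ev y. Proof. exact: rmorphD. Qed.
Lemma evB x y : ev (x - y) = ev x - ev y. Proof. exact: rmorphB. Qed.
Lemma evN x : ev (- x) = - ev x. Proof. exact: rmorphN. Qed.
Lemma evM x y : ev (x * y) = ev x * ev y. Proof. exact: rmorphM. Qed.
Lemma ev0 : ev 0 = 0. Proof. exact: rmorph0. Qed.
Lemma ev_nat (b : bool) : ev b%:R = b%:R. Proof. exact: rmorph_nat. Qed.
Lemma ev_sum I (s : seq I) (P : pred I) (f : I -> A) :
  ev (\sum_(i <- s | P i) f i) = \sum_(i <- s | P i) ev (f i).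
Proof. exact: rmorph_sum. Qed.
Lemma ev_sign n : ev ((-1) ^+ n) = (-1) ^+ n. Proof. exact: rmorph_sign. Qed.

Lemma bdigitE a I : blk I = a -> bdigit Ups mu a (off I) = p I.
Proof. by move=> <-; rewrite /bdigit flat_pos. Qed.

Lemma listedDE a i j r : listed sigma mu (SD a i j r) -> exists I J : 'I_N,
  [/\ (a < size mu)%N, blk I = a, blk J = a, off I = i & off J = j].
Proof.
case/and3P=> a0 ai aj; have [I [bI <-]] := pos_exists sum_mu a0 ai.
by have [J [bJ <-]] := pos_exists sum_mu a0 aj; exists I, J; split=> //; apply: blk_lt.
Qed.
Lemma listedEE b h k r : listed sigma mu (SE b h k r) -> exists H L : 'I_N,
  [/\ blk H = b, blk L = b.+1, off H = h, off L = k & (smu b b.+1 < r)%N].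
Proof.
case/and4P=> b0 bh bk br; have [H [bH <-]] := pos_exists sum_mu (ltnW b0) bh.
by have [L [bL <-]] := pos_exists sum_mu b0 bk; exists H, L.
Qed.
Lemma listedFE b k h r : listed sigma mu (SF b k h r) -> exists L H : 'I_N,
  [/\ blk L = b.+1, blk H = b, off L = k, off H = h & (smu b.+1 b < r)%N].
Proof.
case/and4P=> b0 bk bh br; have [H [bH <-]] := pos_exists sum_mu (ltnW b0) bh.
by have [L [bL <-]] := pos_exists sum_mu b0 bk; exists L, H.
Qed.

Lemma evSD a I J r : blk I = a -> blk J = a -> ev (sym (SD a (off I) (off J) r)) = D r I J.
Proof.
move=> Ia Ja; rewrite ev_sym /= -{1}Ia -?{1}Ja ?flat_pos ?mx_at_ord //.
by rewrite (blk_lt sum_mu) (off_lt sum_mu J) Ja -Ia (off_lt sum_mu).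
Qed.
Lemma evSD' a I J r : blk I = a -> blk J = a -> ev (sym (SD' a (off I) (off J) r)) = D' r I J.
Proof.
move=> Ia Ja; rewrite ev_sym /= -{1}Ia -?{1}Ja ?flat_pos ?mx_at_ord //.
by rewrite (blk_lt sum_mu) (off_lt sum_mu J) Ja -Ia (off_lt sum_mu).
Qed.
Lemma evSE b I J r : blk I = b -> blk J = b.+1 -> (smu b b.+1 < r)%N ->
  ev (sym (SE b (off I) (off J) r)) = E r I J.
Proof.
move=> Ib Jb br; rewrite ev_sym /= -?Jb -?{1}Ib ?flat_pos ?mx_at_ord //.
by rewrite (blk_lt sum_mu) !(off_lt sum_mu) Ib Jb.
Qed.
Lemma evSF b I J r : blk I = b.+1 -> blk J = b -> (smu b.+1 b < r)%N ->
  ev (sym (SF b (off I) (off J) r)) = F r I J.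
Proof.
move=> Ib Jb br; rewrite ev_sym /= -?Ib -?{1}Jb ?flat_pos ?mx_at_ord //.
by rewrite (blk_lt sum_mu) !(off_lt sum_mu) Ib Jb.
Qed.

Lemma pureSD a I J r : blk I = a -> blk J = a -> gpure (par I J) (sym (SD a (off I) (off J) r)).
Proof. by move=> Ia Ja; have := pure_sym (SD a (off I) (off J) r); rewrite /= !bdigitE // oddD !oddb. Qed.
Lemma pureSE b I J r : blk I = b -> blk J = b.+1 -> gpure (par I J) (sym (SE b (off I) (off J) r)).
Proof. by move=> Ia Ja; have := pure_sym (SE b (off I) (off J) r); rewrite /= !bdigitE // oddD !oddb. Qed.
Lemma pureSF b I J r : blk I = b.+1 -> blk J = b -> gpure (par I J) (sym (SF b (off I) (off J) r)).
Proof. by move=> Ia Ja; have := pure_sym (SF b (off I) (off J) r); rewrite /= !bdigitE // oddD !oddb. Qed.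

Arguments pureSD [a I J] r _ _.
Arguments pureSE [b I J] r _ _.
Arguments pureSF [b I J] r _ _.

Lemma delta_off I J : blk I = blk J -> (off I == off J) = (I == J).
Proof.
move=> b; apply/eqP/eqP => [o|->//]; exact: (pos_inj b o).
Qed.

Lemma D0_entry I J : D 0%N I J = (I == J)%:R.
Proof. by rewrite (pc_D0 pc) mxE. Qed.
Lemma D'0_entry I J : D' 0%N I J = (I == J)%:R.
Proof.
by have := congr1 (@^~ 0%N) (pc_DD' pc); rewrite fps_mul0E (pc_D0 pc) mul1r => ->; rewrite mxE.
Qed.
Lemma D_off r I J : blk I != blk J -> D r I J = 0. Proof. exact: (pc_D pc). Qed.

Lemma sum_block (V : nmodType) (f : 'I_N -> V) a : (forall l, blk l != a -> f l = 0) ->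
  \sum_(l | blk l == a) f l = \sum_l f l.
Proof. by move=> f0; rewrite big_mkcond; apply: eq_bigr => l _; case: ifP => // /negbT/f0. Qed.

Ltac sgn := congr ((-1) ^+ nat_of_bool _ * _); repeat match goal with |- context [p ?I] => case: (p I) end.

Lemma eval_R2 a i j r : listed sigma mu (SD a i j r) ->
  ev (\sum_(q < nth 0%N mu a) \sum_(t < r.+1) sym (SD a i q t) * sym (SD' a q j (r - t)))
  = ev ((r == 0%N)%:R * (i == j)%:R).
Proof.
case/listedDE => I [J] [a0 Ia Ja <- <-]; rewrite evM !ev_nat delta_off ?Ia //.
rewrite ev_sum (@block_sum _ _ sum_mu _ _ (fun q => ev (\sum_(t < r.+1) sym (SD a (off I) q t) * sym (SD' a q (off J) (r - t))))) //.
transitivity ((D * D') r I J).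
  rewrite [RHS]fps_mulmxE exchange_big /= -[RHS](@sum_block _ _ a) => [|l la].
    apply: eq_bigr => l /eqP la; rewrite ev_sum; apply: eq_bigr => t _.
    by rewrite evM evSD // evSD'.
  by rewrite big1 // => t _; rewrite D_off ?mul0r // Ia eq_sym.
rewrite (pc_DD' pc); case: r => [|r]; rewrite ?mul1r ?mul0r; last by rewrite [LHS](_ : _ = (0 : 'M[Q]_N) I J) // mxE.
by rewrite [LHS](_ : _ = (1 : 'M[Q]_N) I J) // mxE.
Qed.

Lemma eval_R3 a i j r b h k s : listed sigma mu (SD a i j r) -> listed sigma mu (SD b h k s) ->
  ev (com (sym (SD a i j r)) (sym (SD b h k s))) =
  ev ((a == b)%:R * (-1) ^+ (bdigit Ups mu a i * bdigit Ups mu a j + bdigit Ups mu a i * bdigit Ups mu a h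
     + bdigit Ups mu a j * bdigit Ups mu a h) *
     \sum_(t < minn r s) (sym (SD a h j t) * sym (SD a i k (r + s - 1 - t))
          - sym (SD a h j (r + s - 1 - t)) * sym (SD a i k t))).
Proof.
case/listedDE => I [J] [a0 Ia Ja <- <-] /listedDE[H [L [b0 Hb Lb <- <-]]].
rewrite !evM ev_nat ev_sign (ev_scomm (pureSD _ Ia Ja) (pureSD _ Hb Lb)) !evSD // brE.
have [ab|nab] := eqVneq a b; last first.
  by rewrite !mul0r (rel_DD0 pc FF' F'F EE' E'E) ?Ia ?Ja ?Hb ?Lb.
have Ha : blk H = a by rewrite ab. have La : blk L = a by rewrite ab.
rewrite (rel_DD pc FF' F'F EE' E'E) ?Ia ?Ja ?Ha ?La // mul1r !bdigitE // sign3 ev_sum.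
by congr (_ * _); apply: eq_bigr => t _; rewrite evB !evM !evSD.
Qed.

Lemma eval_R4 a i j r b h k s : listed sigma mu (SD a i j r) -> listed sigma mu (SE b h k s) ->
  ev (com (sym (SD a i j r)) (sym (SE b h k s))) =
  ev ((a == b)%:R * (h == j)%:R * (-1) ^+ (bdigit Ups mu a h * bdigit Ups mu a j) *
       (\sum_(q < nth 0%N mu a) \sum_(t < r) sym (SD a i q t) * sym (SE b q k (r + s - 1 - t)))
     - (a == b.+1)%:R * (-1) ^+ (bdigit Ups mu b h * bdigit Ups mu a k + bdigit Ups mu b h * bdigit Ups mu a j
         + bdigit Ups mu a j * bdigit Ups mu a k) *
       (\sum_(t < r) sym (SD a i k t) * sym (SE b h j (r + s - 1 - t)))).
Proof.
case/listedDE => I [J] [a0 Ia Ja <- <-] /listedEE[H [L [Hb Lb <- <- bs]]].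
have s0 : (0 < s)%N by apply: leq_ltn_trans bs.
rewrite (ev_scomm (pureSD _ Ia Ja) (pureSE _ Hb Lb)) evSD // evSE // evB !evM !ev_nat !ev_sign brE.
have [ab|nab] := eqVneq a b.
  have -> : (a == b.+1) = false by apply/negbTE; rewrite ab; lia.
  have Ha : blk H = a by rewrite ab. have La : blk L = a.+1 by rewrite ab.
  rewrite !mul0r subr0 mul1r (rel_DE pc FF' F'F EE' E'E) ?Ia ?Ja ?Ha ?La // delta_off ?Ha //.
  have [->|_] := eqVneq H J; last by rewrite !mul0r mulr0.
  rewrite !mul1r bdigitE // mulnb andbb; congr (_ * _).
  rewrite ev_sum (@block_sum _ _ sum_mu _ _ (fun q => ev (\sum_(t < r) sym (SD a (off I) q t) * sym (SE b q (off L) (r + s - 1 - t))))) //.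
  transitivity (\sum_(t < r) \sum_(l | blk l == a) D t I l * E (r + s - 1 - t)%N l L).
    apply: eq_bigr => t _; rewrite mxE sum_block // => l la.
    by rewrite D_off ?mul0r // Ia eq_sym.
  rewrite exchange_big; apply: eq_bigr => l /eqP la; rewrite ev_sum; apply: eq_bigr => t _.
  by rewrite evM evSD // evSE ?la //; have := ltn_ord t; lia.
rewrite !mul0r add0r; have [ab|nab'] := eqVneq a b.+1.
  have La : blk L = a by rewrite ab.
  have hb : blk L = (blk H).+1 by rewrite Lb Hb.
  rewrite -[sc _ _ _]brE brC brE (rel_ED pc FF' F'F EE' E'E) ?La ?Ia ?Ja // ?Hb //.
  rewrite mul1r !bdigitE // sign3 mulr_sign2; congr (- _).
  rewrite ev_sum.
  congr (_ * _); last by apply: eq_bigr => t _; rewrite evM evSD // evSE ?Ja // 1?addnC //; have := ltn_ord t; lia.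
  by congr ((-1) ^+ nat_of_bool _); case: (p I); case: (p J); case: (p H); case: (p L).
by rewrite !mul0r oppr0 (rel_DE_far pc FF' F'F EE' E'E) ?Ia ?Ja ?Hb ?Lb.
Qed.

Lemma eval_R5 a i j r b h k s : listed sigma mu (SD a i j r) -> listed sigma mu (SF b h k s) ->
  ev (com (sym (SD a i j r)) (sym (SF b h k s))) =
  ev (- ((a == b)%:R * (i == k)%:R * (-1) ^+ (bdigit Ups mu a i * bdigit Ups mu a j
          + bdigit Ups mu a.+1 h * bdigit Ups mu a i + bdigit Ups mu a.+1 h * bdigit Ups mu a j) *
          (\sum_(q < nth 0%N mu a) \sum_(t < r) sym (SF b h q (r + s - 1 - t)) * sym (SD a q j t)))
       + (a == b.+1)%:R * (-1) ^+ (bdigit Ups mu a h * bdigit Ups mu b k + bdigit Ups mu a h * bdigit Ups mu a j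
           + bdigit Ups mu a j * bdigit Ups mu b k) *
         (\sum_(t < r) sym (SF b i k (r + s - 1 - t)) * sym (SD a h j t))).
Proof.
case/listedDE => I [J] [a0 Ia Ja <- <-] /listedFE[H [L [Hb Lb <- <- bs]]].
have s0 : (0 < s)%N by apply: leq_ltn_trans bs.
rewrite (ev_scomm (pureSD _ Ia Ja) (pureSF _ Hb Lb)) evSD // evSF // evD evN !evM !ev_nat !ev_sign brE.
have [ab|nab] := eqVneq a b.
  have -> : (a == b.+1) = false by apply/negbTE; rewrite ab; lia.
  have La : blk L = a by rewrite ab. have Ha : blk H = a.+1 by rewrite ab.
  rewrite !mul0r addr0 mul1r (rel_DF pc FF' F'F EE' E'E) ?Ia ?Ja ?Ha ?La // delta_off ?Ia //.
  congr (- _); have [->|_] := eqVneq I L; last by rewrite !mul0r mulr0.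
  rewrite !mul1r !bdigitE // sign3; congr (_ * _).
  rewrite ev_sum (@block_sum _ _ sum_mu _ _ (fun q => ev (\sum_(t < r) sym (SF b (off H) q (r + s - 1 - t)) * sym (SD a q (off J) t)))) //.
  transitivity (\sum_(t < r) \sum_(l | blk l == a) F (r + s - 1 - t)%N H l * D t l J).
    apply: eq_bigr => t _; rewrite mxE sum_block // => l la.
    by rewrite D_off ?mulr0 // Ja.
  rewrite exchange_big; apply: eq_bigr => l /eqP la; rewrite ev_sum; apply: eq_bigr => t _.
  by rewrite evM evSD // evSF ?la //; have := ltn_ord t; lia.
rewrite !mul0r oppr0 add0r; have [ab|nab'] := eqVneq a b.+1.
  have Ha : blk H = a by rewrite ab.
  rewrite (rel_FD pc FF' F'F EE' E'E) ?Ia ?Ja ?Ha ?Lb //.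
  rewrite mul1r !bdigitE // sign3 ev_sum; congr (_ * _); apply: eq_bigr => t _.
  by rewrite evM evSD // evSF ?Ia //; have := ltn_ord t; lia.
by rewrite !mul0r (rel_DF_far pc FF' F'F EE' E'E) ?Ia ?Ja ?Hb ?Lb.
Qed.

Lemma eval_R6 a i j r b h k s : listed sigma mu (SE a i j r) -> listed sigma mu (SF b h k s) ->
  ev (com (sym (SE a i j r)) (sym (SF b h k s))) =
  ev ((a == b)%:R * (-1) ^+ (bdigit Ups mu a.+1 h * bdigit Ups mu a k
      + bdigit Ups mu a.+1 j * bdigit Ups mu a k + bdigit Ups mu a.+1 h * bdigit Ups mu a.+1 j + 1) *
      \sum_(t < r + s) sym (SD' a i k (r + s - 1 - t)) * sym (SD a.+1 h j t)).
Proof.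
case/listedEE => I [J] [Ia Ja <- <- ar] /listedFE[H [L [Hb Lb <- <- bs]]].
have s0 : (0 < s)%N by apply: leq_ltn_trans bs.
have r0 : (0 < r)%N by apply: leq_ltn_trans ar.
rewrite (ev_scomm (pureSE _ Ia Ja) (pureSF _ Hb Lb)) evSE // evSF // !evM !ev_nat !ev_sign brE.
have [ab|nab] := eqVneq a b; last first.
  by rewrite !mul0r (rel_EF_far' pc FF' F'F EE' E'E) ?Ia ?Ja ?Hb ?Lb.
have La : blk L = a by rewrite ab. have Ha : blk H = a.+1 by rewrite ab.
rewrite (rel_EF pc FF' F'F EE' E'E) ?Ia ?Ja ?Ha ?La // mul1r !bdigitE // addn1 exprS sign3 mulN1r mulNr.
congr (- (_ * _)); rewrite ev_sum; apply: eq_bigr => t _.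
by rewrite evM evSD // evSD'.
Qed.

Lemma eval_R7 a i j r h k s : listed sigma mu (SE a i j r) -> listed sigma mu (SE a h k s) ->
  ev (com (sym (SE a i j r)) (sym (SE a h k s))) =
  ev ((-1) ^+ (bdigit Ups mu a h * bdigit Ups mu a.+1 j + bdigit Ups mu a.+1 j * bdigit Ups mu a.+1 k
        + bdigit Ups mu a h * bdigit Ups mu a.+1 k) *
       (\sum_((smu a a.+1).+1 <= t < s) sym (SE a i k (r + s - 1 - t)) * sym (SE a h j t)
        - \sum_((smu a a.+1).+1 <= t < r) sym (SE a i k (r + s - 1 - t)) * sym (SE a h j t))).
Proof.
case/listedEE => I [J] [Ia Ja <- <- ar] /listedEE[H [L [Ha La <- <- as_]]].
have s0 : (0 < s)%N by apply: leq_ltn_trans as_.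
have r0 : (0 < r)%N by apply: leq_ltn_trans ar.
rewrite (ev_scomm (pureSE _ Ia Ja) (pureSE _ Ha La)) !evSE // evM ev_sign evB !ev_sum brE.
rewrite (rel_EE_row pc FF' F'F EE' E'E) ?Ia ?Ja ?Ha ?La // !bdigitE // sign3.
rewrite -(sum_cut (fun t => E (r + s - 1 - t)%N I L * E t H J) ar as_).
congr (_ * _); first by congr ((-1) ^+ nat_of_bool _); case: (p H); case: (p J); case: (p L).
by congr (_ - _); apply: eq_big_nat => t /andP[t1 t2]; rewrite evM !evSE //; lia.
Qed.

Lemma eval_R8 a i j r h k s : listed sigma mu (SF a i j r) -> listed sigma mu (SF a h k s) ->
  ev (com (sym (SF a i j r)) (sym (SF a h k s))) =
  ev ((-1) ^+ (bdigit Ups mu a.+1 h * bdigit Ups mu a j + bdigit Ups mu a j * bdigit Ups mu a k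
        + bdigit Ups mu a.+1 h * bdigit Ups mu a k) *
       (\sum_((smu a.+1 a).+1 <= t < r) sym (SF a i k (r + s - 1 - t)) * sym (SF a h j t)
        - \sum_((smu a.+1 a).+1 <= t < s) sym (SF a i k (r + s - 1 - t)) * sym (SF a h j t))).
Proof.
case/listedFE => I [J] [Ia Ja <- <- ar] /listedFE[H [L [Ha La <- <- as_]]].
have s0 : (0 < s)%N by apply: leq_ltn_trans as_.
have r0 : (0 < r)%N by apply: leq_ltn_trans ar.
rewrite (ev_scomm (pureSF _ Ia Ja) (pureSF _ Ha La)) !evSF // evM ev_sign evB !ev_sum brE.
rewrite (rel_FF pc FF' F'F EE' E'E) ?Ia ?Ja ?Ha ?La // !bdigitE // sign3.
rewrite -(sum_cut (fun t => F (r + s - 1 - t)%N I L * F t H J) as_ ar).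
congr (_ * _).
by congr (_ - _); apply: eq_big_nat => t /andP[t1 t2]; rewrite evM !evSF //; lia.
Qed.

Lemma eval_R9 a i j r h k s : listed sigma mu (SE a i j r) -> listed sigma mu (SE a.+1 h k s) ->
  ev (com (sym (SE a i j r.+1)) (sym (SE a.+1 h k s))
      - com (sym (SE a i j r)) (sym (SE a.+1 h k s.+1))) =
  ev ((-1) ^+ (bdigit Ups mu a.+1 j * bdigit Ups mu a.+1 h) * (h == j)%:R *
       \sum_(q < nth 0%N mu a.+1) sym (SE a i q r) * sym (SE a.+1 q k s)).
Proof.
case/listedEE => I [J] [Ia Ja <- <- ar] /listedEE[H [L [Ha La <- <- as_]]].
have s0 : (0 < s)%N by apply: leq_ltn_trans as_.
have r0 : (0 < r)%N by apply: leq_ltn_trans ar.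
rewrite evB !(ev_scomm (pureSE _ Ia Ja) (pureSE _ Ha La)) !evSE ?ltnS ?(ltnW ar) ?(ltnW as_) // !evM !ev_sign ev_nat !brE.
have JI : blk J = (blk I).+1 by rewrite Ia. have HJ : blk H = blk J by rewrite Ja.
have LJ : blk L = (blk J).+1 by rewrite La Ja.
case: (rel_mid pc FF' F'F EE' E'E r s JI HJ LJ) => -> // _ _ _.
rewrite !bdigitE // delta_off ?HJ // -mulrA; have [->|_] := eqVneq H J; last by rewrite !mul0r !mulr0.
rewrite mulnb andbb; congr (_ * (_ * _)).
have a0 : (a.+1 < size mu)%N by rewrite -Ja (blk_lt sum_mu).
rewrite ev_sum (@block_sum _ _ sum_mu _ _ (fun q => ev (sym (SE a (off I) q r) * sym (SE a.+1 q (off L) s)))) // Ja.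
by apply: eq_bigr => l /eqP la; rewrite evM !evSE.
Qed.

Lemma eval_R10 a i j r h k s : listed sigma mu (SF a i j r) -> listed sigma mu (SF a.+1 h k s) ->
  ev (com (sym (SF a i j r.+1)) (sym (SF a.+1 h k s))
      - com (sym (SF a i j r)) (sym (SF a.+1 h k s.+1))) =
  ev ((-1) ^+ (bdigit Ups mu a.+1 i * (bdigit Ups mu a j + bdigit Ups mu a.+2 h)
        + bdigit Ups mu a j * bdigit Ups mu a.+2 h + 1) * (i == k)%:R *
       \sum_(q < nth 0%N mu a.+1) sym (SF a.+1 h q s) * sym (SF a q j r)).
Proof.
case/listedFE => I [J] [Ia Ja <- <- ar] /listedFE[H [L [Ha La <- <- as_]]].
have s0 : (0 < s)%N by apply: leq_ltn_trans as_.
have r0 : (0 < r)%N by apply: leq_ltn_trans ar.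
rewrite evB !(ev_scomm (pureSF _ Ia Ja) (pureSF _ Ha La)) !evSF ?ltnS ?(ltnW ar) ?(ltnW as_) // !evM !ev_sign ev_nat !brE.
rewrite (rel_midF pc FF' F'F EE' E'E) ?Ia ?Ja ?Ha ?La // !bdigitE // delta_off ?Ia //.
rewrite addn1 exprS mulN1r !mulNr -mulrA; congr (- _).
congr (_ * (_ * _)).
  by rewrite -[RHS]signr_odd oddD !oddM oddD !oddb.
have a0 : (a.+1 < size mu)%N by rewrite -Ia (blk_lt sum_mu).
rewrite ev_sum (@block_sum _ _ sum_mu _ _ (fun q => ev (sym (SF a.+1 (off H) q s) * sym (SF a q (off J) r)))) //.
by apply: eq_bigr => l /eqP la; rewrite evM !evSF.
Qed.

Lemma eval_R11 a i j r b h k s : listed sigma mu (SE a i j r) -> listed sigma mu (SE b h k s) ->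
  (1 < `|b - a|)%N \/ (b = a.+1 /\ h <> j) ->
  ev (com (sym (SE a i j r)) (sym (SE b h k s))) = ev 0.
Proof.
case/listedEE => I [J] [Ia Ja <- <- ar] /listedEE[H [L [Ha La <- <- as_]]] c.
rewrite (ev_scomm (pureSE _ Ia Ja) (pureSE _ Ha La)) !evSE // ev0 brE.
case: c => [c|[ba nhj]].
  by apply: (rel_far pc FF' F'F EE' E'E); rewrite ?Ia ?Ja ?Ha ?La //; move: c; lia.
have JI : blk J = (blk I).+1 by rewrite Ia. have HJ : blk H = blk J by rewrite Ha Ja.
have LJ : blk L = (blk J).+1 by rewrite La Ja ba.
case: (rel_mid pc FF' F'F EE' E'E r s JI HJ LJ) => _ _ _ -> //.
by rewrite -(delta_off HJ); apply/eqP.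
Qed.

Lemma eval_R12 a i j r b h k s : listed sigma mu (SF a i j r) -> listed sigma mu (SF b h k s) ->
  (1 < `|b - a|)%N \/ (b = a.+1 /\ i <> k) ->
  ev (com (sym (SF a i j r)) (sym (SF b h k s))) = ev 0.
Proof.
case/listedFE => I [J] [Ia Ja <- <- ar] /listedFE[H [L [Ha La <- <- as_]]] c.
rewrite (ev_scomm (pureSF _ Ia Ja) (pureSF _ Ha La)) !evSF // ev0 brE.
apply: (rel_F0 pc FF' F'F EE' E'E); rewrite ?Ia ?Ja ?Ha ?La //.
case: c => [c|[ba nhj]]; first by move: c; lia.
apply/orP; right; rewrite ba eqxx /= eq_sym -delta_off ?Ia ?La ?ba //.
exact/eqP.
Qed.

Lemma eval_R13 a i j r h k s b f g t :
  listed sigma mu (SE a i j r) -> listed sigma mu (SE a h k s) -> listed sigma mu (SE b f g t) ->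
  (1 <= `|a - b|)%N ->
  ev (com (sym (SE a i j r)) (com (sym (SE a h k s)) (sym (SE b f g t)))
     + com (sym (SE a i j s)) (com (sym (SE a h k r)) (sym (SE b f g t)))) = ev 0.
Proof.
case/listedEE => I [J] [Ia Ja <- <- ar] /listedEE[H [L [Ha La <- <- as_]]] /listedEE[X [Z [Xb Zb <- <- bt]]] c.
have s0 : (0 < s)%N by apply: leq_ltn_trans as_.
have r0 : (0 < r)%N by apply: leq_ltn_trans ar.
have t0 : (0 < t)%N by apply: leq_ltn_trans bt.
have pX u := pure_scomm (pureSE u Ha La) (pureSE t Xb Zb).
rewrite evD !(ev_scomm (pureSE _ Ia Ja) (pX _)) !(ev_scomm (pureSE _ Ha La) (pureSE _ Xb Zb)) !evSE // ev0.
by apply: (rel_serre pc FF' F'F EE' E'E); rewrite ?Ia ?Ja ?Ha ?La ?Xb ?Zb //; lia.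
Qed.

Lemma eval_R14 a i j r h k s b f g t :
  listed sigma mu (SF a i j r) -> listed sigma mu (SF a h k s) -> listed sigma mu (SF b f g t) ->
  (1 <= `|a - b|)%N ->
  ev (com (sym (SF a i j r)) (com (sym (SF a h k s)) (sym (SF b f g t)))
     + com (sym (SF a i j s)) (com (sym (SF a h k r)) (sym (SF b f g t)))) = ev 0.
Proof.
case/listedFE => I [J] [Ia Ja <- <- ar] /listedFE[H [L [Ha La <- <- as_]]] /listedFE[X [Z [Xb Zb <- <- bt]]] c.
have s0 : (0 < s)%N by apply: leq_ltn_trans as_.
have r0 : (0 < r)%N by apply: leq_ltn_trans ar.
have t0 : (0 < t)%N by apply: leq_ltn_trans bt.
have pX u := pure_scomm (pureSF u Ha La) (pureSF t Xb Zb).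
rewrite evD !(ev_scomm (pureSF _ Ia Ja) (pX _)) !(ev_scomm (pureSF _ Ha La) (pureSF _ Xb Zb)) !evSF // ev0.
by apply: (rel_serreF pc FF' F'F EE' E'E); rewrite ?Ia ?Ja ?Ha ?La ?Xb ?Zb //; lia.
Qed.

Lemma eval_R15 a i f1 r f2 j h g1 g2 k s :
  (0 < a)%N ->
  listed sigma mu (SE a.-1 i f1 r) -> listed sigma mu (SE a f2 j (smu a a.+1).+1) ->
  listed sigma mu (SE a h g1 (smu a a.+1).+1) -> listed sigma mu (SE a.+1 g2 k s) ->
  ev (com (com (sym (SE a.-1 i f1 r)) (sym (SE a f2 j (smu a a.+1).+1)))
         (com (sym (SE a h g1 (smu a a.+1).+1)) (sym (SE a.+1 g2 k s)))) = ev 0.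
Proof.
case: a => // a _ /= /listedEE[I [X1 [Ia X1a ei <- ar]]] /listedEE[X2 [J [X2a Ja <- ej aj]]].
case/listedEE => H [G1 [Ha G1a eh <- ah]] /listedEE[G2 [L [G2a La <- <- as_]]].
rewrite -ei -ej -eh.
have s0 : (0 < s)%N by apply: leq_ltn_trans as_.
have r0 : (0 < r)%N by apply: leq_ltn_trans ar.
rewrite (ev_scomm (pure_scomm (pureSE r Ia X1a) (pureSE _ X2a Ja)) (pure_scomm (pureSE _ Ha G1a) (pureSE s G2a La))).
rewrite (ev_scomm (pureSE r Ia X1a) (pureSE _ X2a Ja)) (ev_scomm (pureSE _ Ha G1a) (pureSE s G2a La)) !evSE // ev0.
apply: (rel_quartics two_tf pc FF' F'F EE' E'E); rewrite ?Ia ?X1a ?X2a ?Ja ?Ha ?G1a ?G2a ?La //.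
Qed.

Lemma eval_R16 a i f1 r f2 j h g1 g2 k s :
  (0 < a)%N ->
  listed sigma mu (SF a.-1 i f1 r) -> listed sigma mu (SF a f2 j (smu a.+1 a).+1) ->
  listed sigma mu (SF a h g1 (smu a.+1 a).+1) -> listed sigma mu (SF a.+1 g2 k s) ->
  ev (com (com (sym (SF a.-1 i f1 r)) (sym (SF a f2 j (smu a.+1 a).+1)))
         (com (sym (SF a h g1 (smu a.+1 a).+1)) (sym (SF a.+1 g2 k s)))) = ev 0.
Proof.
case: a => // a _ /= /listedFE[I [X1 [Ia X1a ei <- ar]]] /listedFE[X2 [J [X2a Ja <- ej aj]]].
case/listedFE => H [G1 [Ha G1a eh <- ah]] /listedFE[G2 [L [G2a La <- <- as_]]].
rewrite -ei -ej -eh.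
have s0 : (0 < s)%N by apply: leq_ltn_trans as_.
have r0 : (0 < r)%N by apply: leq_ltn_trans ar.
rewrite (ev_scomm (pure_scomm (pureSF r Ia X1a) (pureSF _ X2a Ja)) (pure_scomm (pureSF _ Ha G1a) (pureSF s G2a La))).
rewrite (ev_scomm (pureSF r Ia X1a) (pureSF _ X2a Ja)) (ev_scomm (pureSF _ Ha G1a) (pureSF s G2a La)) !evSF // ev0.
apply: (rel_quarticsF two_tf pc FF' F'F EE' E'E); rewrite ?Ia ?X1a ?X2a ?Ja ?Ha ?G1a ?G2a ?La //.
Qed.

Lemma eval_R1D a i j : listed sigma mu (SD a i j 0) -> ev (sym (SD a i j 0)) = ev (i == j)%:R.
Proof. by case/listedDE => I [J] [a0 Ia Ja <- <-]; rewrite evSD // ev_nat D0_entry delta_off ?Ia. Qed.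
Lemma eval_R1D' a i j : listed sigma mu (SD' a i j 0) -> ev (sym (SD' a i j 0)) = ev (i == j)%:R.
Proof. by case/(@listedDE a i j 0) => I [J] [a0 Ia Ja <- <-]; rewrite evSD' // ev_nat D'0_entry delta_off ?Ia. Qed.

End Evaluation.

Section Homomorphism.
Variables (K : comNzRingType) (Q : pzRingType) (eta : {rmorphism K -> Q}).
Hypothesis etaC : forall c x, eta c * x = x * eta c.
Variables (N : nat) (Ups : seq bool) (sigma : 'M[nat]_N) (mu : seq nat).
Hypothesis sum_mu : sumn mu = N.
Hypothesis two_tf : forall y : Q, y + y = 0 -> y = 0.
Variables T F D D' E F' E' : fps 'M[Q]_N.
Hypothesis pc : pencil (ord_digit Ups) (@blk_of N mu) T F D D' E.
Hypotheses (FF' : F * F' = 1) (F'F : F' * F = 1) (EE' : E * E' = 1) (E'E : E' * E = 1).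
Local Notation gpar := (@pgen_parity N Ups sigma mu).
Local Notation ev := (free_eval_rm (fun g : pgen sigma mu => parabolic_elt mu F D D' E (val g)) etaC).

Lemma eval_psym g : listed sigma mu g -> ev (psym K sigma mu g) = parabolic_elt mu F D D' E g.
Proof. by move=> lg; rewrite /psym insubT; apply: free_eval_gen. Qed.

Lemma pure_psym g : pure gpar (symbol_parity Ups mu g) (psym K sigma mu g).
Proof. by rewrite /psym; case: insubP => [u _ <-|_]; [apply: pure_gen | apply: pure0]. Qed.

Lemma eval_scomm a b x y : pure gpar a x -> pure gpar b y -> ev (scomm gpar x y) = br a b (ev x) (ev y).
Proof. by move=> px py; rewrite (scomm_pure px py); apply: rmorph_br. Qed.

Lemma pure_psym_scomm a b (x y : free_alg K (pgen sigma mu)) :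
  pure gpar a x -> pure gpar b y -> pure gpar (a (+) b) (scomm gpar x y).
Proof. exact: pure_scomm. Qed.

Lemma parabolic_rel_eval l r : @parabolic_rel K N Ups sigma mu l r -> ev l = ev r.
Proof.
have pp := pure_psym. have es := eval_scomm. have ps := pure_psym_scomm. have ey := eval_psym.
case; intros.
- exact: (eval_R1D sum_mu pc ey).
- exact: (eval_R1D' sum_mu pc ey).
- exact: (eval_R2 sum_mu pc ey).
- exact: (eval_R3 sum_mu pc FF' F'F EE' E'E ey pp es).
- exact: (eval_R4 sum_mu pc FF' F'F EE' E'E ey pp es).
- exact: (eval_R5 sum_mu pc FF' F'F EE' E'E ey pp es).
- exact: (eval_R6 sum_mu pc FF' F'F EE' E'E ey pp es).
- exact: (eval_R7 sum_mu pc FF' F'F EE' E'E ey pp es).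
- exact: (eval_R8 sum_mu pc FF' F'F EE' E'E ey pp es).
- exact: (eval_R9 sum_mu pc FF' F'F EE' E'E ey pp es).
- exact: (eval_R10 sum_mu pc FF' F'F EE' E'E ey pp es).
- exact: (eval_R11 sum_mu pc FF' F'F EE' E'E ey pp es).
- exact: (eval_R12 sum_mu pc FF' F'F EE' E'E ey pp es).
- exact: (eval_R13 sum_mu pc FF' F'F EE' E'E ey pp es ps).
- exact: (eval_R14 sum_mu pc FF' F'F EE' E'E ey pp es ps).
- exact: (eval_R15 sum_mu two_tf pc FF' F'F EE' E'E ey pp es ps).
- exact: (eval_R16 sum_mu two_tf pc FF' F'F EE' E'E ey pp es ps).
Qed.

End Homomorphism.

(** * Root vectors *)

Section Roots.
Variables (G : pzRingType) (I : finType) (p : I -> bool) (blk : I -> nat).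
Hypothesis two_tf : forall y : G, y + y = 0 -> y = 0.
Local Notation par i j := (p i (+) p j).
Variables (s : nat -> nat) (mid : nat -> I) (e : I -> I -> nat -> G).
Hypothesis blk_mid : forall i j a, (blk i < a < blk j)%N -> blk (mid a) = a.

(** The least degree of a root vector from block a to block b: a simple vector leaving block c has
    degree at least [s c]. *)
Definition lev a b := (\sum_(a <= c < b) s c)%N.

(** An iterated bracket through the chosen positions [mid], in which the first simple factor carries
    all the surplus degree and the others have their least degree. *)
Fixpoint root_rec n i j r : G :=
  if n is n'.+1 then
    let l := mid (blk i).+1 in
    br (par i l) (par l j) (e i l (r - lev (blk i).+1 (blk j))) (root_rec n' l j (lev (blk i).+1 (blk j)))
  else e i j r.
Definition root i j r := root_rec (blk j - blk i).-1 i j r.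

Hypothesis e_same : forall i j h k r t, blk j = (blk i).+1 -> blk h = blk i -> blk k = blk j ->
  (s (blk i) <= r)%N -> (s (blk h) <= t)%N -> br (par i j) (par h k) (e i j r) (e h k t) = 0.
Hypothesis e_far : forall i j h k r t, blk j = (blk i).+1 -> blk k = (blk h).+1 -> (blk j < blk h)%N ->
  (s (blk i) <= r)%N -> (s (blk h) <= t)%N -> br (par i j) (par h k) (e i j r) (e h k t) = 0.
Hypothesis e_ne : forall i j h k r t, blk j = (blk i).+1 -> blk h = blk j -> blk k = (blk h).+1 -> j != h ->
  (s (blk i) <= r)%N -> (s (blk h) <= t)%N -> br (par i j) (par h k) (e i j r) (e h k t) = 0.
Hypothesis e_shift : forall i j k r t, blk j = (blk i).+1 -> blk k = (blk j).+1 ->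
  (s (blk i) <= r)%N -> (s (blk j) <= t)%N ->
  br (par i j) (par j k) (e i j r.+1) (e j k t) = br (par i j) (par j k) (e i j r) (e j k t.+1).
Hypothesis e_indep : forall i j j' k r t, blk j = (blk i).+1 -> blk j' = blk j -> blk k = (blk j).+1 ->
  (s (blk i) <= r)%N -> (s (blk j) <= t)%N ->
  br (par i j) (par j k) (e i j r) (e j k t) = br (par i j') (par j' k) (e i j' r) (e j' k t).
Hypothesis e_serre : forall i j h k f g r r' t, blk j = (blk i).+1 -> blk h = blk i -> blk k = blk j ->
  blk g = (blk f).+1 -> blk f = blk j \/ blk g = blk i ->
  (s (blk i) <= r)%N -> (s (blk i) <= r')%N -> (s (blk f) <= t)%N ->
  nest (par i j) (par h k) (par f g) (e i j r) (e i j r') (e h k r') (e h k r) (e f g t) = 0.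
Hypothesis e_quartic : forall i h j k r t, blk h = (blk i).+1 -> blk j = (blk h).+1 -> blk k = (blk j).+1 ->
  par h j = true -> (s (blk i) <= r)%N -> (s (blk j) <= t)%N ->
  br (par i h (+) par h j) (par h j (+) par j k)
    (br (par i h) (par h j) (e i h r) (e h j (s (blk h))))
    (br (par h j) (par j k) (e h j (s (blk h))) (e j k t)) = 0.

Lemma par_split l i j : par i j = par i l (+) par l j.
Proof. by case: (p i); case: (p j); case: (p l). Qed.

Lemma lev_nn a : lev a a = 0%N. Proof. by rewrite /lev big_geq. Qed.
Lemma lev_recl a b : (a < b)%N -> lev a b = (s a + lev a.+1 b)%N.
Proof. by move=> ab; rewrite /lev big_ltn. Qed.
Lemma lev_recr a b : (a <= b)%N -> lev a b.+1 = (lev a b + s b)%N.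
Proof. by move=> ab; rewrite /lev big_nat_recr. Qed.
Lemma lev1 a : lev a a.+1 = s a. Proof. by rewrite lev_recl // lev_nn addn0. Qed.

Lemma root1 i j r : blk j = (blk i).+1 -> root i j r = e i j r.
Proof. by move=> ji; rewrite /root ji subSnn. Qed.
Lemma root_def i j r : ((blk i).+1 < blk j)%N -> root i j r =
  br (par i (mid (blk i).+1)) (par (mid (blk i).+1) j) (e i (mid (blk i).+1) (r - lev (blk i).+1 (blk j)))
    (root (mid (blk i).+1) j (lev (blk i).+1 (blk j))).
Proof.
move=> ij; rewrite /root (@blk_mid i j) ?ltnSn //.
by have -> : ((blk j - blk i).-1 = (blk j - (blk i).+1).-1.+1)%N by lia.
Qed.

(** The shift relation moves degree from the second factor to the first until the second is minimal,
    and [e_indep] replaces the middle position by [mid]; what remains is the definition of the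
    root. *)
Lemma e_e i l l' j r t : blk l = (blk i).+1 -> blk l' = blk l -> blk j = (blk l).+1 ->
  (s (blk i) <= r)%N -> (s (blk l) <= t)%N ->
  br (par i l) (par l' j) (e i l r) (e l' j t) = (l == l')%:R * root i j (r + t).
Proof.
move=> li l'l jl ri tl; have [<-|nl] := eqVneq l l'; last first.
  by rewrite e_ne ?l'l // mul0r.
have ij : ((blk i).+1 < blk j)%N by rewrite jl li.
have mi : blk (mid (blk i).+1) = (blk i).+1 by apply: (@blk_mid i j); rewrite ltnSn.
rewrite mul1r root_def // root1 ?mi ?jl ?li // lev1.
rewrite (@e_indep i l (mid (blk i).+1)) //; last lia.
rewrite li in tl; move: (mid _) mi => m mi.
have jm : blk j = (blk m).+1 by rewrite jl mi li.
elim: (t - s (blk i).+1)%N {-2}t tl (erefl (t - s (blk i).+1)%N) r ri => [|u IH] t' tl e' r ri.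
  have -> : t' = s (blk i).+1 by lia.
  by rewrite addnK.
have -> : t' = t'.-1.+1 by lia.
rewrite -e_shift ?mi //; try lia.
rewrite IH; try lia.
by congr (br _ _ (e _ _ _) _); lia.
Qed.

(** Multiplication by a simple vector on the left and on the right has to be proved together: each
    case splits the root at the opposite end, moves the simple vector past the distant factor by
    Jacobi, and falls back on the other statement for shorter roots. *)
Lemma root_mul n : (forall i l l' j r t, blk l = (blk i).+1 -> blk l' = blk l -> blk j = (blk l + n).+1 ->
    (s (blk i) <= r)%N -> (lev (blk l) (blk j) <= t)%N ->
    br (par i l) (par l' j) (e i l r) (root l' j t) = (l == l')%:R * root i j (r + t)) /\
  (forall i l l' j r t, blk l = (blk i + n).+1 -> blk l' = blk l -> blk j = (blk l).+1 ->
    (lev (blk i) (blk l) <= r)%N -> (s (blk l) <= t)%N ->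
    br (par i l) (par l' j) (root i l r) (e l' j t) = (l == l')%:R * root i j (r + t)).
Proof.
elim: n => [|n [IHA IHA']].
  split=> i l l' j r t; rewrite addn0 => li l'l jl; rewrite ?jl ?li lev1 => ri tl.
    by rewrite root1 ?jl ?l'l // e_e // li.
  by rewrite root1 // e_e // ?li.
have A i l l' j r t : blk l = (blk i).+1 -> blk l' = blk l -> blk j = (blk l + n.+1).+1 ->
    (s (blk i) <= r)%N -> (lev (blk l) (blk j) <= t)%N ->
    br (par i l) (par l' j) (e i l r) (root l' j t) = (l == l')%:R * root i j (r + t).
  move=> li l'l jl ri tl.
  have jl' : blk j = (blk l + n).+2 by rewrite jl addnS.
  have mj : blk (mid (blk l + n).+1) = (blk l + n).+1 by apply: (@blk_mid i j); lia.
  pose z u := br (par i (mid (blk l + n).+1)) (par (mid (blk l + n).+1) j)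
    (root i (mid (blk l + n).+1) (u - s (blk l + n).+1)) (e (mid (blk l + n).+1) j (s (blk l + n).+1)).
  have Z l1 l2 r1 t1 : blk l1 = (blk i).+1 -> blk l2 = blk l1 -> (s (blk i) <= r1)%N ->
     (lev (blk l) (blk j) <= t1)%N ->
     br (par i l1) (par l2 j) (e i l1 r1) (root l2 j t1) = (l1 == l2)%:R * z (r1 + t1)%N.
    rewrite {1}jl' lev_recr; last lia.
    move=> l1i l2l1 ri1 tl1; rewrite -{1}[t1](@subnK (s (blk l + n).+1)); last lia.
    have -> : root l2 j (t1 - s (blk l + n).+1 + s (blk l + n).+1) =
      br (par l2 (mid (blk l + n).+1)) (par (mid (blk l + n).+1) j)
        (root l2 (mid (blk l + n).+1) (t1 - s (blk l + n).+1))
        (e (mid (blk l + n).+1) j (s (blk l + n).+1)).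
      rewrite IHA' ?eqxx ?mul1r ?mj //; try lia.
      have -> : blk l2 = blk l by lia.
      by lia.
    rewrite (par_split (mid (blk l + n).+1) l2 j) br_jacobi e_far ?mj //; try lia.
    rewrite br0r mulr0 addr0 IHA ?mj //; try lia; last first.
      have -> : blk l1 = blk l by lia.
      by lia.
    have [<-|nl] := eqVneq l1 l2; last by rewrite !mul0r br0l.
    by rewrite !mul1r -(par_split l1); congr (br _ _ (root _ _ _) _); lia.
  have mi : blk (mid (blk i).+1) = (blk i).+1 by apply: (@blk_mid i j); lia.
  rewrite Z //; congr (_ * _); rewrite root_def; last lia.
  move: tl; rewrite {1}li => tl; rewrite Z //; last by rewrite -li.
    by rewrite eqxx mul1r; congr z; lia.
  by lia.
split=> // i l l' j r t li l'l jl ri tl.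
have mi : blk (mid (blk i).+1) = (blk i).+1 by apply: (@blk_mid i j); lia.
have ri' : (s (blk i) + lev (blk i).+1 (blk l) <= r)%N by rewrite -lev_recl //; lia.
rewrite root_def; last lia.
rewrite {1}(par_split (mid (blk i).+1) i l).
have := br_jacobi (par i (mid (blk i).+1)) (par (mid (blk i).+1) l) (par l' j)
  (e i (mid (blk i).+1) (r - lev (blk i).+1 (blk l))) (root (mid (blk i).+1) l (lev (blk i).+1 (blk l)))
  (e l' j t).
rewrite [X in _ * br _ _ _ X]e_far //; try lia.
rewrite br0r mulr0 addr0 => <-.
rewrite IHA' ?mi //; try lia.
have [<-|nl] := eqVneq l l'; last by rewrite !mul0r br0r.
rewrite !mul1r -(par_split l) A ?mi ?eqxx ?mul1r //; try lia.
- by congr root; lia.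
- rewrite jl lev_recr; lia.
- by rewrite l'l.
Qed.

Lemma e_root i l l' j r t : blk l = (blk i).+1 -> blk l' = blk l -> (blk l < blk j)%N ->
    (s (blk i) <= r)%N -> (lev (blk l) (blk j) <= t)%N ->
    br (par i l) (par l' j) (e i l r) (root l' j t) = (l == l')%:R * root i j (r + t).
Proof.
by move=> li l'l jl ri tl; case: (root_mul (blk j - (blk l).+1)) => -> //; lia.
Qed.
Lemma root_e i l l' j r t : (blk i < blk l)%N -> blk l' = blk l -> blk j = (blk l).+1 ->
    (lev (blk i) (blk l) <= r)%N -> (s (blk l) <= t)%N ->
    br (par i l) (par l' j) (root i l r) (e l' j t) = (l == l')%:R * root i j (r + t).
Proof.
by move=> il l'l jl ri tl; case: (root_mul (blk l - (blk i).+1)) => _ -> //; lia.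
Qed.

(* A bracket with a root is computed on one of its two factorizations. *)
Lemma root_left i l j r t : blk l = (blk i).+1 -> (blk l < blk j)%N ->
  (s (blk i) <= r)%N -> (lev (blk l) (blk j) <= t)%N ->
  root i j (r + t) = br (par i l) (par l j) (e i l r) (root l j t).
Proof. by move=> *; rewrite e_root ?eqxx ?mul1r. Qed.
Lemma root_right i l j r t : (blk i < blk l)%N -> blk j = (blk l).+1 ->
  (lev (blk i) (blk l) <= r)%N -> (s (blk l) <= t)%N ->
  root i j (r + t) = br (par i l) (par l j) (root i l r) (e l j t).
Proof. by move=> *; rewrite root_e ?eqxx ?mul1r. Qed.

Lemma root_two i l j r t : blk l = (blk i).+1 -> blk j = (blk l).+1 ->
  (s (blk i) <= r)%N -> (s (blk l) <= t)%N ->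
  root i j (r + t) = br (par i l) (par l j) (e i l r) (e l j t).
Proof. by move=> *; rewrite e_e ?eqxx ?mul1r. Qed.

Lemma e_root_far n i j h k r t : blk k = (blk h).+1 -> blk j = (blk i + n).+1 ->
  (blk k < blk i)%N || (blk j < blk h)%N -> (s (blk h) <= r)%N -> (lev (blk i) (blk j) <= t)%N ->
  br (par h k) (par i j) (e h k r) (root i j t) = 0.
Proof.
elim: n i t => [|n IH] i t kh ji kihj rh tj.
  rewrite addn0 in ji; rewrite root1 //; move: tj; rewrite ji lev1 => ti.
  case/orP: kihj => ?; first by rewrite e_far.
  by rewrite brC e_far // mulr0 oppr0.
have mi : blk (mid (blk i).+1) = (blk i).+1 by apply: (@blk_mid i j); lia.
have tj' : (s (blk i) + lev (blk i).+1 (blk j) <= t)%N by rewrite -lev_recl //; lia.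
have -> : t = (s (blk i) + (t - s (blk i)))%N by lia.
rewrite (@root_left i (mid (blk i).+1)) ?mi //; try lia.
rewrite (par_split (mid (blk i).+1) i j) br_jacobi (IH (mid _)) ?mi //; try lia.
rewrite br0r mulr0 addr0; case/orP: kihj => ?; first by rewrite e_far ?br0l ?mi //; lia.
by rewrite [br (par h k) _ _ (e i _ _)]brC e_far ?mi ?mulr0 ?oppr0 ?br0l //; lia.
Qed.

Lemma twice0 (x : G) : x = - x -> x = 0.
Proof. by move=> /eqP; rewrite -addr_eq0 => /eqP; apply: two_tf. Qed.

(** The Serre relation makes the bracket f antisymmetric under exchange of the surplus degrees of
    its two equal simple factors. It vanishes when these agree, by absence of 2-torsion, and one
    exchange reduces the general case to that one. *)
Lemma e_root2 i j h k u v : blk j = (blk i).+2 -> blk k = (blk h).+1 ->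
  (blk i <= blk h)%N -> (blk k <= blk j)%N -> (s (blk h) <= u)%N -> (lev (blk i) (blk j) <= v)%N ->
  br (par h k) (par i j) (e h k u) (root i j v) = 0.
Proof.
move=> ji kh ih kj hu; rewrite ji lev_recl ?lev1 // => vs.
pose f u' v' := br (par h k) (par i j) (e h k u') (root i j v').
have swap u1 u2 t : (s (blk h) <= u1)%N -> (s (blk h) <= u2)%N ->
    (s (blk i) + s (blk i).+1 <= s (blk h) + t)%N -> f u1 (u2 + t)%N = - f u2 (u1 + t)%N.
  move=> hu1 hu2 ht; apply/eqP; rewrite -addr_eq0; apply/eqP.
  have [hi|hi] : blk h = blk i \/ blk h = (blk i).+1 by lia.
    rewrite hi in hu1 hu2 ht; have := @e_serre h k i k k j u1 u2 t; rewrite /nest -(par_split k) hi -!root_two ?kh ?hi ?ji ?lev1; try lia.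
    by apply; by [lia|left; lia].
  rewrite hi in hu1 hu2 ht; have := @e_serre h k h j i h u1 u2 t; rewrite /nest.
  have -> : par h j (+) par i h = par i j by rewrite addbC -(par_split h).
  rewrite ![br (par h j) _ _ _]brC -!root_two ?hi ?ji; try lia.
  rewrite ![(t + _)%N]addnC.
  rewrite !brNr !br_signr -opprD -mulrDr => H; apply: (@sign_eq0 _ (par h j && par i h)).
  by rewrite -[RHS]opprK H ?oppr0 //; try lia; right; lia.
have f0 t : (s (blk i) + s (blk i).+1 <= s (blk h) + t)%N -> f (s (blk h)) (s (blk h) + t)%N = 0.
  by move=> ht; apply: twice0; apply: swap.
have vh : (s (blk h) <= v)%N.
  have [->|->] : blk h = blk i \/ blk h = (blk i).+1 by lia.
    by lia.
  by lia.
have -> : v = (s (blk h) + (v - s (blk h)))%N by lia.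
rewrite -/(f _ _) swap ?leqnn //; try lia.
have -> : (u + (v - s (blk h)) = s (blk h) + (u + v - s (blk h) - s (blk h)))%N by lia.
by rewrite f0 ?oppr0 //; lia.
Qed.

(** Splitting the root on the left or on the right expresses the bracket by the same [om], a bracket
    of two overlapping roots of length two. For an even middle vector the signs are opposite, so it
    vanishes. For an odd one the signs agree and nothing follows: this is the case that the quartic
    relation settles. *)
Lemma e_root3 i j h k u v : blk h = (blk i).+1 -> blk k = (blk h).+1 -> blk j = (blk k).+1 ->
  (s (blk h) <= u)%N -> (lev (blk i) (blk j) <= v)%N ->
  br (par h k) (par i j) (e h k u) (root i j v) = 0.
Proof.
move=> hi kh jk hu; have -> : lev (blk i) (blk j) = (s (blk i) + (s (blk h) + s (blk k)))%N.
  rewrite lev_recl; last lia.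
  by rewrite jk lev_recr ?kh ?hi // lev1.
move=> vs.
have lhj : lev (blk h) (blk j) = (s (blk h) + s (blk k))%N by rewrite jk lev_recr ?kh ?lev1.
have lik : lev (blk i) (blk k) = (s (blk i) + s (blk h))%N by rewrite kh lev_recr ?hi ?lev1.
pose om x y := br (par i k) (par h j) (root i k x) (root h j y).
have left x r t : (s (blk i) <= r)%N -> (s (blk h) + s (blk k) <= t)%N -> (s (blk h) <= x)%N ->
    br (par h k) (par i j) (e h k x) (root i j (r + t)) = - ((-1) ^+ (par i h && par h k) * om (r + x)%N t).
  move=> ri th xh; rewrite (@root_left i h) ?lhj //; last lia.
  rewrite (par_split h i j) br_jacobi e_root2 ?lhj //; try lia.
  rewrite br0r mulr0 addr0 [br _ _ (e h k x) _]brC -root_two //.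
  by rewrite brNl br_signl [par h k && _]andbC [par h k (+) _]addbC -!(par_split h).
have right x r t : (s (blk i) + s (blk h) <= r)%N -> (s (blk k) <= t)%N -> (s (blk h) <= x)%N ->
    br (par h k) (par i j) (e h k x) (root i j (r + t)) = (-1) ^+ (par i k && par h k) * om r (x + t)%N.
  move=> ri th xh; rewrite (@root_right i k) ?lik //; try lia.
  rewrite (par_split k i j) br_jacobi e_root2 ?lik //; try lia.
  by rewrite br0l add0r -root_two // andbC -(par_split k).
have red : br (par h k) (par i j) (e h k u) (root i j v) =
    br (par h k) (par i j) (e h k (s (blk h))) (root i j (u + v - s (blk h))).
  have -> : v = (s (blk i) + (v - s (blk i)))%N by lia.
  have -> : (u + (s (blk i) + (v - s (blk i))) - s (blk h) = (u + s (blk i) - s (blk h)) + (v - s (blk i)))%N by lia.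
  by rewrite !left //; try lia; congr (- (_ * om _ _)); lia.
rewrite red.
have [w ->] : exists w, (u + v - s (blk h) = s (blk i) + (s (blk h) + s (blk k) + w))%N.
  by exists (u + v - s (blk h) - s (blk i) - s (blk h) - s (blk k))%N; lia.
case e_hk: (par h k); last first.
  apply: twice0; rewrite -e_hk {1}left; try lia.
  have -> : (s (blk i) + (s (blk h) + s (blk k) + w) = (s (blk i) + s (blk h)) + (s (blk k) + w))%N by lia.
  rewrite right; try lia.
  by rewrite e_hk !andbF !mul1r; congr (- om _ _); lia.
rewrite -e_hk left; try lia.
have := @e_quartic i h k j (s (blk i)) (s (blk k) + w).
rewrite -!root_two ?leqnn ?leq_addr //; try lia.
by rewrite -!par_split addnA /om => ->; rewrite ?mulr0 ?oppr0; try lia.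
Qed.

(** Jacobi splits off the end blocks that do not touch h and k, until a root of length one or two,
    or the middle of a root of length three, is left. *)
Lemma e_root_in n i j h k u v : blk j = (blk i + n)%N -> blk k = (blk h).+1 ->
  (blk i <= blk h)%N -> (blk k <= blk j)%N -> (s (blk h) <= u)%N -> (lev (blk i) (blk j) <= v)%N ->
  br (par h k) (par i j) (e h k u) (root i j v) = 0.
Proof.
elim: n i j v => [|[|[|n]] IH] i j v ji kh ih kj hu vs; try lia.
- have ji' : blk j = (blk i).+1 by lia.
  have hi : blk h = blk i by lia.
  rewrite root1 // e_same ?hi //; try lia; first by rewrite -hi.
  by move: vs; rewrite ji' lev1.
- by apply: e_root2 => //; lia.
have [c1|c1] := boolP (blk k < (blk j).-1)%N.
  have mj : blk (mid (blk j).-1) = (blk j).-1 by apply: (@blk_mid i j); lia.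
  have jj : blk j = (blk j).-1.+1 by lia.
  move: vs; rewrite {1}jj lev_recr => [vs|]; last lia.
  have -> : v = ((v - s (blk j).-1) + s (blk j).-1)%N by lia.
  rewrite (@root_right i (mid (blk j).-1)) ?mj //; try lia.
  rewrite (par_split (mid (blk j).-1) i j) br_jacobi IH ?mj //; try lia.
  by rewrite br0l add0r e_far ?br0r ?mulr0 ?mj //; lia.
have [c2|c2] := boolP ((blk i).+1 < blk h)%N.
  have mi : blk (mid (blk i).+1) = (blk i).+1 by apply: (@blk_mid i j); lia.
  move: vs; rewrite lev_recl => [vs|]; last lia.
  have -> : v = (s (blk i) + (v - s (blk i)))%N by lia.
  rewrite (@root_left i (mid (blk i).+1)) ?mi //; try lia.
  rewrite (par_split (mid (blk i).+1) i j) br_jacobi [br (par h k) _ _ (root _ _ _)]IH ?mi //; try lia.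
  rewrite br0r mulr0 addr0 [br (par h k) _ _ (e i _ _)]brC e_far ?mulr0 ?oppr0 ?br0l ?mi //; lia.
by apply: e_root3 => //; lia.
Qed.

(** These are the structure constants of matrix units in a loop superalgebra: the bracket of
    $e_{h,k}t^u$ with $e_{i,j}t^v$. *)
Lemma e_root_bracket i j h k u v : blk k = (blk h).+1 -> (blk i < blk j)%N ->
  (s (blk h) <= u)%N -> (lev (blk i) (blk j) <= v)%N ->
  br (par h k) (par i j) (e h k u) (root i j v) =
  (k == i)%:R * root h j (u + v) - (-1) ^+ (par h k && par i j) * ((j == h)%:R * root i k (v + u)).
Proof.
move=> kh ij hu vs.
have [ki|nki] := eqVneq k i.
  have -> : (j == h) = false by apply/eqP => jh; move: kh ij; rewrite ki jh; lia.
  by subst k; rewrite mul0r mulr0 subr0 (e_root (l := i)) ?eqxx ?mul1r.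
have [jh|njh] := eqVneq j h.
  subst j; rewrite mul0r sub0r brC -root_right ?mul1r //.
rewrite !mul0r mulr0 subr0.
have [h1|h1] := boolP (blk k < blk i)%N.
  by rewrite (@e_root_far (blk j - (blk i).+1)) ?h1 //; lia.
have [h2|h2] := boolP (blk j < blk h)%N.
  by rewrite (@e_root_far (blk j - (blk i).+1)) ?h2 ?orbT //; lia.
have [ki|ki] := eqVneq (blk k) (blk i).
  by rewrite e_root // ?(negPf nki) ?mul0r // ki.
have [jh|jh] := eqVneq (blk j) (blk h).
  by rewrite brC root_e // ?(negPf njh) ?mul0r ?mulr0 ?oppr0 // jh.
by apply: (@e_root_in (blk j - blk i)) => //; lia.
Qed.

End Roots.

(** * Spans of ordered monomials *)

Section Span.
Variables (K : comNzRingType) (G : pzRingType) (eta : {rmorphism K -> G}).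
Hypothesis etaC : forall c x, eta c * x = x * eta c.
Implicit Types (S : G -> Prop).

(** Scalars act only through the central homomorphism [eta], so the span is given by generation and
    not as a submodule. *)
Inductive span S : G -> Prop :=
| span_nil : span S 0
| span_cons c x y : S x -> span S y -> span S (eta c * x + y).

Lemma span_in S x : S x -> span S x.
Proof. by move=> Sx; have := span_cons 1 Sx (span_nil S); rewrite rmorph1 mul1r addr0. Qed.
Lemma spanD S x y : span S x -> span S y -> span S (x + y).
Proof. by move=> Sx Sy; elim: Sx => [|c z w Sz _ IH]; rewrite ?add0r // -addrA; apply: span_cons. Qed.
Lemma spanZ S c x : span S x -> span S (eta c * x).
Proof.
elim=> [|b z w Sz _ IH]; first by rewrite mulr0; apply: span_nil.
by rewrite mulrDr mulrA -rmorphM; apply: span_cons.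
Qed.
Lemma spanN S x : span S x -> span S (- x).
Proof. by move=> Sx; rewrite -mulN1r -(rmorphN1 eta); apply: spanZ. Qed.
Lemma spanB S x y : span S x -> span S y -> span S (x - y).
Proof. by move=> Sx Sy; apply/spanD/spanN. Qed.
Lemma span_signr S (b : bool) x : span S x -> span S ((-1) ^+ b * x).
Proof. by case: b; rewrite ?mul1r // mulN1r; apply: spanN. Qed.
Lemma span_natr S (b : bool) x : span S x -> span S (b%:R * x).
Proof. by case: b; rewrite ?mul1r // mul0r => _; apply: span_nil. Qed.
Lemma span_sub S S' x : span S x -> (forall y, S y -> span S' y) -> span S' x.
Proof.
move=> + h; elim=> [|c z w Sz _ IH]; first exact: span_nil.
by apply: spanD => //; apply/spanZ/h.
Qed.
Lemma span_sum S I (r : seq I) (Q : pred I) (F : I -> G) :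
  (forall i, Q i -> span S (F i)) -> span S (\sum_(i <- r | Q i) F i).
Proof. by move=> SF; elim/big_ind: _ => //; [apply: span_nil | apply: spanD]. Qed.
Lemma span_mul S S' S'' x y : (forall u v, S u -> S' v -> span S'' (u * v)) ->
  span S x -> span S' y -> span S'' (x * y).
Proof.
move=> h Sx Sy; elim: Sx => [|c z w Sz _ IH]; first by rewrite mul0r; apply: span_nil.
rewrite mulrDl -mulrA; apply: spanD => //; apply: spanZ; elim: Sy => [|b u v Su _ IHy].
  by rewrite mulr0; apply: span_nil.
by rewrite mulrDr mulrA -etaC -mulrA; apply: spanD => //; apply/spanZ/h.
Qed.

Lemma br_etar a b c x y : br a b x (eta c * y) = eta c * br a b x y.
Proof.
rewrite !brE /sc mulrBr (mulrA x) -etaC -!mulrA; congr (_ - _).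
by case: (a && b); rewrite ?mul1r // !mulN1r mulrN.
Qed.
Lemma br_etal a b c x y : br a b (eta c * x) y = eta c * br a b x y.
Proof. by rewrite brC br_etar [in RHS]brC mulrN; congr (- _); case: (a && b); rewrite ?mul1r // !mulN1r mulrN. Qed.

Lemma span_br S S' S'' a b x y : (forall u v, S u -> S' v -> span S'' (br a b u v)) ->
  span S x -> span S' y -> span S'' (br a b x y).
Proof.
move=> h Sx Sy; elim: Sx => [|c z w Sz _ IH]; first by rewrite br0l; apply: span_nil.
rewrite brDl br_etal; apply: spanD => //; apply: spanZ; elim: Sy => [|b' u v Su _ IHy].
  by rewrite br0r; apply: span_nil.
by rewrite brDr br_etar; apply: spanD => //; apply/spanZ/h.
Qed.

(** Invariance under ad x, up to linear combinations; the families are indexed by parity because the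
    sign in the bracket needs it. *)
Definition maps (F F' : bool -> G -> Prop) a x :=
  forall b y, F b y -> span (F' (a (+) b)) (br a b x y).

Lemma maps_span F F' a x b y : maps F F' a x -> span (F b) y -> span (F' (a (+) b)) (br a b x y).
Proof.
move=> m; apply: (@span_br (fun z => z = x)) => [u v ->|]; first exact: m.
exact: span_in.
Qed.

(** Jacobi: invariance under a bracket follows from invariance under its two factors. So closure has
    to be checked only for simple vectors. *)
Lemma maps_br F F1 F2 F' a1 a2 x1 x2 : maps F F1 a1 x1 -> maps F1 F' a2 x2 ->
  maps F F2 a2 x2 -> maps F2 F' a1 x1 -> maps F F' (a1 (+) a2) (br a1 a2 x1 x2).
Proof.
move=> m1 m2 m3 m4 b y Fy; have := br_jacobi a1 a2 b x1 x2 y.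
move/eqP; rewrite -subr_eq => /eqP <-; apply: spanB.
  by rewrite -addbA; apply: maps_span m4 _; apply: m3.
by apply: span_signr; rewrite [a1 (+) a2]addbC -addbA; apply: maps_span m2 _; apply: m1.
Qed.

Section Triangular.
Variables (I : finType) (p : I -> bool) (blk : I -> nat) (s : nat -> nat) (mid : nat -> I).
Variable e : I -> I -> nat -> G.
Local Notation par i j := (p i (+) p j).
Local Notation lev := (lev s).
Local Notation root := (root p blk s mid e).
Hypothesis blk_mid : forall i j a, (blk i < a < blk j)%N -> blk (mid a) = a.
Hypothesis e_root_br : forall i j h k u v, blk k = (blk h).+1 -> (blk i < blk j)%N ->
  (s (blk h) <= u)%N -> (lev (blk i) (blk j) <= v)%N ->
  br (par h k) (par i j) (e h k u) (root i j v) =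
  (k == i)%:R * root h j (u + v) - (-1) ^+ (par h k && par i j) * ((j == h)%:R * root i k (v + u)).

Definition is_root a x := exists i j r, [/\ (blk i < blk j)%N, (lev (blk i) (blk j) <= r)%N,
  par i j = a & x = root i j r].
Definition is_simple a x := exists i j r, [/\ blk j = (blk i).+1, (s (blk i) <= r)%N,
  par i j = a & x = e i j r].

Lemma simple_root a x : is_simple a x -> is_root a x.
Proof.
by move=> [i [j [r [ji ir <- ->]]]]; exists i, j, r; rewrite root1 // ji lev1.
Qed.

Lemma root_ind (P : bool -> G -> Prop) : (forall a x, is_simple a x -> P a x) ->
  (forall a b x y, is_simple a x -> P a x -> is_root b y -> P b y -> P (a (+) b) (br a b x y)) ->
  forall a x, is_root a x -> P a x.
Proof.
move=> P1 P2 a x [i [j [r [ij jr <- ->]]]].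
have [n ji] : exists n, blk j = (blk i + n).+1 by exists (blk j - (blk i).+1)%N; lia.
elim: n i r ji ij jr => [|n IH] i r ji ij jr.
  rewrite addn0 in ji; rewrite root1 //; apply: P1; exists i, j, r; split=> //.
  by move: jr; rewrite ji lev1.
have mi : blk (mid (blk i).+1) = (blk i).+1 by apply: (@blk_mid i j); lia.
move: jr; rewrite lev_recl // => jr.
rewrite (root_def _ _ _ blk_mid); last lia.
rewrite [par i j](par_split p (mid (blk i).+1)).
have Sx : is_simple (par i (mid (blk i).+1)) (e i (mid (blk i).+1) (r - lev (blk i).+1 (blk j))).
  by exists i, (mid (blk i).+1), (r - lev (blk i).+1 (blk j))%N; split=> //; lia.
have mj : (blk (mid (blk i).+1) < blk j)%N by lia.
apply: P2 => //; first exact: P1.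
  by exists (mid (blk i).+1), j, (lev (blk i).+1 (blk j)); rewrite mi; split=> //; lia.
by apply: IH; rewrite ?mi //; lia.
Qed.

Lemma simple_maps_root a x : is_simple a x -> maps is_root is_root a x.
Proof.
move=> [h [k [u [kh hu <- ->]]]] b y [i [j [v [ij jv <- ->]]]].
rewrite e_root_br //; apply: spanB; last apply: span_signr.
  have [ki|_] := eqVneq k i; last by rewrite mul0r; apply: span_nil.
  subst i; rewrite mul1r; apply: span_in; exists h, j, (u + v)%N; split=> //; try lia.
    by rewrite lev_recl ?kh -?kh; lia.
have [jh|_] := eqVneq j h; last by rewrite mul0r; apply: span_nil.
subst j; rewrite mul1r; apply: span_in; exists i, k, (v + u)%N; split=> //; try lia.
by rewrite kh lev_recr; lia.
Qed.

Variable R0 : bool -> G -> Prop.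
Hypothesis R00 : forall a x, R0 a x -> maps R0 R0 a x.
Hypothesis R0e : forall a x, R0 a x -> maps is_simple is_simple a x.

Lemma zero_maps_root a x : R0 a x -> maps is_root is_root a x.
Proof.
move=> Rx b y Ry; elim/root_ind: b y / Ry => [b y Sy|b c y z Sy IHy Rz IHz].
  by apply: span_sub (R0e Rx Sy) _ => ? ?; apply/span_in/simple_root.
rewrite br_jacobi; apply: spanD; last first.
  apply: span_signr; rewrite addbCA; apply: maps_span IHz; exact: simple_maps_root.
rewrite addbA; apply: (@span_br (is_simple (a (+) b)) (is_root c)) => [u v Su Rv||]; last exact: span_in.
  exact: (simple_maps_root Su).
exact: R0e.
Qed.

Definition is_nonneg a x := R0 a x \/ is_root a x.

Lemma root_maps_zero a x : is_root a x -> maps R0 is_root a x.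
Proof.
move=> Rx b y Ry; rewrite brC addbC; apply/spanN/span_signr; exact: zero_maps_root.
Qed.

Lemma simple_maps_nonneg a x : is_simple a x -> maps is_nonneg is_root a x.
Proof.
move=> Sx b y [Ry|Ry]; last exact: simple_maps_root.
exact: root_maps_zero (simple_root Sx) _ _ _.
Qed.

(** Applied to simple vectors z of the opposite triangle. It is enough that z sends simple vectors
    to zero roots: Jacobi carries it past the simple factors of a longer root, and the remainders
    stay in the nonnegative part. *)
Lemma lower_maps_root c z : (forall b y, is_simple b y -> span (R0 (c (+) b)) (br c b z y)) ->
  maps is_root is_nonneg c z.
Proof.
move=> zS b y Ry; elim/root_ind: b y / Ry => [b y Sy|a b x y Sx _ Ry IHy].
  by apply: span_sub (zS _ _ Sy) _ => *; apply: span_in; left.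
rewrite br_jacobi; apply: spanD; last first.
  apply: span_signr; rewrite addbCA; apply: span_sub (maps_span (simple_maps_nonneg Sx) IHy) _ => *.
  by apply: span_in; right.
rewrite addbA; apply: (@span_br (R0 (c (+) a)) (is_root b)) => [u v Ru Rv||]; last exact: span_in.
  by apply: span_sub (zero_maps_root Ru Rv) _ => *; apply: span_in; right.
exact: zS.
Qed.

End Triangular.

(** * Reordering words: the spanning half of the Poincare-Birkhoff-Witt theorem *)

Section Pbw.
Variables (X : countType) (q : X -> bool) (v : X -> G) (valid : X -> bool) (half : K).
Hypothesis half2 : half + half = 1.
Definition is_val a x := exists z, [/\ valid z, q z = a & x = v z].
Hypothesis closed : forall x y, valid x -> valid y ->
  span (is_val (q x (+) q y)) (br (q x) (q y) (v x) (v y)).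

(** The order of the letters is that of their enumeration. Reflexivity is kept for even letters
    only, so that in a sorted word every odd letter occurs at most once. *)
Definition pbw_le (x y : X) := (choice.pickle x < choice.pickle y)%N || ((x == y) && ~~ q x).
Definition pbw_word (w : seq X) := sorted pbw_le w && all valid w.
Definition word (w : seq X) : G := \prod_(x <- w) v x.

Lemma word_cons x w : word (x :: w) = v x * word w. Proof. exact: big_cons. Qed.
Lemma word_cat u w : word (u ++ w) = word u * word w. Proof. exact: big_cat. Qed.

Definition short n x := exists w, [/\ (size w < n)%N, all valid w & x = word w].

Lemma bracket_short u x y w : all valid u -> all valid w -> valid x -> valid y ->
  span (short (size u + size w).+2) (word u * br (q x) (q y) (v x) (v y) * word w).
Proof.
move=> vu vw vx vy; apply: (@span_mul (short (size u).+2) (fun z => z = word w)); last exact: span_in.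
  move=> _ _ [w1 [s1 v1 ->]] ->; apply: span_in; exists (w1 ++ w).
  by rewrite size_cat all_cat v1 vw word_cat; split=> //; lia.
apply: (@span_mul (fun z => z = word u) (is_val (q x (+) q y))); last exact: closed.
  move=> _ _ -> [z [vz _ ->]]; apply: span_in; exists (u ++ [:: z]).
  by rewrite size_cat /= addn1 all_cat vu /= vz word_cat /word big_seq1.
exact: span_in.
Qed.

Lemma short_consl n x y : valid x -> span (short n) y -> span (short n.+1) (v x * y).
Proof.
move=> vx; apply: (@span_mul (fun z => z = v x)); last exact: span_in.
move=> _ _ -> [w [sw vw ->]]; apply: span_in; exists (x :: w); split=> //=; rewrite ?vx ?vw //.
by rewrite word_cons.
Qed.

Lemma swapE x y : v x * v y = (-1) ^+ (q x && q y) * (v y * v x) + br (q x) (q y) (v x) (v y).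
Proof. by rewrite brE /sc addrC subrK. Qed.

Local Notation ple := (fun x y : X => (choice.pickle x <= choice.pickle y)%N).

(** One step of insertion sort, up to a sign and shorter words: the bracket produced by each swap is
    a combination of single letters and so shortens the word by one. *)
Lemma insert_word x w : valid x -> all valid w -> sorted ple w -> exists b : bool, exists w',
  [/\ sorted ple w', perm_eq w' (x :: w) &
      span (short (size w).+1) (word (x :: w) - (-1) ^+ b * word w')].
Proof.
move=> vx; elim: w => [|y w IH] vw sw.
  by exists false, [:: x]; split=> //; rewrite mul1r subrr; apply: span_nil.
have [xy|yx] := leqP (choice.pickle x) (choice.pickle y).
  exists false, (x :: y :: w); split=> //=; first by rewrite xy.
  by rewrite mul1r subrr; apply: span_nil.
have /andP[vy vw'] := vw.
have [b [w' [sw' pw' sp]]] := IH vw' (path_sorted sw).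
exists (b (+) (q x && q y)), (y :: w'); split.
- rewrite /= path_min_sorted //; apply/allP => z; rewrite (perm_mem pw') inE => /orP[/eqP->|zw].
    exact: ltnW.
  have := order_path_min _ sw; move/(_ (fun _ _ _ => @leq_trans _ _ _)) => /allP; exact.
- by rewrite -(perm_cons y) in pw'; apply: perm_trans pw' _; apply/permP => a /=; rewrite addnCA.
rewrite !word_cons mulrA swapE mulrDl addrAC; apply: spanD; last first.
  by have := @bracket_short [::] x y w isT vw' vx vy; rewrite /word big_nil mul1r.
rewrite addbC -mulr_sign2 -!mulrA -mulrBr [(-1) ^+ b * _]mulrA signrC -mulrA -mulrBr.
have [sz] : size w' = (size w).+1 by rewrite (perm_size pw').
by apply: span_signr; rewrite -word_cons; apply: short_consl.
Qed.

Lemma sort_word w : all valid w -> exists b : bool, exists w',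
  [/\ sorted ple w', perm_eq w' w & span (short (size w)) (word w - (-1) ^+ b * word w')].
Proof.
elim: w => [_|x w IH /= /andP[vx vw]].
  by exists false, [::]; split=> //; rewrite mul1r subrr; apply: span_nil.
have [b [w' [sw' pw' sp]]] := IH vw.
have vw' : all valid w' by rewrite (perm_all _ pw').
have [c [u [su pu sp']]] := insert_word vx vw' sw'.
exists (b (+) c), u; split=> //; first by rewrite (perm_trans pu) // perm_cons.
rewrite (perm_size pw') in sp'.
have -> : word (x :: w) - (-1) ^+ (b (+) c) * word u =
    v x * (word w - (-1) ^+ b * word w') + (-1) ^+ b * (word (x :: w') - (-1) ^+ c * word u).
  rewrite !word_cons [in RHS]mulrBr [v x * ((-1) ^+ b * _)]mulrA -signrC -mulrA.
  by rewrite [in RHS]mulrBr mulr_sign2 addrA subrK.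
by apply: spanD; [apply: short_consl | apply: span_signr].
Qed.

Lemma sorted_dichotomy w : sorted ple w -> sorted pbw_le w \/
  exists u x u', w = u ++ [:: x, x & u'] /\ q x.
Proof.
elim: w => [|x [|y w] IH] /=; [by left | by left | move=> /andP[xy yw]].
have [sw|[u [z [u' [-> qz]]]]] := IH yw; last first.
  by right; exists (x :: u), z, u'.
rewrite [path _ _ _]sw andbT /pbw_le ltn_neqAle xy andbT.
have [/(pcan_inj choice.pickleK) e|_] := eqVneq; last by left.
subst y; rewrite eqxx /=; case e: (q x); last by left.
by right; exists [::], x, w.
Qed.

Definition pbw n x := exists w, [/\ (size w <= n)%N, pbw_word w & x = word w].

(** A weakly sorted word fails to be a PBW word only through a repeated odd letter x. There $x^2$ is
    half of [x, x], again a combination of single letters, and the word becomes shorter. *)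
Lemma word_pbw w : all valid w -> span (pbw (size w)) (word w).
Proof.
have [n] := ubnP (size w); elim: n w => // n IH w; rewrite ltnS => wn vw.
have sh m x : (m <= n)%N -> span (short m) x -> span (pbw m.-1) x.
  move=> mn Sx; apply: span_sub Sx _ => y [u [um vu ->]].
  have := IH u; rewrite (leq_trans um mn) => /(_ isT vu) Su.
  by apply: span_sub Su _ => z [u' [s1 s2 ->]]; apply: span_in; exists u'; split=> //; lia.
have up m m' x : (m <= m')%N -> span (pbw m) x -> span (pbw m') x.
  move=> mm Sx; apply: span_sub Sx _ => y [u [um vu ->]]; apply: span_in; exists u; split=> //; lia.
have [b [w' [sw' pw' sp]]] := sort_word vw.
rewrite -(subrK ((-1) ^+ b * word w') (word w)); apply: spanD.
  by apply: up (sh _ _ wn sp); lia.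
apply: span_signr; have vw' : all valid w' by rewrite (perm_all _ pw').
rewrite -(perm_size pw') in wn *; have [s'|[u [x [u' [e qx]]]]] := sorted_dichotomy sw'.
  by apply: span_in; exists w'; rewrite /pbw_word s'.
subst w'; move: vw'; rewrite all_cat => /andP[vu /and3P[vx _ vu']].
have -> : word (u ++ [:: x, x & u']) = eta half * (word u * br (q x) (q x) (v x) (v x) * word u').
  rewrite brE /sc qx mulN1r opprK word_cat !word_cons !mulrA etaC -!mulrA; congr (_ * _).
  by rewrite mulrDl mulrDr -mulrDl -rmorphD half2 rmorph1 mul1r mulrA.
apply: spanZ; apply: up (sh _ _ _ (bracket_short vu vu' vx vx)); move: wn; rewrite size_cat /=; lia.
Qed.

End Pbw.

(** * Closure of upper, zero and lower root vectors under brackets *)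

Section Opposite.
Variables (I : finType) (p : I -> bool) (R0 : bool -> G -> Prop).
Variables (blk blk' : I -> nat) (s s' : nat -> nat) (mid mid' : nat -> I) (e f : I -> I -> nat -> G).
Local Notation par i j := (p i (+) p j).
Local Notation isR := (is_root p blk s mid e).
Local Notation isR' := (is_root p blk' s' mid' f).
Local Notation isS := (is_simple p blk s e).
Local Notation isS' := (is_simple p blk' s' f).
Hypothesis mapsS : forall a x, isS a x -> maps isR isR a x.
Hypothesis maps0 : forall a x, isS a x -> maps R0 isR a x.
Hypothesis maps' : forall a x, isS a x -> maps isR' (is_nonneg p blk' s' mid' f R0) a x.

Definition is_loop a x := [\/ isR a x, R0 a x | isR' a x].

Lemma simple_stable a x : isS a x -> maps is_loop is_loop a x.
Proof.
move=> Sx b y [Ry|Ry|Ry].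
- by apply: span_sub (mapsS Sx Ry) _ => *; apply: span_in; apply: Or31.
- by apply: span_sub (maps0 Sx Ry) _ => *; apply: span_in; apply: Or31.
by apply: span_sub (maps' Sx Ry) _ => z [Rz|Rz]; apply: span_in; [apply: Or32 | apply: Or33].
Qed.

Hypothesis blk_mid : forall i j a, (blk i < a < blk j)%N -> blk (mid a) = a.
Lemma root_stable a x : isR a x -> maps is_loop is_loop a x.
Proof.
move=> Rx; move: a x Rx; apply: (root_ind blk_mid) => [a x|a b x y _ ? _ ?]; first exact: simple_stable.
by apply: (@maps_br _ is_loop is_loop).
Qed.
End Opposite.

(** The symmetry between the two triangles; the lower case of [loop_closed] is the upper case with
    the roles exchanged. *)
Lemma is_loopC (I : finType) (p : I -> bool) R0 blk blk' s s' mid mid' e f a x :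
  is_loop p R0 blk blk' s s' mid mid' e f a x -> is_loop p R0 blk' blk s' s mid' mid f e a x.
Proof. by case=> ?; [apply: Or33 | apply: Or32 | apply: Or31]. Qed.

Section Loop.
Variables (I : finType) (p : I -> bool) (R0 : bool -> G -> Prop).
Variables (blk blk' : I -> nat) (s s' : nat -> nat) (mid mid' : nat -> I) (e f : I -> I -> nat -> G).
Local Notation par i j := (p i (+) p j).
Local Notation isS := (is_simple p blk s e).
Local Notation isS' := (is_simple p blk' s' f).
Hypothesis blk_mid : forall i j a, (blk i < a < blk j)%N -> blk (mid a) = a.
Hypothesis blk_mid' : forall i j a, (blk' i < a < blk' j)%N -> blk' (mid' a) = a.
Hypothesis e_br : forall i j h k u v, blk k = (blk h).+1 -> (blk i < blk j)%N ->
  (s (blk h) <= u)%N -> (lev s (blk i) (blk j) <= v)%N ->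
  br (par h k) (par i j) (e h k u) (root p blk s mid e i j v) =
  (k == i)%:R * root p blk s mid e h j (u + v) -
  (-1) ^+ (par h k && par i j) * ((j == h)%:R * root p blk s mid e i k (v + u)).
Hypothesis f_br : forall i j h k u v, blk' k = (blk' h).+1 -> (blk' i < blk' j)%N ->
  (s' (blk' h) <= u)%N -> (lev s' (blk' i) (blk' j) <= v)%N ->
  br (par h k) (par i j) (f h k u) (root p blk' s' mid' f i j v) =
  (k == i)%:R * root p blk' s' mid' f h j (u + v) -
  (-1) ^+ (par h k && par i j) * ((j == h)%:R * root p blk' s' mid' f i k (v + u)).
Hypothesis R00 : forall a x, R0 a x -> maps R0 R0 a x.
Hypothesis R0e : forall a x, R0 a x -> maps isS isS a x.
Hypothesis R0f : forall a x, R0 a x -> maps isS' isS' a x.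
Hypothesis ef : forall a b x y, isS a x -> isS' b y -> span (R0 (a (+) b)) (br a b x y).

Local Notation loop := (is_loop p R0 blk blk' s s' mid mid' e f).
Lemma loop_closed a x : loop a x -> maps loop loop a x.
Proof.
case=> Rx.
- apply: root_stable Rx => // c z Sz.
  + exact: simple_maps_root.
  + exact/root_maps_zero/simple_root.
  + by apply: lower_maps_root => // b y; apply: ef.
- move=> b y [Ry|Ry|Ry].
  + by apply: span_sub (zero_maps_root blk_mid e_br R0e Rx Ry) _ => *; apply: span_in; apply: Or31.
  + by apply: span_sub (R00 Rx Ry) _ => *; apply: span_in; apply: Or32.
  + by apply: span_sub (zero_maps_root blk_mid' f_br R0f Rx Ry) _ => *; apply: span_in; apply: Or33.
move=> b y /is_loopC Ry.
suff S : span (is_loop p R0 blk' blk s' s mid' mid f e (a (+) b)) (br a b x y).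
  by apply: span_sub S _ => z /is_loopC; apply: span_in.
apply: root_stable Rx _ _ Ry => // c z Sz.
- exact: simple_maps_root.
- exact/root_maps_zero/simple_root.
- apply: lower_maps_root => // d w Sw; rewrite brC addbC; apply/spanN/span_signr; exact: ef.
Qed.

End Loop.

End Span.

(** * The associated graded algebra of the presented algebra *)

Lemma span_image (K : comNzRingType) (A B : pzRingType) (eta : {rmorphism K -> A})
    (eta' : {rmorphism K -> B}) (h : {rmorphism A -> B}) (S : A -> Prop) y :
  (forall c, h (eta c) = eta' c) ->
  span eta' (fun y => exists2 x, S x & y = h x) y <-> exists2 x, span eta S x & y = h x.
Proof.
move=> he; split=> [|[x Sx ->]].
  elim=> [|c z w [x Sx ->] _ [x' Sx' ->]]; first by exists 0; rewrite ?rmorph0 //; apply: span_nil.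
  by exists (eta c * x + x'); [apply: span_cons | rewrite rmorphD rmorphM he].
elim: Sx => [|c u w Su _ IH]; first by rewrite rmorph0; apply: span_nil.
by rewrite rmorphD rmorphM he; apply: span_cons => //; exists u.
Qed.

Section Low.
Variables (K : comNzRingType) (A : pzRingType) (eta : {rmorphism K -> A}).
Hypothesis etaC : forall c x, eta c * x = x * eta c.
Variables (X : choiceType) (dg : X -> nat) (v : X -> A).

Definition weight (w : seq X) := (\sum_(g <- w) dg g)%N.
(** The filtration is indexed by a strict bound: [low n] means degree less than n. So [low 0]
    contains only 0, and inductions on degree have a trivial start. *)
Definition low n := span eta (fun y => exists2 w, (weight w < n)%N & y = \prod_(g <- w) v g).

Lemma low_le m n x : (m <= n)%N -> low m x -> low n x.
Proof.
move=> mn Lx; apply: span_sub Lx _ => _ [w wm ->]; apply: span_in.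
by exists w => //; apply: leq_trans mn.
Qed.
Lemma low_prod w n : (weight w < n)%N -> low n (\prod_(g <- w) v g).
Proof. by move=> wn; apply: span_in; exists w. Qed.
Lemma low_gen g : low (dg g).+1 (v g).
Proof. by rewrite -[v g](big_seq1 *%R g v); apply: low_prod; rewrite /weight big_seq1. Qed.
Lemma low1 n : low n.+1 1.
Proof. by rewrite -(big_nil 1 *%R predT v); apply: low_prod; rewrite /weight big_nil. Qed.
Lemma lowD n x y : low n x -> low n y -> low n (x + y). Proof. exact: spanD. Qed.
Lemma lowN n x : low n x -> low n (- x). Proof. exact: spanN. Qed.
Lemma low0 n : low n 0. Proof. exact: span_nil. Qed.
Lemma lowM l m n x y : (l + m <= n.+1)%N -> low l x -> low m y -> low n (x * y).
Proof.
move=> lmn; apply: span_mul => // _ _ [u ul ->] [w wm ->].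
by rewrite -big_cat; apply: low_prod; rewrite /weight big_cat /=; rewrite /weight in ul wm; lia.
Qed.
Lemma low_sum n I (r : seq I) (Q : pred I) (f : I -> A) : (forall i, Q i -> low n (f i)) ->
  low n (\sum_(i <- r | Q i) f i).
Proof. exact: span_sum. Qed.
Lemma low_zero x : low 0 x -> x = 0.
Proof. by elim=> // c z w [u]. Qed.
End Low.

Section Graded.
Variables (K : comNzRingType) (X : choiceType) (dg : X -> nat).
Variable rels : free_alg K X -> free_alg K X -> Prop.
Local Notation FA := (free_alg K X).
Local Notation P := (presented rels).
Local Notation pi := (pres_pi_rm rels).
Local Notation lowP := (low (pres_cst rels) dg (pres_gen rels)).

Definition fps_const : {rmorphism K -> fps P} := rcomp (fps_cst_rm P) (pres_cst rels).
Lemma fps_constC c x : fps_const c * x = x * fps_const c.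
Proof. by apply: fpsP => n; rewrite /= fps_cstMl fps_cstMr pres_cstC. Qed.
(** Each generator goes to the coefficient of its degree. The n-th coefficient of the image of f is
    then the class in P of the part of weight n of f, obtained without splitting f itself. *)
Definition graded_gen g : fps P := fun n => if n == dg g then pres_gen rels g else 0.
Definition graded_ev : {rmorphism FA -> fps P} := free_eval_rm graded_gen fps_constC.
Definition comp (n : nat) (f : FA) : P := graded_ev f n.

Lemma comp0 n : comp n 0 = 0. Proof. by rewrite /comp rmorph0. Qed.
Lemma compD n f g : comp n (f + g) = comp n f + comp n g. Proof. by rewrite /comp rmorphD. Qed.
Lemma compN n f : comp n (- f) = - comp n f. Proof. by rewrite /comp rmorphN. Qed.
Lemma compB n f g : comp n (f - g) = comp n f - comp n g. Proof. by rewrite /comp rmorphB. Qed.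
Lemma compM n f g : comp n (f * g) = \sum_(t < n.+1) comp t f * comp (n - t) g.
Proof. by rewrite /comp rmorphM. Qed.
Lemma compZ n c f : comp n (c *: f) = c *: comp n f.
Proof. by rewrite /comp free_evalZ /= fps_cstMl pres_cstMl. Qed.
Lemma comp1 n : comp n 1 = (n == 0%N)%:R. Proof. by rewrite /comp rmorph1 fps1E. Qed.
Lemma comp_gen n g : comp n (free_gen K g) = if n == dg g then pres_gen rels g else 0.
Proof. by rewrite /comp free_eval_gen. Qed.

Lemma lowZ n (c : K) x : lowP n x -> lowP n (c *: x).
Proof. by rewrite -pres_cstMl; apply: spanZ. Qed.

Lemma comp_low n f : lowP n.+1 (comp n f).
Proof.
elim/free_ind: f n => [||c f IH|f g IHf IHg|g f IH] n.
- by rewrite comp0; apply: low0.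
- rewrite comp1; case: eqP => _; last exact: low0.
  by apply: low_le (low1 _ _ _ 0); lia.
- by rewrite compZ; apply: lowZ.
- by rewrite compD; exact: lowD (IHf n) (IHg n).
rewrite compM; apply: low_sum => t _; rewrite comp_gen; case: eqP => [e|_]; last by rewrite mul0r; apply: low0.
by apply: lowM (low_gen _ _ _ g) (IH _); [apply: pres_cstC | have := ltn_ord t; lia].
Qed.

(** The kernel of the passage to the associated graded algebra: each component drops below its own
    degree in P. The graded algebra is presented by setting these elements to zero, so that the
    general construction of presented algebras provides its ring structure. *)
Definition small (f : FA) := forall n, lowP n (comp n f).

Local Notation gpi := (pres_pi_rm (fun f g => small (f - g))).

(** Small elements already form a two-sided ideal, so nothing else is identified with 0. *)
Lemma gr0P f : gpi f = 0 -> small f.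
Proof.
move/pres_piP; rewrite subr0; elim=> [l r //|n|x y _ IHx _ IHy n|a x _ IH n|a x _ IH n].
- by rewrite comp0; apply: low0.
- by rewrite compD; exact: lowD (IHx n) (IHy n).
- rewrite compM; apply: low_sum => t _; apply: lowM (comp_low _ _) (IH _); first exact: pres_cstC.
  by have := ltn_ord t; lia.
rewrite compM; apply: low_sum => t _; apply: lowM (IH _) (comp_low _ _); first exact: pres_cstC.
by have := ltn_ord t; lia.
Qed.

(** Homogeneity of the classes in P only, which is weaker than homogeneity in the free algebra but
    sufficient for comparing leading terms. *)
Definition homog n (f : FA) := forall d, comp d f = if d == n then pi f else 0.

Lemma homog_gen g : homog (dg g) (free_gen K g). Proof. by move=> d; apply: comp_gen. Qed.
Lemma homog0 n : homog n 0. Proof. by move=> d; rewrite comp0 rmorph0 if_same. Qed.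
Lemma homog1 : homog 0 1. Proof. by move=> d; rewrite comp1 rmorph1; case: eqP. Qed.
Lemma homogD n f g : homog n f -> homog n g -> homog n (f + g).
Proof. by move=> hf hg d; rewrite compD hf hg rmorphD; case: ifP; rewrite ?addr0. Qed.
Lemma homogN n f : homog n f -> homog n (- f).
Proof. by move=> hf d; rewrite compN hf rmorphN; case: ifP; rewrite ?oppr0. Qed.
Lemma homogB n f g : homog n f -> homog n g -> homog n (f - g).
Proof. by move=> hf /homogN; apply: homogD. Qed.
Lemma homogM m n f g : homog m f -> homog n g -> homog (m + n)%N (f * g).
Proof.
move=> hf hg d; rewrite compM; case: eqP => [->|ne]; last first.
  rewrite big1 // => t _; rewrite hf hg; case: eqP => [e|_]; last by rewrite mul0r.
  by case: eqP => [e'|_]; [have := ltn_ord t; lia | rewrite mulr0].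
have lt : (m < (m + n).+1)%N by lia.
rewrite (sum_one (i := Ordinal lt)); [|by []|move=> t _ nt].
  by rewrite hf hg addKn !eqxx -rmorphM.
by rewrite hf; case: eqP => [e|_]; [case/eqP: nt; apply: val_inj | rewrite mul0r].
Qed.
Lemma homog_sign n (b : nat) f : homog n f -> homog n ((-1) ^+ b * f).
Proof. by rewrite -signr_odd; case: odd; rewrite ?mul1r // mulN1r; apply: homogN. Qed.
Lemma homog_br m n a b f g : homog m f -> homog n g -> homog (m + n)%N (br a b f g).
Proof.
move=> hf hg; rewrite brE; apply: homogB; first exact: homogM.
by apply: homog_sign; rewrite addnC; apply: homogM.
Qed.

Lemma gr_eq n f g : homog n f -> homog n g -> lowP n (pi f - pi g) -> gpi f = gpi g.
Proof.
move=> hf hg lo; apply/pres_piP; rewrite -[f - g]subr0; apply: rel_ideal_rel => d.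
rewrite subr0 (homogB hf hg) rmorphB; case: eqP => [->//|_]; exact: low0.
Qed.

Definition malg_cst : {rmorphism K -> FA} := @malgC _ K.

(** Induction on the degree. A word of weight n equals in the graded algebra a combination of images
    from S; the component of degree n of that combination differs from the word in P by an element
    of degree less than n. *)
Lemma gr_span (S : FA -> Prop) : (forall f, S f -> exists n, homog n f) ->
  (forall w : seq X, span (pres_cst (fun f g => small (f - g))) (fun y => exists2 f, S f & y = gpi f)
     (gpi (\prod_(g <- w) free_gen K g))) ->
  forall x : P, span (pres_cst rels) (fun y => exists2 f, S f & y = pi f) x.
Proof.
move=> Sh SG.
have word_homog w : homog (weight dg w) (\prod_(g <- w) free_gen K g).
  elim: w => [|g w IH]; first by rewrite /weight !big_nil; apply: homog1.
  by rewrite /weight !big_cons; apply: homogM => //; apply: homog_gen.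
have piw w : pi (\prod_(g <- w) free_gen K g) = \prod_(g <- w) pres_gen rels g by rewrite rmorph_prod.
have main n x : lowP n x -> span (pres_cst rels) (fun y => exists2 f, S f & y = pi f) x.
  elim: n x => [x /low_zero ->|n IH x]; first exact: span_nil.
  move=> Lx; apply: span_sub Lx _ => _ [w wn ->].
  have [wn'|wn'] := ltnP (weight dg w) n; first exact/IH/low_prod.
  have en : n = weight dg w by lia.
  have [f Sf ef] := (@span_image _ _ _ malg_cst (pres_cst (fun f g => small (f - g))) gpi S _
    (fun c => erefl)).1 (SG w).
  have /gr0P /(_ n) : gpi (\prod_(g <- w) free_gen K g - f) = 0 by rewrite rmorphB ef subrr.
  rewrite compB (word_homog w) en eqxx piw -en => Lf; have s1 := IH _ Lf.
  rewrite -[X in span _ _ X](subrK (comp n f)); apply: spanD => //.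
  elim: Sf => [|c z u Sz _ IHu]; first by rewrite comp0; apply: span_nil.
  rewrite compD /= mul_malgC compZ -pres_cstMl; apply: spanD => //; apply: spanZ.
  have [d hz] := Sh _ Sz; rewrite hz; case: ifP => _; last exact: span_nil.
  by apply: span_in; exists z.
move=> x; have [n Lx] : exists n, lowP n x; last exact: main Lx.
elim/pres_pi_ind: x; apply: free_ind => [||c f [n IH]|f g [m IHf] [n IHg]|g f [n IH]].
- by exists 0%N; rewrite rmorph0; apply: low0.
- by exists 1%N; rewrite rmorph1; apply: low1.
- by exists n; rewrite pres_piZ; apply: lowZ.
- exists (maxn m n); rewrite pres_piD.
  by apply: lowD; [apply: low_le IHf; apply: leq_maxl | apply: low_le IHg; apply: leq_maxr].
- exists (dg g + n)%N; rewrite pres_piM.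
  by apply: (lowM (@pres_cstC _ _ _) _ (low_gen _ _ _ g) IH); rewrite addSn.
Qed.

End Graded.

(** Truncated subtraction gives degree 0 to exponent 0, in agreement with $D^{(0)}$ and $D'^{(0)}$
    being constants. *)
Definition symbol_degree (g : parabolic_symbol) : nat :=
  match g with SD _ _ _ r | SD' _ _ _ r | SE _ _ _ r | SF _ _ _ r => r.-1 end.

(** * Leading terms of the relations (R1)-(R16) *)

Section Leading.
Variables (N : nat) (Ups : seq bool) (sigma : 'M[nat]_N) (mu : seq nat).
Hypothesis sum_mu : sumn mu = N.
Local Notation blk := (@blk_of N mu).
Local Notation off := (@off_of N mu).
Local Notation p := (@ord_digit N Ups).
Local Notation par i j := (p i (+) p j).
Local Notation smu a b := (block_shift sigma mu a b).
Variables (A Q G : pzRingType) (ev : {rmorphism A -> Q}) (gp : {rmorphism A -> G}).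
Variables (sym : parabolic_symbol -> A) (com : A -> A -> A) (gpure : bool -> A -> Prop).
Variables (hom : nat -> A -> Prop) (lo : nat -> Q -> Prop).
Hypothesis pure_sym : forall g, gpure (symbol_parity Ups mu g) (sym g).
Hypothesis gp_scomm : forall a b x y, gpure a x -> gpure b y -> gp (com x y) = br a b (gp x) (gp y).
Hypothesis pure_scomm : forall a b x y, gpure a x -> gpure b y -> gpure (a (+) b) (com x y).
Hypothesis hom_sym : forall g, hom (symbol_degree g) (sym g).
Hypothesis hom_com : forall a b m n x y, gpure a x -> gpure b y -> hom m x -> hom n y ->
  hom (m + n)%N (com x y).
Hypothesis hom0 : forall n, hom n 0.
Hypothesis homD : forall n x y, hom n x -> hom n y -> hom n (x + y).
Hypothesis homN : forall n x, hom n x -> hom n (- x).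
Hypothesis lo_sym : forall n g g', (symbol_degree g + symbol_degree g' < n)%N ->
  lo n (ev (sym g) * ev (sym g')).
Hypothesis lo0 : forall n, lo n 0.
Hypothesis loD : forall n x y, lo n x -> lo n y -> lo n (x + y).
Hypothesis loN : forall n x, lo n x -> lo n (- x).
Hypothesis gr_eq : forall n x y, hom n x -> hom n y -> lo n (ev x - ev y) -> gp x = gp y.

Hypothesis hR2 : forall a i j r, listed sigma mu (SD a i j r) ->
  ev (\sum_(q < nth 0%N mu a) \sum_(t < r.+1) sym (SD a i q t) * sym (SD' a q j (r - t)))
  = ev ((r == 0%N)%:R * (i == j)%:R).
Hypothesis hR3 : forall a i j r b h k s, listed sigma mu (SD a i j r) -> listed sigma mu (SD b h k s) ->
  ev (com (sym (SD a i j r)) (sym (SD b h k s))) =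
  ev ((a == b)%:R * (-1) ^+ (bdigit Ups mu a i * bdigit Ups mu a j + bdigit Ups mu a i * bdigit Ups mu a h
     + bdigit Ups mu a j * bdigit Ups mu a h) *
     \sum_(t < minn r s) (sym (SD a h j t) * sym (SD a i k (r + s - 1 - t))
          - sym (SD a h j (r + s - 1 - t)) * sym (SD a i k t))).
Hypothesis hR4 : forall a i j r b h k s, listed sigma mu (SD a i j r) -> listed sigma mu (SE b h k s) ->
  ev (com (sym (SD a i j r)) (sym (SE b h k s))) =
  ev ((a == b)%:R * (h == j)%:R * (-1) ^+ (bdigit Ups mu a h * bdigit Ups mu a j) *
       (\sum_(q < nth 0%N mu a) \sum_(t < r) sym (SD a i q t) * sym (SE b q k (r + s - 1 - t)))
     - (a == b.+1)%:R * (-1) ^+ (bdigit Ups mu b h * bdigit Ups mu a k + bdigit Ups mu b h * bdigit Ups mu a j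
         + bdigit Ups mu a j * bdigit Ups mu a k) *
       (\sum_(t < r) sym (SD a i k t) * sym (SE b h j (r + s - 1 - t)))).
Hypothesis hR5 : forall a i j r b h k s, listed sigma mu (SD a i j r) -> listed sigma mu (SF b h k s) ->
  ev (com (sym (SD a i j r)) (sym (SF b h k s))) =
  ev (- ((a == b)%:R * (i == k)%:R * (-1) ^+ (bdigit Ups mu a i * bdigit Ups mu a j
          + bdigit Ups mu a.+1 h * bdigit Ups mu a i + bdigit Ups mu a.+1 h * bdigit Ups mu a j) *
          (\sum_(q < nth 0%N mu a) \sum_(t < r) sym (SF b h q (r + s - 1 - t)) * sym (SD a q j t)))
       + (a == b.+1)%:R * (-1) ^+ (bdigit Ups mu a h * bdigit Ups mu b k + bdigit Ups mu a h * bdigit Ups mu a j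
           + bdigit Ups mu a j * bdigit Ups mu b k) *
         (\sum_(t < r) sym (SF b i k (r + s - 1 - t)) * sym (SD a h j t))).
Hypothesis hR6 : forall a i j r b h k s, listed sigma mu (SE a i j r) -> listed sigma mu (SF b h k s) ->
  ev (com (sym (SE a i j r)) (sym (SF b h k s))) =
  ev ((a == b)%:R * (-1) ^+ (bdigit Ups mu a.+1 h * bdigit Ups mu a k
      + bdigit Ups mu a.+1 j * bdigit Ups mu a k + bdigit Ups mu a.+1 h * bdigit Ups mu a.+1 j + 1) *
      \sum_(t < r + s) sym (SD' a i k (r + s - 1 - t)) * sym (SD a.+1 h j t)).
Hypothesis hR7 : forall a i j r h k s, listed sigma mu (SE a i j r) -> listed sigma mu (SE a h k s) ->
  ev (com (sym (SE a i j r)) (sym (SE a h k s))) =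
  ev ((-1) ^+ (bdigit Ups mu a h * bdigit Ups mu a.+1 j + bdigit Ups mu a.+1 j * bdigit Ups mu a.+1 k
        + bdigit Ups mu a h * bdigit Ups mu a.+1 k) *
       (\sum_((smu a a.+1).+1 <= t < s) sym (SE a i k (r + s - 1 - t)) * sym (SE a h j t)
        - \sum_((smu a a.+1).+1 <= t < r) sym (SE a i k (r + s - 1 - t)) * sym (SE a h j t))).
Hypothesis hR8 : forall a i j r h k s, listed sigma mu (SF a i j r) -> listed sigma mu (SF a h k s) ->
  ev (com (sym (SF a i j r)) (sym (SF a h k s))) =
  ev ((-1) ^+ (bdigit Ups mu a.+1 h * bdigit Ups mu a j + bdigit Ups mu a j * bdigit Ups mu a k
        + bdigit Ups mu a.+1 h * bdigit Ups mu a k) *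
       (\sum_((smu a.+1 a).+1 <= t < r) sym (SF a i k (r + s - 1 - t)) * sym (SF a h j t)
        - \sum_((smu a.+1 a).+1 <= t < s) sym (SF a i k (r + s - 1 - t)) * sym (SF a h j t))).
Hypothesis hR9 : forall a i j r h k s, listed sigma mu (SE a i j r) -> listed sigma mu (SE a.+1 h k s) ->
  ev (com (sym (SE a i j r.+1)) (sym (SE a.+1 h k s))
      - com (sym (SE a i j r)) (sym (SE a.+1 h k s.+1))) =
  ev ((-1) ^+ (bdigit Ups mu a.+1 j * bdigit Ups mu a.+1 h) * (h == j)%:R *
       \sum_(q < nth 0%N mu a.+1) sym (SE a i q r) * sym (SE a.+1 q k s)).
Hypothesis hR10 : forall a i j r h k s, listed sigma mu (SF a i j r) -> listed sigma mu (SF a.+1 h k s) ->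
  ev (com (sym (SF a i j r.+1)) (sym (SF a.+1 h k s))
      - com (sym (SF a i j r)) (sym (SF a.+1 h k s.+1))) =
  ev ((-1) ^+ (bdigit Ups mu a.+1 i * (bdigit Ups mu a j + bdigit Ups mu a.+2 h)
        + bdigit Ups mu a j * bdigit Ups mu a.+2 h + 1) * (i == k)%:R *
       \sum_(q < nth 0%N mu a.+1) sym (SF a.+1 h q s) * sym (SF a q j r)).
Hypothesis hR11 : forall a i j r b h k s, listed sigma mu (SE a i j r) -> listed sigma mu (SE b h k s) ->
  (1 < `|b - a|)%N \/ (b = a.+1 /\ h <> j) ->
  ev (com (sym (SE a i j r)) (sym (SE b h k s))) = ev 0.
Hypothesis hR12 : forall a i j r b h k s, listed sigma mu (SF a i j r) -> listed sigma mu (SF b h k s) ->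
  (1 < `|b - a|)%N \/ (b = a.+1 /\ i <> k) ->
  ev (com (sym (SF a i j r)) (sym (SF b h k s))) = ev 0.
Hypothesis hR13 : forall a i j r h k s b f g t, listed sigma mu (SE a i j r) -> listed sigma mu (SE a h k s) -> listed sigma mu (SE b f g t) ->
  (1 <= `|a - b|)%N ->
  ev (com (sym (SE a i j r)) (com (sym (SE a h k s)) (sym (SE b f g t)))
     + com (sym (SE a i j s)) (com (sym (SE a h k r)) (sym (SE b f g t)))) = ev 0.
Hypothesis hR14 : forall a i j r h k s b f g t, listed sigma mu (SF a i j r) -> listed sigma mu (SF a h k s) -> listed sigma mu (SF b f g t) ->
  (1 <= `|a - b|)%N ->
  ev (com (sym (SF a i j r)) (com (sym (SF a h k s)) (sym (SF b f g t)))
     + com (sym (SF a i j s)) (com (sym (SF a h k r)) (sym (SF b f g t)))) = ev 0.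
Hypothesis hR15 : forall a i f1 r f2 j h g1 g2 k s, (4 <= size mu)%N -> (0 < a)%N ->
  (bdigit Ups mu a h + bdigit Ups mu a.+1 j)%N = 1%N ->
  listed sigma mu (SE a.-1 i f1 r) -> listed sigma mu (SE a f2 j (smu a a.+1).+1) ->
  listed sigma mu (SE a h g1 (smu a a.+1).+1) -> listed sigma mu (SE a.+1 g2 k s) ->
  ev (com (com (sym (SE a.-1 i f1 r)) (sym (SE a f2 j (smu a a.+1).+1)))
         (com (sym (SE a h g1 (smu a a.+1).+1)) (sym (SE a.+1 g2 k s)))) = ev 0.
Hypothesis hR16 : forall a i f1 r f2 j h g1 g2 k s, (4 <= size mu)%N -> (0 < a)%N ->
  (bdigit Ups mu a j + bdigit Ups mu a.+1 h)%N = 1%N ->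
  listed sigma mu (SF a.-1 i f1 r) -> listed sigma mu (SF a f2 j (smu a.+1 a).+1) ->
  listed sigma mu (SF a h g1 (smu a.+1 a).+1) -> listed sigma mu (SF a.+1 g2 k s) ->
  ev (com (com (sym (SF a.-1 i f1 r)) (sym (SF a f2 j (smu a.+1 a).+1)))
         (com (sym (SF a h g1 (smu a.+1 a).+1)) (sym (SF a.+1 g2 k s)))) = ev 0.
Hypothesis hR1D : forall a i j, listed sigma mu (SD a i j 0) -> ev (sym (SD a i j 0)) = ev (i == j)%:R.
Hypothesis hR1D' : forall a i j, listed sigma mu (SD' a i j 0) -> ev (sym (SD' a i j 0)) = ev (i == j)%:R.

Lemma hom_sign n (b : bool) x : hom n x -> hom n ((-1) ^+ b * x).
Proof. by case: b; rewrite ?mul1r // mulN1r; apply: homN. Qed.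
Lemma hom_nat n (b : bool) x : hom n x -> hom n (b%:R * x).
Proof. by case: b; rewrite ?mul1r // mul0r. Qed.
Lemma homB n x y : hom n x -> hom n y -> hom n (x - y).
Proof. by move=> hx /homN; apply: homD. Qed.
Lemma lo_sign n (b : nat) x : lo n x -> lo n ((-1) ^+ b * x).
Proof. by rewrite -signr_odd; case: odd; rewrite ?mul1r // mulN1r; apply: loN. Qed.
Lemma loB n x y : lo n x -> lo n y -> lo n (x - y).
Proof. by move=> hx /loN; apply: loD. Qed.
Lemma lo_nat n (b : bool) x : lo n x -> lo n (b%:R * x).
Proof. by case: b; rewrite ?mul1r // mul0r. Qed.
Lemma lo_sum n I (r : seq I) (P : pred I) (f : I -> Q) : (forall i, P i -> lo n (f i)) ->
  lo n (\sum_(i <- r | P i) f i).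
Proof. by move=> lf; elim/big_ind: _ => //; apply: loD. Qed.

Lemma listedD I J r : blk I = blk J -> listed sigma mu (SD (blk I) (off I) (off J) r).
Proof. by move=> IJ; rewrite /= (blk_lt sum_mu) (off_lt sum_mu) IJ (off_lt sum_mu). Qed.
Lemma listedD' I J r : blk I = blk J -> listed sigma mu (SD' (blk I) (off I) (off J) r).
Proof. exact: listedD. Qed.
Lemma listedE I J r : blk J = (blk I).+1 -> (smu (blk I) (blk I).+1 < r)%N ->
  listed sigma mu (SE (blk I) (off I) (off J) r).
Proof. by move=> JI lt; rewrite /= lt (off_lt sum_mu) -JI (off_lt sum_mu) (blk_lt sum_mu). Qed.
Lemma listedF I J r : blk I = (blk J).+1 -> (smu (blk J).+1 (blk J) < r)%N ->
  listed sigma mu (SF (blk J) (off I) (off J) r).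
Proof. by move=> IJ lt; rewrite /= lt (off_lt sum_mu J) -IJ (off_lt sum_mu) (blk_lt sum_mu). Qed.

Local Notation sD I J r := (sym (SD (blk I) (off I) (off J) r)).
Local Notation sE I J r := (sym (SE (blk I) (off I) (off J) r)).
Local Notation sF I J r := (sym (SF (blk J) (off I) (off J) r)).
(** The sign $(-1)^{|I|}$ and the shift of the exponent turn the leading parts of the relations for
    D, E and F into one formula, the bracket of matrix units $e_{I,J}t^r$. *)
Definition gD I J r := (-1) ^+ p I * gp (sD I J r.+1).
Definition gE I J r := (-1) ^+ p I * gp (sE I J r.+1).
Definition gF I J r := (-1) ^+ p I * gp (sF I J r.+1).

Lemma pure_sD I J r : blk I = blk J -> gpure (par I J) (sD I J r).
Proof. by move=> IJ; apply: (pureSD pure_sym). Qed.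
Lemma pure_sE I J r : blk J = (blk I).+1 -> gpure (par I J) (sE I J r).
Proof. by move=> IJ; apply: (pureSE pure_sym). Qed.
Lemma pure_sF I J r : blk I = (blk J).+1 -> gpure (par I J) (sF I J r).
Proof. by move=> IJ; apply: (pureSF pure_sym). Qed.

Lemma ev_D0 a I J : blk I = a -> blk J = a -> ev (sym (SD a (off I) (off J) 0)) = (I == J)%:R.
Proof. by move=> <- /esym IJ; rewrite hR1D ?listedD // delta_off // ev_nat. Qed.
Lemma ev_D'0 a I J : blk I = a -> blk J = a -> ev (sym (SD' a (off I) (off J) 0)) = (I == J)%:R.
Proof. by move=> <- /esym IJ; rewrite hR1D' ?listedD' // delta_off // ev_nat. Qed.
Lemma mulr_boolC (b : bool) (x : Q) : x * b%:R = b%:R * x.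
Proof. by case: b; rewrite ?mul1r ?mulr1 // mul0r mulr0. Qed.

Lemma br_signs a b (c d : bool) (x y : G) :
  br a b ((-1) ^+ c * x) ((-1) ^+ d * y) = (-1) ^+ (c (+) d) * br a b x y.
Proof. by rewrite br_signl br_signr mulr_sign2. Qed.

Lemma gr_zero n x : hom n x -> lo n (ev x) -> gp x = 0.
Proof. by move=> hx lx; rewrite (gr_eq hx (hom0 n)) ?rmorph0 ?subr0. Qed.

Lemma gr_dd I J H L r t : blk I = blk J -> blk H = blk L ->
  br (par I J) (par H L) (gD I J r) (gD H L t) =
  (J == H)%:R * gD I L (r + t) - (-1) ^+ (par I J && par H L) * ((I == L)%:R * gD H J (r + t)).
Proof.
move=> IJ HL; rewrite br_signs -(gp_scomm (pure_sD _ IJ) (pure_sD _ HL)).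
have hx := hom_com (pure_sD r.+1 IJ) (pure_sD t.+1 HL) (hom_sym _) (hom_sym _).
have rel := hR3 (listedD r.+1 IJ) (listedD t.+1 HL).
have [IH|nIH] := eqVneq (blk I) (blk H); last first.
  have -> : (J == H) = false by apply: contraNF nIH => /eqP <-; rewrite IJ.
  have -> : (I == L) = false by apply: contraNF nIH => /eqP ->; rewrite HL.
  rewrite !mul0r mulr0 subr0 (gr_zero hx) ?mulr0 //.
  by rewrite rel !evM ev_nat (negPf nIH) !mul0r.
set sg := (p I && p J) (+) (p I && p H) (+) (p J && p H).
pose y := (-1) ^+ sg * ((J == H)%:R * sD I L (r + t).+1 - (I == L)%:R * sD H J (r + t).+1).
have hy : hom (r + t)%N y.
  by apply/hom_sign/homB; apply: hom_nat; apply: (hom_sym (SD _ _ _ (r + t).+1)).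
have HJ : blk H = blk J by rewrite -IH.
have IL : blk I = blk L by rewrite IH.
(* The summand with exponent 0, where D is a Kronecker delta, gives y; all the other summands have
   smaller total degree. *)
rewrite (gr_eq hx hy) /y; last first.
  rewrite rel !evM ev_nat !ev_sign IH eqxx mul1r !bdigitE // sign3 -/sg -mulrBr.
  apply: lo_sign; rewrite minnSS ev_sum big_ord_recl.
  have -> : (r.+1 + t.+1 - 1 - @ord0 (minn r t) = (r + t).+1)%N by rewrite /=; lia.
  rewrite !evB !evM !ev_nat !ev_D0 // mulr_boolC [J == H]eq_sym.
  rewrite addrAC subrr add0r; apply: lo_sum => g _; rewrite evB !evM.
  by apply: loB; apply: lo_sym; have := ltn_ord g; rewrite /= /bump; lia.
rewrite rmorphM rmorph_sign rmorphB !rmorphM !rmorph_nat mulr_sign2 mulrBr /gD.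
congr (_ - _).
  have [e|_] := eqVneq J H; last by rewrite !mul0r !mulr0.
  rewrite !mul1r; congr ((-1) ^+ nat_of_bool _ * _); rewrite /sg e.
  by case: (p I); case: (p H).
have [e|_] := eqVneq I L; last by rewrite !mul0r !mulr0.
rewrite !mul1r mulr_sign2; congr ((-1) ^+ nat_of_bool _ * _); rewrite /sg e.
by case: (p L); case: (p H); case: (p J).
Qed.

(** In a sum over a block and over exponents only $D^{(0)}$ reaches the top degree, and it selects
    the single position I of the block. *)
Lemma lead_left a I (g : nat -> nat -> parabolic_symbol) r t : blk I = a ->
  (forall q u, symbol_degree (g q u) = u.-1) ->
  lo (r + t)%N (ev (\sum_(q < nth 0%N mu a) \sum_(u < r.+1) sym (SD a (off I) q u) * sym (g q (r.+1 + t.+1 - 1 - u)%N))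
    - ev (sym (g (off I) (r + t).+1))).
Proof.
move=> Ia dg; have am : (a < size mu)%N by rewrite -Ia (blk_lt sum_mu).
rewrite ev_sum (@block_sum _ _ sum_mu _ a (fun q => ev (\sum_(u < r.+1) sym (SD a (off I) q u) *
  sym (g q (r.+1 + t.+1 - 1 - u)%N)))) //.
have -> : \sum_(l | blk l == a) ev (\sum_(u < r.+1) sym (SD a (off I) (off l) u) * sym (g (off l) (r.+1 + t.+1 - 1 - u)%N)) =
  \sum_(l | blk l == a) ((I == l)%:R * ev (sym (g (off l) (r + t).+1))
    + \sum_(u < r) ev (sym (SD a (off I) (off l) u.+1)) * ev (sym (g (off l) (r + t - u)%N))).
  apply: eq_bigr => l /eqP la; rewrite ev_sum big_ord_recl evM ev_D0 //.
  have -> : (r.+1 + t.+1 - 1 - @ord0 r = (r + t).+1)%N by rewrite /=; lia.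
  congr (_ + _); apply: eq_bigr => u _; rewrite evM /= /bump /=.
  by have -> : (r.+1 + t.+1 - 1 - (1 + u) = r + t - u)%N by lia.
rewrite big_split (sum_one (i := I)) ?Ia // ?eqxx ?mul1r => [|l _ nl].
  rewrite addrAC subrr add0r; apply: lo_sum => l _; apply: lo_sum => u _.
  by apply: lo_sym; rewrite dg /=; have := ltn_ord u; lia.
by rewrite eq_sym (negPf nl) mul0r.
Qed.

Lemma lead_right a I (g : nat -> nat -> parabolic_symbol) r t : blk I = a ->
  (forall q u, symbol_degree (g q u) = u.-1) ->
  lo (r + t)%N (ev (\sum_(q < nth 0%N mu a) \sum_(u < r.+1) sym (g q (r.+1 + t.+1 - 1 - u)%N) * sym (SD a q (off I) u))
    - ev (sym (g (off I) (r + t).+1))).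
Proof.
move=> Ia dg; have am : (a < size mu)%N by rewrite -Ia (blk_lt sum_mu).
rewrite ev_sum (@block_sum _ _ sum_mu _ a (fun q => ev (\sum_(u < r.+1) 
  sym (g q (r.+1 + t.+1 - 1 - u)%N) * sym (SD a q (off I) u)))) //.
have -> : \sum_(l | blk l == a) ev (\sum_(u < r.+1) sym (g (off l) (r.+1 + t.+1 - 1 - u)%N) * sym (SD a (off l) (off I) u)) =
  \sum_(l | blk l == a) ((l == I)%:R * ev (sym (g (off l) (r + t).+1))
    + \sum_(u < r) ev (sym (g (off l) (r + t - u)%N)) * ev (sym (SD a (off l) (off I) u.+1))).
  apply: eq_bigr => l /eqP la; rewrite ev_sum big_ord_recl evM ev_D0 // mulr_boolC.
  have -> : (r.+1 + t.+1 - 1 - @ord0 r = (r + t).+1)%N by rewrite /=; lia.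
  congr (_ + _); apply: eq_bigr => u _; rewrite evM /= /bump /=.
  by have -> : (r.+1 + t.+1 - 1 - (1 + u) = r + t - u)%N by lia.
rewrite big_split (sum_one (i := I)) ?Ia // ?eqxx ?mul1r => [|l _ nl].
  rewrite addrAC subrr add0r; apply: lo_sum => l _; apply: lo_sum => u _.
  by apply: lo_sym; rewrite dg /=; have := ltn_ord u; lia.
by rewrite (negPf nl) mul0r.
Qed.

Lemma lead_one x (g : nat -> parabolic_symbol) r t a I J : blk I = a -> blk J = a ->
  (forall u, symbol_degree (g u) = u.-1) ->
  x = (fun u => sym (SD a (off I) (off J) u) * sym (g (r.+1 + t.+1 - 1 - u)%N)) \/
  x = (fun u => sym (g (r.+1 + t.+1 - 1 - u)%N) * sym (SD a (off I) (off J) u)) ->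
  lo (r + t)%N (ev (\sum_(u < r.+1) x u) - (I == J)%:R * ev (sym (g (r + t).+1))).
Proof.
move=> Ia Ja dg e; rewrite ev_sum big_ord_recl.
have -> : ev (x (@ord0 r)) = (I == J)%:R * ev (sym (g (r + t).+1)).
  have s0 : (r.+1 + t.+1 - 1 - @ord0 r = (r + t).+1)%N by rewrite /=; lia.
  by case: e => ->; rewrite evM s0 ev_D0 // mulr_boolC.
rewrite addrAC subrr add0r; apply: lo_sum => u _.
by case: e => ->; rewrite evM; apply: lo_sym; rewrite dg /= /bump; have := ltn_ord u; lia.
Qed.

Lemma gr_de I J H L r t : blk I = blk J -> blk L = (blk H).+1 -> (smu (blk H) (blk H).+1 <= t)%N ->
  br (par I J) (par H L) (gD I J r) (gE H L t) =
  (J == H)%:R * gE I L (r + t) - (-1) ^+ (par I J && par H L) * ((I == L)%:R * gE H J (r + t)).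
Proof.
move=> IJ LH ht; rewrite br_signs -(gp_scomm (pure_sD _ IJ) (pure_sE _ LH)).
have hx := hom_com (pure_sD r.+1 IJ) (pure_sE t.+1 LH) (hom_sym _) (hom_sym _).
have rel := hR4 (listedD r.+1 IJ) (listedE (r := t.+1) LH ht).
have [IH|nIH] := eqVneq (blk I) (blk H).
  have -> : (I == L) = false by apply/eqP => e; move: LH; rewrite -e IH; lia.
  rewrite mul0r mulr0 subr0.
  pose y := (-1) ^+ p J * ((J == H)%:R * sE I L (r + t).+1).
  have hy : hom (r + t)%N y by apply/hom_sign/hom_nat; apply: (hom_sym (SE _ _ _ (r + t).+1)).
  rewrite (gr_eq hx hy) /y; last first.
    have LHn : (blk H == (blk H).+1) = false by lia.
    rewrite rel evB !evM !ev_nat !ev_sign.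
    rewrite IH eqxx LHn !mul0r subr0 mul1r !bdigitE -?IJ // delta_off -?IJ // [H == J]eq_sym.
    have [e|_] := eqVneq J H; last by rewrite !mul0r mulr0 subrr.
    rewrite !mul1r e mulnb andbb -mulrBr; apply: lo_sign.
    exact: (@lead_left (blk H) I (fun q => SE (blk H) q (off L))).
  rewrite rmorphM rmorph_sign rmorphM rmorph_nat mulr_sign2 /gE.
  have [e|_] := eqVneq J H; last by rewrite !mul0r !mulr0.
  by rewrite !mul1r e addbK.
have -> : (J == H) = false by apply: contraNF nIH => /eqP <-; rewrite IJ.
rewrite mul0r sub0r.
have [IL|nIL] := eqVneq (blk I) (blk L); last first.
  have -> : (I == L) = false by apply: contraNF nIL => /eqP ->.
  rewrite (gr_zero hx) ?mulr0 ?mul0r ?mulr0 ?oppr0 //.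
  by rewrite rel evB !evM !ev_nat (negPf nIH) -LH (negPf nIL) !mul0r subr0.
set sg := (p H && p L) (+) (p H && p J) (+) (p J && p L).
pose y := - ((-1) ^+ sg * ((I == L)%:R * sE H J (r + t).+1)).
have hy : hom (r + t)%N y by apply/homN/hom_sign/hom_nat; apply: (hom_sym (SE _ _ _ (r + t).+1)).
rewrite (gr_eq hx hy) /y; last first.
  rewrite rel evB !evM !ev_nat !ev_sign (negPf nIH) -LH IL eqxx !mul0r sub0r mul1r.
  rewrite !bdigitE -?IL // sign3 -/sg evN !evM ev_nat ev_sign -opprD -mulrBr; apply/loN/lo_sign.
  exact: (@lead_one _ (fun u => SE (blk H) (off H) (off J) u) r t (blk I) I L erefl (esym IL) (fun=> erefl) (or_introl erefl)).
rewrite rmorphN rmorphM rmorph_sign rmorphM rmorph_nat mulrN mulr_sign2 /gE; congr (- _).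
have [e|_] := eqVneq I L; last by rewrite !mul0r !mulr0.
rewrite !mul1r mulr_sign2; congr ((-1) ^+ nat_of_bool _ * _); rewrite /sg e.
by case: (p L); case: (p H); case: (p J).
Qed.

Lemma gr_df I J H L r t : blk I = blk J -> blk H = (blk L).+1 -> (smu (blk L).+1 (blk L) <= t)%N ->
  br (par I J) (par H L) (gD I J r) (gF H L t) =
  (J == H)%:R * gF I L (r + t) - (-1) ^+ (par I J && par H L) * ((I == L)%:R * gF H J (r + t)).
Proof.
move=> IJ HL ht; rewrite br_signs -(gp_scomm (pure_sD _ IJ) (pure_sF _ HL)).
have hx := hom_com (pure_sD r.+1 IJ) (pure_sF t.+1 HL) (hom_sym _) (hom_sym _).
have rel := hR5 (listedD r.+1 IJ) (listedF (r := t.+1) HL ht).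
have [IL|nIL] := eqVneq (blk I) (blk L).
  have -> : (J == H) = false by apply/eqP => e; move: HL; rewrite -e -IJ IL; lia.
  rewrite mul0r sub0r.
  set sg := (p I && p J) (+) (p H && p I) (+) (p H && p J).
  pose y := - ((-1) ^+ sg * ((I == L)%:R * sF H J (r + t).+1)).
  have hy : hom (r + t)%N y by apply/homN/hom_sign/hom_nat; apply: (hom_sym (SF _ _ _ (r + t).+1)).
  rewrite (gr_eq hx hy) /y; last first.
    have LHn : (blk L == (blk L).+1) = false by lia.
    rewrite rel evD !evN !evM !ev_nat !ev_sign IL eqxx LHn !mul0r addr0 mul1r.
    rewrite !bdigitE -?IJ // delta_off ?IL // sign3 -/sg.
    have [e|_] := eqVneq I L; last by rewrite !mul0r mulr0 subrr.
    rewrite !mul1r -opprD -mulrBr; apply/loN/lo_sign.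
    by apply: (@lead_right (blk L) J (fun q => SF (blk L) (off H) q)); rewrite // -IJ.
  rewrite rmorphN rmorphM rmorph_sign rmorphM rmorph_nat mulrN mulr_sign2 /gF; congr (- _).
  have [e|_] := eqVneq I L; last by rewrite !mul0r !mulr0.
  rewrite !mul1r mulr_sign2; congr ((-1) ^+ nat_of_bool _ * _); rewrite /sg e.
  by case: (p L); case: (p H); case: (p J).
have -> : (I == L) = false by apply: contraNF nIL => /eqP ->.
rewrite mul0r mulr0 subr0.
have [IH|nIH] := eqVneq (blk I) (blk H); last first.
  have -> : (J == H) = false by apply: contraNF nIH => /eqP <-; rewrite IJ.
  rewrite (gr_zero hx) ?mulr0 ?mul0r //.
  by rewrite rel evD evN !evM !ev_nat (negPf nIL) -HL (negPf nIH) !mul0r oppr0 addr0.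
set sg := (p H && p L) (+) (p H && p J) (+) (p J && p L).
pose y := (-1) ^+ sg * ((J == H)%:R * sF I L (r + t).+1).
have hy : hom (r + t)%N y by apply/hom_sign/hom_nat; apply: (hom_sym (SF _ _ _ (r + t).+1)).
rewrite (gr_eq hx hy) /y; last first.
  rewrite rel evD evN !evM !ev_nat !ev_sign (negPf nIL) -HL IH eqxx !mul0r oppr0 add0r mul1r.
  rewrite !bdigitE -?IJ // sign3 -/sg -mulrBr [J == H]eq_sym; apply/lo_sign.
  have JH' : blk J = blk H by rewrite -IJ.
  exact: (@lead_one _ (fun u => SF (blk L) (off I) (off L) u) r t (blk H) H J erefl JH' (fun=> erefl) (or_intror erefl)).
rewrite rmorphM rmorph_sign rmorphM rmorph_nat mulr_sign2 /gF.
have [e|_] := eqVneq J H; last by rewrite !mul0r !mulr0.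
rewrite !mul1r; congr ((-1) ^+ nat_of_bool _ * _); rewrite /sg e.
by case: (p I); case: (p H); case: (p L).
Qed.

(* D' = - D + (terms of lower degree), from D D' = 1. *)
Lemma ev_D' I J r : blk I = blk J ->
  lo r (ev (sym (SD' (blk I) (off I) (off J) r.+1)) + ev (sD I J r.+1)).
Proof.
move=> IJ; have := hR2 (listedD r.+1 IJ); rewrite evM !ev_nat mul0r.
rewrite ev_sum (@block_sum _ _ sum_mu _ (blk I) (fun q => ev (\sum_(u < r.+2) sym (SD (blk I) (off I) q u) *
  sym (SD' (blk I) q (off J) (r.+1 - u)%N)))) ?(blk_lt sum_mu) //.
have -> : \sum_(l | blk l == blk I) ev (\sum_(u < r.+2) sym (SD (blk I) (off I) (off l) u)
     * sym (SD' (blk I) (off l) (off J) (r.+1 - u)%N)) =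
  \sum_(l | blk l == blk I) ((l == I)%:R * ev (sym (SD' (blk I) (off l) (off J) r.+1))
    + (l == J)%:R * ev (sym (SD (blk I) (off I) (off l) r.+1))
    + \sum_(u < r) ev (sym (SD (blk I) (off I) (off l) u.+1)) *
        ev (sym (SD' (blk I) (off l) (off J) (r - u)%N))).
  apply: eq_bigr => l /eqP lI; rewrite ev_sum big_ord_recl big_ord_recr /= subn0.
  rewrite !evM ev_D0 // /bump /= add1n subnn ev_D'0 // mulr_boolC [I == l]eq_sym -addrA; congr (_ + _).
  by rewrite addrC; congr (_ + _); apply: eq_bigr => u _; rewrite evM /= add1n.
rewrite !big_split (sum_one (i := I)) ?eqxx ?mul1r //=; last by move=> l _ /negPf ->; rewrite mul0r.
rewrite (sum_one (i := J)) ?IJ ?eqxx ?mul1r //=; last by move=> l _ /negPf ->; rewrite mul0r.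
rewrite -IJ => /eqP; rewrite addr_eq0 => /eqP ->; apply/loN.
apply: lo_sum => l _; apply: lo_sum => u _; apply: lo_sym => /=; have := ltn_ord u; lia.
Qed.

(** The top degree of (R6) sits at the two ends of the sum, where D or D' has exponent 0. The end
    with D' counts as minus D by [ev_D'], which yields the two terms of opposite sign. *)
Lemma gr_ef I J H L r t : blk J = (blk I).+1 -> blk H = (blk L).+1 ->
  (smu (blk I) (blk I).+1 <= r)%N -> (smu (blk L).+1 (blk L) <= t)%N ->
  br (par I J) (par H L) (gE I J r) (gF H L t) =
  (J == H)%:R * gD I L (r + t) - (-1) ^+ (par I J && par H L) * ((I == L)%:R * gD H J (r + t)).
Proof.
move=> JI HL hr ht; rewrite br_signs -(gp_scomm (pure_sE _ JI) (pure_sF _ HL)).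
have hx := hom_com (pure_sE r.+1 JI) (pure_sF t.+1 HL) (hom_sym _) (hom_sym _).
have rel := hR6 (listedE (r := r.+1) JI hr) (listedF (r := t.+1) HL ht).
have [IL|nIL] := eqVneq (blk I) (blk L); last first.
  have -> : (I == L) = false by apply: contraNF nIL => /eqP ->.
  have -> : (J == H) = false by apply: contraNF nIL => /eqP e; move: HL; rewrite -e JI => -[->].
  rewrite (gr_zero hx) ?mulr0 ?mul0r ?mulr0 ?subr0 //.
  by rewrite rel !evM !ev_nat (negPf nIL) !mul0r.
set sg := (p H && p L) (+) (p J && p L) (+) (p H && p J).
pose y := (-1) ^+ sg * ((J == H)%:R * sD I L (r + t).+1 - (I == L)%:R * sD H J (r + t).+1).
have hy : hom (r + t)%N y.
  by apply/hom_sign/homB; apply: hom_nat; apply: (hom_sym (SD _ _ _ (r + t).+1)).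
have HJ : blk H = blk J by rewrite JI IL HL.
rewrite (gr_eq hx hy) /y; last first.
  rewrite rel !evM !ev_nat !ev_sign IL eqxx mul1r exprD expr1 !bdigitE ?JI ?IL // sign3 -/sg.
  rewrite mulrN1 mulNr -mulrN -mulrBr; apply: lo_sign.
  rewrite ev_sum addSn addnS big_ord_recl big_ord_recr.
  have -> : ((r + t).+2 - 1 - @ord0 (r + t).+1 = (r + t).+1)%N by rewrite /=; lia.
  have -> : nat_of_ord (lift (@ord0 (r + t).+1) (@ord_max (r + t))) = (r + t).+1 by [].
  have -> : ((r + t).+2 - 1 - (r + t).+1 = 0)%N by lia.
  have JH' : blk J = (blk L).+1 by rewrite JI IL.
  rewrite !evB !evM !ev_nat ev_D'0 // ev_D0 // mulr_boolC [H == J]eq_sym.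
  set S := \sum_(i < _) _; set a := ev (sym (SD' _ _ _ _)); set b := ev (sD H J _).
  have -> : b = ev (sym (SD (blk L).+1 (off H) (off J) (r + t).+1)) by rewrite /b HL.
  set b' := ev _.
  have -> : - ((J == H)%:R * a + (S + (I == L)%:R * b')) - ((J == H)%:R * ev (sym (SD (blk L) (off I) (off L) (r + t).+1)) - (I == L)%:R * b')
     = - ((J == H)%:R * (a + ev (sym (SD (blk L) (off I) (off L) (r + t).+1)))) - S.
    rewrite mulrDr; move: (_ * a) (_ * ev _) (_ * b') => x1 x2 x3; ncring.
  apply: loB.
    by apply/loN/lo_nat; rewrite /a -IL; apply: ev_D'.
  apply: lo_sum => u _; rewrite evM; apply: lo_sym => /=; rewrite /bump /=; have := ltn_ord u; lia.
rewrite rmorphM rmorph_sign rmorphB !rmorphM !rmorph_nat mulr_sign2 mulrBr /gD.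
congr (_ - _).
  have [e|_] := eqVneq J H; last by rewrite !mul0r !mulr0.
  rewrite !mul1r; congr ((-1) ^+ nat_of_bool _ * _); rewrite /sg e.
  by case: (p I); case: (p H); case: (p L).
have [e|_] := eqVneq I L; last by rewrite !mul0r !mulr0.
rewrite !mul1r mulr_sign2; congr ((-1) ^+ nat_of_bool _ * _); rewrite /sg e.
by case: (p L); case: (p H); case: (p J).
Qed.

(** The products on the right of (R7) have total degree r + t - 1, one less than the bracket;
    nothing survives in the graded algebra. *)
Lemma gr_ee I J H L r t : blk J = (blk I).+1 -> blk H = blk I -> blk L = blk J ->
  (smu (blk I) (blk I).+1 <= r)%N -> (smu (blk H) (blk H).+1 <= t)%N ->
  br (par I J) (par H L) (gE I J r) (gE H L t) = 0.
Proof.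
move=> JI HI LJ hr ht; have LH : blk L = (blk H).+1 by rewrite LJ HI.
rewrite br_signs -(gp_scomm (pure_sE _ JI) (pure_sE _ LH)).
have hx := hom_com (pure_sE r.+1 JI) (pure_sE t.+1 LH) (hom_sym _) (hom_sym _).
rewrite (gr_zero hx) ?mulr0 //.
have := listedE (r := t.+1) LH ht; rewrite HI => lHL; rewrite HI in ht.
rewrite (hR7 (listedE (r := r.+1) JI hr) lHL).
rewrite evM ev_sign; apply: lo_sign; rewrite evB !ev_sum; apply: loB; rewrite big_seq; apply: lo_sum => u.
  by rewrite mem_index_iota evM => hu; apply: lo_sym => /=; lia.
by rewrite mem_index_iota evM => hu; apply: lo_sym => /=; lia.
Qed.

Lemma gr_ff I J H L r t : blk I = (blk J).+1 -> blk H = blk I -> blk L = blk J ->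
  (smu (blk J).+1 (blk J) <= r)%N -> (smu (blk L).+1 (blk L) <= t)%N ->
  br (par I J) (par H L) (gF I J r) (gF H L t) = 0.
Proof.
move=> JI HI LJ hr ht; have LH : blk H = (blk L).+1 by rewrite LJ HI.
rewrite br_signs -(gp_scomm (pure_sF _ JI) (pure_sF _ LH)).
have hx := hom_com (pure_sF r.+1 JI) (pure_sF t.+1 LH) (hom_sym _) (hom_sym _).
rewrite (gr_zero hx) ?mulr0 //.
have := listedF (r := t.+1) LH ht; rewrite LJ => lHL; rewrite LJ in ht.
rewrite (hR8 (listedF (r := r.+1) JI hr) lHL).
rewrite evM ev_sign; apply: lo_sign; rewrite evB !ev_sum; apply: loB; rewrite big_seq; apply: lo_sum => u.
  by rewrite mem_index_iota evM => hu; apply: lo_sym => /=; lia.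
by rewrite mem_index_iota evM => hu; apply: lo_sym => /=; lia.
Qed.

Lemma gr_e0 I J H L r t : blk J = (blk I).+1 -> blk L = (blk H).+1 ->
  (blk J < blk H)%N || (blk H == blk J) && (J != H) ->
  (smu (blk I) (blk I).+1 <= r)%N -> (smu (blk H) (blk H).+1 <= t)%N ->
  br (par I J) (par H L) (gE I J r) (gE H L t) = 0.
Proof.
move=> JI LH c hr ht; rewrite br_signs -(gp_scomm (pure_sE _ JI) (pure_sE _ LH)).
have hx := hom_com (pure_sE r.+1 JI) (pure_sE t.+1 LH) (hom_sym _) (hom_sym _).
rewrite (gr_zero hx) ?mulr0 // (hR11 (listedE (r := r.+1) JI hr) (listedE (r := t.+1) LH ht)) ?ev0 //.
case/orP: c => [c|/andP[/eqP c n]]; [left; lia | right; split; first by rewrite c].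
by move=> e; case/eqP: n; apply: (pos_inj (mu := mu)).
Qed.

Lemma gr_f0 I J H L r t : blk I = (blk J).+1 -> blk H = (blk L).+1 ->
  (blk I < blk L)%N || (blk L == blk I) && (I != L) ->
  (smu (blk J).+1 (blk J) <= r)%N -> (smu (blk L).+1 (blk L) <= t)%N ->
  br (par I J) (par H L) (gF I J r) (gF H L t) = 0.
Proof.
move=> JI LH c hr ht; rewrite br_signs -(gp_scomm (pure_sF _ JI) (pure_sF _ LH)).
have hx := hom_com (pure_sF r.+1 JI) (pure_sF t.+1 LH) (hom_sym _) (hom_sym _).
rewrite (gr_zero hx) ?mulr0 // (hR12 (listedF (r := r.+1) JI hr) (listedF (r := t.+1) LH ht)) ?ev0 //.
case/orP: c => [c|/andP[/eqP c n]]; [left; lia | right; split; first by rewrite c].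
by move=> e; case/eqP: n; apply: (pos_inj (mu := mu)).
Qed.

Lemma gr_eshift I J L r t : blk J = (blk I).+1 -> blk L = (blk J).+1 ->
  (smu (blk I) (blk I).+1 <= r)%N -> (smu (blk J) (blk J).+1 <= t)%N ->
  br (par I J) (par J L) (gE I J r.+1) (gE J L t) = br (par I J) (par J L) (gE I J r) (gE J L t.+1).
Proof.
move=> JI LJ hr ht; rewrite !br_signs; congr (_ * _).
rewrite -!(gp_scomm (pure_sE _ JI) (pure_sE _ LJ)).
have h1 := hom_com (pure_sE r.+2 JI) (pure_sE t.+1 LJ) (hom_sym _) (hom_sym _).
have h2 := hom_com (pure_sE r.+1 JI) (pure_sE t.+2 LJ) (hom_sym _) (hom_sym _).
rewrite /= addnS in h2; rewrite /= in h1; apply: (gr_eq h1 h2).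
rewrite -evB.
have l1 := listedE (r := r.+1) JI hr; have := listedE (r := t.+1) LJ ht; rewrite JI => l2.
rewrite (hR9 l1 l2) !evM ev_nat ev_sign -mulrA; apply/lo_sign/lo_nat.
rewrite ev_sum; apply: lo_sum => q _; rewrite evM; apply: lo_sym => /=; lia.
Qed.

Lemma gr_fshift I J L r t : blk I = (blk J).+1 -> blk J = (blk L).+1 ->
  (smu (blk J).+1 (blk J) <= r)%N -> (smu (blk L).+1 (blk L) <= t)%N ->
  br (par I J) (par J L) (gF I J r.+1) (gF J L t) = br (par I J) (par J L) (gF I J r) (gF J L t.+1).
Proof.
move=> IJ JL hr ht; rewrite brC [RHS]brC; congr (- (_ * _)); rewrite !br_signs; congr (_ * _).
rewrite -!(gp_scomm (pure_sF _ JL) (pure_sF _ IJ)).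
have h1 := hom_com (pure_sF t.+1 JL) (pure_sF r.+2 IJ) (hom_sym _) (hom_sym _).
have h2 := hom_com (pure_sF t.+2 JL) (pure_sF r.+1 IJ) (hom_sym _) (hom_sym _).
rewrite /= addnS in h1; rewrite /= in h2; apply: esym; apply: (gr_eq h2 h1).
rewrite -evB.
have l1 := listedF (r := t.+1) JL ht; have := listedF (r := r.+1) IJ hr; rewrite JL => l2.
rewrite (hR10 l1 l2) !evM ev_nat ev_sign -mulrA; apply/lo_sign/lo_nat.
rewrite ev_sum; apply: lo_sum => q _; rewrite evM; apply: lo_sym => /=; lia.
Qed.

Lemma nest_signs a1 a2 c (b1 b2 b3 : bool) (x1 x1' x2 x2' y : G) :
  nest a1 a2 c ((-1) ^+ b1 * x1) ((-1) ^+ b1 * x1') ((-1) ^+ b2 * x2) ((-1) ^+ b2 * x2') ((-1) ^+ b3 * y)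
  = (-1) ^+ (b1 (+) (b2 (+) b3)) * nest a1 a2 c x1 x1' x2 x2' y.
Proof. by rewrite /nest !br_signs mulrDr. Qed.

Lemma gr_serre_e i j h k f g r r' t : blk j = (blk i).+1 -> blk h = blk i -> blk k = blk j ->
  blk g = (blk f).+1 -> blk f != blk i ->
  (smu (blk i) (blk i).+1 <= r)%N -> (smu (blk i) (blk i).+1 <= r')%N -> (smu (blk f) (blk f).+1 <= t)%N ->
  nest (par i j) (par h k) (par f g) (gE i j r) (gE i j r') (gE h k r') (gE h k r) (gE f g t) = 0.
Proof.
move=> ji hi kj gf fi hr hr' ht; have kh : blk k = (blk h).+1 by rewrite kj hi.
rewrite nest_signs.
have pi u := pure_sE u ji. have ph u := pure_sE u kh. have pf := pure_sE t.+1 gf.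
have ps u := pure_scomm (ph u) pf.
rewrite /nest -!(gp_scomm (ph _) pf) -!(gp_scomm (pi _) (ps _)) -rmorphD.
have hh u w : hom (u + (w + t))%N (com (sE i j u.+1) (com (sE h k w.+1) (sE f g t.+1))).
  exact: (hom_com (pi u.+1) (ps w.+1) (hom_sym (SE _ _ _ u.+1)) (hom_com (ph w.+1) pf
    (hom_sym (SE _ _ _ w.+1)) (hom_sym (SE _ _ _ t.+1)))).
have hx := homD (hh r r') (eq_rect _ (fun n => hom n _) (hh r' r) _ (addnCA r' r t)).
rewrite (gr_zero hx) ?mulr0 // -hi.
have := listedE (r := r.+1) ji hr; have := listedE (r := r'.+1) kh; rewrite hi => l2 l1.
by rewrite (hR13 l1 (l2 hr') (listedE (r := t.+1) gf ht)) ?ev0 //; lia.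
Qed.

Lemma gr_serre_f i j h k f g r r' t : blk i = (blk j).+1 -> blk h = blk i -> blk k = blk j ->
  blk f = (blk g).+1 -> blk g != blk j ->
  (smu (blk j).+1 (blk j) <= r)%N -> (smu (blk j).+1 (blk j) <= r')%N -> (smu (blk g).+1 (blk g) <= t)%N ->
  nest (par i j) (par h k) (par f g) (gF i j r) (gF i j r') (gF h k r') (gF h k r) (gF f g t) = 0.
Proof.
move=> ji hi kj gf fi hr hr' ht; have kh : blk h = (blk k).+1 by rewrite kj hi.
rewrite nest_signs.
have pi u := pure_sF u ji. have ph u := pure_sF u kh. have pf := pure_sF t.+1 gf.
have ps u := pure_scomm (ph u) pf.
rewrite /nest -!(gp_scomm (ph _) pf) -!(gp_scomm (pi _) (ps _)) -rmorphD.
have hh u w : hom (u + (w + t))%N (com (sF i j u.+1) (com (sF h k w.+1) (sF f g t.+1))).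
  exact: (hom_com (pi u.+1) (ps w.+1) (hom_sym (SF _ _ _ u.+1)) (hom_com (ph w.+1) pf
    (hom_sym (SF _ _ _ w.+1)) (hom_sym (SF _ _ _ t.+1)))).
have hx := homD (hh r r') (eq_rect _ (fun n => hom n _) (hh r' r) _ (addnCA r' r t)).
rewrite (gr_zero hx) ?mulr0 // -kj.
have := listedF (r := r.+1) ji hr; have := listedF (r := r'.+1) kh; rewrite kj => l2 l1.
by rewrite (hR14 l1 (l2 hr') (listedF (r := t.+1) gf ht)) ?ev0 //; lia.
Qed.

Lemma gr_quartic_e i h j k r t : blk h = (blk i).+1 -> blk j = (blk h).+1 -> blk k = (blk j).+1 ->
  par h j = true -> (smu (blk i) (blk i).+1 <= r)%N -> (smu (blk j) (blk j).+1 <= t)%N ->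
  br (par i h (+) par h j) (par h j (+) par j k)
    (br (par i h) (par h j) (gE i h r) (gE h j (smu (blk h) (blk h).+1)))
    (br (par h j) (par j k) (gE h j (smu (blk h) (blk h).+1)) (gE j k t)) = 0.
Proof.
move=> hi jh kj hj hr ht; set u := smu _ _; rewrite ![in br _ _ (br _ _ _ _) _]br_signs !br_signs.
have pi := pure_sE r.+1 hi. have ph := pure_sE u.+1 jh. have pk := pure_sE t.+1 kj.
have p1 := pure_scomm pi ph. have p2 := pure_scomm ph pk.
rewrite -!(gp_scomm pi ph) -!(gp_scomm ph pk) -!(gp_scomm p1 p2).
have hx := hom_com p1 p2 (hom_com pi ph (hom_sym _) (hom_sym _)) (hom_com ph pk (hom_sym _) (hom_sym _)).
rewrite (gr_zero hx) ?mulr0 //.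
have l1 := listedE (r := r.+1) hi hr. have l2 := listedE (r := u.+1) jh (leqnn _).
have := listedE (r := t.+1) kj ht; rewrite jh => l3; have e1 : blk i = (blk h).-1 by rewrite hi.
rewrite e1 in l1 *.
have size4 : (4 <= size mu)%N by have := blk_lt sum_mu k; lia.
rewrite (hR15 size4 _ _ l1 l2 l2 l3) ?ev0 //; first by rewrite hi.
by rewrite !bdigitE //; move: hj; case: (p h); case: (p j).
Qed.

(** (R16) lists the blocks in increasing order, while a lower root runs through them in decreasing
    order; hence all three brackets are reversed. *)
Lemma gr_quartic_f i h j k r t : blk i = (blk h).+1 -> blk h = (blk j).+1 -> blk j = (blk k).+1 ->
  par h j = true -> (smu (blk h).+1 (blk h) <= r)%N -> (smu (blk k).+1 (blk k) <= t)%N ->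
  br (par i h (+) par h j) (par h j (+) par j k)
    (br (par i h) (par h j) (gF i h r) (gF h j (smu (blk j).+1 (blk j))))
    (br (par h j) (par j k) (gF h j (smu (blk j).+1 (blk j))) (gF j k t)) = 0.
Proof.
move=> ih hj jk par1 hr ht; set u := smu _ _.
rewrite brC [br (par i h) _ _ _]brC [br (par h j) (par j k) _ _]brC !(brNl, brNr, br_signl, br_signr).
have pi := pure_sF r.+1 ih. have ph := pure_sF u.+1 hj. have pk := pure_sF t.+1 jk.
have p1 := pure_scomm pk ph. have p2 := pure_scomm ph pi.
rewrite [par h j (+) par j k]addbC [par i h (+) _]addbC.
rewrite -!(gp_scomm pk ph) -!(gp_scomm ph pi) -!(gp_scomm p1 p2).
have hx := hom_com p1 p2 (hom_com pk ph (hom_sym _) (hom_sym _)) (hom_com ph pi (hom_sym _) (hom_sym _)).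
rewrite (gr_zero hx) ?mulr0 ?oppr0 ?mulr0 ?oppr0 //.
have l1 := listedF (r := t.+1) jk ht. have l2 := listedF (r := u.+1) hj (leqnn _).
have := listedF (r := r.+1) ih hr; rewrite hj => l3; have e1 : blk k = (blk j).-1 by rewrite jk.
rewrite e1 in l1 *.
have size4 : (4 <= size mu)%N by have := blk_lt sum_mu i; lia.
rewrite (hR16 size4 _ _ l1 l2 l2 l3) ?ev0 //; first by rewrite jk.
by rewrite !bdigitE //; move: par1; case: (p h); case: (p j).
Qed.

Hypothesis hom1 : hom 0 1.
Lemma gr_D0 I J : blk I = blk J -> gp (sD I J 0) = (I == J)%:R.
Proof.
move=> IJ; rewrite -(rmorph_nat gp); apply: (gr_eq (hom_sym (SD _ _ _ 0))).
  by rewrite -[_%:R]mulr1; apply: hom_nat.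
by rewrite ev_D0 // ev_nat subrr.
Qed.
Lemma gr_D'0 I J : blk I = blk J -> gp (sym (SD' (blk I) (off I) (off J) 0)) = (I == J)%:R.
Proof.
move=> IJ; rewrite -(rmorph_nat gp); apply: (gr_eq (hom_sym (SD' _ _ _ 0))).
  by rewrite -[_%:R]mulr1; apply: hom_nat.
by rewrite ev_D'0 // ev_nat subrr.
Qed.
Lemma gr_D' I J r : blk I = blk J ->
  gp (sym (SD' (blk I) (off I) (off J) r.+1)) = - gp (sD I J r.+1).
Proof.
move=> IJ; rewrite -rmorphN; apply: (gr_eq (hom_sym (SD' _ _ _ r.+1))).
  exact: homN (hom_sym (SD _ _ _ r.+1)).
by rewrite evN opprK; apply: ev_D'.
Qed.

End Leading.

Section RootVectors.
Variables (G : pzRingType) (I : finType) (p : I -> bool) (blk : I -> nat) (B : nat) (mid : nat -> I).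
Variables (s t : nat -> nat) (d e f : I -> I -> nat -> G).
Local Notation par i j := (p i (+) p j).

(* Lower roots are upper roots for the reversed order of the blocks. *)
Definition rev_blk i := (B - blk i)%N.
(** A lower simple vector from block a + 1 to block a has least degree [t a]. It starts at the
    reversed block c = B - (a + 1), and a is recovered as the predecessor of B - c. *)
Definition rev_shift c := t (B - c).-1.
Definition rev_mid c := mid (B - c)%N.

Definition root_val (z : I * I * nat) : G := let: (i, j, r) := z in
  if blk i == blk j then d i j r else
  if (blk i < blk j)%N then root p blk s mid e i j r else root p rev_blk rev_shift rev_mid f i j r.
Definition root_par (z : I * I * nat) : bool := par z.1.1 z.1.2.
Definition root_valid (z : I * I * nat) : bool := let: (i, j, r) := z in
  if blk i == blk j then true else
  if (blk i < blk j)%N then (lev s (blk i) (blk j) <= r)%N else (lev rev_shift (rev_blk i) (rev_blk j) <= r)%N.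
End RootVectors.

Section PbwRoots.
Variables (K : comNzRingType) (G : pzRingType) (eta : {rmorphism K -> G}) (half : K).
Hypothesis etaC : forall c x, eta c * x = x * eta c.
Hypothesis half2 : half + half = 1.
Variables (I : finType) (p : I -> bool) (blk : I -> nat) (B : nat) (mid : nat -> I).
Variables (s t : nat -> nat) (d e f : I -> I -> nat -> G).
Local Notation par i j := (p i (+) p j).
Local Notation rblk := (rev_blk blk B).
Local Notation rs := (rev_shift B t).
Local Notation rmid := (rev_mid B mid).
Hypothesis blk_lt : forall i, (blk i < B)%N.
Hypothesis midP : forall a, (a < B)%N -> blk (mid a) = a.
Local Notation gl x y i j h l := ((j == h)%:R * x - (-1) ^+ (par i j && par h l) * ((i == l)%:R * y)).
Hypothesis dd : forall i j h l r u, blk i = blk j -> blk h = blk l ->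
  br (par i j) (par h l) (d i j r) (d h l u) = gl (d i l (r + u)%N) (d h j (r + u)%N) i j h l.
Hypothesis de : forall i j h l r u, blk i = blk j -> blk l = (blk h).+1 -> (s (blk h) <= u)%N ->
  br (par i j) (par h l) (d i j r) (e h l u) = gl (e i l (r + u)%N) (e h j (r + u)%N) i j h l.
Hypothesis df : forall i j h l r u, blk i = blk j -> blk h = (blk l).+1 -> (t (blk l) <= u)%N ->
  br (par i j) (par h l) (d i j r) (f h l u) = gl (f i l (r + u)%N) (f h j (r + u)%N) i j h l.
Hypothesis ef : forall i j h l r u, blk j = (blk i).+1 -> blk h = (blk l).+1 ->
  (s (blk i) <= r)%N -> (t (blk l) <= u)%N ->
  br (par i j) (par h l) (e i j r) (f h l u) = gl (d i l (r + u)%N) (d h j (r + u)%N) i j h l.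
Hypothesis ee : forall i j h l r u, blk j = (blk i).+1 -> blk h = blk i -> blk l = blk j ->
  (s (blk i) <= r)%N -> (s (blk h) <= u)%N -> br (par i j) (par h l) (e i j r) (e h l u) = 0.
Hypothesis ff : forall i j h l r u, blk i = (blk j).+1 -> blk h = blk i -> blk l = blk j ->
  (t (blk j) <= r)%N -> (t (blk l) <= u)%N -> br (par i j) (par h l) (f i j r) (f h l u) = 0.
Hypothesis e0 : forall i j h l r u, blk j = (blk i).+1 -> blk l = (blk h).+1 ->
  (blk j < blk h)%N || (blk h == blk j) && (j != h) ->
  (s (blk i) <= r)%N -> (s (blk h) <= u)%N -> br (par i j) (par h l) (e i j r) (e h l u) = 0.
Hypothesis f0 : forall i j h l r u, blk i = (blk j).+1 -> blk h = (blk l).+1 ->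
  (blk i < blk l)%N || (blk l == blk i) && (i != l) ->
  (t (blk j) <= r)%N -> (t (blk l) <= u)%N -> br (par i j) (par h l) (f i j r) (f h l u) = 0.
Hypothesis eshift : forall i j l r u, blk j = (blk i).+1 -> blk l = (blk j).+1 ->
  (s (blk i) <= r)%N -> (s (blk j) <= u)%N ->
  br (par i j) (par j l) (e i j r.+1) (e j l u) = br (par i j) (par j l) (e i j r) (e j l u.+1).
Hypothesis fshift : forall i j l r u, blk i = (blk j).+1 -> blk j = (blk l).+1 ->
  (t (blk j) <= r)%N -> (t (blk l) <= u)%N ->
  br (par i j) (par j l) (f i j r.+1) (f j l u) = br (par i j) (par j l) (f i j r) (f j l u.+1).
Hypothesis serre_e : forall i j h k a b r r' u, blk j = (blk i).+1 -> blk h = blk i -> blk k = blk j ->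
  blk b = (blk a).+1 -> blk a != blk i ->
  (s (blk i) <= r)%N -> (s (blk i) <= r')%N -> (s (blk a) <= u)%N ->
  nest (par i j) (par h k) (par a b) (e i j r) (e i j r') (e h k r') (e h k r) (e a b u) = 0.
Hypothesis serre_f : forall i j h k a b r r' u, blk i = (blk j).+1 -> blk h = blk i -> blk k = blk j ->
  blk a = (blk b).+1 -> blk b != blk j ->
  (t (blk j) <= r)%N -> (t (blk j) <= r')%N -> (t (blk b) <= u)%N ->
  nest (par i j) (par h k) (par a b) (f i j r) (f i j r') (f h k r') (f h k r) (f a b u) = 0.
Hypothesis quartic_e : forall i h j k r u, blk h = (blk i).+1 -> blk j = (blk h).+1 -> blk k = (blk j).+1 ->
  par h j = true -> (s (blk i) <= r)%N -> (s (blk j) <= u)%N ->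
  br (par i h (+) par h j) (par h j (+) par j k)
    (br (par i h) (par h j) (e i h r) (e h j (s (blk h))))
    (br (par h j) (par j k) (e h j (s (blk h))) (e j k u)) = 0.
Hypothesis quartic_f : forall i h j k r u, blk i = (blk h).+1 -> blk h = (blk j).+1 -> blk j = (blk k).+1 ->
  par h j = true -> (t (blk h) <= r)%N -> (t (blk k) <= u)%N ->
  br (par i h (+) par h j) (par h j (+) par j k)
    (br (par i h) (par h j) (f i h r) (f h j (t (blk j))))
    (br (par h j) (par j k) (f h j (t (blk j))) (f j k u)) = 0.

Lemma two_tfG (y : G) : y + y = 0 -> y = 0.
Proof.
by move=> yy; rewrite -[y]mul1r -(rmorph1 eta) -half2 rmorphD mulrDl -mulrDr yy mulr0.
Qed.

(** The zero root vector $d_{j,j'}$ moves the middle position: its ad is applied to a bracket that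
    vanishes because the two middle positions j and j' differ, and the two Jacobi terms are
    compared. *)
Lemma indep_of_zero i j j' k (x1 x2 x1' x2' dj : G) : j != j' ->
  br (par i j) (par j' k) x1 x2' = 0 ->
  br (par j j') (par i j) dj x1 = - ((-1) ^+ (par j j' && par i j) * x1') ->
  br (par j j') (par j' k) dj x2' = x2 ->
  br (par i j) (par j k) x1 x2 = br (par i j') (par j' k) x1' x2'.
Proof.
move=> jj z h1 h2; have := br_jacobi (par j j') (par i j) (par j' k) dj x1 x2'.
rewrite z br0r h1 h2 brNl br_signl => /esym/eqP; rewrite addrC subr_eq0.
have -> : par j j' (+) par j' k = par j k by rewrite -(par_split p).
have -> : par j j' (+) par i j = par i j' by rewrite addbC -(par_split p).
by move=> /eqP /(congr1 (fun x => (-1) ^+ (par j j' && par i j) * x)); rewrite !mulr_sign2 addbb !mul1r.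
Qed.

Lemma rblk1 i j : (rblk j = (rblk i).+1) <-> (blk i = (blk j).+1).
Proof. by rewrite /rev_blk; have := blk_lt i; have := blk_lt j; split; lia. Qed.
Lemma rblk_eq i j : (rblk j = rblk i) <-> (blk j = blk i).
Proof. by rewrite /rev_blk; have := blk_lt i; have := blk_lt j; split; lia. Qed.
Lemma rsE i j : blk i = (blk j).+1 -> rs (rblk i) = t (blk j).
Proof. by move=> ij; rewrite /rev_shift /rev_blk; congr t; have := blk_lt i; lia. Qed.

Lemma up_mid i j a : (blk i < a < blk j)%N -> blk (mid a) = a.
Proof. by move=> /andP[_ aj]; apply: midP; apply: ltn_trans aj _. Qed.
Lemma low_mid i j a : (rblk i < a < rblk j)%N -> rblk (rmid a) = a.
Proof. by rewrite /rev_blk /rev_mid => h; rewrite midP; lia. Qed.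

Definition up_root_bracket := @e_root_bracket G I p blk two_tfG s mid e up_mid.
Lemma up_br i j h k u v : blk k = (blk h).+1 -> (blk i < blk j)%N ->
  (s (blk h) <= u)%N -> (lev s (blk i) (blk j) <= v)%N ->
  br (par h k) (par i j) (e h k u) (root p blk s mid e i j v) =
  (k == i)%:R * root p blk s mid e h j (u + v) -
  (-1) ^+ (par h k && par i j) * ((j == h)%:R * root p blk s mid e i k (v + u)).
Proof.
apply: up_root_bracket => //.
- by move=> *; apply: e0 => //; apply/orP; left.
- by move=> i1 j1 h1 k1 r w ji hj kh n hr hw; apply: e0 => //; rewrite hj eqxx n orbT.
- move=> i1 j1 j1' k1 r w ji jj' kj hr hw.
  have [->//|n] := eqVneq j1 j1'.
  apply: (indep_of_zero (dj := d j1 j1' 0)) => //.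
  + by apply: e0; rewrite ?jj' ?eqxx ?n ?orbT.
  + rewrite de ?jj' // eqxx add0n mul1r; have -> : (j1' == i1) = false by apply/eqP => E; move: ji; rewrite -E; lia.
    by rewrite mul0r sub0r.
  + rewrite de ?jj' // eqxx add0n mul1r; have -> : (j1 == k1) = false by apply/eqP => E; move: kj; rewrite -E; lia.
    by rewrite mul0r mulr0 subr0.
- by move=> i1 j1 h1 k1 a b r r' w ji hi kj ba c *; apply: serre_e => //; case: c; lia.
Qed.

Lemma low_root_br i j h k u v : rblk k = (rblk h).+1 -> (rblk i < rblk j)%N ->
  (rs (rblk h) <= u)%N -> (lev rs (rblk i) (rblk j) <= v)%N ->
  br (par h k) (par i j) (f h k u) (root p rblk rs rmid f i j v) =
  (k == i)%:R * root p rblk rs rmid f h j (u + v) -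
  (-1) ^+ (par h k && par i j) * ((j == h)%:R * root p rblk rs rmid f i k (v + u)).
Proof.
apply: (@e_root_bracket G I p rblk two_tfG rs rmid f low_mid).
- move=> i1 j1 h1 k1 r w /rblk1 ij /rblk_eq hi /rblk_eq kj.
  have hk : blk h1 = (blk k1).+1 by lia.
  by rewrite (rsE ij) (rsE hk) => *; apply: ff.
- move=> i1 j1 h1 k1 r w /rblk1 ij /rblk1 hk far; rewrite (rsE ij) (rsE hk) => hr hw.
  rewrite brC f0 ?mulr0 ?oppr0 //; apply/orP; left; move: far; rewrite /rev_blk.
  by have := blk_lt h1; lia.
- move=> i1 j1 h1 k1 r w /rblk1 ij /rblk_eq hj /rblk1 hk n; rewrite (rsE ij) (rsE hk) => hr hw.
  by rewrite brC f0 ?mulr0 ?oppr0 //; apply/orP; right; rewrite hj eqxx eq_sym.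
- move=> i1 j1 k1 r w /rblk1 ij /rblk1 jk; rewrite (rsE ij) (rsE jk) => hr hw; exact: fshift.
- move=> i1 j1 j1' k1 r w /rblk1 ij /rblk_eq jj' /rblk1 jk; rewrite (rsE ij) (rsE jk) => hr hw.
  have [->//|n] := eqVneq j1 j1'.
  apply: (indep_of_zero (dj := d j1 j1' 0)) => //.
  + by rewrite brC f0 ?mulr0 ?oppr0 ?jj' ?eqxx ?orbT // eq_sym n orbT.
  + rewrite df ?jj' // eqxx add0n mul1r; have -> : (j1' == i1) = false by apply/eqP => E; move: ij; rewrite -E; lia.
    by rewrite mul0r sub0r.
  + rewrite df ?jj' // eqxx add0n mul1r; have -> : (j1 == k1) = false by apply/eqP => E; move: jk; rewrite -E; lia.
    by rewrite mul0r mulr0 subr0.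
- move=> i1 j1 h1 k1 a b r r' w /rblk1 ij /rblk_eq hi /rblk_eq kj /rblk1 ab c.
  rewrite (rsE ij) (rsE ab) => hr hr' hw; apply: serre_f => //.
  by case: c; rewrite /rev_blk; have := blk_lt i1; have := blk_lt j1; have := blk_lt a; have := blk_lt b; lia.
- move=> i1 h1 j1 k1 r w /rblk1 ih /rblk1 hj /rblk1 jk; rewrite (rsE ih) (rsE hj) (rsE jk).
  by move=> *; apply: quartic_f.
Qed.

Definition is_zero_root a (x : G) := exists i j r, [/\ blk i = blk j, par i j = a & x = d i j r].

Local Notation loop := (is_loop p is_zero_root blk rblk s rs mid rmid e f).
Lemma roots_closed a x : loop a x -> maps eta loop loop a x.
Proof.
apply: loop_closed => //.
- exact: up_mid.
- exact: low_mid.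
- exact: up_br.
- exact: low_root_br.
- move=> b y [i [j [r [ij <- ->]]]] c z [h [l [u [hl <- ->]]]]; rewrite dd //.
  apply: spanB; last apply: span_signr.
    have [jh|_] := eqVneq j h; last by rewrite mul0r; apply: span_nil.
    rewrite mul1r; apply: span_in; exists i, l, (r + u)%N; split=> //; first by rewrite ij jh.
    by subst h; rewrite -(par_split p).
  have [il0|_] := eqVneq i l; last by rewrite mul0r; apply: span_nil.
  rewrite mul1r; apply: span_in; exists h, j, (r + u)%N; split=> //; first by rewrite hl -il0.
  by subst l; rewrite [RHS]addbC -(par_split p).
- move=> b y [i [j [r [ij <- ->]]]] c z [h [l [u [lh hu <- ->]]]]; rewrite de //.
  apply: spanB; last apply: span_signr.
    have [jh|_] := eqVneq j h; last by rewrite mul0r; apply: span_nil.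
    subst h; rewrite mul1r; apply: span_in; exists i, l, (r + u)%N; split=> //; try lia.
    by rewrite ij; lia.
  have [il0|_] := eqVneq i l; last by rewrite mul0r; apply: span_nil.
  subst l; rewrite mul1r; apply: span_in; exists h, j, (r + u)%N; split=> //; try lia.
- move=> b y [i [j [r [ij <- ->]]]] c z [h [l [u [/rblk1 hl hu <- ->]]]]; rewrite (rsE hl) in hu.
  rewrite df //; apply: spanB; last apply: span_signr.
    have [jh|_] := eqVneq j h; last by rewrite mul0r; apply: span_nil.
    subst h; rewrite mul1r; apply: span_in; exists i, l, (r + u)%N.
    have il : blk i = (blk l).+1 by rewrite ij.
    by split=> //; [exact/rblk1 | rewrite (rsE il); lia | rewrite -(par_split p)].
  have [il0|_] := eqVneq i l; last by rewrite mul0r; apply: span_nil.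
  subst l; rewrite mul1r; apply: span_in; exists h, j, (r + u)%N.
  have hj : blk h = (blk j).+1 by rewrite -ij.
  by split=> //; [exact/rblk1 | rewrite (rsE hj) -ij; lia | rewrite [RHS]addbC -(par_split p)].
- move=> b c y z [i [j [r [ji hr <- ->]]]] [h [l [u [/rblk1 hl hu <- ->]]]]; rewrite (rsE hl) in hu.
  rewrite ef //; apply: spanB; last apply: span_signr.
    have [jh|_] := eqVneq j h; last by rewrite mul0r; apply: span_nil.
    subst h; rewrite mul1r; apply: span_in; exists i, l, (r + u)%N; split=> //; first by lia.
    by rewrite -(par_split p).
  have [il0|_] := eqVneq i l; last by rewrite mul0r; apply: span_nil.
  subst l; rewrite mul1r; apply: span_in; exists h, j, (r + u)%N; split=> //; first by lia.
  by rewrite [RHS]addbC -(par_split p).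
Qed.

Local Notation val := (root_val p blk B mid s t d e f).
Local Notation q := (root_par p).
Local Notation valid := (root_valid blk B s t).

Lemma rblk_ltn i j : (rblk i < rblk j)%N = (blk j < blk i)%N.
Proof. by rewrite /rev_blk; have := blk_lt i; have := blk_lt j; lia. Qed.

Lemma loop_val a x : loop a x <-> is_val q val valid a x.
Proof.
split=> [[|[i [j [r [ij pa ->]]]]|]|[[[i j] r] [/= vz qz ->]]].
- move=> [i [j [r [ij lr pa ->]]]]; exists (i, j, r); rewrite /= ij ltn_eqF //; split=> //.
- by exists (i, j, r); rewrite /= ij eqxx.
- move=> [i [j [r [ij lr pa ->]]]]; exists (i, j, r); rewrite rblk_ltn in ij.
  by rewrite /= gtn_eqF // ltnNge ltnW.
move: vz; rewrite /=; case: eqP => [ij _|/eqP ij]; first by apply: Or32; exists i, j, r.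
case: ifP => [lt lr|lt lr]; first by apply: Or31; exists i, j, r.
by apply: Or33; exists i, j, r; split=> //; rewrite rblk_ltn ltn_neqAle eq_sym ij leqNgt lt.
Qed.

Theorem roots_pbw w : all valid w -> span eta (pbw q val valid (size w)) (word val w).
Proof.
apply: (word_pbw etaC half2) => x y vx vy.
have lx : loop (q x) (val x) by apply/loop_val; exists x.
have ly : loop (q y) (val y) by apply/loop_val; exists y.
by apply: span_sub (roots_closed lx ly) _ => z /loop_val; apply: span_in.
Qed.

End PbwRoots.

Section RootMorphism.
Variables (A B : pzRingType) (h : {rmorphism A -> B}).
Lemma rmorph_br' a b x y : h (br a b x y) = br a b (h x) (h y).
Proof. by rewrite !brE /sc rmorphB !rmorphM rmorph_sign. Qed.
Lemma rmorph_root (I : finType) (p : I -> bool) blk s mid (e : I -> I -> nat -> A) (e' : I -> I -> nat -> B) i j r :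
  (forall i j r, h (e i j r) = e' i j r) -> h (root p blk s mid e i j r) = root p blk s mid e' i j r.
Proof.
move=> he; rewrite /root; move: (blk j - blk i).-1 => n; elim: n i r => [|n IH] i r //=.
by rewrite rmorph_br' he IH.
Qed.
Lemma rmorph_root_val (I : finType) (p : I -> bool) blk C mid s t d e f d' e' f' (z : I * I * nat) :
  (forall i j r, h (d i j r) = d' i j r) -> (forall i j r, h (e i j r) = e' i j r) ->
  (forall i j r, h (f i j r) = f' i j r) ->
  h (root_val p blk C mid s t d e f z) = root_val p blk C mid s t d' e' f' z.
Proof.
by case: z => [[i j] r] hd he hf; rewrite /root_val; do 2?case: ifP => // _; apply: rmorph_root.
Qed.
Lemma rmorph_word (X : countType) (v : X -> A) (v' : X -> B) w : (forall z, h (v z) = v' z) ->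
  h (word v w) = word v' w.
Proof. by move=> hv; rewrite /word rmorph_prod; apply: eq_bigr => z _; apply: hv. Qed.
End RootMorphism.

(** * Ordered monomials span the presented algebra *)

Section PresentedSpan.
Variables (K : comNzRingType) (half : K) (N : nat) (Ups : seq bool) (sigma : 'M[nat]_N) (mu : seq nat).
Hypothesis half2 : half + half = 1.
Hypothesis sum_mu : sumn mu = N.
Local Notation blk := (@blk_of N mu).
Local Notation off := (@off_of N mu).
Local Notation p := (@ord_digit N Ups).
Local Notation rels := (@parabolic_rel K N Ups sigma mu).
Local Notation gpar := (@pgen_parity N Ups sigma mu).
Local Notation sym := (psym K sigma mu).
Definition pgen_degree (g : pgen sigma mu) := symbol_degree (val g).
Local Notation sm := (fun f g => small pgen_degree rels (f - g)).
Local Notation gp := (pres_pi_rm sm).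
Local Notation pi := (pres_pi_rm rels).
Variable mid : nat -> 'I_N.
Hypothesis midP : forall a, (a < size mu)%N -> blk (mid a) = a.
Definition up_shift a := block_shift sigma mu a a.+1.
Definition low_shift a := block_shift sigma mu a.+1 a.

(** The root vectors are first built in the free algebra, so that the same element has an image in
    the graded algebra, where words are reordered, and in the presented algebra, where they have to
    span. *)
Definition dA I J r : free_alg K (pgen sigma mu) := (-1) ^+ p I * sym (SD (blk I) (off I) (off J) r.+1).
Definition eA I J r : free_alg K (pgen sigma mu) := (-1) ^+ p I * sym (SE (blk I) (off I) (off J) r.+1).
Definition fA I J r : free_alg K (pgen sigma mu) := (-1) ^+ p I * sym (SF (blk J) (off I) (off J) r.+1).
Local Notation valA := (root_val p blk (size mu) mid up_shift low_shift dA eA fA).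
Local Notation q := (root_par p).
Local Notation valid := (root_valid blk (size mu) up_shift low_shift).

Let lo := low (pres_cst rels) pgen_degree (pres_gen rels).
Let hom := homog pgen_degree rels.

Lemma hom_psym g : hom (symbol_degree g) (sym g).
Proof.
rewrite /psym; case: insubP => [u _ <-|_]; last exact: homog0.
exact: (homog_gen _ rels u).
Qed.
Lemma lo_psym g : lo (symbol_degree g).+1 (pi (sym g)).
Proof.
rewrite /psym; case: insubP => [u _ <-|_]; last by rewrite rmorph0; apply: low0.
exact: (low_gen _ pgen_degree (pres_gen rels) u).
Qed.
Lemma lo_psym2 n g g' : (symbol_degree g + symbol_degree g' < n)%N -> lo n (pi (sym g) * pi (sym g')).
Proof.
by move=> dn; apply: (lowM (@pres_cstC _ _ _) _ (lo_psym g) (lo_psym g')); rewrite addSn addnS ltnS.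
Qed.
Lemma gp_com a b x y : pure gpar a x -> pure gpar b y -> gp (scomm gpar x y) = br a b (gp x) (gp y).
Proof. by move=> px py; rewrite (scomm_pure px py) rmorph_br. Qed.
Lemma hom_com a b m n x y : pure gpar a x -> pure gpar b y -> hom m x -> hom n y ->
  hom (m + n)%N (scomm gpar x y).
Proof. by move=> px py; rewrite (scomm_pure px py); apply: homog_br. Qed.
Lemma rels_pi l r : rels l r -> pi l = pi r.
Proof. by move=> lr; apply/pres_piP/rel_ideal_rel. Qed.
Lemma homN n x : hom n x -> hom n (- x). Proof. exact: homogN. Qed.
Lemma homD n x y : hom n x -> hom n y -> hom n (x + y). Proof. exact: homogD. Qed.
Lemma loD n x y : lo n x -> lo n y -> lo n (x + y). Proof. exact: lowD. Qed.
Lemma loN n x : lo n x -> lo n (- x). Proof. exact: lowN. Qed.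
Lemma gr_eq' n x y : hom n x -> hom n y -> lo n (pi x - pi y) -> gp x = gp y.
Proof. exact: gr_eq. Qed.

Definition gDl I J r := @gD N Ups mu _ _ gp sym I J r.
Definition gEl I J r := @gE N Ups mu _ _ gp sym I J r.
Definition gFl I J r := @gF N Ups mu _ _ gp sym I J r.
Local Notation valG := (root_val p blk (size mu) mid up_shift low_shift gDl gEl gFl).

Lemma gp_val z : gp (valA z) = valG z.
Proof. by apply: rmorph_root_val => i j r; rewrite rmorphM rmorph_sign. Qed.

Let pp := @pure_psym K N Ups sigma mu.
Let ps := @pure_scomm K _ gpar.
Let h0 n : hom n 0 := homog0 _ _ n.
Let h1 : hom 0 1 := homog1 _ _.
Let l0 n : lo n 0 := low0 _ _ _ n.
Let H3 a i j r b h k s l1 l2 := rels_pi (@R3 K N Ups sigma mu a i j r b h k s l1 l2).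
Let H4 a i j r b h k s l1 l2 := rels_pi (@R4 K N Ups sigma mu a i j r b h k s l1 l2).
Let H5 a i j r b h k s l1 l2 := rels_pi (@R5 K N Ups sigma mu a i j r b h k s l1 l2).
Let H6 a i j r b h k s l1 l2 := rels_pi (@R6 K N Ups sigma mu a i j r b h k s l1 l2).
Let H7 a i j r h k s l1 l2 := rels_pi (@R7 K N Ups sigma mu a i j r h k s l1 l2).
Let H8 a i j r h k s l1 l2 := rels_pi (@R8 K N Ups sigma mu a i j r h k s l1 l2).
Let H9 a i j r h k s l1 l2 := rels_pi (@R9 K N Ups sigma mu a i j r h k s l1 l2).
Let H10 a i j r h k s l1 l2 := rels_pi (@R10 K N Ups sigma mu a i j r h k s l1 l2).
Let H11 a i j r b h k s l1 l2 c := rels_pi (@R11 K N Ups sigma mu a i j r b h k s l1 l2 c).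
Let H12 a i j r b h k s l1 l2 c := rels_pi (@R12 K N Ups sigma mu a i j r b h k s l1 l2 c).
Let H13 a i j r h k s b f g t l1 l2 l3 c := rels_pi (@R13 K N Ups sigma mu a i j r h k s b f g t l1 l2 l3 c).
Let H14 a i j r h k s b f g t l1 l2 l3 c := rels_pi (@R14 K N Ups sigma mu a i j r h k s b f g t l1 l2 l3 c).
Let H15 a i f1 r f2 j h g1 g2 k s c1 c2 c3 l1 l2 l3 l4 := rels_pi (@R15 K N Ups sigma mu a i f1 r f2 j h g1 g2 k s c1 c2 c3 l1 l2 l3 l4).
Let H16 a i f1 r f2 j h g1 g2 k s c1 c2 c3 l1 l2 l3 l4 := rels_pi (@R16 K N Ups sigma mu a i f1 r f2 j h g1 g2 k s c1 c2 c3 l1 l2 l3 l4).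
Let H1D a i j l := rels_pi (@R1D K N Ups sigma mu a i j l).
Let H1D' a i j l := rels_pi (@R1D' K N Ups sigma mu a i j l).
Let H2 a i j r l := rels_pi (@R2 K N Ups sigma mu a i j r l).
Let Ldd := gr_dd sum_mu pp gp_com hom_psym hom_com h0 homD homN lo_psym2 l0 loD loN gr_eq' H3 H1D.
Let Lde := gr_de sum_mu pp gp_com hom_psym hom_com h0 homN lo_psym2 l0 loD loN gr_eq' H4 H1D.
Let Ldf := gr_df sum_mu pp gp_com hom_psym hom_com h0 homN lo_psym2 l0 loD loN gr_eq' H5 H1D.
Let Lef := gr_ef sum_mu pp gp_com hom_psym hom_com h0 homD homN lo_psym2 l0 loD loN gr_eq' H2 H6 H1D H1D'.
Let Lee := gr_ee sum_mu pp gp_com hom_psym hom_com h0 lo_psym2 l0 loD loN gr_eq' H7.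
Let Lff := gr_ff sum_mu pp gp_com hom_psym hom_com h0 lo_psym2 l0 loD loN gr_eq' H8.
Let Le0 := gr_e0 sum_mu pp gp_com hom_psym hom_com h0 l0 gr_eq' H11.
Let Lf0 := gr_f0 sum_mu pp gp_com hom_psym hom_com h0 l0 gr_eq' H12.
Let Leshift := gr_eshift sum_mu pp gp_com hom_psym hom_com lo_psym2 l0 loD loN gr_eq' H9.
Let Lfshift := gr_fshift sum_mu pp gp_com hom_psym hom_com lo_psym2 l0 loD loN gr_eq' H10.
Let Lserre_e := gr_serre_e sum_mu pp gp_com ps hom_psym hom_com h0 homD l0 gr_eq' H13.
Let Lserre_f := gr_serre_f sum_mu pp gp_com ps hom_psym hom_com h0 homD l0 gr_eq' H14.
Let Lquartic_e := gr_quartic_e sum_mu pp gp_com ps hom_psym hom_com h0 l0 gr_eq' H15.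
Let Lquartic_f := gr_quartic_f sum_mu pp gp_com ps hom_psym hom_com h0 l0 gr_eq' H16.
Let LD0 := gr_D0 sum_mu hom_psym h0 l0 gr_eq' H1D h1.
Let LD'0 := gr_D'0 sum_mu hom_psym h0 l0 gr_eq' H1D' h1.
Let LD' := gr_D' sum_mu hom_psym homN lo_psym2 l0 loD loN gr_eq' H2 H1D H1D'.

Lemma gr_words w : all valid w -> span (pres_cst sm) (pbw q valG valid (size w)) (word valG w).
Proof.
apply: (roots_pbw (@pres_cstC _ _ _) half2 (blk_lt sum_mu) midP).
- exact: Ldd.
- exact: Lde.
- exact: Ldf.
- exact: Lef.
- exact: Lee.
- exact: Lff.
- exact: Le0.
- exact: Lf0.
- exact: Leshift.
- exact: Lfshift.
- exact: Lserre_e.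
- exact: Lserre_f.
- exact: Lquartic_e.
- exact: Lquartic_f.
Qed.

Local Notation vwords := (fun y => exists2 w, all valid w & y = word valG w).

Lemma span_word1 z (b : bool) : valid z -> span (pres_cst sm) vwords ((-1) ^+ b * valG z).
Proof.
by move=> vz; apply/span_signr/span_in; exists [:: z]; rewrite /= ?vz // /word big_seq1.
Qed.
Lemma span_wordn (b : bool) : span (pres_cst sm) vwords b%:R.
Proof. by rewrite -[b%:R]mulr1; apply/span_natr/span_in; exists [::]; rewrite // /word big_nil. Qed.

(** In the graded algebra D' is minus D and exponent 0 gives constants, so every generator becomes a
    scalar or a root vector up to sign. *)
Lemma gp_gen (g : pgen sigma mu) : span (pres_cst sm) vwords (gp (free_gen K g)).
Proof.
have -> : free_gen K g = sym (val g) by rewrite /psym valK.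
have sg I x : gp x = (-1) ^+ p I * ((-1) ^+ p I * gp x) by rewrite mulr_sign2 addbb mul1r.
case: g => -[a i j r|a i j r|a i j r|a i j r] lg; rewrite [val _]/=.
- have [I [J [_ <- Ja <- <-]]] := listedDE sum_mu lg; case: r {lg} => [|r].
    by rewrite LD0 //; apply: span_wordn.
  rewrite (sg I); have := @span_word1 (I, J, r) (p I); rewrite /= Ja eqxx; exact.
- have [I [J [_ <- Ja <- <-]]] := listedDE sum_mu (lg : listed sigma mu (SD a i j r)); case: r {lg} => [|r].
    by rewrite LD'0 //; apply: span_wordn.
  rewrite LD' //.
  rewrite (sg I); have := @span_word1 (I, J, r) (p I); rewrite /= Ja eqxx => h; apply/spanN; exact: h.
- have [I [J [<- Jb <- <- br]]] := listedEE sum_mu lg; case: r {lg} br => [|r] // br.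
  rewrite (sg I); have := @span_word1 (I, J, r) (p I).
  by rewrite /= Jb root1 // ltn_eqF ?ltnSn // lev1; apply.
have [I [J [Ib Jb <- <- br]]] := listedFE sum_mu lg; case: r {lg} br => [|r] // br; subst a.
rewrite (sg I); have := @span_word1 (I, J, r) (p I).
have rI : rev_blk blk (size mu) J = (rev_blk blk (size mu) I).+1 by rewrite /rev_blk; have := blk_lt sum_mu I; lia.
rewrite /root_valid /root_val Ib gtn_eqF // ltnNge leqnSn /= root1 // rI lev1.
by rewrite (rsE low_shift (blk_lt sum_mu) Ib); apply.
Qed.

Lemma gp_prod (w : seq (pgen sigma mu)) : span (pres_cst sm) vwords (gp (\prod_(g <- w) free_gen K g)).
Proof.
elim: w => [|g w IH]; first by rewrite big_nil rmorph1; apply: (span_wordn true).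
rewrite big_cons rmorphM; apply: (span_mul (@pres_cstC _ _ _) _ (gp_gen g) IH).
move=> _ _ [u vu ->] [u' vu' ->]; apply: span_in; exists (u ++ u'); first by rewrite all_cat vu.
by rewrite word_cat.
Qed.

Lemma hom_sign_psym (b : bool) g : hom (symbol_degree g) ((-1) ^+ b * sym g).
Proof. by apply: homog_sign; apply: hom_psym. Qed.

Lemma hom_root rb s m (e : 'I_N -> 'I_N -> nat -> free_alg K (pgen sigma mu)) i j r :
  (forall i j r, hom r (e i j r)) -> (lev s (rb i) (rb j) <= r)%N -> exists n, hom n (root p rb s m e i j r).
Proof.
move=> he _; rewrite /root; move: (_ - _).-1 => n; elim: n i r => [|n IH] i r; first by exists r.
have [k hk] := IH (m (rb i).+1) (lev s (rb i).+1 (rb j)).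
by eexists => /=; apply: homog_br; [apply: he | apply: hk].
Qed.

Lemma hom_val z : valid z -> exists n, hom n (valA z).
Proof.
case: z => [[i j] r] /=; case: ifP => _; first by exists r; apply: (hom_sign_psym _ (SD _ _ _ r.+1)).
case: ifP => _ h; apply: hom_root h => i' j' r'.
  exact: (hom_sign_psym _ (SE _ _ _ r'.+1)).
exact: (hom_sign_psym _ (SF _ _ _ r'.+1)).
Qed.

Definition root_gen z := pi (valA z).

Theorem presented_span x : span (pres_cst rels)
  (fun y => exists2 w, pbw_word q valid w & y = word root_gen w) x.
Proof.
pose S f := exists2 w, pbw_word q valid w & f = word valA w.
have Sx : span (pres_cst rels) (fun y => exists2 f, S f & y = pi f) x.
  apply: (@gr_span _ _ pgen_degree rels S) => [f [w /andP[_ vw] ->]|w].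
    elim: w vw => [_|z w IH /andP[vz /IH[n hn]]]; first by exists 0%N; rewrite /word big_nil; apply: homog1.
    have [m hm] := hom_val vz; exists (m + n)%N; rewrite word_cons; exact: homogM.
  apply: span_sub (gp_prod w) _ => _ [u vu ->]; apply: span_sub (gr_words vu) _ => _ [u' [_ pu ->]].
  apply: span_in; exists (word valA u'); first by exists u'.
  by rewrite (rmorph_word (h := gp) u' gp_val).
apply: span_sub Sx _ => _ [_ [w pw ->] ->]; apply: span_in; exists w => //.
by apply: rmorph_word.
Qed.

End PresentedSpan.

(** * Evaluation modules and coaction *)

Section RttProducts.
Variables (Q : pzRingType) (N : nat) (p : 'I_N -> bool).
Local Notation L := (legs Q p).
Local Notation par i j := (p i (+) p j).
Implicit Types T : fps 'M[Q]_N.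

Lemma rtt_coef_legs T : T 0%N = 1 -> rtt_coef p T -> rtt L T.
Proof.
move=> T0 rT; have [T' [TT' T'T]] := fps_inverse_exists T0.
have one0 (r : nat) (i j : 'I_N) : ((1 : fps 'M[Q]_N) r i j) = ((r == 0%N) && (i == j))%:R.
  by rewrite fps1E; case: r => [|r]; rewrite /= ?mulr1n mxE //; case: (i == j).
(* The trivial Gauss decomposition with all positions in a single block. *)
have pc : pencil p (fun=> 0%N) T 1 T T' 1 by split; rewrite ?mul1r ?mulr1 // => r i j _; apply: one0.
by apply: (rtt_legs pc); rewrite mul1r.
Qed.

Lemma legs_rtt_coef T : rtt L T -> rtt_coef p T.
Proof.
move=> /rtt_comm/diff_varE2[Z0 _ ZS] i j h k r s _ _.
have mmD (x y : 'M['M[Q]_N]_N) : (x + y) i j h k = x i j h k + y i j h k by rewrite !mxE.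
have Zsum : comm_ab p T r s i j h k = \sum_(g < minn r s) flip_ab p T g (r + s - 1 - g)%N i j h k.
  elim: r s => [|r IH] s; first by rewrite min0n big_ord0 [comm_ab _ _ _ _]Z0 !mxE.
  rewrite [comm_ab _ _ _ _]ZS mmD [X in X + _](IH s.+1).
  rewrite (@minn_sum_step _ (fun t u => flip_ab p T t u i j h k)) // => [t u|t].
    exact: flip_ab_asym.
  exact: flip_ab_diag.
move: Zsum; rewrite comm_abE => /sign_moveK => ->.
rewrite !mulr_sumr; apply: eq_bigr => g _; rewrite flip_abE mulr_sign2.
by congr ((-1) ^+ _ * _); congr nat_of_bool; case: (p h); case: (p i); case: (p j).
Qed.

(** The argument behind the coproduct: RTT is multiplicative for matrices whose entries supercommute
    with each other. *)
Lemma rtt_mul A B : rtt L A -> rtt L B -> a1 L B * b2 L A = b2 L A * a1 L B ->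
  a1 L A * b2 L B = b2 L B * a1 L A -> rtt L (A * B).
Proof.
rewrite /rtt !rmorphM; set c := (_ - _ * _); move: (a1 L A) (a1 L B) (b2 L A) (b2 L B) c.
move=> x1 y1 x2 y2 c.
move=> rA rB c1 c2.
have -> : x1 * y1 * (x2 * y2) = (x1 * x2) * (y1 * y2) by rewrite mulrA -(mulrA x1) c1 !mulrA.
by rewrite mulrA rA -mulrA rB !mulrA -(mulrA x2 x1 y2) c2 !mulrA.
Qed.

Lemma comm_legs (A B : fps 'M[Q]_N) : (forall i j h k r s, sc (par i j && par h k) (A r i j) (B s h k) = 0) ->
  a1 L A * b2 L B = b2 L B * a1 L A.
Proof.
move=> AB; apply/eqP; rewrite -subr_eq0; apply/eqP; apply: SP => r s; apply: mmP => i j h k.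
by rewrite comm_abE AB mulr0 !mxE.
Qed.
End RttProducts.

Lemma munit_signs (R : pzRingType) (a b d f d1 d2 : bool) (c x y : R) :
  (d1 -> d = b) -> (d2 -> a = f) ->
  c * (d2%:R * ((-1) ^+ ((a && b) (+) (d && a) (+) (d && b)) * x))
    - (-1) ^+ ((a (+) b) && (d (+) f)) *
      (c * (d1%:R * ((-1) ^+ ((d && f) (+) (a && d) (+) (a && f)) * y))) =
  (-1) ^+ ((a && b) (+) (a && d) (+) (b && d)) * (d1%:R * - (c * y) - - (c * x) * d2%:R).
Proof.
case: d1 => [/(_ isT) ->|_]; case: d2 => [/(_ isT) ->|_];
  rewrite ?(mul0r, mulr0, mul1r, mulr1, subr0, sub0r, oppr0) //.
- by case: b; case: f; rewrite /= ?(expr0, expr1); ncring.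
- by case: a; case: b; case: f; rewrite /= ?(expr0, expr1); ncring.
- by case: f; case: b; case: d; rewrite /= ?(expr0, expr1); ncring.
Qed.

Section VectorEvaluation.
Variables (Y : pzRingType) (N : nat) (p : 'I_N -> bool).
Local Notation par i j := (p i (+) p j).
Local Notation Z := (fps Y).
Local Notation Q := 'M[Z]_N.
(** The matrix unit $e_{j,i}$ with a sign. Reading it off the flip amounts to letting the R-matrix
    define the vector representation. *)
Definition munit i j : Q := flip Z p i j.
Definition mono r : Z := (fps_X Y) ^+ r.
Definition mono_mx r : Q := (mono r)%:M.

Lemma monoC r x : mono r * x = x * mono r.
Proof.
rewrite /mono; elim: r => [|r IH]; first by rewrite mulr1 mul1r.
by rewrite exprS -mulrA IH mulrA fps_XC -mulrA.
Qed.
Lemma monoM r s : mono r * mono s = mono (r + s). Proof. by rewrite /mono exprD. Qed.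
Lemma mono_coef r (f : Z) n : (mono r * f) n = if (r <= n)%N then f (n - r)%N else 0.
Proof.
rewrite /mono; elim: r n => [|r IH] n; first by rewrite mul1r subn0.
by rewrite exprS -mulrA fps_XM; case: n => [|n] //; rewrite IH ltnS subSS.
Qed.
Lemma mono_mxE r (M : Q) h k : (mono_mx r * M) h k = mono r * M h k.
Proof. by rewrite [mono_mx r * M]mul_scalar_mx mxE. Qed.
Lemma mono_mxC r (M : Q) : mono_mx r * M = M * mono_mx r.
Proof.
apply/matrixP => h k; rewrite mono_mxE [RHS]mxE (bigD1 k) //= mxE eqxx mulr1n big1 ?addr0 ?monoC //.
by move=> i /negPf n; rewrite mxE n mulr0n mulr0.
Qed.
Lemma mono_mxM r s : mono_mx r * mono_mx s = mono_mx (r + s).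
Proof. by rewrite /mono_mx [_ * _]mul_scalar_mx scale_scalar_mx monoM. Qed.

Lemma munitE i j h k : munit i j h k = if (h == j) && (k == i) then (-1) ^+ (p i && p j) else 0.
Proof. exact: flipE. Qed.
Lemma munitMl i j (M : Q) h k : (munit i j * M) h k = if h == j then (-1) ^+ (p i && p j) * M i k else 0.
Proof.
rewrite mxE (bigD1 i) //= big1 ?addr0 => [|l /negPf n]; rewrite munitE ?n ?andbF ?mul0r // eqxx andbT.
by case: ifP; rewrite ?mul0r.
Qed.
Lemma munitM i j h k : munit i j * munit h k =
  (i == k)%:R * ((-1) ^+ ((p i && p j) (+) (p h && p i) (+) (p h && p j)) * munit h j).
Proof.
apply/matrixP => x y; rewrite munitMl munitE.
have [->|ik] := eqVneq i k; last by rewrite mul0r mxE /=; case: ifP; rewrite ?mulr0.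
have signmx (b : bool) (M : Q) : ((-1) ^+ b * M) x y = (-1) ^+ b * M x y.
  by case: b; rewrite ?mul1r // !mulN1r mxE.
rewrite mul1r signmx munitE; case: (x == j); case: (y == h); rewrite /= ?mulr0 // -!signr_addb.
by congr ((-1) ^+ nat_of_bool _); case: (p k); case: (p j); case: (p h).
Qed.

(** The expansion of $1-P/(u-a)$ in $u^{-1}$, where the formal parameter $a$ is the series variable:
    the coefficient of $u^{-r-1}$ is $-a^rP$. *)
Definition evalA : fps 'M[Q]_N := fun r =>
  if r is r'.+1 then \matrix_(i, j) (- (mono_mx r' * munit i j)) else 1.
Lemma evalA0 i j : evalA 0%N i j = (i == j)%:R.
Proof. by rewrite mxE; case: (i == j). Qed.
Lemma evalAE r i j : evalA r.+1 i j = - (mono_mx r * munit i j). Proof. by rewrite mxE. Qed.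

Lemma evalA_rtt : rtt_coef p evalA.
Proof.
(* For g > 0 the two products differ only in how the central power of $a$ is distributed, so they
   cancel; the summand g = 0 is the whole relation. *)
move=> i j h k [|r] [|s] // _ _; rewrite minnSS big_ord_recl [X in _ + X]big1; last first.
  move=> g _; rewrite lift0.
  have -> : (r.+1 + s.+1 - 1 - g.+1 = (r + s - g.+1).+1)%N by have := ltn_ord g; lia.
  have cc (n m : nat) (M M' : Q) : - (mono_mx n * M) * - (mono_mx m * M') = mono_mx (n + m) * (M * M').
    by rewrite mulrNN -mulrA (mulrA M) -mono_mxC !mulrA mono_mxM.
  by rewrite !evalAE !cc [(g + _)%N]addnC subrr.
have -> : (r.+1 + s.+1 - 1 - @ord0 (minn r s) = (r + s).+1)%N by rewrite /=; lia.
have cc (n m : nat) (M M' : Q) : mono_mx n * M * (mono_mx m * M') = mono_mx (n + m) * (M * M').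
  by rewrite -mulrA (mulrA M) -mono_mxC !mulrA mono_mxM.
rewrite addr0 !evalAE !evalA0 /sc !mulrNN !cc [(s + r)%N]addnC !munitM.
by apply: munit_signs => /eqP ->.
Qed.

(* The sign matrix through which odd elements of Y act on the tensor product. *)
Definition smx (b : bool) : Q := \matrix_(h, k) (if h == k then (-1) ^+ (p h && b) else 0).
Definition signed b (x : Z) : Q := smx b * x%:M.

Lemma signedE b x h k : signed b x h k = if h == k then (-1) ^+ (p h && b) * x else 0.
Proof.
rewrite mxE (bigD1 h) //= big1 ?addr0 => [|l /negPf n]; rewrite !mxE ?eqxx.
  by case: eqVneq => // _; rewrite mulr0n mulr0.
by rewrite eq_sym n mul0r.
Qed.
Lemma signedMl b x (M : Q) h k : (signed b x * M) h k = (-1) ^+ (p h && b) * (x * M h k).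
Proof.
rewrite mxE (bigD1 h) //= big1 ?addr0 => [|l /negPf n]; rewrite signedE ?eqxx ?mulrA //.
by rewrite eq_sym n mul0r.
Qed.
Lemma signedM a b x y : signed a x * signed b y = signed (a (+) b) (x * y).
Proof.
apply/matrixP => h k; rewrite signedMl !signedE; case: eqP => [->|_]; last by rewrite !mulr0.
by rewrite mulr_signl mulr_sign2; congr ((-1) ^+ nat_of_bool _ * _); case: (p k); case: a.
Qed.
Lemma signedD b x y : signed b (x + y) = signed b x + signed b y.
Proof. by apply/matrixP => h k; rewrite signedE [RHS]mxE !signedE mulrDr; case: eqP; rewrite ?addr0. Qed.
Lemma signedN b x : signed b (- x) = - signed b x.
Proof. by apply/matrixP => h k; rewrite signedE [RHS]mxE !signedE mulrN; case: eqP; rewrite ?oppr0. Qed.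
Lemma signed_sign b (c : bool) x : signed b ((-1) ^+ c * x) = (-1) ^+ c * signed b x.
Proof. by case: c; rewrite ?mul1r // !mulN1r signedN. Qed.
Lemma signed0 b : signed b 0 = 0.
Proof. by apply/matrixP => h k; rewrite signedE mulr0 if_same mxE. Qed.
Lemma signed_sum b I (r : seq I) (P : pred I) (f : I -> Z) :
  signed b (\sum_(i <- r | P i) f i) = \sum_(i <- r | P i) signed b (f i).
Proof. exact: (big_morph _ (signedD b) (signed0 b)). Qed.
Lemma signed_br a b c x y : sc c (signed a x) (signed b y) = signed (a (+) b) (sc c x y).
Proof. by rewrite /sc !signedM signedD signedN signed_sign [b (+) a]addbC. Qed.

Variable T : fps 'M[Y]_N.
Hypotheses (T0 : T 0%N = 1) (rT : rtt_coef p T).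
Definition evalB : fps 'M[Q]_N := fun r => \matrix_(i, j) signed (par i j) (fps_cst (T r i j)).
Lemma evalBE r i j : evalB r i j = signed (par i j) (fps_cst (T r i j)). Proof. by rewrite mxE. Qed.
Lemma evalB0 : evalB 0%N = 1.
Proof.
apply/matrixP => i j; rewrite evalBE T0 !mxE; have [->|_] := eqVneq i j; last by rewrite raddf0 signed0.
apply/matrixP => h k; rewrite signedE addbb andbF mxE mul1r.
by case: (h == k).
Qed.

Lemma evalB_rtt : rtt_coef p evalB.
Proof.
move=> i j h k r s r0 s0; rewrite !evalBE signed_br.
have -> : sc (par i j && par h k) (fps_cst (T r i j)) (fps_cst (T s h k)) =
    fps_cst (sc (par i j && par h k) (T r i j) (T s h k)).
  by rewrite /sc rmorphB !rmorphM rmorph_sign.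
rewrite rT // rmorphM rmorph_sign signed_sign rmorph_sum signed_sum; congr (_ * _).
apply: eq_bigr => g _; rewrite !evalBE !signedM rmorphB !rmorphM signedD signedN.
have -> // : par h j (+) par i k = par i j (+) par h k.
by case: (p i); case: (p j); case: (p h); case: (p k).
Qed.

Lemma munit_signed i j b x : munit i j * signed b x = (-1) ^+ (par i j && b) * (signed b x * munit i j).
Proof.
apply/matrixP => h k; rewrite munitMl signedE.
have signmx (c : bool) (M : Q) : ((-1) ^+ c * M) h k = (-1) ^+ c * M h k.
  by case: c; rewrite ?mul1r // !mulN1r mxE.
rewrite signmx signedMl munitE [k == i]eq_sym.
have [->|_] := eqVneq h j; last by rewrite !mulr0.
have [->|_] := eqVneq i k; last by rewrite !mulr0.
rewrite /= -signrC !mulr_sign2; congr ((-1) ^+ nat_of_bool _ * _).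
by case: (p j); case: (p k); case: b.
Qed.

Lemma evalAB_comm i j h k r s : sc (par i j && par h k) (evalA r i j) (evalB s h k) = 0.
Proof.
case: r => [|r]; first by rewrite evalA0 sc_nat0 //; case: eqP => // ->; rewrite addbb.
rewrite evalAE evalBE /sc mulNr mulrN mulrN opprK.
rewrite -mulrA munit_signed [signed _ _ * (_ * _)]mulrA -mono_mxC -mulrA mulr_signl.
by rewrite addNr.
Qed.

(** The action of T(u) on the tensor product of the vector evaluation module with Y: the coproduct
    with its first factor evaluated. *)
Definition coactT : fps 'M[Q]_N := evalA * evalB.
Lemma coactT0 : coactT 0%N = 1. Proof. by rewrite /coactT fps_mul0E evalB0 mulr1. Qed.
Lemma coactT_rtt : rtt_coef p coactT.
Proof.
apply/legs_rtt_coef/rtt_mul; [exact/rtt_coef_legs/evalA_rtt | exact/rtt_coef_legs/evalB_rtt/evalB0 | | ].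
  apply: comm_legs => i j h k r s; rewrite scC andbC evalAB_comm mulr0 oppr0 //.
by apply: comm_legs => *; apply: evalAB_comm.
Qed.

End VectorEvaluation.

(** * Linear independence of ordered monomials *)

Section YangianEval.
Variables (K : comNzRingType) (N : nat) (Ups : seq bool).
Local Notation p := (@ord_digit N Ups).
Local Notation par i j := (p i (+) p j).
Local Notation rels := (@yangian_rel K N Ups).
Local Notation tpar := (@tgen_parity N Ups).
Local Notation FA := (free_alg K (tgen N)).

Lemma push_rtt (A Q : pzRingType) (ev : {rmorphism A -> Q}) (sym : 'I_N -> 'I_N -> nat -> A)
    (T : nat -> 'I_N -> 'I_N -> Q) (i j h k : 'I_N) r s :
  (forall i j r, ev (sym i j r) = T r i j) ->
  ev ((-1) ^+ (digit Ups i * digit Ups j + digit Ups i * digit Ups h + digit Ups j * digit Ups h)%N *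
     \sum_(g < minn r s) (sym h j g * sym i k (r + s - 1 - g)%N - sym h j (r + s - 1 - g)%N * sym i k g)) =
  (-1) ^+ ((p i && p j) (+) (p i && p h) (+) (p j && p h)) *
  \sum_(g < minn r s) (T g h j * T (r + s - 1 - g)%N i k - T (r + s - 1 - g)%N h j * T g i k).
Proof.
move=> e; rewrite rmorphM rmorph_sign (sign3 _ (p i) (p j) (p i) (p h) (p j) (p h)) rmorph_sum.
by congr (_ * _); apply: eq_bigr => g _; rewrite rmorphB !rmorphM !e.
Qed.

Lemma pure_tsym (i j : 'I_N) r : (0 < r)%N -> pure tpar (par i j) (tsym K i j r).
Proof.
case: r => // r _; have := @pure_gen K _ tpar ((i, j, r) : tgen N).
by rewrite /tgen_parity /= oddD !oddb.
Qed.
Arguments pure_tsym : clear implicits.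

Section Evaluate.
Variables (Q : pzRingType) (eta : {rmorphism K -> Q}) (T : fps 'M[Q]_N).
Hypothesis etaC : forall c x, eta c * x = x * eta c.
Hypotheses (T0 : T 0%N = 1) (rT : rtt_coef p T).
Local Notation ev := (free_eval_rm (fun g : tgen N => T g.2.+1 g.1.1 g.1.2) etaC).

Lemma eval_tsym i j r : ev (tsym K i j r) = T r i j.
Proof.
case: r => [|r]; last by rewrite [tsym _ _ _ _]/= free_eval_gen.
by rewrite [tsym _ _ _ _]/= rmorph_nat T0 mxE; case: (i == j).
Qed.

Lemma yangian_rel_eval l r : rels l r -> ev l = ev r.
Proof.
case=> i j h k r0 s0 hr hs; rewrite (scomm_pure (pure_tsym i j _ hr) (pure_tsym h k _ hs)).
rewrite rmorph_br; have := push_rtt i j h k r0 s0 eval_tsym; rewrite -rT // => ->.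
by rewrite !eval_tsym brE.
Qed.
End Evaluate.

Local Notation Y := (super_yangian K N Ups).
Lemma Tmx_rtt : rtt_coef p (Tmx K N Ups).
Proof.
move=> i j h k r s hr hs.
have e i' j' r' : pres_pi_rm rels (tsym K i' j' r') = Tmx K N Ups r' i' j' by rewrite mxE.
have := push_rtt i j h k r s e; move/esym => ->.
have -> : sc (par i j && par h k) (Tmx K N Ups r i j) (Tmx K N Ups s h k) =
    pres_pi_rm rels (scomm tpar (tsym K i j r) (tsym K h k s)).
  by rewrite (scomm_pure (pure_tsym i j _ hr) (pure_tsym h k _ hs)) rmorph_br !e brE.
by apply/pres_piP/rel_ideal_rel/Yangian_rel.
Qed.

End YangianEval.

Lemma word_diff (R : pzRingType) (D B x y : R) :
  D * x - B * y = B * (x - y) + (D - B) * y + (D - B) * (x - y).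
Proof. by ncring. Qed.
Lemma word_diff_main (R : pzRingType) (D B a x y m : R) :
  D * x - B * y - (B * m + a * y) = B * (x - y - m) + (D - B - a) * y + (D - B) * (x - y).
Proof. by ncring. Qed.

Lemma mul_diff (R : pzRingType) (x x' y y' : R) :
  x * y - x' * y' = (x - x') * (y - y') + ((x - x') * y' + x' * (y - y')).
Proof. by ncring. Qed.

Section Independence.
Variables (K : comNzRingType) (Y : pzRingType) (eta : {rmorphism K -> Y}).
Hypothesis etaC : forall c x, eta c * x = x * eta c.
Hypothesis eta_inj : injective eta.
Hypothesis natK : forall (c : K) m, c * m.+1%:R = 0 -> c = 0.
Variables (N : nat) (p : 'I_N -> bool).
Local Notation par i j := (p i (+) p j).
Local Notation X := ('I_N * 'I_N * nat)%type.
Local Notation q := (root_par p).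
Local Notation Z := (fps Y).
Local Notation Q := 'M[Z]_N.
Variable T : fps 'M[Y]_N.
Definition tval (z : X) : Y := T z.2.+1 z.1.1 z.1.2.
Definition xdeg (z : X) := z.2.
Local Notation wt := (weight xdeg).
Local Notation tword := (word tval).

(** Two-step comparison of words: weight less than d, or weight at most d and fewer than l letters.
    With l = 0 only the strict bound on the weight remains. *)
Definition below d l (y : Y) := span eta (fun y => exists2 w,
  ((wt w < d) || (wt w <= d) && (size w < l))%N & y = tword w) y.

Lemma weight_cat u w : wt (u ++ w) = (wt u + wt w)%N. Proof. exact: big_cat. Qed.
Lemma weight_cons z w : wt (z :: w) = (xdeg z + wt w)%N. Proof. exact: big_cons. Qed.

Lemma below_le d l d' l' y : (d < d')%N || (d <= d')%N && (l <= l')%N -> below d l y -> below d' l' y.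
Proof.
move=> dl By; apply: span_sub By _ => _ [w hw ->]; apply: span_in; exists w => //.
by move: dl hw; case: ltngtP => //=; lia.
Qed.
Lemma below_mul d l d' l' y y' : below d l y -> below d' l' y' -> below (d + d') (l + l').-1 (y * y').
Proof.
apply: span_mul => // _ _ [w hw ->] [w' hw' ->]; apply: span_in; exists (w ++ w').
  by rewrite weight_cat size_cat; lia.
by rewrite word_cat.
Qed.
Lemma below_mul0l d d' l' y y' : below d 0 y -> below d' l' y' -> below (d + d') 0 (y * y').
Proof.
apply: span_mul => // _ _ [w hw ->] [w' hw' ->]; apply: span_in; exists (w ++ w').
  by rewrite weight_cat; lia.
by rewrite word_cat.
Qed.
Lemma below_mul0r d l d' y y' : below d l y -> below d' 0 y' -> below (d + d') 0 (y * y').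
Proof.
apply: span_mul => // _ _ [w hw ->] [w' hw' ->]; apply: span_in; exists (w ++ w').
  by rewrite weight_cat; lia.
by rewrite word_cat.
Qed.
Lemma below0 d l : below d l 0. Proof. exact: span_nil. Qed.
Lemma belowD d l x y : below d l x -> below d l y -> below d l (x + y). Proof. exact: spanD. Qed.
Lemma belowN d l x : below d l x -> below d l (- x). Proof. exact: spanN. Qed.
Lemma below_sign d l (b : bool) x : below d l x -> below d l ((-1) ^+ b * x).
Proof. exact: span_signr. Qed.
Lemma below_sum d l I (r : seq I) (P : pred I) (f : I -> Y) : (forall i, P i -> below d l (f i)) ->
  below d l (\sum_(i <- r | P i) f i).
Proof. exact: span_sum. Qed.
Lemma below_word w d l : ((wt w < d) || (wt w <= d) && (size w < l))%N -> below d l (tword w).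
Proof. by move=> h; apply: span_in; exists w. Qed.

(* The entries of M have at a^x a coefficient of degree at most d - x, and
   length less than l in degree d - x. *)
Definition ebelow d l (M : Q) := forall h k x,
  (if (x <= d)%N then below (d - x) l (M h k x) else M h k x = 0).

Lemma ebelow_le d l d' l' M : (d < d')%N || (d <= d')%N && (l <= l')%N -> ebelow d l M -> ebelow d' l' M.
Proof.
move=> dl BM h k x; have := BM h k x; case: (leqP x d) => [xd|dx].
  by move=> Bx; rewrite ifT; [apply: below_le Bx; move: dl; case: ltngtP => //=; lia | lia].
by move=> ->; case: ifP => // _; apply: below0.
Qed.
Lemma ebelowD d l M M' : ebelow d l M -> ebelow d l M' -> ebelow d l (M + M').
Proof.
move=> BM BM' h k x; have := BM h k x; have := BM' h k x.
rewrite mxE fpsDE; case: ifP => _; last by move=> -> ->; rewrite addr0.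
by move=> h1 h2; apply: belowD.
Qed.
Lemma ebelowN d l M : ebelow d l M -> ebelow d l (- M).
Proof.
move=> BM h k x; have := BM h k x; rewrite mxE fpsNE; case: ifP => _; first exact: belowN.
by move=> ->; rewrite oppr0.
Qed.
Lemma ebelow0 d l : ebelow d l 0.
Proof. by move=> h k x; rewrite mxE; case: ifP => // _; apply: below0. Qed.
Lemma ebelow_sum d l I (r : seq I) (P : pred I) (f : I -> Q) : (forall i, P i -> ebelow d l (f i)) ->
  ebelow d l (\sum_(i <- r | P i) f i).
Proof. by move=> Bf; elim/big_ind: _ => //; [apply: ebelow0 | apply: ebelowD]. Qed.
Lemma ebelow_mul d l d' l' M M' : ebelow d l M -> ebelow d' l' M' ->
  ebelow (d + d')%N (l + l').-1 (M * M').
Proof.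
move=> BM BM' h k x; rewrite mxE.
have e (y : Z) : y = \sum_(i : 'I_N) M h i * M' i k -> y x = \sum_i \sum_(t < x.+1) M h i t * M' i k (x - t)%N.
  by move=> ->; rewrite -[LHS]/(fps_coef x _) raddf_sum; apply: eq_bigr => i _; rewrite /= /fps_coef fpsME.
rewrite (e _ erefl); case: ifP => [xd|/negbT]; last rewrite -ltnNge => dx.
  apply: below_sum => i _; apply: below_sum => t _.
  have := BM h i t; have := BM' i k (x - t)%N.
  case: ifP => h1; last by move=> -> _; rewrite mulr0; apply: below0.
  case: ifP => h2; last by move=> _ ->; rewrite mul0r; apply: below0.
  move=> B' B; have := below_mul B B'; have -> // : (d - t + (d' - (x - t)) = d + d' - x)%N.
  by have := ltn_ord t; lia.
rewrite big1 // => i _; rewrite big1 // => t _.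
have := BM h i t; have := BM' i k (x - t)%N.
case: ifP => h1; last by move=> -> _; rewrite mulr0.
case: ifP => h2; last by move=> _ ->; rewrite mul0r.
by have := ltn_ord t; lia.
Qed.

Hypothesis T0 : T 0%N = 1.
(** [bl] and [dl] are the images of a letter under T -> B and T -> A B; [al] is the leading part of
    their difference. *)
Definition bl (z : X) : Q := evalB p T z.2.+1 z.1.1 z.1.2.
Definition dl (z : X) : Q := coactT p T z.2.+1 z.1.1 z.1.2.
Definition al (z : X) : Q := - (mono_mx Y N z.2 * munit Y p z.1.1 z.1.2).

Lemma blE z : bl z = signed p (q z) (fps_cst (tval z)). Proof. exact: evalBE. Qed.

Lemma ebelow_signed b w y d l : ((wt w < d) || (wt w <= d) && (size w < l))%N -> y = tword w ->
  ebelow d l (signed p b (fps_cst y)).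
Proof.
move=> dl -> h k x; rewrite signedE; case: x => [|x]; rewrite ?subn0 /=.
  case: eqP => _; last exact: below0.
  have -> : ((-1) ^+ (p h && b) * fps_cst (tword w) : Z) 0%N = (-1) ^+ (p h && b) * tword w.
    by rewrite -(rmorph_sign (fps_cst_rm Y)) fps_cstMl.
  by apply/below_sign/below_word.
have -> : (if h == k then (-1) ^+ (p h && b) * fps_cst (tword w) else 0 : Z) x.+1 = 0.
  case: eqP => // _; rewrite -(rmorph_sign (fps_cst_rm Y)) fps_cstMl /= mulr0 //.
by case: ifP => // _; apply: below0.
Qed.

Lemma ebelow_bl z : ebelow (xdeg z) 2 (bl z).
Proof.
rewrite blE; apply: (@ebelow_signed _ [:: z]); last by rewrite /word big_seq1.
by rewrite /weight big_seq1 leqnn orbT.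
Qed.

Lemma ebelow_mono d d' l r M : (r + d <= d')%N -> ebelow d l M -> ebelow d' l (mono_mx Y N r * M).
Proof.
move=> rd BM h k x; rewrite mono_mxE mono_coef; have := BM h k (x - r)%N.
case: (leqP r x) => rx; last by move=> _; case: ifP => // _; apply: below0.
case: ifP => h1; last by move=> ->; case: ifP => // _; apply: below0.
by move=> Bx; rewrite ifT; [apply: below_le Bx; lia | lia].
Qed.

Lemma ebelow_munit d l i j (b : bool) y : below d l y -> ebelow d l (munit Y p i j * signed p b (fps_cst y)).
Proof.
move=> By h k x; rewrite munitMl signedE.
have s1 (c : bool) (f : Z) : ((-1) ^+ c * f) x = (-1) ^+ c * f x.
  by rewrite -(rmorph_sign (fps_cst_rm Y)) fps_cstMl.
case: x s1 => [|x] s1; last first.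
  suff -> : (if h == j then (-1) ^+ (p i && p j) * (if i == k then (-1) ^+ (p i && b) * fps_cst y else 0) else 0 : Z) x.+1 = 0.
    by case: ifP => // _; apply: below0.
  by case: eqP => // _; rewrite s1; case: eqP => // _; rewrite ?s1 /= !mulr0.
rewrite subn0 leq0n; case: eqP => _; last exact: below0.
rewrite s1; apply: below_sign; case: eqP => _; last exact: below0.
by rewrite s1; apply: below_sign.
Qed.

Lemma munit_one i j : munit Y p i j = munit Y p i j * signed p false (fps_cst 1).
Proof.
rewrite (_ : signed p false _ = 1) ?mulr1 //; apply/matrixP => h k.
by rewrite signedE andbF mxE mul1r; case: (h == k).
Qed.

Lemma ebelow_al z : ebelow (xdeg z) 1 (al z).
Proof.
apply: ebelowN; rewrite munit_one; apply: (@ebelow_mono 0); first by rewrite addn0.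
apply: ebelow_munit; have := @below_word [::] 0 1; rewrite /word big_nil; apply.
by rewrite /weight big_nil.
Qed.

(** A product of positive coefficients of A and B has total degree one less, counting the power of
    $a$; besides B itself only the coefficient of A multiplied by the constant term of B reaches the
    top. *)
Lemma dl_main z : ebelow (xdeg z) 0 (dl z - bl z - al z).
Proof.
case: z => [[i j] r]; rewrite /dl /bl /al /xdeg /=.
have -> : coactT p T r.+1 i j = evalB p T r.+1 i j +
    (\sum_(t < r) \sum_l - (mono_mx Y N t * (munit Y p i l * evalB p T (r - t)%N l j))
     + - (mono_mx Y N r * munit Y p i j)).
  rewrite /coactT fps_mulmxE big_ord_recl big_ord_recr; congr (_ + (_ + _)).
  - rewrite (sum_one (i := i)) // => [|l _ /negPf li]; first by rewrite evalA0 eqxx mul1r.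
    by rewrite evalA0 eq_sym li mul0r.
  - apply: eq_bigr => t _; apply: eq_bigr => l _; rewrite lift0 evalAE mulNr mulrA.
    by congr (- (_ * evalB p T _ _ _)); rewrite /=; lia.
  - have m1 (a b : 'I_N) : (1 : 'M[Q]_N) a b = (a == b)%:R by rewrite mxE; case: (a == b).
    have e : (lift ord0 (@ord_max r) = r.+1 :> nat) by [].
    rewrite e subnn evalB0 // (sum_one (i := j)) // => [|l _ /negPf lj].
      by rewrite m1 eqxx mulr1 evalAE.
    by rewrite m1 lj mulr0.
rewrite [evalB _ _ _ _ _ + _]addrC addrK addrK.
apply: ebelow_sum => t _; apply: ebelow_sum => l _; apply: ebelowN.
apply: (@ebelow_mono (r - t)); first by have := ltn_ord t; lia.
rewrite evalBE; apply: ebelow_munit.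
have -> : T (r - t)%N l j = tword [:: (l, j, (r - t).-1)].
  by rewrite /word big_seq1 /tval /= prednK //; have := ltn_ord t; lia.
by apply: below_word; rewrite /weight big_seq1 /xdeg /=; have := ltn_ord t; lia.
Qed.

Definition bw (w : seq X) := \prod_(z <- w) bl z.
Definition dw (w : seq X) := \prod_(z <- w) dl z.
Definition wpar (w : seq X) := foldr (fun z b => q z (+) b) false w.
(** The Leibniz rule: the sum over the positions of w of the product with the letter there replaced
    by its [al]. *)
Fixpoint main (w : seq X) : Q := if w is z :: w' then bl z * main w' + al z * bw w' else 0.

Arguments main : simpl never.

Lemma main_cons z w : main (z :: w) = bl z * main w + al z * bw w. Proof. by []. Qed.
Lemma bw_cons z w : bw (z :: w) = bl z * bw w. Proof. exact: big_cons. Qed.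
Lemma dw_cons z w : dw (z :: w) = dl z * dw w. Proof. exact: big_cons. Qed.
Lemma bwE w : bw w = signed p (wpar w) (fps_cst (tword w)).
Proof.
elim: w => [|z w IH]; last by rewrite bw_cons IH blE signedM -rmorphM -word_cons.
rewrite /bw /word !big_nil; apply/matrixP => h k.
by rewrite signedE /= andbF mxE mul1r; case: (h == k).
Qed.
Lemma ebelow_bw w : ebelow (wt w) (size w).+1 (bw w).
Proof. by rewrite bwE; apply: (@ebelow_signed _ w) => //; rewrite !leqnn orbT. Qed.

(** Each factor of [dw] is its [bl] plus [al] plus lower terms. Replacing one letter lowers the
    length by one; replacing two, or using a lower term, falls below the main part. *)
Lemma dw_main w : ebelow (wt w) (size w) (dw w - bw w) /\ ebelow (wt w) (size w).-1 (dw w - bw w - main w).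
Proof.
elim: w => [|z w [IH1 IH2]]; first by rewrite /dw /bw !big_nil subrr [main _]/main subr0; split; apply: ebelow0.
have Bm : ebelow (xdeg z + wt w) (size w) (bl z * (dw w - bw w - main w)).
  case: w IH1 IH2 => [|y w] IH1 IH2; last by apply: ebelow_le (ebelow_mul (ebelow_bl z) IH2); rewrite /=; lia.
  by rewrite /dw /bw !big_nil subrr [main _]/main subr0 mulr0; apply: ebelow0.
set c := dl z - bl z; set d := dw w - bw w.
have Bc : ebelow (xdeg z) 1 c.
  by rewrite -(subrK (al z) c); apply/ebelowD/ebelow_al; apply: ebelow_le (dl_main z); rewrite leqnn orbT.
rewrite dw_cons bw_cons; split.
  rewrite word_diff -/c -/d weight_cons; apply/ebelowD; first apply/ebelowD.
  - by apply: ebelow_le (ebelow_mul (ebelow_bl z) IH1); rewrite /=; lia.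
  - by apply: ebelow_le (ebelow_mul Bc (ebelow_bw w)); rewrite /=; lia.
  - by apply: ebelow_le (ebelow_mul Bc IH1); rewrite /=; lia.
rewrite main_cons word_diff_main -/c -/d weight_cons; apply/ebelowD; first apply/ebelowD.
- exact: Bm.
- by apply: ebelow_le (ebelow_mul (dl_main z) (ebelow_bw w)); rewrite /=; lia.
- by apply: ebelow_le (ebelow_mul Bc IH1); rewrite /=; lia.
Qed.

(** For g = (i, j, r): the only entry of [munit i j] is at (j, i), and [al g] carries $a^r$, so this
    coordinate detects the replacement of the letter g. *)
Definition psi (g : X) (M : Q) : Y := M g.1.2 g.1.1 g.2.

Lemma psi_cons g z w : psi g (main (z :: w)) = (-1) ^+ (p g.1.2 && q z) * (tval z * psi g (main w))
  + (z == g)%:R * ((-1) ^+ (~~ ((p g.1.1 && p g.1.2) (+) (p g.1.1 && wpar w))) * tword w).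
Proof.
case: g z => [[i j] r] [[i' j'] r']; rewrite /psi main_cons /= mxE fpsDE; congr (_ + _).
  rewrite blE signedMl -(rmorph_sign (fps_cst_rm Y)) fps_cstMl fps_cstMl.
  by [].
rewrite /al /= mulNr mxE fpsNE -mulrA mono_mxE mono_coef munitMl bwE signedE !xpair_eqE.
have s1 (c : bool) (f : Z) x : ((-1) ^+ c * f) x = (-1) ^+ c * f x.
  by rewrite -(rmorph_sign (fps_cst_rm Y)) fps_cstMl.
have [->|nj] := eqVneq j j'; last first.
  by rewrite andbF /= mul0r fps0E if_same oppr0.
have [->|ni] := eqVneq i' i; last by rewrite mulr0 fps0E if_same oppr0 mul0r.
rewrite /= !s1.
case: (ltngtP r' r) => rr /=.
- by rewrite fps_cstE subn_eq0 leqNgt rr /= !mulr0 oppr0 mul0r.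
- by rewrite oppr0 mul0r.
rewrite rr subnn /= mul1r mulr_sign2.
by case: (p i); case: (p j'); case: (wpar w); rewrite /= ?expr0 ?expr1 ?mul1r ?mulN1r ?opprK.
Qed.

Local Notation psiw g w := (psi g (main w)).
Local Notation ple := (pbw_le q).

Lemma pbw_le_trans : transitive ple.
Proof.
move=> y x z /orP[xy|/andP[/eqP-> _]] // /orP[yz|/andP[/eqP<- _]]; last by rewrite /pbw_le xy.
by rewrite /pbw_le (ltn_trans xy yz).
Qed.
Lemma pbw_notin g y w : path ple g (y :: w) -> y != g -> g \notin y :: w.
Proof.
move=> /= /andP[gy yw] ny; have lt : (choice.pickle g < choice.pickle y)%N.
  by case/orP: gy => // /andP[/eqP e]; rewrite e eqxx in ny.
rewrite inE eq_sym (negPf ny) /=; apply/negP => gw.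
have := order_path_min pbw_le_trans yw => /allP /(_ _ gw) /orP[h|/andP[/eqP e _]].
  by have := ltn_trans lt h; rewrite ltnn.
by rewrite e eqxx in ny.
Qed.

Lemma psi_notin g w : g \notin w -> psiw g w = 0.
Proof.
elim: w => [|z w IH]; first by rewrite /psi mxE.
by rewrite inE negb_or => /andP[gz gw]; rewrite psi_cons IH // eq_sym (negPf gz) mulr0 mul0r addr0 mulr0.
Qed.

(** In a sorted word the copies of its least letter stand at the head. If there is more than one, g
    is even, so all contributions have the same sign and add up to the multiplicity; [natK] allows
    this integer to be cancelled. *)
Lemma psi_head g w : path ple g w -> psiw g (g :: w) =
  (-1) ^+ (~~ ((p g.1.1 && p g.1.2) (+) (p g.1.1 && wpar w))) * ((count_mem g w).+1%:R * tword w).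
Proof.
elim: w => [|y w IH] pw.
  by rewrite psi_cons eqxx /psi mxE fps0E /= !mulr0 add0r !mul1r.
rewrite psi_cons eqxx mul1r; have [e|ny] := eqVneq y g; last first.
  rewrite psi_notin ?pbw_notin // !mulr0 add0r.
  have /count_memPn -> : g \notin y :: w by apply: pbw_notin.
  by rewrite mul1r.
subst y; have /andP[gg pw'] := pw; have qg : q g = false.
  by move: gg; rewrite /pbw_le ltnn /= eqxx /= => /negPf.
rewrite IH // qg andbF mul1r /= eqxx qg word_cons.
rewrite mulr_signl -mulrDr; congr (_ * _).
rewrite mulrA -[in RHS]addn1 natrD mulrDl mul1r add1n; congr (_ + _).
by rewrite commr_nat -mulrA.
Qed.

Lemma psi_sorted g w : sorted ple w -> g \in w -> exists b : bool, exists m,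
  psiw g w = (-1) ^+ b * (m.+1%:R * tword (rem g w)).
Proof.
elim: w => // z w IH pw; rewrite inE /= [z == g]eq_sym; have [e _|ng /= gw] := eqVneq g z.
  by subst z; exists (~~ ((p g.1.1 && p g.1.2) (+) (p g.1.1 && wpar w))), (count_mem g w); apply: psi_head.
have [b [m e]] := IH (path_sorted pw) gw.
exists (b (+) (p g.1.2 && q z)), m; rewrite psi_cons e eq_sym (negPf ng) mul0r addr0 word_cons.
by rewrite mulr_signl mulr_sign2 addbC; congr (_ * _); rewrite !mulrA commr_nat.
Qed.

Variables (Delta Delta0 : {rmorphism Y -> Q}).
Hypotheses (DeltaT : forall z, Delta (tval z) = dl z) (Delta0T : forall z, Delta0 (tval z) = bl z).
Hypothesis Delta_eta : forall c, Delta (eta c) = signed p false (fps_cst (eta c)).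
Hypothesis Delta0_eta : forall c, Delta0 (eta c) = signed p false (fps_cst (eta c)).

(** To leading order and up to signs a partial derivative with respect to the letter g: it lowers
    the weight by the degree of g and the length by one. *)
Definition Psi g y := psi g (Delta y - Delta0 y).
Lemma PsiD g : {morph Psi g : x y / x + y}.
Proof. by move=> x y; rewrite /Psi !rmorphD opprD addrACA /psi mxE fpsDE. Qed.
Lemma Psi0 g : Psi g 0 = 0.
Proof. by rewrite /Psi !rmorph0 subr0 /psi mxE fps0E. Qed.
Lemma PsiZ g c y : Psi g (eta c * y) = eta c * Psi g y.
Proof.
by rewrite /Psi !rmorphM Delta_eta Delta0_eta -mulrBr /psi signedMl andbF mul1r fps_cstMl.
Qed.
Lemma Psi_wordE g w : Psi g (tword w) = psi g (dw w - bw w).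
Proof.
rewrite /Psi /word !rmorph_prod; congr (psi g (_ - _)); apply: eq_bigr => z _; [exact: DeltaT | exact: Delta0T].
Qed.
Lemma Psi_below g d l y : (xdeg g <= d)%N -> below d l y -> below (d - xdeg g) l.-1 (Psi g y).
Proof.
move=> gd; elim=> [|c _ y' [w hw ->] _ IH]; first by rewrite Psi0; apply: below0.
rewrite PsiD PsiZ; apply: belowD => //; apply: spanZ; rewrite Psi_wordE.
have [B _] := dw_main w; have := B g.1.2 g.1.1 g.2; rewrite /psi; case: ifP => gw; last by move=> ->; apply: below0.
by apply: below_le; move: gd gw hw; rewrite /xdeg; lia.
Qed.
Lemma Psi_main g w : (xdeg g <= wt w)%N -> below (wt w - xdeg g) (size w).-1 (Psi g (tword w) - psiw g w).
Proof.
move=> gw; have [_ B] := dw_main w; have := B g.1.2 g.1.1 g.2; rewrite ifT // Psi_wordE.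
by rewrite [((_ - _ : Q) _ _)]mxE fpsDE [((- _ : Q) _ _)]mxE fpsNE.
Qed.

Lemma ple_anti : antisymmetric ple.
Proof.
move=> x y /andP[/orP[xy|/andP[/eqP-> _]] // /orP[yx|/andP[/eqP-> _]] //].
by have := ltn_trans xy yx; rewrite ltnn.
Qed.

Lemma below00 y : below 0 0 y -> y = 0.
Proof. by elim=> // c z y' [w h _]; move: h; rewrite !ltn0 andbF. Qed.

Lemma wt_perm u w : perm_eq u w -> wt u = wt w. Proof. exact: perm_big. Qed.

(** Induction on the length. Applying [Psi g], with g the head of the word in question, keeps
    exactly the words containing g and deletes one g from each. The shortened words are still
    distinct, because a sorted word is determined by its multiset of letters. *)
Lemma indep_top l (J : eqType) (ws : seq J) (f : J -> seq X) (c : J -> K) d :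
  uniq (map f ws) -> (forall j, j \in ws -> [/\ sorted ple (f j), wt (f j) = d & size (f j) = l]) ->
  below d l (\sum_(j <- ws) eta (c j) * tword (f j)) -> forall j, j \in ws -> c j = 0.
Proof.
elim: l J ws f c d => [|l IH] J ws f c d uws hf Bs j jws.
  have f0 i : i \in ws -> f i = [::] by move=> /hf[_ _ /size0nil].
  have d0 : d = 0%N by have [_ <- _] := hf _ jws; rewrite (f0 _ jws) /weight big_nil.
  case: ws uws hf Bs jws f0 => [|i [|i' ws]] // uws hf Bs jws f0; last first.
    by move: uws; rewrite /= (f0 i) ?(f0 i') ?inE ?eqxx ?orbT.
  move: Bs; rewrite d0 big_seq1 (f0 i) ?inE // /word big_nil mulr1 => /below00.
  rewrite -(rmorph0 eta) => /eta_inj; by move: jws; rewrite inE => /eqP ->.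
have [sj wj szj] := hf _ jws; case ej : (f j) szj => [|g w] // _.
have gd : (xdeg g <= d)%N by rewrite -wj ej weight_cons leq_addr.
have /choice[k kP] i : exists k : K, i \in ws -> g \in f i ->
    psiw g (f i) = eta k * tword (rem g (f i)) /\ (forall a, a * k = 0 -> a = 0).
  have [iws|] := boolP (i \in ws); last by exists 0.
  have [gi|] := boolP (g \in f i); last by exists 0.
  have [si _ _] := hf _ iws; have [b [m e]] := psi_sorted si gi.
  exists ((-1) ^+ b * m.+1%:R) => _ _; split.
    by rewrite e rmorphM rmorph_sign rmorph_nat mulrA.
  move=> a; case: b {e}; rewrite ?mul1r; last exact: natK.
  by rewrite mulN1r mulrN => /eqP; rewrite oppr_eq0 => /eqP; apply: natK.
have jw' : j \in [seq i <- ws | g \in f i] by rewrite mem_filter jws ej inE eqxx.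
have [_ kj] := kP j jws (ltac:(by rewrite ej inE eqxx)).
apply: kj; apply: (IH J [seq i <- ws | g \in f i] (fun i => rem g (f i)) (fun i => c i * k i) (d - xdeg g)%N) jw'.
- rewrite map_inj_in_uniq ?filter_uniq //; first by apply: map_uniq uws.
  move=> a b; rewrite !mem_filter => /andP[ga aws] /andP[gb bws] e.
  have [sa _ _] := hf _ aws; have [sb _ _] := hf _ bws.
  have eab : f a = f b.
    apply: (sorted_eq pbw_le_trans ple_anti sa sb).
    by apply: perm_trans (perm_to_rem ga) _; rewrite e perm_sym perm_to_rem.
  apply/eqP; apply/negPn/negP => ab; move: uws.
  have [i1 i2] := (index_mem a ws, index_mem b ws).
  move/(nth_uniq [::]) => /(_ (index a ws) (index b ws)); rewrite size_map i1 i2 => /(_ aws bws).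
  rewrite !(nth_map a) ?i1 ?i2 // !nth_index // eab eqxx => /esym/eqP e2.
  by case/eqP: ab; rewrite -(nth_index a aws) e2 nth_index.
- move=> i; rewrite mem_filter => /andP[gi iws]; have [si wi szi] := hf _ iws; split.
  + by apply: (subseq_sorted pbw_le_trans _ si); apply: rem_subseq.
  + by have := wt_perm (perm_to_rem gi); rewrite wi weight_cons; lia.
  + by rewrite size_rem // szi.
have main_sum : below (d - xdeg g) l (\sum_(i <- ws) eta (c i) * psiw g (f i)).
  have := Psi_below gd Bs; rewrite (big_morph _ (PsiD g) (Psi0 g)) /= => B1.
  have -> : \sum_(i <- ws) eta (c i) * psiw g (f i) =
     \sum_(i <- ws) Psi g (eta (c i) * tword (f i)) - \sum_(i <- ws) eta (c i) * (Psi g (tword (f i)) - psiw g (f i)).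
    by rewrite -sumrB; apply: eq_bigr => i _; rewrite PsiZ mulrBr opprB addrC subrK.
  apply: belowD => //; apply: belowN; rewrite big_seq; apply: below_sum => i iws; apply: spanZ.
  have [_ wi szi] := hf _ iws; have := @Psi_main g (f i); rewrite wi szi; exact.
rewrite big_filter; have -> : \sum_(i <- ws | g \in f i) eta (c i * k i) * tword (rem g (f i)) = \sum_(i <- ws) eta (c i) * psiw g (f i).
  rewrite [RHS](bigID (fun i => g \in f i)) /= [X in _ + X]big1 ?addr0; last first.
    by move=> i gi; rewrite psi_notin ?mulr0.
  rewrite big_seq_cond [RHS]big_seq_cond; apply: eq_bigr => i /andP[iws gi].
  by have [-> _] := kP i iws gi; rewrite rmorphM mulrA.
exact: main_sum.
Qed.

Variables (valid : X -> bool) (rho : X -> Y).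
Hypothesis rho_lead : forall z, valid z -> exists b : bool, below (xdeg z) 0 (rho z - (-1) ^+ b * tval z).

Lemma rho_word w : all valid w -> exists b : bool,
  below (wt w) 0 (word rho w - (-1) ^+ b * tword w).
Proof.
elim: w => [_|z w IH /= /andP[/rho_lead[b Bz] /IH[c Bw]]].
  by exists false; rewrite /word !big_nil mul1r subrr; apply: below0.
exists (b (+) c); rewrite weight_cons !word_cons.
have -> : rho z * word rho w - (-1) ^+ (b (+) c) * (tval z * tword w) =
   (rho z - (-1) ^+ b * tval z) * (word rho w - (-1) ^+ c * tword w)
   + ((rho z - (-1) ^+ b * tval z) * ((-1) ^+ c * tword w) + (-1) ^+ b * tval z * (word rho w - (-1) ^+ c * tword w)).
  have s2 : (-1) ^+ (b (+) c) * (tval z * tword w) = ((-1) ^+ b * tval z) * ((-1) ^+ c * tword w).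
    by rewrite mulr_signl -[in RHS]mulrA mulr_sign2 addbC.
  by rewrite s2; apply: mul_diff.
apply: belowD; first exact: (below_mul Bz Bw).
apply: belowD.
  apply: (below_mul0l Bz (l' := (size w).+1)).
  by apply/below_sign/below_word; rewrite !leqnn orbT.
apply: (below_mul0r (l := 2) _ Bw); apply: below_sign.
have := @below_word [:: z] (xdeg z) 2; rewrite /word big_seq1; apply.
by rewrite /weight big_seq1 leqnn orbT.
Qed.

Lemma seq_max (J : eqType) (r : rel J) (s : seq J) x0 : transitive r -> total r -> x0 \in s ->
  exists2 x, x \in s & forall y, y \in s -> r y x.
Proof.
move=> rT rt; elim: s x0 => // x s IH x0 _; case: s IH => [|y s] IH.
  by exists x; rewrite ?inE // => z; rewrite inE => /eqP ->; have := rt x x; rewrite orbb.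
have [m ms mP] := IH y (mem_head _ _).
have [xm|mx] := orP (rt x m).
  exists m; first by rewrite inE ms orbT.
  by move=> z; rewrite inE => /orP[/eqP ->|/mP].
exists x; first exact: mem_head.
by move=> z; rewrite inE => /orP[/eqP ->|/mP zm]; [have := rt x x; rewrite orbb | apply: rT mx].
Qed.

Theorem words_independent (ws : seq (seq X)) (c : seq X -> K) : uniq ws ->
  (forall w, w \in ws -> pbw_word q valid w) -> \sum_(w <- ws) eta (c w) * word rho w = 0 ->
  forall w, w \in ws -> c w = 0.
Proof.
move=> uws hw s0 w1 w1s; apply/eqP/negPn/negP => c1.
pose ws' := [seq w <- ws | c w != 0].
pose le u w := (wt u < wt w)%N || (wt u == wt w) && (size u <= size w)%N.
have [|||w0 w0s max] := @seq_max _ le ws' w1; first by move=> y x z; rewrite /le; lia.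
- by move=> x y; rewrite /le; lia.
- by rewrite mem_filter c1.
move: (w0s); rewrite mem_filter => /andP[/eqP c0 w0ws]; apply: c0.
have /choice[b bP] w : exists b : bool, w \in ws -> below (wt w) 0 (word rho w - (-1) ^+ b * tword w).
  have [/hw/andP[_ /rho_word[b B]]|] := boolP (w \in ws); [by exists b | by exists true].
(* Words of maximal weight, and of maximal length among these, in the support of c. Replacing root
   vectors by single letters there and discarding the other words costs only terms below. *)
pose top w := (wt w == wt w0) && (size w == size w0).
suff : (-1) ^+ b w0 * c w0 = 0.
  by case: (b w0); rewrite ?mul1r // mulN1r => /eqP; rewrite oppr_eq0 => /eqP.
apply: (@indep_top (size w0) _ [seq w <- ws | top w] id (fun w => (-1) ^+ b w * c w) (wt w0)).
- by rewrite map_id filter_uniq.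
- by move=> w; rewrite mem_filter => /andP[/andP[/eqP ? /eqP ?] /hw /andP[? _]].
- rewrite big_filter.
  have -> : \sum_(w <- ws | top w) eta ((-1) ^+ b w * c w) * tword w =
     - (\sum_(w <- ws | top w) eta (c w) * (word rho w - (-1) ^+ b w * tword w)
        + \sum_(w <- ws | ~~ top w) eta (c w) * word rho w).
    apply/eqP; rewrite -subr_eq0 opprK addrA -big_split /=; apply/eqP; rewrite -[RHS]s0 [RHS](bigID top) /=.
    congr (_ + _); apply: eq_bigr => w _; rewrite rmorphM rmorph_sign mulrBr.
    by rewrite -(commr_sign (eta (c w))) -mulrA addrC subrK.
  apply: belowN; apply: belowD; rewrite big_seq_cond; apply: below_sum => w /andP[wws tw].
    apply: spanZ; have /andP[/eqP ew _] := tw; apply: below_le (bP w wws); rewrite ew leqnn orbT //.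
  have [->|cw] := eqVneq (c w) 0; first by rewrite rmorph0 mul0r; apply: below0.
  have /max : w \in ws' by rewrite mem_filter cw.
  rewrite /le => lw; apply: spanZ.
  have -> : word rho w = (word rho w - (-1) ^+ b w * tword w) + (-1) ^+ b w * tword w by rewrite subrK.
  apply: belowD; first by apply: below_le (bP w wws); move: lw tw; rewrite /top; lia.
  apply/below_sign/below_word; case/orP: lw => [-> //|/andP[ew sl]].
  move: tw; rewrite /top ew /= => sw.
  by rewrite (eqP ew) leqnn [(size w < _)%N]ltn_neqAle sl sw orbT.
- by rewrite mem_filter /top !eqxx.
Qed.

End Independence.

(** * Leading terms of the Gauss factors and root vectors *)

Section GaussStep.
Variables (Y : pzRingType) (N : nat) (blk : 'I_N -> nat).

Lemma mulmx_rowl (A X : 'M[Y]_N) i j : (forall k, A i k = (i == k)%:R) -> (A *m X) i j = X i j.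
Proof.
move=> Ai; rewrite mxE (bigD1 i) //= Ai eqxx mul1r big1 ?addr0 // => k ki.
by rewrite Ai eq_sym (negPf ki) mul0r.
Qed.
Lemma mulmx_colr (X B : 'M[Y]_N) i j : (forall k, X i k * B k j = X i k * (k == j)%:R) -> (X *m B) i j = X i j.
Proof.
move=> Bj; rewrite mxE (bigD1 j) //= Bj eqxx mulr1 big1 ?addr0 // => k /negPf kj.
by rewrite Bj kj mulr0.
Qed.

(** Applied to the constant terms of the Gauss factors, on which the decomposition itself imposes
    nothing for D. The ring is not commutative, so entries are determined by strong induction on the
    smaller of the two block numbers, rows before columns. *)
Lemma block_unitri_one (A B C : 'M[Y]_N) : A *m B *m C = 1%:M ->
  (forall i j, ~~ (blk j < blk i)%N -> A i j = (i == j)%:R) ->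
  (forall i j, blk i != blk j -> B i j = 0) ->
  (forall i j, ~~ (blk i < blk j)%N -> C i j = (i == j)%:R) ->
  [/\ A = 1%:M, B = 1%:M & C = 1%:M].
Proof.
move=> ABC lA dB uC.
have one i j : (1%:M : 'M[Y]_N) i j = (i == j)%:R by rewrite mxE; case: (i == j).
have dif i j : blk i != blk j -> (i == j) = false by move=> ij; apply: contraNF ij => /eqP ->.
suff H n i j : minn (blk i) (blk j) = n -> [/\ A i j = (i == j)%:R, B i j = (i == j)%:R & C i j = (i == j)%:R].
  by split; apply/matrixP => i j; rewrite one; have [] := H _ i j erefl.
elim/ltn_ind: n i j => n IH.
have Arow i : blk i = n -> forall k, A i k = (i == k)%:R.
  move=> bi k; have [ki|ki] := ltnP (blk k) (blk i); last by apply: lA; rewrite -leqNgt.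
  by have [] := IH (minn (blk i) (blk k)) _ i k erefl; first by lia.
have Brow i : blk i = n -> forall j, B i j = (i == j)%:R.
  move=> bi j; have [ij|ij] := eqVneq (blk i) (blk j); last by rewrite dB // dif.
  rewrite -one -ABC -mulmxA mulmx_rowl; last exact: Arow.
  apply/esym/mulmx_colr => k; have [ik|ik] := eqVneq (blk i) (blk k); last by rewrite dB ?mul0r.
  by rewrite uC // -leqNgt -ij ik.
have Crow i : blk i = n -> forall j, C i j = (i == j)%:R.
  move=> bi j; rewrite -one -ABC -mulmxA mulmx_rowl; last exact: Arow.
  by rewrite mulmx_rowl //; apply: Brow.
have Bcol j : blk j = n -> forall k, B k j = (k == j)%:R.
  move=> bj k; have [kj|kj] := eqVneq (blk k) (blk j); last by rewrite dB // dif.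
  by apply: Brow; rewrite kj.
have Ccol j : blk j = n -> forall k, C k j = (k == j)%:R.
  move=> bj k; have [kj|kj] := ltnP (blk k) (blk j); last by apply: uC; rewrite -leqNgt.
  by have [] := IH (minn (blk k) (blk j)) _ k j erefl; first by lia.
have Acol j : blk j = n -> forall i, A i j = (i == j)%:R.
  move=> bj i; rewrite -one -ABC mulmx_colr => [|k]; last by rewrite Ccol.
  by rewrite mulmx_colr // => k; rewrite Bcol.
move=> i j; case: (leqP (blk i) (blk j)) => _ h; first by rewrite Arow ?Brow ?Crow.
by rewrite Acol ?Bcol ?Ccol.
Qed.

(** An abstract condition on entries with a product rule that loses one in the index. It is used
    twice: with the filtration, to find leading terms of the Gauss factors, and with parity, where
    the index is ignored. *)
Variable S : nat -> 'I_N -> 'I_N -> Y -> Prop.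
Hypothesis S0 : forall d i j, S d i j 0.
Hypothesis SD : forall d i j x y, S d i j x -> S d i j y -> S d i j (x + y).
Hypothesis SN : forall d i j x, S d i j x -> S d i j (- x).
Hypothesis SM : forall d e i l j x y, S d i l x -> S e l j y -> S (d + e).-1 i j (x * y).
Hypothesis Sle : forall d i j x, S d i j x -> S d.+1 i j x.
Implicit Types A B : fps 'M[Y]_N.

Lemma mul_step A B r i j : A 0%N = 1 -> B 0%N = 1 ->
  (forall k i j, (0 < k <= r)%N -> S k i j (A k i j)) -> (forall k i j, (0 < k <= r)%N -> S k i j (B k i j)) ->
  S r i j ((A * B) r.+1 i j - A r.+1 i j - B r.+1 i j).
Proof.
move=> A0 B0 SA SB; rewrite [(A * B) r.+1](ps_mulS A B r) A0 B0.
rewrite [(1 *m B r.+1)]mul1r [(A r.+1 *m 1)]mulr1 [in X in S _ _ _ X]mxE [in X in S _ _ _ X]mxE.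
have c3 (a b c : Y) : a + (c + b) - b - a = c by ncring.
rewrite c3 summxE; elim/big_ind: _ => [||t _]; [exact: S0 | exact: SD | ].
rewrite mxE; elim/big_ind: _ => [||l _]; [exact: S0 | exact: SD | ].
have lt := ltn_ord t; have h1 : S t.+1 i l (A t.+1 i l) by apply: SA; rewrite /=.
have h2 : S (r - t) l j (B (r - t)%N l j) by apply: SB; lia.
by have := SM h1 h2; have -> : (t.+1 + (r - t)).-1 = r by lia.
Qed.
Lemma mul_below A B r : A 0%N = 1 -> B 0%N = 1 ->
  (forall k i j, (0 < k <= r)%N -> S k i j (A k i j)) -> (forall k i j, (0 < k <= r)%N -> S k i j (B k i j)) ->
  forall k i j, (0 < k <= r)%N -> S k i j ((A * B) k i j).
Proof.
move=> A0 B0 SA SB [|k] i j //= kr.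
have -> : (A * B) k.+1 i j = ((A * B) k.+1 i j - A k.+1 i j - B k.+1 i j) + B k.+1 i j + A k.+1 i j by rewrite !subrK.
apply: SD; last exact: SA; apply: SD; last exact: SB.
by apply/Sle/mul_step => // l i' j' lk; [apply: SA | apply: SB]; lia.
Qed.

Section Factors.
Variables (p : 'I_N -> bool) (T F D D' E : fps 'M[Y]_N).
Hypothesis pc : pencil p blk T F D D' E.
Hypothesis ST : forall r i j, S r.+1 i j (T r.+1 i j).

Lemma pc_off (X : fps 'M[Y]_N) (ord : rel 'I_N) r i j : unitri ord X -> ~~ ord i j -> X r.+1 i j = 0.
Proof. by move=> uX ij; rewrite uX. Qed.

Lemma gauss_lead r : (forall k i j, (0 < k <= r)%N -> [/\ S k i j (F k i j), S k i j (D k i j) & S k i j (E k i j)]) ->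
  forall i j, S r i j (T r.+1 i j - (F r.+1 i j + D r.+1 i j + E r.+1 i j)).
Proof.
move=> h i j; have FD0 : (F * D) 0%N = 1 by rewrite fps_mul0E (pc_F0 pc) (pc_D0 pc) mulr1.
have h1 k i' j' : (0 < k <= r)%N -> S k i' j' (F k i' j') by case/(h _ i' j').
have h2 k i' j' : (0 < k <= r)%N -> S k i' j' (D k i' j') by case/(h _ i' j').
have h3 k i' j' : (0 < k <= r)%N -> S k i' j' (E k i' j') by case/(h _ i' j').
rewrite (pc_T pc).
have e (t fd f d e : Y) : t - (f + d + e) = (t - fd - e) + (fd - f - d).
  by ncring.
rewrite (e _ ((F * D) r.+1 i j)); apply: SD.
  by apply: mul_step (pc_E0 pc) _ h3 => //; apply: mul_below (pc_F0 pc) (pc_D0 pc) h1 h2.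
exact: mul_step (pc_F0 pc) (pc_D0 pc) h1 h2.
Qed.

(** Above exponent 0 the factors F, D and E are supported below, on and above the block diagonal.
    Hence at each position T agrees with one of them up to products of lower order, and the other
    two vanish there. *)
Lemma gauss_parts r i j :
  [/\ S r i j (if (blk j < blk i)%N then T r.+1 i j - F r.+1 i j else F r.+1 i j),
      S r i j (if blk i == blk j then T r.+1 i j - D r.+1 i j else D r.+1 i j) &
      S r i j (if (blk i < blk j)%N then T r.+1 i j - E r.+1 i j else E r.+1 i j)].
Proof.
have F1 r' i' j' : ~~ (blk j' < blk i')%N -> F r'.+1 i' j' = 0 by apply: pc_off (pc_F pc).
have E1 r' i' j' : ~~ (blk i' < blk j')%N -> E r'.+1 i' j' = 0 by apply: pc_off (pc_E pc).
elim/ltn_ind: r i j => r IH i j.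
have /gauss_lead/(_ i j) : forall k i j, (0 < k <= r)%N -> [/\ S k i j (F k i j), S k i j (D k i j) & S k i j (E k i j)].
  move=> [|k] i' j' //= kr; have [hF hD hE] := IH k kr i' j'; have hT := ST k i' j'.
  have tr (b : bool) x : S k i' j' (if b then T k.+1 i' j' - x else x) -> S k.+1 i' j' x.
    case: b => h; last exact: Sle.
    by rewrite -[x](subKr (T k.+1 i' j')); apply/SD => //; apply/SN/Sle.
  by split; [exact: tr hF | exact: tr hD | exact: tr hE].
case: (ltngtP (blk i) (blk j)) => ij.
- have f0 : F r.+1 i j = 0 by apply: F1; lia.
  have d0 : D r.+1 i j = 0 by apply: (pc_D pc); lia.
  by rewrite f0 d0 !add0r; split.
- have e0 : E r.+1 i j = 0 by apply: E1; lia.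
  have d0 : D r.+1 i j = 0 by apply: (pc_D pc); lia.
  by rewrite e0 d0 !addr0; split.
have f0 : F r.+1 i j = 0 by apply: F1; lia.
have e0 : E r.+1 i j = 0 by apply: E1; lia.
by rewrite f0 e0 add0r addr0; split.
Qed.

Lemma gauss_below r i j : [/\ S r.+1 i j (F r.+1 i j), S r.+1 i j (D r.+1 i j) & S r.+1 i j (E r.+1 i j)].
Proof.
have tr (b : bool) x : S r i j (if b then T r.+1 i j - x else x) -> S r.+1 i j x.
  case: b => h; last exact: Sle.
  by rewrite -[x](subKr (T r.+1 i j)); apply/SD; [exact: ST | apply/SN/Sle].
by have [/tr hF /tr hD /tr hE] := gauss_parts r i j.
Qed.

Lemma inverse_below r i j : S r.+1 i j (D' r.+1 i j).
Proof.
have D'0 : D' 0%N = 1.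
  by have := congr1 (fun f : fps _ => f 0%N) (pc_DD' pc); rewrite fps_mul0E (pc_D0 pc) mul1r.
elim/ltn_ind: r i j => r IH i j.
have := mul_step (r := r) (A := D) (B := D') i j (pc_D0 pc) D'0.
rewrite (pc_DD' pc) [(1 : fps 'M_N) _ i j]mxE sub0r => /(_ _ _)/SN.
rewrite opprB opprK => h; have {}h : S r i j (D' r.+1 i j + D r.+1 i j).
  by apply: h => -[|k] i' j' //= kr; [have [] := gauss_below k i' j' | apply: IH].
by rewrite -[D' _ _ _](addrK (D r.+1 i j)); apply: SD; [exact: Sle | apply: SN; have [] := gauss_below r i j].
Qed.
End Factors.

End GaussStep.

Section RootLeading.
Variables (K : comNzRingType) (Y : pzRingType) (eta : {rmorphism K -> Y}).
Hypothesis etaC : forall c x, eta c * x = x * eta c.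
Variables (N : nat) (p : 'I_N -> bool) (T : fps 'M[Y]_N).
Hypotheses (T0 : T 0%N = 1) (rT : rtt_coef p T).
Local Notation par i j := (p i (+) p j).
Local Notation below := (below eta T).
Local Notation t i j r := (T (r : nat).+1 i j).

Lemma below_coef r i j : below r.+1 0 (t i j r).
Proof.
have := @below_word _ _ eta _ T [:: (i, j, r)] r.+1 0; rewrite /word big_seq1; apply.
by rewrite /weight big_seq1 /xdeg ltnSn.
Qed.
Definition leads i j r y := exists b : bool, below r 0 (y - (-1) ^+ b * t i j r).

Lemma below_mulS d e x y : below d 0 x -> below e 0 y -> below (d + e).-1 0 (x * y).
Proof.
apply: span_mul => // _ _ [w hw ->] [w' hw' ->]; apply: span_in; exists (w ++ w').
  by rewrite weight_cat; lia.
by rewrite word_cat.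
Qed.
Lemma below_brl a b d e x y : below d 0 x -> below e.+1 0 y -> below (d + e) 0 (br a b x y).
Proof.
move=> Bx By; rewrite brE; apply: belowD; first by have := below_mulS Bx By; rewrite addnS.
by apply/belowN/below_sign; have := below_mulS By Bx; rewrite addSn addnC.
Qed.
Lemma below_brr a b d e x y : below d.+1 0 x -> below e 0 y -> below (d + e) 0 (br a b x y).
Proof.
by move=> Bx By; rewrite brC addnC; apply/belowN/below_sign/below_brl.
Qed.

Lemma leads_sign (c : bool) i j r y : leads i j r y -> leads i j r ((-1) ^+ c * y).
Proof.
case=> b By; exists (c (+) b); rewrite signr_addb -mulrA -mulrBr; exact: below_sign.
Qed.
Lemma leads_near i j r y : below r 0 (t i j r - y) -> leads i j r y.
Proof. by move=> By; exists false; rewrite mul1r -opprB; apply: belowN. Qed.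
Lemma leads_below i j r y : leads i j r y -> below r.+1 0 y.
Proof.
case=> b By; rewrite -[y](subrK ((-1) ^+ b * t i j r)); apply: belowD; last exact/below_sign/below_coef.
by apply: below_le By; rewrite ltnSn.
Qed.

(** The summand g = 0 of RTT is the leading one, and i != j removes its second half; every other
    summand is a product of lower total degree. *)
Lemma leads_brT i l j u v : i != j -> leads i j (u + v) (br (par i l) (par l j) (t i l u) (t l j v)).
Proof.
move=> ij; rewrite brE rT //; apply: leads_sign; rewrite minnSS big_ord_recl.
have -> : (u.+1 + v.+1 - 1 - @ord0 (minn u v) = (u + v).+1)%N by rewrite /=; lia.
rewrite T0 !mxE eqxx (negPf ij) mulr0 subr0 mul1r; exists false; rewrite mul1r addrC addKr.
apply: below_sum => g _; have lg := ltn_ord g; rewrite lift0.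
have [a [b [ha hb ab]]] : exists a b, [/\ g.+1 = a.+1, (u.+1 + v.+1 - 1 - g.+1)%N = b.+1 & (a + b < u + v)%N].
  by exists g, (u + v - g.+1)%N; split; lia.
rewrite hb ha; apply: belowD; last apply: belowN.
  by apply: below_le (below_mulS (below_coef a l l) (below_coef b i j)); lia.
by apply: below_le (below_mulS (below_coef b l l) (below_coef a i j)); lia.
Qed.

Lemma leads_br i l j u v x y : i != j -> leads i l u x -> leads l j v y ->
  leads i j (u + v) (br (par i l) (par l j) x y).
Proof.
move=> ij lx ly; have By := leads_below ly; case: lx => b Bx; case: ly => c By'.
have /leads_sign -/(_ (b (+) c)) [d Bd] := leads_brT l u v ij.
exists d; set x' := (-1) ^+ b * t i l u; set y' := (-1) ^+ c * t l j v.
have -> : br (par i l) (par l j) x y = br (par i l) (par l j) (x - x') y + br (par i l) (par l j) x' (y - y') + br (par i l) (par l j) x' y'.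
  by rewrite [in X in X + _]brDr brNr !brDl brNl; ncring.
rewrite -addrA; apply: belowD.
  apply: belowD; first exact: below_brl.
  by apply: below_brr => //; apply/below_sign/below_coef.
by rewrite /x' /y' br_signl br_signr mulrA -signr_addb.
Qed.

Section RootVector.
Variables (blk : 'I_N -> nat) (s : nat -> nat) (mid : nat -> 'I_N) (e : 'I_N -> 'I_N -> nat -> Y).
Hypothesis blk_mid : forall i j a, (blk i < a < blk j)%N -> blk (mid a) = a.
Hypothesis e_leads : forall i j r, blk j = (blk i).+1 -> (s (blk i) <= r)%N -> leads i j r (e i j r).

Lemma root_leads i j r : (blk i < blk j)%N -> (lev s (blk i) (blk j) <= r)%N ->
  leads i j r (root p blk s mid e i j r).
Proof.
rewrite /root => ij; have [n nE] : exists n, blk j = (blk i + n).+1 by exists (blk j - blk i).-1; lia.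
have -> : (blk j - blk i).-1 = n by lia.
elim: n i r nE {ij} => [|n IH] i r nE hr; first by apply: e_leads; [lia | move: hr; rewrite nE addn0 lev1].
have bm : blk (mid (blk i).+1) = (blk i).+1 by apply: (blk_mid (i := i) (j := j)); lia.
have sl : (s (blk i) + lev s (blk i).+1 (blk j) <= r)%N by rewrite -lev_recl //; lia.
have -> : r = (r - lev s (blk i).+1 (blk j) + lev s (blk i).+1 (blk j))%N by lia.
rewrite /= addnK; apply: leads_br.
- by apply/eqP => h; move: nE; rewrite h; lia.
- by apply: e_leads => //; lia.
by apply: IH; rewrite ?bm //; lia.
Qed.
End RootVector.
End RootLeading.

(** * The realization homomorphism *)

Section Words.
Variables (K : comNzRingType) (G : choiceType) (rels : free_alg K G -> free_alg K G -> Prop).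

Lemma malg_word c (w : {fmonom G}) : << c *g w >> = c%:MP * \prod_(g <- w) free_gen K g.
Proof.
rewrite mul_malgC (_ : << c *g w >> = c *: << w >>); last first.
  by apply/malgP => u; rewrite mcoeffZ !mcoeffU mulrnAr mulr1.
congr (_ *: _); case: w => w; elim: w => [|g w IH]; first by rewrite big_nil -fmoneE.
rewrite big_cons -IH malgM_def /free_gen fgmulUU mulr1; congr << _ *g _ >>.
by apply/eqP; rewrite fmP fmM fmU.
Qed.

Lemma pres_pi_words f :
  pres_pi rels f = \sum_(w <- msupp f) pres_cst rels f@_w * \prod_(g <- w) pres_gen rels g.
Proof.
rewrite {1}[f]monalgE (raddf_sum (pres_pi_rm rels)); apply: eq_bigr => w _.
by rewrite malg_word [LHS]pres_piM; congr (_ * _); apply: (rmorph_prod (pres_pi_rm rels)).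
Qed.

Lemma homogeneous_pi par b f : pure par b f -> homogeneous par b (pres_pi rels f).
Proof. by move=> /pureP pf; exists f. Qed.

Lemma homogeneous_map par (Q : pzRingType) (h : {rmorphism presented rels -> Q}) (H : bool -> Q -> Prop) :
  (forall b, H b 0) -> (forall b x y, H b x -> H b y -> H b (x + y)) -> H false 1 ->
  (forall a b x y, H a x -> H b y -> H (a (+) b) (x * y)) ->
  (forall b c x, H b x -> H b (h (pres_cst rels c) * x)) ->
  (forall g, H (par g) (h (pres_gen rels g))) ->
  forall b x, homogeneous par b x -> H b (h x).
Proof.
move=> H0 HD H1 HM Hc Hg b _ [f /pureP pf ->]; rewrite pres_pi_words rmorph_sum big_seq.
elim/big_ind: _ => [||w wf]; [exact: H0 | exact: HD | ].
rewrite rmorphM; apply: Hc; rewrite -(pf w); last by rewrite mcoeff_neq0.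
rewrite /word_parity rmorph_prod; case: w {wf} => w /=.
elim: w => [|g w IH]; first by rewrite big_nil.
by rewrite big_cons /= oddD oddb; apply: HM.
Qed.

Variables (Q : pzRingType) (eta : {rmorphism K -> Q}) (v : G -> Q).
Hypothesis etaC : forall c x, eta c * x = x * eta c.
Hypothesis rels_eval : forall l r, rels l r -> free_eval_rm v etaC l = free_eval_rm v etaC r.
Lemma pres_lift_cst c : pres_lift_rm rels_eval (pres_cst rels c) = eta c.
Proof.
apply: (etrans (pres_liftE rels_eval _)); apply: (etrans (free_evalU _ _ _ _)).
by rewrite /word_val fm1 big_nil mulr1.
Qed.
Lemma pres_lift_gen g : pres_lift_rm rels_eval (pres_gen rels g) = v g.
Proof. exact: etrans (pres_liftE rels_eval _) (free_eval_gen v etaC g). Qed.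
End Words.

(** Collects equal words, so that linear independence of distinct words becomes applicable. *)
Lemma span_words (K : comNzRingType) (G : pzRingType) (eta : {rmorphism K -> G}) (W : eqType)
    (P : W -> bool) (v : W -> G) x : span eta (fun y => exists2 w, P w & y = v w) x ->
  exists ws (c : W -> K), [/\ uniq ws, forall w, w \in ws -> P w & x = \sum_(w <- ws) eta (c w) * v w].
Proof.
elim=> [|a _ y [w Pw ->] _ [ws [c [uws Pws ->]]]]; first by exists [::], (fun=> 0); rewrite big_nil.
pose c' u := (if u == w then a else 0) + (if u \in ws then c u else 0).
have main s : uniq s -> w \in s -> (forall u, (u \in s) = (u == w) || (u \in ws)) ->
    eta a * v w + \sum_(u <- ws) eta (c u) * v u = \sum_(u <- s) eta (c' u) * v u.
  move=> us ws' sE; transitivity (\sum_(u <- s) (eta (if u == w then a else 0) * v u) +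
      \sum_(u <- s) eta (if u \in ws then c u else 0) * v u); last first.
    by rewrite -big_split /=; apply: eq_bigr => u _; rewrite -mulrDl -rmorphD.
  congr (_ + _).
    rewrite (bigD1_seq w) //= eqxx big1 ?addr0 // => u /negPf ->; by rewrite rmorph0 mul0r.
  rewrite [RHS](bigID (mem ws)) /= [X in _ + X]big1 ?addr0; last by move=> u /negPf ->; rewrite rmorph0 mul0r.
  rewrite -[RHS]big_filter [RHS](perm_big ws); last first.
    by apply: uniq_perm; rewrite ?filter_uniq // => u; rewrite mem_filter sE; case: (u \in ws); rewrite ?orbT.
  by rewrite big_seq [RHS]big_seq; apply: eq_bigr => u ->.
have [ww|ww] := boolP (w \in ws).
  exists ws, c'; split=> //; apply: main => // u.
  by case: eqP => [->|].
exists (w :: ws), c'; split=> [|u|]; first by rewrite /= ww.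
  by rewrite inE => /orP[/eqP ->|/Pws].
by apply: main => [||u]; rewrite ?inE ?eqxx //= ww.
Qed.

Lemma mulr_signs (R : pzRingType) (a b : bool) (x y : R) :
  (-1) ^+ a * x * ((-1) ^+ b * y) = (-1) ^+ (a (+) b) * (x * y).
Proof. by rewrite mulr_signl -mulrA mulr_sign2 addbC. Qed.

Lemma sc_signs (R : pzRingType) (a b c : bool) (x y : R) :
  sc c ((-1) ^+ a * x) ((-1) ^+ b * y) = (-1) ^+ (a (+) b) * sc c x y.
Proof. by rewrite /sc !mulr_signs [b (+) a]addbC [X in _ - X]mulr_signl -mulrBr. Qed.

Lemma signed_central (R : pzRingType) N (p : 'I_N -> bool) (x : R) (M : 'M[fps R]_N) :
  (forall y, x * y = y * x) -> signed p false (fps_cst x) * M = M * signed p false (fps_cst x).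
Proof.
move=> xC; apply/matrixP => h k; rewrite signedMl andbF mul1r [RHS]mxE (bigD1 k) //= signedE eqxx.
rewrite andbF mul1r big1 ?addr0 => [|l /negPf lk]; last by rewrite signedE lk mulr0.
by apply: fpsP => n; rewrite fps_cstMl fps_cstMr xC.
Qed.

Section SignEigen.
Variables (R : pzRingType) (f : {rmorphism R -> R}).
Definition sign_eigen (b : bool) (y : R) := f y = (-1) ^+ b * y.
Lemma sign_eigen0 b : sign_eigen b 0. Proof. by rewrite /sign_eigen rmorph0 mulr0. Qed.
Lemma sign_eigenD b x y : sign_eigen b x -> sign_eigen b y -> sign_eigen b (x + y).
Proof. by rewrite /sign_eigen rmorphD mulrDr => -> ->. Qed.
Lemma sign_eigen1 : sign_eigen false 1. Proof. by rewrite /sign_eigen rmorph1 mul1r. Qed.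
Lemma sign_eigenM a b x y : sign_eigen a x -> sign_eigen b y -> sign_eigen (a (+) b) (x * y).
Proof. by rewrite /sign_eigen rmorphM => -> ->; rewrite mulr_signs. Qed.
Lemma sign_eigenZ b c x : f c = c -> sign_eigen b x -> sign_eigen b (c * x).
Proof. by rewrite /sign_eigen rmorphM => -> ->; rewrite mulr_signl. Qed.
Lemma sign_eigen_unique x : (forall y : R, y + y = 0 -> y = 0) ->
  sign_eigen false x -> sign_eigen true x -> x = 0.
Proof. by rewrite /sign_eigen => two ->; rewrite mul1r mulN1r => e; apply: two; rewrite {1}e addNr. Qed.
End SignEigen.

Section SignEntries.
Variables (R : pzRingType) (N : nat) (p : 'I_N -> bool) (T : fps 'M[R]_N).
Local Notation par i j := (p i (+) p j).
Definition sign_entries : fps 'M[R]_N := fun r => \matrix_(i, j) ((-1) ^+ par i j * T r i j).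
Lemma sign_entriesE r i j : sign_entries r i j = (-1) ^+ par i j * T r i j.
Proof. by rewrite mxE. Qed.
Lemma sign_entries0 : T 0%N = 1 -> sign_entries 0%N = 1.
Proof.
move=> T0; apply/matrixP => i j; rewrite sign_entriesE T0 !mxE.
by have [->|_] := eqVneq i j; [rewrite addbb mul1r | rewrite mulr0].
Qed.
Lemma sign_rtt : rtt_coef p T -> rtt_coef p sign_entries.
Proof.
move=> rT i j h k r s hr hs; rewrite !sign_entriesE sc_signs rT //.
rewrite mulr_signl mulr_sumr; congr (_ * _); apply: eq_bigr => g _.
have e : par h j (+) par i k = par i j (+) par h k by case: (p i); case: (p j); case: (p h); case: (p k).
by rewrite !sign_entriesE !mulr_signs e mulrBr.
Qed.
End SignEntries.

(** * Homomorphisms out of the super Yangian *)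

Section YangianMaps.
Variables (K : comNzRingType) (N : nat) (Ups : seq bool).
Local Notation p := (@ord_digit N Ups).
Local Notation par i j := (p i (+) p j).
Local Notation rels := (@yangian_rel K N Ups).
Local Notation tpar := (@tgen_parity N Ups).
Local Notation Y := (presented rels).
Local Notation eta := (pres_cst rels).
Local Notation T := (Tmx K N Ups : fps 'M[Y]_N).

Lemma TmxE r i j : T r.+1 i j = pres_gen rels ((i, j, r) : tgen N).
Proof. by rewrite mxE. Qed.

Lemma yangian_map (Q : pzRingType) (h : {rmorphism K -> Q}) (X : fps 'M[Q]_N) :
  (forall c x, h c * x = x * h c) -> X 0%N = 1 -> rtt_coef p X ->
  exists f : {rmorphism Y -> Q}, (forall c, f (eta c) = h c) /\ (forall r i j, f (T r i j) = X r i j).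
Proof.
move=> hC X0 rX; have re := yangian_rel_eval hC X0 rX.
exists (pres_lift_rm re); split=> [c|r i j]; first exact: pres_lift_cst.
by rewrite mxE; apply: (etrans (pres_liftE re _)); apply: eval_tsym.
Qed.

Lemma rtt_coef_one (Q : pzRingType) : rtt_coef p (1 : fps 'M[Q]_N).
Proof.
move=> i j h k [|r] [|s] // _ _; have e n i' j' : (1 : fps 'M[Q]_N) n.+1 i' j' = 0 by rewrite mxE.
rewrite !e /sc !mulr0 subrr big1 ?mulr0 // => g _.
have [n ->] : exists n, (r.+1 + s.+1 - 1 - g)%N = n.+1 by exists (r + s - g)%N; have := ltn_ord g; lia.
by rewrite !e mulr0 mul0r subrr.
Qed.

(** The counit, which sends T(u) to 1, is a left inverse of the embedding of scalars. *)
Lemma eta_inj : injective eta.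
Proof.
have [f [fc _]] := @yangian_map K idfun 1 (fun c x => mulrC c x) erefl (@rtt_coef_one K).
by move=> c d /(congr1 f); rewrite !fc.
Qed.

(* The parity automorphism, which shows that the parity of a nonzero element is unique. *)
Lemma parity_automorphism : exists f : {rmorphism Y -> Y},
  (forall c, f (eta c) = eta c) /\ (forall g, f (pres_gen rels g) = (-1) ^+ tpar g * pres_gen rels g).
Proof.
have [|f [fc fT]] := @yangian_map _ eta (sign_entries p T) (@pres_cstC _ _ _) _ (sign_rtt (@Tmx_rtt K N Ups)).
  exact: sign_entries0 (Tmx0 K N Ups).
exists f; split=> // -[[i j] r]; have := fT r.+1 i j; rewrite sign_entriesE TmxE => ->.
by rewrite /tgen_parity /= oddD !oddb.
Qed.

Local Notation hom := (@homogeneous K (tgen N) rels tpar).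
Lemma homogeneous0 b : hom b 0. Proof. exact/homogeneous_pi/pure0. Qed.
Lemma homogeneous1 : hom false 1. Proof. exact/homogeneous_pi/pure1. Qed.
Lemma homogeneousD b x y : hom b x -> hom b y -> hom b (x + y).
Proof. by move=> [f /pureP pf ->] [g /pureP pg ->]; rewrite -pres_piD; apply/homogeneous_pi/pureD. Qed.
Lemma homogeneousN b x : hom b x -> hom b (- x).
Proof. by move=> [f /pureP pf ->]; rewrite -pres_piN; apply/homogeneous_pi/pureN. Qed.
Lemma homogeneousM a b x y : hom a x -> hom b y -> hom (a (+) b) (x * y).
Proof. by move=> [f /pureP pf ->] [g /pureP pg ->]; rewrite -pres_piM; apply/homogeneous_pi/pureM. Qed.
Lemma homogeneousZ b c x : hom b x -> hom b (eta c * x).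
Proof. by rewrite pres_cstMl => -[f /pureP pf ->]; rewrite -pres_piZ; apply/homogeneous_pi/pureZ. Qed.
Lemma homogeneousT r i j : (0 < r)%N -> hom (par i j) (T r i j).
Proof. by move=> hr; rewrite mxE; apply/homogeneous_pi/pure_tsym. Qed.

(** An element that is both even and odd is its own negative under the parity automorphism. This
    gives uniqueness of homogeneous components in Y, needed to see that the image of the realization
    contains the components of its elements. *)
Lemma hom_unique x : (forall y : Y, y + y = 0 -> y = 0) -> hom false x -> hom true x -> x = 0.
Proof.
move=> two h0 h1; have [f [fc fT]] := parity_automorphism.
have sg b y : hom b y -> sign_eigen f b y.
  apply: (homogeneous_map (h := idfun) (H := sign_eigen f)) => {b y}.
  - exact: sign_eigen0.
  - exact: sign_eigenD.
  - exact: sign_eigen1.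
  - exact: sign_eigenM.
  - by move=> b c y; apply: sign_eigenZ; apply: fc.
  exact: fT.
exact: sign_eigen_unique two (sg _ _ h0) (sg _ _ h1).
Qed.

Definition etaQ c : 'M[fps Y]_N := signed p false (fps_cst (eta c)).
Lemma etaQ_is_additive : zmod_morphism etaQ.
Proof. by move=> c d; rewrite /etaQ !rmorphB signedD signedN. Qed.
Lemma etaQ_is_multiplicative : monoid_morphism etaQ.
Proof.
split=> [|c d]; last by rewrite /etaQ signedM !rmorphM.
apply/matrixP => h k; rewrite signedE !rmorph1 andbF mxE mul1r.
by case: (h == k).
Qed.
HB.instance Definition _ := GRing.isZmodMorphism.Build K 'M[fps Y]_N etaQ etaQ_is_additive.
HB.instance Definition _ := GRing.isMonoidMorphism.Build K 'M[fps Y]_N etaQ etaQ_is_multiplicative.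

Lemma etaQC c M : etaQ c * M = M * etaQ c.
Proof. by apply: signed_central => y; rewrite pres_cstC. Qed.

Lemma rho_independent (valid : 'I_N * 'I_N * nat -> bool) rho ws (c : seq ('I_N * 'I_N * nat) -> K) :
  (forall (a : K) m, a * m.+1%:R = 0 -> a = 0) ->
  (forall z, valid z -> leads eta T z.1.1 z.1.2 z.2 (rho z)) -> uniq ws ->
  (forall w, w \in ws -> pbw_word (root_par p) valid w) ->
  \sum_(w <- ws) eta (c w) * word rho w = 0 -> forall w, w \in ws -> c w = 0.
Proof.
move=> natK lead.
have rT := @Tmx_rtt K N Ups; have T0 : T 0%N = 1 := Tmx0 K N Ups.
have [f [fc fT]] := @yangian_map _ etaQ _ etaQC (coactT0 p T0) (coactT_rtt T0 rT).
have [g [gc gT]] := @yangian_map _ etaQ _ etaQC (evalB0 p T0) (evalB_rtt rT).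
apply: (words_independent (@pres_cstC _ _ _) eta_inj natK T0 (Delta := f) (Delta0 := g)).
- by move=> z; apply: fT.
- by move=> z; apply: gT.
- exact: fc.
- exact: gc.
- exact: lead.
Qed.
End YangianMaps.

Lemma addr_split (V : zmodType) (a b c d : V) : a + b = c + d -> c - a = 0 -> b = d.
Proof. by move=> e /subr0_eq ca; apply: (addrI a); rewrite e ca. Qed.

Section GaussPencil.
Variables (Y : pzRingType) (N : nat) (p : 'I_N -> bool) (mu : seq nat).
Local Notation blk := (@blk_of N mu).
Variables T F D D' E : fps 'M[Y]_N.
Hypotheses (T0 : T 0%N = 1) (rT : rtt_coef p T).

Lemma gauss_pencil : gauss_decomposition mu T F D E -> ps_inverse D D' -> pencil p blk T F D D' E.
Proof.
move=> [TE dD uE lF] [DD' D'D].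
have one r (i j : 'I_N) : @ps_one Y N r i j = ((r == 0%N) && (i == j))%:R.
  by case: r => [|r]; rewrite mxE //; case: (i == j).
have uF : unitri (fun i j => (blk j < blk i)%N) F.
  move=> r i j ij; rewrite lF // one; case: eqP => // bij.
  by have [e|_] := eqVneq i j; [case: bij; rewrite e | rewrite andbF].
have uE' : unitri (fun i j => (blk i < blk j)%N) E.
  move=> r i j ij; rewrite uE // one; case: eqP => // bij.
  by have [e|_] := eqVneq i j; [case: bij; rewrite e | rewrite andbF].
have dD' r i j : blk i != blk j -> D r i j = 0 by apply: dD.
have [F0 D0 E0] : [/\ F 0%N = 1%:M, D 0%N = 1%:M & E 0%N = 1%:M].
  apply: (@block_unitri_one Y N blk) => [|i j ij|i j|i j ij].
  - by have := TE 0%N; rewrite T0 /ps_mul !big_ord1 => <-.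
  - by rewrite uF.
  - exact: dD'.
  - by rewrite uE'.
split=> //.
- by apply: fpsP => r; rewrite TE.
- by apply: fpsP => r; rewrite [LHS]DD'; case: r.
- by apply: fpsP => r; rewrite [LHS]D'D; case: r.
Qed.
End GaussPencil.

Section Realization.
Variables (K : comNzRingType) (half : K) (N : nat) (Ups : seq bool) (sigma : 'M[nat]_N) (mu : seq nat).
Hypothesis half2 : half + half = 1.
Hypothesis natK : forall (a : K) m, a * m.+1%:R = 0 -> a = 0.
Hypothesis mu_pos : all (ltn 0) mu.
Hypothesis sum_mu : sumn mu = N.
Local Notation blk := (@blk_of N mu).
Local Notation off := (@off_of N mu).
Local Notation p := (@ord_digit N Ups).
Local Notation par i j := (p i (+) p j).
Local Notation yrels := (@yangian_rel K N Ups).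
Local Notation prels := (@parabolic_rel K N Ups sigma mu).
Local Notation Y := (presented yrels).
Local Notation P := (presented prels).
Local Notation eta := (pres_cst yrels).
Local Notation T := (Tmx K N Ups : fps 'M[Y]_N).
Local Notation yhom := (@homogeneous K (tgen N) yrels (@tgen_parity N Ups)).
Local Notation phom := (@homogeneous K (pgen sigma mu) prels (@pgen_parity N Ups sigma mu)).
Variables F D D' E : fps 'M[Y]_N.
Hypothesis TFDE : gauss_decomposition mu T F D E.
Hypothesis DD' : ps_inverse D D'.
Local Notation elt := (parabolic_elt mu F D D' E).

Let T0 : T 0%N = 1 := Tmx0 K N Ups.
Let rT : rtt_coef p T := @Tmx_rtt K N Ups.
Let pc : pencil p blk T F D D' E := gauss_pencil T0 rT TFDE DD'.
Let two_tf (y : Y) : y + y = 0 -> y = 0. Proof. exact: (two_tfG eta half2). Qed.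

Local Notation ev := (free_eval_rm (fun g : pgen sigma mu => elt (val g)) (@pres_cstC _ _ yrels)).

Lemma realization_rel l r : prels l r -> ev l = ev r.
Proof.
have [F' [FF' F'F]] := fps_inverse_exists (pc_F0 pc).
have [E' [EE' E'E]] := fps_inverse_exists (pc_E0 pc).
exact: (parabolic_rel_eval (@pres_cstC _ _ yrels) sum_mu two_tf pc FF' F'F EE' E'E).
Qed.

Definition realization : {rmorphism P -> Y} := pres_lift_rm realization_rel.
Local Notation phi := realization.

Lemma realization_cst c : phi (pres_cst prels c) = eta c.
Proof. exact: pres_lift_cst. Qed.
Lemma realization_gen g : phi (pres_gen prels g) = elt (val g).
Proof. exact: pres_lift_gen. Qed.
Lemma realizationZ : scalable phi.
Proof. by move=> c x; rewrite -pres_cstMl rmorphM realization_cst pres_cstMl. Qed.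

(** The degree argument is ignored: this is the second instance of the family S of conditions on
    entries. *)
Definition entry_parity (d : nat) (i j : 'I_N) (y : Y) := yhom (par i j) y.
Lemma entry_parity_coef r i j :
  [/\ yhom (par i j) (F r i j), yhom (par i j) (D r i j), yhom (par i j) (E r i j) & yhom (par i j) (D' r i j)].
Proof.
have h1 : yhom (par i j) ((1 : 'M_N) i j).
  rewrite mxE; have [->|_] := eqVneq i j; last exact: homogeneous0.
  by rewrite addbb; apply: homogeneous1.
have D'0 : D' 0%N = 1.
  by have := congr1 (fun f : fps _ => f 0%N) (pc_DD' pc); rewrite fps_mul0E (pc_D0 pc) mul1r.
case: r => [|r]; first by rewrite (pc_F0 pc) (pc_D0 pc) (pc_E0 pc) D'0.
have S0 (d : nat) i' j' : entry_parity d i' j' 0 by apply: homogeneous0.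
have SD (d : nat) i' j' x y : entry_parity d i' j' x -> entry_parity d i' j' y -> entry_parity d i' j' (x + y).
  exact: homogeneousD.
have SN (d : nat) i' j' x : entry_parity d i' j' x -> entry_parity d i' j' (- x) by exact: homogeneousN.
have SM (d e : nat) i' l j' x y : entry_parity d i' l x -> entry_parity e l j' y -> entry_parity (d + e).-1 i' j' (x * y).
  by rewrite /entry_parity (par_split p l i' j'); apply: homogeneousM.
have Sle (d : nat) i' j' x : entry_parity d i' j' x -> entry_parity d.+1 i' j' x by [].
have ST r' i' j' : entry_parity r'.+1 i' j' (T r'.+1 i' j') by apply: homogeneousT.
have [hF hD hE] := gauss_below S0 SD SN SM Sle pc ST r i j.
by split=> //; apply: (inverse_below S0 SD SN SM Sle pc ST).
Qed.

Lemma elt_parity g : listed sigma mu g -> yhom (symbol_parity Ups mu g) (elt g).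
Proof.
have e a b I J : blk I = a -> blk J = b ->
    odd (bdigit Ups mu a (off I) + bdigit Ups mu b (off J)) = par I J.
  by move=> Ia Jb; rewrite !bdigitE // oddD !oddb.
case: g => [a i j r|a i j r|a i j r|a i j r] lg.
- have [I [J [_ Ia Ja <- <-]]] := listedDE sum_mu lg.
  by rewrite /= (e _ _ _ _ Ia Ja) -{1}Ia -Ja !flat_pos mx_at_ord; case: (entry_parity_coef r I J).
- have [I [J [_ Ia Ja <- <-]]] := listedDE sum_mu (lg : listed sigma mu (SD a i j r)).
  by rewrite /= (e _ _ _ _ Ia Ja) -{1}Ia -Ja !flat_pos mx_at_ord; case: (entry_parity_coef r I J).
- have [I [J [Ia Ja <- <- _]]] := listedEE sum_mu lg.
  by rewrite /= (e _ _ _ _ Ia Ja) -{1}Ia -Ja !flat_pos mx_at_ord; case: (entry_parity_coef r I J).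
have [I [J [Ia Ja <- <- _]]] := listedFE sum_mu lg.
by rewrite /= (e _ _ _ _ Ia Ja) -Ia -Ja !flat_pos mx_at_ord; case: (entry_parity_coef r I J).
Qed.

Lemma realization_parity b x : phom b x -> yhom b (phi x).
Proof.
apply: homogeneous_map => {b x}.
- exact: homogeneous0.
- exact: homogeneousD.
- exact: homogeneous1.
- exact: homogeneousM.
- by move=> b c x; rewrite realization_cst; apply: homogeneousZ.
by move=> g; rewrite realization_gen; apply/elt_parity/(valP g).
Qed.

Lemma realization_image y : shifted_yangian sigma mu F D D' E y <-> exists x, phi x = y.
Proof.
split=> [/(_ (fun y => exists x, phi x = y)) h|[x <-] B subB SB].
  apply: h => [|_ [g lg ->]]; last by exists (pres_gen prels (exist _ g lg)); rewrite realization_gen.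
  split.
  - by exists 1; rewrite rmorph1.
  - by move=> c _ _ [x <-] [y' <-]; exists (c *: x + y'); rewrite rmorphD realizationZ.
  - by move=> _ _ [x <-] [y' <-]; exists (x * y'); rewrite rmorphM.
  (* The preimage splits into parity parts; their images have the same parities, so by uniqueness
     they are the components x0 and x1. *)
  move=> x0 x1 h0 h1 [x]; elim/pres_pi_ind: x => f; rewrite (parts_sum (@pgen_parity N Ups sigma mu) f) pres_piD rmorphD.
  set y0 := phi _; set y1 := phi (pres_pi _ _) => e.
  have k0 : yhom false y0 := realization_parity (homogeneous_pi _ (@pure_part K _ (@pgen_parity N Ups sigma mu) false f)).
  have k1 : yhom true y1 := realization_parity (homogeneous_pi _ (@pure_part K _ (@pgen_parity N Ups sigma mu) true f)).
  have z : x0 - y0 = 0.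
    apply: hom_unique two_tf _ _; first by apply: homogeneousD => //; apply: homogeneousN.
    have -> : x0 - y0 = y1 - x1 by apply/eqP; rewrite subr_eq addrAC eq_sym subr_eq [y1 + _]addrC e.
    by apply: homogeneousD => //; apply: homogeneousN.
  split; first by eexists; apply/esym/(subr0_eq z).
  by exists (pres_pi prels (parity_part (@pgen_parity N Ups sigma mu) true f)); exact: addr_split e z.
have [B1 BD BM _] := subB.
have B0 : B 0 by have := BD (-1) _ _ B1 B1; rewrite scaleN1r addNr.
have BZ c z : B z -> B (eta c * z) by move=> Bz; rewrite pres_cstMl -[_ *: _]addr0; apply: BD.
have BA u v : B u -> B v -> B (u + v) by move=> Bu Bv; rewrite -[u]scale1r; apply: BD.
elim/pres_pi_ind: x => f; rewrite pres_pi_words rmorph_sum.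
elim/big_ind: _ => [||w _]; [exact: B0 | exact: BA | rewrite rmorphM realization_cst rmorph_prod; apply: BZ].
elim/big_ind: _ => [||g _]; [exact: B1 | exact: BM | rewrite realization_gen; apply: SB].
by exists (val g) => //; apply: valP.
Qed.

Section Leading.
Variable mid : nat -> 'I_N.
Hypothesis midP : forall a, (a < size mu)%N -> blk (mid a) = a.
Local Notation B := (size mu).
Local Notation us := (up_shift sigma mu).
Local Notation ls := (low_shift sigma mu).
Local Notation rho := (fun z => phi (root_gen K Ups sigma mu mid z)).
Let ep g : listed sigma mu g -> ev (psym K sigma mu g) = elt g. Proof. exact: eval_psym. Qed.

Lemma realization_root z : rho z = root_val p blk B mid us ls
  (fun i j r => ev (dA K Ups sigma mu i j r)) (fun i j r => ev (eA K Ups sigma mu i j r))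
  (fun i j r => ev (fA K Ups sigma mu i j r)) z.
Proof. by apply: (etrans (pres_liftE realization_rel _)); apply: rmorph_root_val. Qed.

Lemma factor_leads r i j :
  [/\ (blk j < blk i)%N -> leads eta T i j r (F r.+1 i j), blk i = blk j -> leads eta T i j r (D r.+1 i j) &
      (blk i < blk j)%N -> leads eta T i j r (E r.+1 i j)].
Proof.
have etaC := @pres_cstC _ _ yrels.
have [] := @gauss_parts Y N blk (fun d _ _ => below eta T d 0) _ _ _ _ _ _ _ _ _ _ _ pc _ r i j.
- by move=> d _ _; apply: below0.
- by move=> d _ _ x y; apply: belowD.
- by move=> d _ _ x; apply: belowN.
- by move=> d e _ _ _ x y; apply: below_mulS.
- by move=> d _ _ x; apply: below_le; rewrite ltnSn.
- by move=> r' i' j'; apply: below_coef.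
move=> hF hD hE; split=> h; apply: leads_near.
- by move: hF; rewrite h.
- by move: hD; rewrite h eqxx.
- by move: hE; rewrite h.
Qed.

Lemma root_vector_leads z : root_valid blk B us ls z -> leads eta T z.1.1 z.1.2 z.2 (rho z).
Proof.
have etaC := @pres_cstC _ _ yrels.
case: z => [[i j] r]; rewrite realization_root /root_valid /root_val.
case: ifP => [/eqP ij _|/negbT ne].
  rewrite rmorphM rmorph_sign; apply: leads_sign => //; rewrite (evSD sum_mu ep _ erefl (esym ij)).
  by have [_ h _] := factor_leads r i j; apply: h.
case: ifP => [ij h|/negbT nij h].
  apply: (root_leads etaC T0 rT _ _ ij h) => [i' j' a|i' j' r' ij' hr'].
    exact: (up_mid (blk_lt sum_mu) midP).
  rewrite rmorphM rmorph_sign; apply: leads_sign => //; rewrite (evSE sum_mu ep erefl ij') //.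
  by have [_ _ h'] := factor_leads r' i' j'; apply: h'; rewrite ij'.
have ij : (rev_blk blk B i < rev_blk blk B j)%N.
  by rewrite /rev_blk; have := blk_lt sum_mu i; have := blk_lt sum_mu j; lia.
apply: (root_leads etaC T0 rT _ _ ij h) => [i' j' a|i' j' r' ij' hr'].
  exact: (low_mid midP).
have {}ij' := (rblk1 (blk_lt sum_mu) i' j').1 ij'; rewrite (rsE ls (blk_lt sum_mu) ij') in hr'.
rewrite rmorphM rmorph_sign; apply: leads_sign => //; rewrite (evSF sum_mu ep ij' erefl) //.
by have [h' _ _] := factor_leads r' i' j'; apply: h'; rewrite ij'.
Qed.

(** A kernel element is a combination of distinct ordered words in root vectors. Their images have
    the letters $t_{i,j}^{(r+1)}$ as leading terms, up to sign, and are therefore independent, so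
    all coefficients vanish. *)
Lemma realization_injective_mid : injective phi.
Proof.
suff inj0 x : phi x = 0 -> x = 0.
  by move=> x y xy; apply/eqP; rewrite -subr_eq0; apply/eqP/inj0; rewrite rmorphB xy subrr.
have [ws [c [uws vws ->]]] := span_words (presented_span half2 sum_mu midP x).
rewrite rmorph_sum => s0; rewrite big_seq big1 // => w wws.
rewrite (rho_independent (valid := root_valid blk B us ls) (rho := rho) natK _ uws vws _ wws).
- by rewrite rmorph0 mul0r.
- exact: root_vector_leads.
rewrite -[RHS]s0; apply: eq_bigr => u _; rewrite rmorphM realization_cst; congr (_ * _).
by rewrite (rmorph_word (h := phi) u (v' := rho)).
Qed.
End Leading.

Lemma realization_injective : injective phi.
Proof.
(* For N = 0 there is no position to serve as a default for [mid]; there are then no generators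
   either, and every element of P is a scalar. *)
have [N0|N0] := posnP N; last first.
  have /choice[mid midP] a : exists I : 'I_N, (a < size mu)%N -> blk I = a.
    have [aB|_] := ltnP a (size mu); last by exists (Ordinal N0).
    by have [I [Ia _]] := pos_exists sum_mu aB (all_nthP 0%N mu_pos a aB); exists I.
  exact: realization_injective_mid midP.
have nog (g : pgen sigma mu) : False.
  have no (I : 'I_N) : False by have := leq_trans (ltn_ord I) (eq_leq N0).
  case: g => -[a i j r|a i j r|a i j r|a i j r] lg.
  - by have [I] := listedDE sum_mu lg.
  - by have [I] := listedDE sum_mu (lg : listed sigma mu (SD a i j r)).
  - by have [I] := listedEE sum_mu lg.
  - by have [I] := listedFE sum_mu lg.
have cst x : exists c, x = pres_cst prels c.
  elim/pres_pi_ind: x => f; exists (\sum_(w <- msupp f) f@_w); rewrite pres_pi_words rmorph_sum.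
  apply: eq_bigr => -[[|g w]] _; first by rewrite big_nil mulr1.
  by case: (nog g).
move=> x y; have [c ->] := cst x; have [d ->] := cst y.
by rewrite !realization_cst => /eta_inj ->.
Qed.
End Realization.

Theorem theorem5p7 (R : realType) (m n : nat) (Ups : seq bool)
    (sigma : 'M[nat]_(m + n)) (mu : seq nat)
    (Ups0 : count_mem false Ups = m) (Ups1 : count_mem true Ups = n)
    (sigma_shift : shift_matrix sigma)
    (mu_comp : composition mu (m + n))
    (mu_adm : admissible sigma mu)
    (F D D' E : nat -> 'M[super_yangian R[i] (m + n) Ups]_(m + n))
    (TFDE : gauss_decomposition mu (Tmx R[i] (m + n) Ups) F D E)
    (DD' : ps_inverse D D') :
  exists phi : {rmorphism presented_shifted_yangian R[i] Ups sigma mu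
                          -> super_yangian R[i] (m + n) Ups},
    [/\ scalable phi,
        forall p x, homogeneous (@pgen_parity (m + n) Ups sigma mu) p x ->
                    homogeneous (@tgen_parity (m + n) Ups) p (phi x),
        forall g : pgen sigma mu,
          phi (pres_gen (@parabolic_rel R[i] (m + n) Ups sigma mu) g)
          = parabolic_elt mu F D D' E (val g),
        injective phi
      & forall y, shifted_yangian sigma mu F D D' E y <-> exists x, phi x = y].
Proof.
have [mu_pos sum_mu] := mu_comp.
(* One half serves the squares of odd root vectors and the absence of 2-torsion; characteristic 0
   serves the multiplicities of even letters. *)
have half2 : 2^-1 + 2^-1 = 1 :> R[i] by rewrite -mulr2n -[LHS]mulr_natr mulVf // Num.Theory.pnatr_eq0.
have natK (a : R[i]) k : a * k.+1%:R = 0 -> a = 0.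
  by move/eqP; rewrite mulf_eq0 Num.Theory.pnatr_eq0 orbF => /eqP.
exists (realization sigma half2 sum_mu TFDE DD'); split.
- exact: realizationZ.
- by move=> b x; apply: realization_parity.
- exact: realization_gen.
- exact: realization_injective.
- exact: realization_image.
Qed.
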